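(* Let $\alpha\in\mathbb R\setminus\mathbb Q$, $\beta\in\mathbb R$, and let $f:\mathbb T^2\to\mathbb T^2$ be the uniquely ergodic skew-shift $f(x,y)=(x+\alpha,\,y+x+\beta)$. For every positive roof function $\Phi$ belonging to the class $\mathcal M_f$, the special flow $f^\Phi$ is mixing.
   Context: $\mathbb T=\mathbb R/\mathbb Z$, $\mathbb T^2=\mathbb R^2/\mathbb Z^2$. For a (real) function $\Phi$ on $\mathbb T^2$ put $\phi^\perp(x):=\int_{\mathbb T}\Phi(x,y)\,dy$ and $\phi(x,y):=\Phi(x,y)-\phi^\perp(x)$. Class $\mathcal R$: for an integer $d\ge1$ let $\mathcal P_d$ be the space of all continuous functions $\Phi$ on $\mathbb T^2$ such that for each $x\in\mathbb T$ the function $\Phi(x,\cdot)$ is a trigonometric polynomial of degree at most $d$ on $\mathbb T$, and $\mathcal P:=\bigcup_{d\ge1}\mathcal P_d$. Then $\Phi\in\mathcal R$ if and only if $\Phi\in\mathcal P$ and $\phi^\perp$ is a trigonometric polynomial on $\mathbb T$. A function $\phi$ on $\mathbb T^2$ is a measurable coboundary for $f$ if there is a measurable $u:\mathbb T^2\to\mathbb R$ with $\phi=u\circ f-u$ (almost everywhere). Class $\mathcal M_f$: $\Phi\in\mathcal M_f$ if and only if $\Phi\in\mathcal R$ and $\phi$ is not a measurable coboundary for $f$. For continuous $\Phi>0$ the special flow $f^\Phi$ is the quotient of the unit speed vertical flow $(p,z)\mapsto(p,z+t)$ on $\mathbb T^2\times\mathbb R$ by the equivalence relation generated by $(p,\Phi(p)+z)\sim_\Phi(f(p),z)$.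 It is viewed on the fundamental domain $\{(p,z):0\le z<\Phi(p)\}$ and preserves the probability measure $\mu$ obtained by normalizing the restriction of $3$-dimensional Lebesgue measure to this domain. It is mixing if $\lim_{t\to\infty}\mu(f^\Phi_t(A)\cap B)=\mu(A)\mu(B)$ for all measurable $A,B$. *)

(* Defs.v *)
From HB Require Import structures.
From mathcomp Require Import all_boot all_order all_algebra.
From mathcomp Require Import all_classical all_reals all_analysis.
From Stdlib Require Import Relation_Operators.

Set Implicit Arguments.
Unset Strict Implicit.
Unset Printing Implicit Defensive.
Import Order.TTheory GRing.Theory Num.Theory.
Import numFieldNormedType.Exports.
Local Open Scope classical_set_scope.
Local Open Scope ring_scope.

(* Objects living on T = R/Z and T^2 = R^2/Z^2 are represented by their lifts:
   a function on T^2 is a Z^2-invariant function on R * R, a self-map of T^2 is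
   a self-map of R * R compatible with [torus_eq].  T^2 itself is identified,
   for measure-theoretic purposes, with [0, 1[ x [0, 1[ and its Borel sets;
   completing the sigma-algebra changes neither mixing nor the existence of a
   measurable transfer function almost everywhere. *)

Section torus.
Context {R : realType}.
Implicit Types (x : R) (p : R * R) (Phi phi : R * R -> R).

Definition torus_eq p p' : Prop :=
  exists m n : int, p' = (p.1 + m%:~R, p.2 + n%:~R).

Definition torus_invariant Phi : Prop :=
  forall p p', torus_eq p p' -> Phi p = Phi p'.

Definition unit_square : set (R * R) := `[0, 1[ `*` `[0, 1[.

Definition leb2 := ((@lebesgue_measure R) \x (@lebesgue_measure R))%E.

Definition trig_poly_deg (d : nat) (h : R -> R) : Prop :=
  exists a b : nat -> R, forall x,
    h x = \sum_(k < d.+1) (a k * cos (2 * pi * k%:R * x)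
                         + b k * sin (2 * pi * k%:R * x)).

Definition trig_poly (h : R -> R) : Prop := exists d, trig_poly_deg d h.

Definition fiber_mean Phi (x : R) : R :=
  \int[lebesgue_measure]_(y in `[0, 1]) Phi (x, y).

Definition fiber_centered Phi p : R := Phi p - fiber_mean Phi p.1.

Definition class_P_deg (d : nat) Phi : Prop :=
  [/\ torus_invariant Phi, continuous Phi &
      forall x, trig_poly_deg d (fun y => Phi (x, y))].

Definition class_P Phi : Prop := exists2 d, (1 <= d)%N & class_P_deg d Phi.

Definition class_R Phi : Prop := class_P Phi /\ trig_poly (fiber_mean Phi).

Definition measurable_coboundary (f : R * R -> R * R) phi : Prop :=
  exists u : R * R -> R,
    [/\ torus_invariant u, measurable_fun [set: R * R] u &
        {ae leb2, forall p, unit_square p -> phi p = u (f p) - u p}].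

Definition class_M (f : R * R -> R * R) Phi : Prop :=
  class_R Phi /\ ~ measurable_coboundary f (fiber_centered Phi).

Definition skew_shift (alpha beta : R) p : R * R :=
  (p.1 + alpha, p.2 + p.1 + beta).

End torus.

Section special_flow.
Context {R : realType}.
Variables (f : R * R -> R * R) (Phi : R * R -> R).

(* The first constructor identifies the lifts of a point of T^2 x R, the
   second one is (p, Phi p + z) ~ (f p, z). *)
Inductive special_step : R * R * R -> R * R * R -> Prop :=
| special_step_torus p p' z : torus_eq p p' -> special_step (p, z) (p', z)
| special_step_roof p z : special_step (p, Phi p + z) (f p, z).

Definition special_equiv : R * R * R -> R * R * R -> Prop :=
  clos_refl_sym_trans _ special_step.

Definition special_domain : set (R * R * R) :=
  [set q | unit_square q.1 /\ 0 <= q.2 < Phi q.1].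

(* The representative in [special_domain] of the class of (p, z + t); the
   default value of [xget] is used only when there is no representative. *)
Definition special_flow (t : R) (q : R * R * R) : R * R * R :=
  xget q [set q' | special_domain q' /\ special_equiv (q.1, q.2 + t) q'].

Definition leb3 := (@leb2 R \x (@lebesgue_measure R))%E.

Definition special_measure (A : set (R * R * R)) : R :=
  fine (leb3 (A `&` special_domain)) / fine (leb3 special_domain).

Definition special_flow_mixing : Prop :=
  forall A B : set (R * R * R),
    measurable A -> measurable B ->
    A `<=` special_domain -> B `<=` special_domain ->
    special_measure ((special_flow t @` A) `&` B) @[t --> +oo]
      --> special_measure A * special_measure B.

End special_flow.

(* Main.v *)
(* Let Phi_n be the Birkhoff sums of the roof and c its mean. Since phi^perp is
   a trigonometric polynomial, Phi_n(x, y) = c n + O(1) + phi_n(x, y), where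
   phi_n(x, .) is a trigonometric polynomial of degree at most d, and
   phi_n = o(n) uniformly by van der Corput's inequality.

   Growth: some Fourier mode of phi in the fibers is not a coboundary.
   If its Birkhoff sums returned to a bounded set with positive frequency, then
   the skew product (p, s) |-> (f p, s + mode p) would have an invariant set of
   finite positive measure, and the medians of its fibers would be a transfer
   function. So the returns have zero density, and a decoupling argument using
   the shear of f shows that the coefficients of phi_n(x, .) tend to infinity
   in measure.

   Shear: when phi_N(x, .) is large, N = t / c, the fluctuations of Phi_n(x, .)
   for the relevant n are comparable with those of Phi_N(x, .); hence
   integration by parts in y gives that the integrals of
   sum_n g(f^n p) k(t - Phi_n p) against indicators of fiber segments vanish as
   t tends to infinity whenever k is the difference of a trapezoid and its
   translate. Tiling a long window by translates of the trapezoid and unique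
   ergodicity then give the limit of the correlations of boxes.

   The measure of (f^Phi_t A) meet B is the sum over n of the measures of the
   pieces crossing the roof n times. It is dominated by multiples of the
   measures of A and of B, so convergence passes from boxes to all Borel sets. *)
From HB Require Import structures.
Require Import Defs.
From mathcomp Require Import all_boot all_order all_algebra.
From mathcomp Require Import all_classical all_reals all_analysis.
From mathcomp Require Import zify ring lra.
From Stdlib Require Import Relation_Operators.
Import Order.TTheory GRing.Theory Num.Theory.
Import numFieldNormedType.Exports.
From mathcomp Require Import measurable_realfun complex.
Local Open Scope classical_set_scope.
Local Open Scope ring_scope.
Set Implicit Arguments.
Unset Strict Implicit.
Unset Printing Implicit Defensive.

(** * Trigonometric sums *)

Section trigonometry.
Context {R : realType}.
Implicit Types (a b h x y : R) (m n k : nat).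

(** Nothing is known about how fast the sums phi_n grow, only that they are large off a set of x of
    small measure. The comparison in the shear step therefore uses no rate: if Phi_n(x, y) is near
    t, then |n - N| is at most a constant times the amplitude M of phi_N(x, .), and phi_n - phi_N, a
    sum over |n - N| steps, is o(M). Since D, the derivative of phi_N(x, .), has zeros, integration
    by parts divides not by D but by D + K / D, with K small against M ^ 2; the loss is confined to
    a sublevel set of D, whose measure is small uniformly over trigonometric polynomials of degree
    d. A difference of trapezoids has a primitive of compact support, so every term produced by the
    integration is a sum over boundedly many n. The outcome is only that correlations are almost
    constant in t; their value comes from averaging over a window of fixed large length. In the
    growth step, zero density of returns gives no bound at a particular time N; it only provides
    differences k_j - k_i at which returns are rare, and decoupling carries this over to all large
    N. *)

Lemma cos_periodz x (n : int) : cos (x + 2 * pi * n%:~R) = cos x.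
Proof.
have H (k : nat) y : cos (y + 2 * pi * k%:R) = cos y.
  rewrite -(periodicn (@cosD2pi R) k y); congr cos; congr (_ + _).
  by rewrite -mulr_natr -[pi *+ 2]mulr_natr; ring.
case: n => n; first by rewrite -pmulrn H.
by rewrite NegzE -(H n.+1) mulrNz -pmulrn; congr cos; ring.
Qed.

Lemma sin_periodz x (n : int) : sin (x + 2 * pi * n%:~R) = sin x.
Proof.
by rewrite -cosBpihalf -[RHS]cosBpihalf -(cos_periodz (x - pi / 2) n); congr cos; ring.
Qed.

(** Each product [sin h * cos x] is half of [sin (x + h) - sin (x - h)], and these differences
    telescope. *)
Lemma sum_cos_telescope a h n :
  sin h * (\sum_(k < n) cos (a + 2 * h * k%:R)) =
  (sin (a + 2 * h * n%:R - h) - sin (a - h)) / 2.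
Proof.
elim: n => [|n IH]; first by rewrite big_ord0 mulr0 mulr0 addr0 subrr mul0r.
rewrite big_ord_recr /= mulrDr IH.
have -> : a + 2 * h * n.+1%:R - h = (a + 2 * h * n%:R) + h.
  by rewrite -addn1 natrD; ring.
rewrite (sinD (_ + _) h) (sinB (_ + _) h); lra.
Qed.

Lemma sum_cos_bound a h n : sin h != 0 ->
  `|\sum_(k < n) cos (a + 2 * h * k%:R)| <= `|sin h|^-1.
Proof.
move=> h0; have := sum_cos_telescope a h n.
move=> /(congr1 Num.norm); rewrite normrM => E.
rewrite -[leRHS]mul1r ler_pdivlMr ?normr_gt0// mulrC E.
rewrite normrM (@gtr0_norm _ 2^-1)// ler_pdivrMr//.
apply: le_trans (ler_normB _ _) _.
have := sin_max (a + 2 * h * n%:R - h); have := sin_max (a - h); lra.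
Qed.

Lemma sum_sin_bound a h n : sin h != 0 ->
  `|\sum_(k < n) sin (a + 2 * h * k%:R)| <= `|sin h|^-1.
Proof.
move=> h0; apply: le_trans (sum_cos_bound (a - pi / 2) n h0).
by under eq_bigr do rewrite -cosBpihalf addrAC.
Qed.

Lemma sin_eq0_int (x : R) : sin (pi * x) = 0 -> exists n : int, x = n%:~R.
Proof.
move=> sx; exists (Num.floor x).
have /andP[f1 f2] := floor_itv x.
set y := x - (Num.floor x)%:~R.
have y0 : 0 <= y < 1 by rewrite /y; move: f1 f2; rewrite intrD /=; lra.
have sy : sin (pi * y) = 0.
  (* The square of the sine is a function of [cos (2 * pi * x)], which does not see the sign changes
     of the sine under integer translations. *)
  have : sin (pi * y) ^+ 2 = 0; last by move/eqP; rewrite sqrf_eq0 => /eqP.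
  have -> : sin (pi * y) ^+ 2 = (1 - cos (2 * pi * x + 2 * pi * (- Num.floor x)%:~R)) / 2.
    have -> : 2 * pi * x + 2 * pi * (- Num.floor x)%:~R = (pi * y) *+ 2.
      by rewrite mulrNz /y -mulr_natr; ring.
    by rewrite cos_mulr2n cos2sin2; field.
  rewrite cos_periodz (_ : 2 * pi * x = (pi * x) *+ 2); last by rewrite -mulr_natr; ring.
  by rewrite cos_mulr2n cos2sin2 sx; field.
have [y00|yN0] := eqVneq y 0; first by apply/eqP; rewrite -subr_eq0 -/y y00.
have : 0 < sin (pi * y).
  have p0 := pi_gt0 R.
  by apply: sin_gt0_pi; rewrite mulr_gt0 ?gtr_pMr//=; lra.
by rewrite sy ltxx.
Qed.

Lemma sin_irrational (alpha : R) (l : int) : irrational alpha -> l != 0 ->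
  sin (pi * (l%:~R * alpha)) != 0.
Proof.
move=> ia l0; apply/eqP => /sin_eq0_int [n E]; apply: ia.
exists (n%:Q / l%:Q) => //; rewrite fmorph_div /= !ratr_int -E.
by rewrite mulrAC divff ?mul1r// intr_eq0.
Qed.

Lemma ler_norm_sqr a b : 0 <= b -> a ^+ 2 <= b ^+ 2 -> `|a| <= b.
Proof. by move=> b0; rewrite -(real_normK (num_real a)) ler_sqr ?nnegrE. Qed.

(** Sum [(V k - c) ^+ 2 >= 0] over k, with c the average of V. *)
Lemma cauchy_schwarz_sum n (V : nat -> R) :
  (\sum_(k < n) V k) ^+ 2 <= n%:R * \sum_(k < n) V k ^+ 2.
Proof.
case: n => [|n]; first by rewrite !big_ord0 mulr0 expr0n.
set S := \sum_(k < n.+1) V k; set c := S / n.+1%:R.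
have cS : c * n.+1%:R = S by rewrite /c divfK.
have : \sum_(k < n.+1) (2 * c * V k - c ^+ 2) <= \sum_(k < n.+1) V k ^+ 2.
  apply: ler_sum => k _; rewrite -subr_ge0.
  by rewrite (_ : _ - _ = (V k - c) ^+ 2) ?sqr_ge0//; ring.
rewrite sumrB -mulr_sumr sumr_const card_ord -/S -[c ^+ 2 *+ _]mulr_natr.
set T := \sum_(k < n.+1) V k ^+ 2 => H.
have n0 : 0 < n.+1%:R :> R by rewrite ltr0n.
have -> : S ^+ 2 = n.+1%:R * (2 * c * S - c ^+ 2 * n.+1%:R).
  by rewrite -cS; ring.
by rewrite ler_pM2l.
Qed.

(** The squared modulus of an exponential sum, in real form. *)
Lemma sqr_sum_cos_sin n (t : nat -> R) :
  (\sum_(k < n) cos (t k)) ^+ 2 + (\sum_(k < n) sin (t k)) ^+ 2 =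
  \sum_(i < n) \sum_(j < n) cos (t i - t j).
Proof.
rewrite !expr2 !big_distrlr /= -big_split /=; apply: eq_bigr => i _.
by rewrite -big_split /=; apply: eq_bigr => j _; rewrite cosB.
Qed.

(** Averaging over H shifts and applying Cauchy-Schwarz leaves correlations whose phases are affine
    in k with slope l * alpha * (i - j); for i different from j these are geometric sums. The
    threshold depends on neither [th] nor [d], which is what makes the means of the skew shift
    uniform over the torus. *)
Lemma van_der_corput (alpha : R) (l : int) (eps : R) :
  irrational alpha -> l != 0 -> 0 < eps -> exists n0 : nat,
  forall (th : nat -> R) (d : nat -> R),
    (forall k h : nat, th (k + h)%N - th k = l%:~R * alpha * h%:R * k%:R + d h) ->
    forall n, (n0 <= n)%N ->
    `|\sum_(k < n) cos (2 * pi * th k)| <= eps * n%:R.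
Proof.
move=> ia l0 e0.
(* With 8 <= eps ^ 2 * H, twice the diagonal contribution, 2 * H * n ^ 2, is at most (eps / 2 * H *
   n) ^ 2. *)
pose H := (Num.truncn (8 / eps ^+ 2)).+1.
have H0 : 0 < H%:R :> R by rewrite ltr0n.
have HE : 8 / eps ^+ 2 <= H%:R by exact/ltW/truncnS_gt.
pose s (i j : nat) : R := if i == j then 0 else `|sin (pi * (l%:~R * ((i%:R - j%:R) * alpha)))|^-1.
pose C : R := \sum_(i < H) \sum_(j < H) s i j.
have C0 : 0 <= C.
  by apply: sumr_ge0 => i _; apply: sumr_ge0 => j _; rewrite /s; case: eqP.
(* The first threshold absorbs the off-diagonal sums C, the second one the boundary error 2 * H ^ 2
   caused by the shifts. *)
exists (maxn (Num.truncn C).+1 (Num.truncn (4 * H%:R / eps)).+1) => th d thd n.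
rewrite geq_max => /andP[nC nH].
have {}nC : C <= n%:R.
  by apply: le_trans (ltW (truncnS_gt C)) _; rewrite ler_nat.
have {}nH : 4 * H%:R / eps <= n%:R.
  by apply: le_trans (ltW (truncnS_gt _)) _; rewrite ler_nat.
pose V k := \sum_(h < H) cos (2 * pi * th (k + h)%N).
pose S := \sum_(k < n) cos (2 * pi * th k).
have shift (h : nat) : `|\sum_(k < n) cos (2 * pi * th (k + h)%N) - S| <= 2 * h%:R.
  elim: h => [|h IH].
    rewrite mulr0 normr_le0 subr_eq0; apply/eqP/eq_bigr => k _.
    by rewrite addn0.
  have : \sum_(k < n) cos (2 * pi * th (k + h.+1)%N) =
    \sum_(k < n) cos (2 * pi * th (k + h)%N) +
     (cos (2 * pi * th (n + h)%N) - cos (2 * pi * th h)).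
    elim: (n) => [|m IHm]; first by rewrite !big_ord0 add0n subrr addr0.
    by rewrite 2!big_ord_recr /= IHm addnS addSn; ring.
  move=> ->; move: IH; rewrite -(natr1 h) !ler_norml => /andP[I1 I2].
  have := cos_le1 (2 * pi * th (n + h)%N); have := cos_geN1 (2 * pi * th (n + h)%N).
  have := cos_le1 (2 * pi * th h); have := cos_geN1 (2 * pi * th h).
  by move=> *; apply/andP; split; lra.
have SV : `|\sum_(k < n) V k - H%:R * S| <= 2 * H%:R ^+ 2.
  rewrite exchange_big /= (_ : H%:R * S = \sum_(h < H) S); last first.
    by rewrite sumr_const card_ord mulr_natl.
  rewrite -sumrB (le_trans (ler_norm_sum _ _ _))//.
  have -> : 2 * H%:R ^+ 2 = \sum_(h < H) (2 * H%:R) :> R.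
    by rewrite sumr_const card_ord -[RHS]mulr_natr expr2 mulrA.
  apply: ler_sum => h _; apply: le_trans (shift h) _.
  by rewrite ler_pM2l// ler_nat ltnW.
have VV : (\sum_(k < n) V k) ^+ 2 <= n%:R * (H%:R * n%:R + C).
  apply: le_trans (cauchy_schwarz_sum _ _) _; rewrite ler_wpM2l//.
  have : \sum_(k < n) V k ^+ 2 <= \sum_(k < n) \sum_(i < H) \sum_(j < H)
      cos (2 * pi * th (k + i)%N - 2 * pi * th (k + j)%N).
    apply: ler_sum => k _.
    by rewrite -(sqr_sum_cos_sin H (fun i => 2 * pi * th (k + i)%N)) lerDl sqr_ge0.
  move=> /le_trans; apply.
  rewrite exchange_big /=; under eq_bigr do rewrite exchange_big /=.
  have -> : H%:R * n%:R + C = \sum_(i < H) (\sum_(j < H) ((if i == j :> nat then n%:R else 0) + s i j)).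
    rewrite (_ : H%:R * n%:R = \sum_(i < H) (n%:R : R)); last first.
      by rewrite sumr_const card_ord mulr_natl.
    rewrite -big_split /=; apply: eq_bigr => i _.
    rewrite big_split /=; congr (_ + _).
    rewrite (bigD1 i)//= eqxx big1 ?addr0// => j ji.
    by rewrite ifN// eq_sym.
  apply: ler_sum => i _; apply: ler_sum => j _.
  have [ij|ij] := eqVneq (i : nat) j.
    rewrite /s ij eqxx addr0.
    have -> : n%:R = \sum_(k < n) 1 :> R by rewrite sumr_const card_ord.
    by apply: ler_sum => k _; exact: cos_le1.
  rewrite add0r /s (negbTE ij).
  have sn0 : sin (pi * (l%:~R * ((i%:R - j%:R) * alpha))) != 0.
    have -> : l%:~R * ((i%:R - j%:R) * alpha) = (l * (i%:Z - j%:Z))%:~R * alpha.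
      by rewrite intrM intrD mulrNz /=; ring.
    apply: sin_irrational => //; rewrite mulf_neq0// subr_eq0.
    by apply: contra_neq ij => -[].
  apply: le_trans (ler_norm _) _.
  apply: le_trans (sum_cos_bound (2 * pi * (d i - d j)) n sn0).
  rewrite le_eqVlt; apply/orP; left; apply/eqP; congr `|_|.
  apply: eq_bigr => k _; congr cos.
  have := thd k i; have := thd k j.
  move=> /eqP; rewrite subr_eq => /eqP -> /eqP; rewrite subr_eq => /eqP ->.
  by ring.
have B : `|\sum_(k < n) V k| <= eps / 2 * (H%:R * n%:R).
  apply: ler_norm_sqr; first by rewrite !mulr_ge0// ltW.
  apply: le_trans VV _.
  have n0 : 0 <= n%:R :> R by [].
  have : C <= H%:R * n%:R.
    by apply: le_trans nC _; rewrite ler_peMl// ler1n.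
  have e8 : 8 <= eps ^+ 2 * H%:R.
    by move: HE; rewrite ler_pdivrMr ?exprn_gt0// mulrC.
  move=> CH; apply: (@le_trans _ _ (n%:R * (2 * (H%:R * n%:R)))).
    by rewrite ler_wpM2l//; lra.
  have -> : (eps / 2 * (H%:R * n%:R)) ^+ 2 = (eps ^+ 2 * H%:R) * (n%:R * (H%:R * n%:R)) / 4.
    by field.
  have : 8 * (n%:R * (H%:R * n%:R)) <= (eps ^+ 2 * H%:R) * (n%:R * (H%:R * n%:R)).
    by rewrite ler_wpM2r// !mulr_ge0// ltW.
  lra.
rewrite -/S -(ler_pM2l H0).
have -> : H%:R * `|S| = `|H%:R * S| by rewrite normrM ger0_norm// ltW.
have D : 2 * H%:R ^+ 2 <= eps / 2 * (H%:R * n%:R).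
  have : H%:R * (4 * H%:R) <= H%:R * (n%:R * eps).
    by rewrite ler_pM2l// -ler_pdivrMr.
  by move=> ?; rewrite expr2; lra.
have -> : H%:R * (eps * n%:R) = eps / 2 * (H%:R * n%:R) + eps / 2 * (H%:R * n%:R) by field.
have -> : H%:R * S = \sum_(k < n) V k - (\sum_(k < n) V k - H%:R * S) by ring.
by apply: le_trans (ler_normB _ _) (lerD B (le_trans SV D)).
Qed.

End trigonometry.

(** * Fejer kernels on a grid *)

Section circle_functions.
Context {R : realType}.
Implicit Types (a b x y d e B : R) (g : R -> R) (m n k : nat).

Definition circle_fun g := forall x (z : int), g (x + z%:~R) = g x.

(** [|sin (pi * (x - x'))|] serves as the distance on R / Z: it is half of the chord between the two
    points and is insensitive to integer translations. *)
Definition circle_ucont g := forall e, 0 < e -> exists2 d : R, 0 < d &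
  forall x x', `|sin (pi * (x - x'))| <= d -> `|g x - g x'| <= e.

Lemma sin_pi_periodz x (z : int) : `|sin (pi * (x + z%:~R))| = `|sin (pi * x)|.
Proof.
have H (k : nat) y : `|sin (pi * (y + k%:R))| = `|sin (pi * y)|.
  elim: k => [|k IH]; first by rewrite addr0.
  by rewrite -natr1 addrA mulrDr mulr1 sinDpi normrN IH.
case: z => z; first by rewrite -pmulrn H.
by rewrite NegzE mulrNz -pmulrn -(H z.+1 (x - _)) subrK.
Qed.

Lemma sin_pi_small e : 0 < e -> exists2 d : R, 0 < d &
  forall x, `|sin (pi * x)| <= d -> exists z : int, `|x - z%:~R| <= e.
Proof.
move=> e0.
have p0 := pi_gt0 R.
pose e' := Num.min e (1 / 4).
have e'0 : 0 < e' by rewrite lt_min e0 /=; lra.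
have e'4 : e' <= 1 / 4 by rewrite ge_min lexx orbT.
have s0 : 0 < sin (pi * e').
  by apply: sin_gt0_pi; rewrite mulr_gt0 ?gtr_pMr//=; lra.
exists (sin (pi * e') / 2); first by rewrite divr_gt0.
move=> x sx; pose n := Num.floor x.
have /andP[f1 f2] := floor_itv x; rewrite -/n in f1 f2.
rewrite intrD in f2.
rewrite -(sin_pi_periodz x (- n)) mulrNz in sx.
set u := x - n%:~R in sx.
have u0 : 0 <= u < 1 by rewrite /u; lra.
have e'e : e' <= e by rewrite ge_min lexx.
have [ue|ue] := leP u e'.
  by exists n; rewrite -/u ger0_norm; lra.
have [ue2|ue2] := leP (1 - e') u.
  exists (n + 1); rewrite intrD opprD addrA -/u distrC ger0_norm; lra.
suff : sin (pi * e') <= sin (pi * u) by move: sx; rewrite ler_norml; lra.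
have [uh|uh] := leP u (1 / 2).
  rewrite le_eqVlt ltr_sin ?in_itv /=; first by rewrite ltr_pM2l// ue orbT.
    by apply/andP; split; nra.
  by apply/andP; split; nra.
have -> : sin (pi * u) = sin (pi * (1 - u)).
  rewrite (_ : pi * (1 - u) = pi - pi * u); last by ring.
  by rewrite (sinB pi) sinpi cospi; ring.
rewrite le_eqVlt ltr_sin ?in_itv /=; first by rewrite ltr_pM2l//; lra.
  by apply/andP; split; nra.
by apply/andP; split; nra.
Qed.

(** Only x is confined to the segment: the neighbouring point may leave it, as happens near the ends
    of a fundamental domain. Compactness enters through its near-covering form. *)
Lemma uniform_continuity_segment g a b e : continuous g -> 0 < e -> exists2 d : R, 0 < d &
  forall x x', a <= x <= b -> `|x - x'| < d -> `|g x - g x'| < e.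
Proof.
move=> cg e0.
have := @segment_compact R a b; rewrite compact_near_coveringP => K.
have := K _ (0:R)^'+ (fun d x => forall x', `|x - x'| < d -> `|g x - g x'| < e) _.
case.
  move=> x _.
  have /cvgrPdist_lt /(_ (e / 2)) := cg x.
  rewrite divr_gt0// => /(_ isT) /nbhs_ballP[r /= r0 Hr].
  exists (ball x (r / 2), [set d | 0 < d < r / 2]) => /=.
    split; first by apply: nbhsx_ballx; rewrite divr_gt0.
    near=> d; apply/andP; split; near: d; first exact: nbhs_right_gt.
    by apply: nbhs_right_lt; rewrite divr_gt0.
  move=> [y d] /= [xy /andP[d0 dr]] x' yx'.
  have h1 : `|g x - g y| < e / 2.
    by apply: Hr; apply: le_ball xy; rewrite ler_pdivrMr//; lra.
  have h2 : `|g x - g x'| < e / 2.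
    apply: Hr; rewrite /ball /= in xy *.
    rewrite (_ : x - x' = (x - y) + (y - x')); last by ring.
    by apply: le_lt_trans (ler_normD _ _) _; lra.
  rewrite (_ : g y - g x' = (g x - g x') - (g x - g y)); last by ring.
  by apply: le_lt_trans (ler_normB _ _) _; lra.
move=> r /= r0 Hr.
exists (r / 2); first by rewrite divr_gt0.
move=> x x' xab; apply: (Hr (r / 2)) => //=.
  by rewrite sub0r normrN gtr0_norm ?divr_gt0// ltr_pdivrMr//; lra.
by rewrite divr_gt0.
Unshelve. all: by end_near.
Qed.

Lemma continuous_circle_ucont g : circle_fun g -> continuous g -> circle_ucont g.
Proof.
move=> pg cg e e0.
have [r r0 Hr] := uniform_continuity_segment 0 1 cg e0.
have [d d0 Hd] := @sin_pi_small (r / 2) (divr_gt0 r0 (ltr0Sn _ 1)).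
exists d => // x x' /Hd[z xz].
have /andP[f1 f2] := floor_itv x; rewrite intrD in f2.
set n := Num.floor x in f1 f2.
rewrite -(pg x (- n)) -(pg x' (z - n)) ltW// Hr//; first by rewrite mulrNz; lra.
rewrite intrD mulrNz.
rewrite (_ : _ - (x' + _) = x - x' - z%:~R); last by ring.
by apply: le_lt_trans xz _; lra.
Qed.

Lemma circle_fun_bounded g : circle_fun g -> continuous g ->
  exists2 B : R, 0 < B & forall x, `|g x| <= B.
Proof.
move=> pg cg.
have [] := @EVT_max R (fun x => `|g x|) 0 1 ler01.
  apply: continuous_subspaceT => x.
  by apply: (@continuous_comp _ _ _ g (fun y => `|y|)); [exact: cg|exact: norm_continuous].
move=> c _ Hc; exists (`|g c| + 1); first by rewrite ltr_pwDr.
move=> x; have /andP[f1 f2] := floor_itv x; rewrite intrD in f2.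
rewrite -(pg x (- Num.floor x)) mulrNz (le_trans (Hc _ _)) ?lerDl//.
by rewrite in_itv /=; lra.
Qed.

End circle_functions.

Section fejer.
Context {R : realType}.
Implicit Types (a b x y d e B : R) (g : R -> R) (m n k : nat).

Lemma sumr_const_ord m (c : R) : \sum_(i < m) c = c * m%:R.
Proof. by rewrite sumr_const card_ord mulr_natr. Qed.

(** The squared modulus of a sum of m characters divided by m, in expanded form, so that it is
    visibly a trigonometric polynomial. *)
Definition fejer_kernel m x : R :=
  m%:R^-1 * \sum_(i < m) \sum_(j < m) cos (2 * pi * (i%:R - j%:R) * x).

(** Convolution with the Fejer kernel over the grid of m-th parts instead of an integral: only
    finitely many values of [g] occur, so indicators are treated exactly like continuous
    functions. *)
Definition fejer g m x : R :=
  m%:R^-1 * \sum_(q < m) g (q%:R / m%:R) * fejer_kernel m (x - q%:R / m%:R).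

Lemma fejer_kernelE m x : fejer_kernel m x = m%:R^-1 *
  ((\sum_(i < m) cos (2 * pi * x * i%:R)) ^+ 2 + (\sum_(i < m) sin (2 * pi * x * i%:R)) ^+ 2).
Proof.
rewrite (sqr_sum_cos_sin _ (fun i => 2 * pi * x * i%:R)) /fejer_kernel; congr (_ * _).
by apply: eq_bigr => i _; apply: eq_bigr => j _; congr cos; ring.
Qed.

Lemma fejer_kernel_ge0 m x : 0 <= fejer_kernel m x.
Proof. by rewrite fejer_kernelE mulr_ge0 ?invr_ge0// addr_ge0// sqr_ge0. Qed.

Lemma fejer_kernel_tail m x d : 0 < d -> d <= `|sin (pi * x)| ->
  fejer_kernel m x <= m%:R^-1 * (2 / d ^+ 2).
Proof.
move=> d0 dx; rewrite fejer_kernelE ler_wpM2l ?invr_ge0//.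
have s0 : sin (pi * x) != 0 by rewrite -normr_gt0 (lt_le_trans d0).
have le_sq S : `|S| <= `|sin (pi * x)|^-1 -> S ^+ 2 <= (d ^+ 2)^-1.
  move=> H; rewrite -(real_normK (num_real S)) -exprVn ler_sqr ?nnegrE ?invr_ge0 ?(ltW d0)//.
  by apply: le_trans H _; rewrite lef_pV2 ?posrE// (lt_le_trans d0).
have := sum_cos_bound 0 m s0; have := sum_sin_bound 0 m s0.
have E i : 0 + 2 * (pi * x) * i%:R = 2 * pi * x * i%:R by ring.
under eq_bigr do rewrite E; move=> /le_sq h1.
under eq_bigr do rewrite E; move=> /le_sq h2.
rewrite (_ : 2 / d ^+ 2 = d ^- 2 + d ^- 2); last by ring.
exact: lerD.
Qed.

(** Orthogonality of the characters of the cyclic group of order m. The telescoping identity returns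
    to the same sine after full turns, and [sin h] does not vanish because m does not divide z. *)
Lemma grid_cos_sum m (z : int) x : (0 < `|z| < m)%N ->
  \sum_(q < m) cos (2 * pi * (z%:~R * (x - q%:R / m%:R))) = 0.
Proof.
move=> /andP[z0 zm].
have m0 : (0 < m)%N by apply: leq_ltn_trans zm.
have m0' : m%:R != 0 :> R by rewrite pnatr_eq0 -lt0n.
pose h : R := - (pi * (z%:~R / m%:R)).
have sh : sin h != 0.
  rewrite sinN oppr_eq0; apply/eqP => /sin_eq0_int [n E].
  have E2 : z = n * m%:Z.
    by apply: (@intr_inj R); rewrite intrM -pmulrn -E divfK.
  move: z0 zm; rewrite E2 abszM absz_nat.
  case: (absz n) => [|k]; first by rewrite mul0n.
  by move=> _; rewrite mulSn ltnNge leq_addr.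
apply: (mulfI sh); rewrite mulr0.
have := sum_cos_telescope (2 * pi * (z%:~R * x)) h m.
have -> : 2 * pi * (z%:~R * x) + 2 * h * m%:R - h = 2 * pi * (z%:~R * x) - h + 2 * pi * (- z)%:~R.
  rewrite mulrNz (_ : 2 * h * m%:R = - (2 * pi * z%:~R)); first by ring.
  by rewrite /h; field.
rewrite sin_periodz subrr mul0r => E; rewrite -[RHS]E; congr (_ * _).
by apply: eq_bigr => q _; congr cos; rewrite /h; field.
Qed.

Lemma fejer_kernel_sum m x : (0 < m)%N ->
  \sum_(q < m) fejer_kernel m (x - q%:R / m%:R) = m%:R.
Proof.
move=> m0; have m0' : m%:R != 0 :> R by rewrite pnatr_eq0 -lt0n.
rewrite /fejer_kernel -mulr_sumr exchange_big /=.
apply: (mulfI m0'); rewrite mulrA divff// mul1r.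
have -> : m%:R * m%:R = \sum_(i < m) (m%:R : R) by rewrite sumr_const card_ord mulr_natl.
apply: eq_bigr => i _; rewrite exchange_big /= (bigD1 i)//= [X in _ + X]big1 ?addr0.
  under eq_bigr do rewrite subrr mulr0 mul0r cos0.
  by rewrite sumr_const card_ord.
move=> j ji; rewrite -[RHS](@grid_cos_sum m (i%:Z - j%:Z) x).
  by apply: eq_bigr => q _; rewrite intrD mulrNz -!pmulrn !mulrA.
have /= im := ltn_ord i; have /= jm := ltn_ord j.
have : (i : nat) != j by rewrite eq_sym; exact: ji.
by lia.
Qed.

(** Closeness of values is required around the point x alone, so the estimate serves continuous
    functions as well as indicators away from their jumps. The second error term is the tail of the
    kernel. *)
Lemma fejer_approx g m x B d e : (0 < m)%N -> 0 < d -> 0 <= e ->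
  (forall y, `|g y| <= B) ->
  (forall y, `|sin (pi * (x - y))| <= d -> `|g x - g y| <= e) ->
  `|fejer g m x - g x| <= e + 4 * B / (m%:R * d ^+ 2).
Proof.
move=> m0 d0 e0 gB gd.
have m0' : m%:R != 0 :> R by rewrite pnatr_eq0 -lt0n.
have m0'' : 0 < m%:R :> R by rewrite ltr0n.
have B0 : 0 <= B by apply: le_trans (gB 0).
have -> : fejer g m x - g x = m%:R^-1 * \sum_(q < m)
    (g (q%:R / m%:R) - g x) * fejer_kernel m (x - q%:R / m%:R).
  rewrite /fejer; under [in RHS]eq_bigr do rewrite mulrBl.
  by rewrite sumrB -[X in _ = _ * (_ - X)]mulr_sumr fejer_kernel_sum// mulrBr (mulrC (g x)) mulKf.
rewrite normrM ger0_norm ?invr_ge0//.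
have : `|\sum_(q < m) (g (q%:R / m%:R) - g x) * fejer_kernel m (x - q%:R / m%:R)| <=
   \sum_(q < m) (e * fejer_kernel m (x - q%:R / m%:R) + 2 * B * (m%:R^-1 * (2 / d ^+ 2))).
  apply: le_trans (ler_norm_sum _ _ _) _; apply: ler_sum => q _.
  rewrite normrM [X in _ * X]ger0_norm ?fejer_kernel_ge0//.
  have [small|big] := leP `|sin (pi * (x - q%:R / m%:R))| d.
    rewrite ler_wpDr ?mulr_ge0 ?invr_ge0 ?sqr_ge0//.
    by rewrite ler_wpM2r ?fejer_kernel_ge0// distrC gd.
  apply: ler_wpDl; first by rewrite mulr_ge0 ?fejer_kernel_ge0.
  apply: ler_pM; rewrite ?normr_ge0 ?fejer_kernel_ge0 ?(fejer_kernel_tail _ d0) ?(ltW big)//.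
  rewrite (_ : 2 * B = B + B); last by ring.
  by apply: le_trans (ler_normB _ _) _; exact: lerD.
rewrite big_split /= -mulr_sumr fejer_kernel_sum// sumr_const_ord => H.
rewrite mulrC ler_pdivrMr//; apply: le_trans H _.
rewrite le_eqVlt; apply/orP; left; apply/eqP.
by field; rewrite m0' (gt_eqF d0).
Qed.

Lemma fejer_norm g m x B : (0 < m)%N -> (forall y, `|g y| <= B) -> `|fejer g m x| <= B.
Proof.
move=> m0 gB; have m0'' : 0 < m%:R :> R by rewrite ltr0n.
rewrite /fejer normrM ger0_norm ?invr_ge0// mulrC ler_pdivrMr//.
rewrite -[X in B * X](fejer_kernel_sum x m0) mulr_sumr.
apply: le_trans (ler_norm_sum _ _ _) _; apply: ler_sum => q _.
by rewrite normrM [X in _ * X]ger0_norm ?fejer_kernel_ge0// ler_wpM2r ?fejer_kernel_ge0.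
Qed.

End fejer.

(** * Uniform Birkhoff means of the skew shift *)

Section birkhoff.
Context {R : realType} {T : Type}.
Implicit Types (f : T -> T) (g : T -> R) (n k : nat).

Definition birkhoff f g n p : R := \sum_(k < n) g (iter k f p).

Lemma birkhoff0 f g p : birkhoff f g 0 p = 0.
Proof. by rewrite /birkhoff big_ord0. Qed.

Lemma birkhoffS f g n p : birkhoff f g n.+1 p = g p + birkhoff f g n (f p).
Proof.
rewrite /birkhoff big_ord_recl; congr (_ + _).
by apply: eq_bigr => i _ /=; rewrite -iterS iterSr.
Qed.

Lemma birkhoffSr f g n p : birkhoff f g n.+1 p = birkhoff f g n p + g (iter n f p).
Proof. by rewrite /birkhoff big_ord_recr. Qed.

Lemma birkhoff_add f g m n p :
  birkhoff f g (m + n) p = birkhoff f g m p + birkhoff f g n (iter m f p).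
Proof.
elim: m p => [|m IH] p; first by rewrite birkhoff0 add0r.
by rewrite addSn !birkhoffS IH -addrA -iterSr.
Qed.

(** The sum over m + n steps is split in the two possible orders. This is how small sums over a long
    time constrain the variation of the sums over a short time. *)
Lemma birkhoff_comm f g m n p :
  birkhoff f g m (iter n f p) - birkhoff f g m p =
  birkhoff f g n (iter m f p) - birkhoff f g n p.
Proof.
have := birkhoff_add f g m n p; rewrite addnC birkhoff_add => /eqP.
by rewrite -subr_eq0 => /eqP E; apply/eqP; rewrite -subr_eq0 -E; apply/eqP; ring.
Qed.

Definition unif_mean f g (mu : R) := forall e : R, 0 < e -> exists n0 : nat,
  forall n, (n0 <= n)%N -> forall p, `|birkhoff f g n p - mu * n%:R| <= e * n%:R.

Lemma unif_meanD f g1 g2 m1 m2 : unif_mean f g1 m1 -> unif_mean f g2 m2 ->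
  unif_mean f (fun p => g1 p + g2 p) (m1 + m2).
Proof.
move=> H1 H2 e e0; have e20 : 0 < e / 2 by rewrite divr_gt0.
have [n1 N1] := H1 _ e20; have [n2 N2] := H2 _ e20.
exists (maxn n1 n2) => n; rewrite geq_max => /andP[/N1 {}N1 /N2 {}N2] p.
rewrite /birkhoff big_split /=.
rewrite (_ : _ - _ = (birkhoff f g1 n p - m1 * n%:R) + (birkhoff f g2 n p - m2 * n%:R)).
  apply: le_trans (ler_normD _ _) _; have := N1 p; have := N2 p; lra.
by rewrite /birkhoff; ring.
Qed.

Lemma unif_meanZ f g m (c : R) : unif_mean f g m ->
  unif_mean f (fun p => c * g p) (c * m).
Proof.
move=> H e e0; have c0 : 0 < `|c| + 1 by rewrite ltr_wpDl.
have [n0 N0] := H _ (divr_gt0 e0 c0).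
exists n0 => n /N0 {}N0 p; rewrite /birkhoff -mulr_sumr -mulrA -mulrBr normrM.
have := N0 p; rewrite -/(birkhoff f g n p) => {}N0.
apply: (@le_trans _ _ ((`|c| + 1) * (e / (`|c| + 1) * n%:R))).
  by apply: ler_pM => //; rewrite lerDl.
by rewrite mulrA mulrCA divff ?mulr1// gt_eqF.
Qed.

Lemma unif_mean_cst f (c : R) : unif_mean f (fun _ => c) c.
Proof.
move=> e e0; exists 0%N => n _ p.
by rewrite /birkhoff sumr_const_ord subrr normr0 mulr_ge0// ltW.
Qed.

Lemma unif_mean_sum f (I : finType) (G : I -> T -> R) (m : I -> R) :
  (forall i, unif_mean f (G i) (m i)) ->
  unif_mean f (fun p => \sum_i G i p) (\sum_i m i).
Proof.
move=> H; elim: (index_enum I) => [|i s IH].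
  rewrite big_nil (_ : (fun p => _) = (fun _ => 0)); first exact: unif_mean_cst.
  by apply/funext => p; rewrite big_nil.
rewrite big_cons (_ : (fun p => _) = (fun p => G i p + \sum_(i <- s) G i p)).
  exact: unif_meanD.
by apply/funext => p; rewrite big_cons.
Qed.

Lemma unif_mean_lim f g m :
  (forall e : R, 0 < e -> exists g' m', [/\ unif_mean f g' m', `|m' - m| <= e &
     forall p, `|g p - g' p| <= e]) -> unif_mean f g m.
Proof.
move=> H e e0; have e30 : 0 < e / 3 by rewrite divr_gt0.
have [g' [m' [H1 H2 H3]]] := H _ e30.
have [n0 N0] := H1 _ e30.
exists n0 => n /N0 {}N0 p; have {N0} := N0 p.
have : `|birkhoff f g n p - birkhoff f g' n p| <= e / 3 * n%:R.
  rewrite /birkhoff -sumrB -sumr_const_ord (le_trans (ler_norm_sum _ _ _))//.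
  by apply: ler_sum => i _.
have : `|m' * n%:R - m * n%:R| <= e / 3 * n%:R.
  by rewrite -mulrBl normrM (@ger0_norm _ n%:R)// ler_wpM2r.
move=> a b c.
rewrite (_ : _ - _ = (birkhoff f g n p - birkhoff f g' n p) +
  (birkhoff f g' n p - m' * n%:R) + (m' * n%:R - m * n%:R)); last by ring.
apply: le_trans (ler_normD _ _) _; apply: le_trans (lerD (ler_normD _ _) (lexx _)) _.
by lra.
Qed.

End birkhoff.

Lemma fejer_sum (R : realType) (g : R -> R) m x : fejer g m x =
  \sum_(q < m) \sum_(i < m) \sum_(j < m) m%:R^-1 * (g (q%:R / m%:R) * m%:R^-1) *
    cos (2 * pi * ((i%:Z - j%:Z)%:~R * x - ((i%:R - j%:R) * (q%:R / m%:R)))).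
Proof.
rewrite /fejer /fejer_kernel mulr_sumr.
apply: eq_bigr => q _; rewrite !mulr_sumr; apply: eq_bigr => i _.
rewrite !mulr_sumr; apply: eq_bigr => j _; rewrite intrD mulrNz -!pmulrn.
rewrite (_ : 2 * pi * ((i%:R - j%:R) * x - _) = 2 * pi * (i%:R - j%:R) * (x - q%:R / m%:R)); last by ring.
by ring.
Qed.

Section skew_shift.
Context {R : realType} (alpha beta : R).
Local Notation f := (skew_shift alpha beta).
Implicit Types (p : R * R) (j l : int) (n k : nat).

(** The second coordinate of the k-th iterate of the origin. Its quadratic growth in k is what van
    der Corput's inequality exploits. *)
Definition skew_drift k : R := k%:R * beta + alpha * (k%:R ^+ 2 - k%:R) / 2.

Lemma iter_skew k p :
  iter k f p = (p.1 + k%:R * alpha, p.2 + k%:R * p.1 + skew_drift k).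
Proof.
elim: k => [|k IH].
  by rewrite /skew_drift /= [LHS]surjective_pairing; congr pair; ring.
rewrite iterS IH /skew_shift /skew_drift /= -natr1.
by congr pair; field.
Qed.

Definition character j l (th : R) p : R := cos (2 * pi * (j%:~R * p.1 + l%:~R * p.2 + th)).

Hypothesis ia : irrational alpha.

(** For l different from 0 the phase along an orbit is quadratic in time and [van_der_corput]
    applies; for l = 0 only the rotation by alpha is left, and the sums are geometric or
    constant. *)
Lemma unif_mean_character j l th :
  unif_mean f (character j l th) (if (j == 0) && (l == 0) then cos (2 * pi * th) else 0).
Proof.
have [l0|l0] := eqVneq l 0; last first.
  rewrite andbF => e e0.
  have [n0 N0] := van_der_corput ia l0 e0.
  exists n0 => n nn p; rewrite mul0r subr0 /birkhoff.
  have := N0 (fun k => j%:~R * (p.1 + k%:R * alpha) +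
    l%:~R * (p.2 + k%:R * p.1 + skew_drift k) + th)
    (fun h => j%:~R * h%:R * alpha + l%:~R * (h%:R * p.1 + skew_drift h)) _ n nn.
  have -> : \sum_(k < n) cos (2 * pi * (j%:~R * (p.1 + k%:R * alpha) +
    l%:~R * (p.2 + k%:R * p.1 + skew_drift k) + th)) =
    \sum_(k < n) character j l th (iter k f p).
    by apply: eq_bigr => k _; rewrite iter_skew.
  by apply; move=> k h; rewrite /skew_drift natrD; field.
have [j0|j0] := eqVneq j 0.
  rewrite j0 l0 /= (_ : character _ _ _ = fun _ => cos (2 * pi * th)).
    exact: unif_mean_cst.
  by apply/funext => p; rewrite /character !mul0r !add0r.
rewrite /= => e e0.
have sn0 := sin_irrational ia j0.
pose C := `|sin (pi * (j%:~R * alpha))|^-1.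
exists (Num.truncn (C / e)).+1 => n nn p; rewrite mul0r subr0 /birkhoff.
apply: (@le_trans _ _ C).
  apply: le_trans (sum_cos_bound (2 * pi * (j%:~R * p.1 + th)) n sn0).
  rewrite le_eqVlt; apply/orP; left; apply/eqP; congr `|_|.
  by apply: eq_bigr => k _; rewrite iter_skew /character l0 /=; congr cos; ring.
rewrite mulrC -ler_pdivrMr//; apply: le_trans (ltW (truncnS_gt _)) _.
by rewrite ler_nat.
Qed.

Lemma unif_mean_cos_cos j l th th' : exists2 mu, (l != 0 -> mu = 0) &
  unif_mean f (fun p => cos (2 * pi * (j%:~R * p.1 + th)) * cos (2 * pi * (l%:~R * p.2 + th'))) mu.
Proof.
have H1 := unif_meanZ 2^-1 (unif_mean_character j l (th + th')).
have H2 := unif_meanZ 2^-1 (unif_mean_character j (- l) (th - th')).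
eexists; last first.
  have := unif_meanD H1 H2.
  set F := (fun p => _ + _); rewrite (_ : F = (fun p => cos (2 * pi * (j%:~R * p.1 + th)) * cos (2 * pi * (l%:~R * p.2 + th')))).
    exact.
  apply/funext => p; rewrite /F /character mulrNz.
  rewrite (_ : 2 * pi * (j%:~R * p.1 + l%:~R * p.2 + (th + th')) =
     2 * pi * (j%:~R * p.1 + th) + 2 * pi * (l%:~R * p.2 + th')); last by ring.
  rewrite (_ : 2 * pi * (j%:~R * p.1 + - l%:~R * p.2 + (th - th')) =
     2 * pi * (j%:~R * p.1 + th) - 2 * pi * (l%:~R * p.2 + th')); last by ring.
  by rewrite cosD cosB; field.
by move=> l0; rewrite oppr_eq0 (negbTE l0) !andbF; ring.
Qed.

Lemma unif_mean_fejer_cos g m l th : exists2 mu, (l != 0 -> mu = 0) &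
  unif_mean f (fun p => fejer g m p.1 * cos (2 * pi * (l%:~R * p.2 + th))) mu.
Proof.
pose c (q : 'I_m) := m%:R^-1 * (g (q%:R / m%:R) * m%:R^-1).
have H (q i j : 'I_m) := unif_mean_cos_cos (i%:Z - j%:Z) l
  (- ((i%:R - j%:R) * (q%:R / m%:R))) th.
pose mu (q i j : 'I__) := s2val (cid2 (H q i j)).
exists (\sum_q \sum_i \sum_j c q * mu q i j).
  move=> l0; rewrite big1// => q _; rewrite big1// => i _; rewrite big1// => j _.
  by rewrite /mu (s2valP (cid2 (H q i j)))// mulr0.
rewrite (_ : (fun p => _) = (fun p => \sum_(q < m) \sum_(i < m) \sum_(j < m) c q *
  (cos (2 * pi * ((i%:Z - j%:Z)%:~R * p.1 - ((i%:R - j%:R) * (q%:R / m%:R)))) *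
   cos (2 * pi * (l%:~R * p.2 + th))))).
  do 3 (apply: unif_mean_sum => ?).
  by apply: unif_meanZ; exact: (s2valP' (cid2 (H _ _ _))).
apply/funext => p; rewrite fejer_sum mulr_suml.
apply: eq_bigr => q _; rewrite mulr_suml; apply: eq_bigr => i _.
by rewrite mulr_suml; apply: eq_bigr => j _; rewrite -[LHS]mulrA.
Qed.

(** The value of the mean is left open here; integration against Haar measure identifies it later,
    through [invariant_mean]. *)
Lemma unif_mean_fejer_fejer g1 m1 g2 m2 : exists mu,
  unif_mean f (fun p => fejer g1 m1 p.1 * fejer g2 m2 p.2) mu.
Proof.
pose c (q : 'I_m2) := m2%:R^-1 * (g2 (q%:R / m2%:R) * m2%:R^-1).
have H (q i j : 'I_m2) := unif_mean_fejer_cos g1 m1 (i%:Z - j%:Z)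
  (- ((i%:R - j%:R) * (q%:R / m2%:R))).
pose mu (q i j : 'I__) := s2val (cid2 (H q i j)).
exists (\sum_q \sum_i \sum_j c q * mu q i j).
rewrite (_ : (fun p => _) = (fun p => \sum_(q < m2) \sum_(i < m2) \sum_(j < m2) c q *
  (fejer g1 m1 p.1 * cos (2 * pi * ((i%:Z - j%:Z)%:~R * p.2 - ((i%:R - j%:R) * (q%:R / m2%:R))))))).
  do 3 (apply: unif_mean_sum => ?).
  by apply: unif_meanZ; exact: (s2valP' (cid2 (H _ _ _))).
apply/funext => p; rewrite (fejer_sum g2) mulr_sumr.
apply: eq_bigr => q _; rewrite mulr_sumr; apply: eq_bigr => i _.
by rewrite mulr_sumr; apply: eq_bigr => j _; rewrite mulrCA.
Qed.

(** The coefficient [a] is merely continuous. A Fejer mean replaces it uniformly and turns the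
    product into finitely many characters, all with l different from 0 and hence of mean 0. *)
Lemma unif_mean_mode (a : R -> R) l th B : circle_ucont a -> (forall x, `|a x| <= B) ->
  l != 0 -> unif_mean f (fun p => a p.1 * cos (2 * pi * (l%:~R * p.2 + th))) 0.
Proof.
move=> ua aB l0; apply: unif_mean_lim => e e0.
have e20 : 0 < e / 2 by rewrite divr_gt0.
have [d d0 ud] := ua _ e20.
have B0 : 0 <= B by apply: le_trans (aB 0).
pose m := (Num.truncn (8 * B / (e * d ^+ 2))).+1.
have [mu mu0 H] := unif_mean_fejer_cos a m l th.
exists (fun p => fejer a m p.1 * cos (2 * pi * (l%:~R * p.2 + th))), mu.
split=> //; first by rewrite mu0// subrr normr0 ltW.
move=> p; rewrite -mulrBl normrM.
have : `|a p.1 - fejer a m p.1| <= e.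
  rewrite distrC; apply: le_trans (fejer_approx _ d0 (ltW e20) aB (ud _)) _ => //.
  have m0 : 0 < m%:R :> R by rewrite ltr0n.
  have := ltW (truncnS_gt (8 * B / (e * d ^+ 2))); rewrite -/m.
  rewrite ler_pdivrMr ?mulr_gt0 ?exprn_gt0// => Hm.
  suff : 4 * B / (m%:R * d ^+ 2) <= e / 2 by lra.
  rewrite ler_pdivrMr ?mulr_gt0 ?exprn_gt0//; lra.
move=> h; rewrite -[leRHS]mulr1; apply: ler_pM => //; exact: cos_max.
Qed.

(** Every nonconstant harmonic has bounded sums under an irrational rotation. With finitely many
    harmonics there are no small divisors to control, and the bounds simply add up. *)
Lemma trig_poly_birkhoff_bounded (h : R -> R) d (a b : nat -> R) :
  (forall x, h x = \sum_(k < d.+1) (a k * cos (2 * pi * k%:R * x) + b k * sin (2 * pi * k%:R * x))) ->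
  exists C : R, forall n p, `|birkhoff f (fun p => h p.1 - a 0%N) n p| <= C.
Proof.
move=> hE.
pose C := \sum_(k < d) (`|a k.+1| + `|b k.+1|) * `|sin (pi * (k.+1%:~R * alpha))|^-1.
exists C => n p.
have E x : h x - a 0%N = \sum_(k < d) (a k.+1 * cos (2 * pi * k.+1%:R * x) +
   b k.+1 * sin (2 * pi * k.+1%:R * x)).
  by rewrite hE big_ord_recl /= !mulr0 !mul0r cos0 sin0 mulr1 mulr0 addr0 addrC addKr.
rewrite /birkhoff; under eq_bigr do rewrite E.
rewrite exchange_big /= (le_trans (ler_norm_sum _ _ _))//; apply: ler_sum => k _.
have s0 : sin (pi * (k.+1%:~R * alpha)) != 0 by apply: sin_irrational.
rewrite big_split /= -!mulr_sumr (mulrDl `|_|).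
apply: le_trans (ler_normD _ _) _; rewrite !normrM; apply: lerD; rewrite ler_wpM2l//.
  apply: le_trans (sum_cos_bound (2 * pi * k.+1%:R * p.1) n s0).
  rewrite le_eqVlt; apply/orP; left; apply/eqP; congr `|_|.
  by apply: eq_bigr => i _; rewrite iter_skew /= -pmulrn; congr cos; ring.
apply: le_trans (sum_sin_bound (2 * pi * k.+1%:R * p.1) n s0).
rewrite le_eqVlt; apply/orP; left; apply/eqP; congr `|_|.
by apply: eq_bigr => i _; rewrite iter_skew /= -pmulrn; congr sin; ring.
Qed.

End skew_shift.

(** * Haar measures on the circle, the torus and its suspension *)

Notation RT R := (measurableTypeR R).

(* [haar], [haar2] and [haar3] are Lebesgue measure on [0, 1[, [0, 1[^2 and
   [0, 1[^2 x R, extended by zero. *)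
HB.lock Definition lam {R : realType} : {sigma_finite_measure set (RT R) -> \bar R} :=
  lebesgue_measure.

HB.lock Definition haar {R : realType} : probability (RT R) R := uniform_prob (@ltr01 R).

HB.lock Definition haar2 {R : realType} : probability (RT R * RT R)%type R :=
  lebesgue_integral_fubini_product_measure1__canonical__probability_measure_Probability
    (@haar R) (@haar R).

HB.lock Definition haar3 {R : realType} : {measure set (RT R * RT R * RT R)%type -> \bar R} :=
  lebesgue_integral_fubini_product_measure1__canonical__measure_function_Measure
    (@haar2 R) (@lam R).

Section haar.
Context {R : realType}.
Local Open Scope ereal_scope.
Local Notation T1 := (measurableTypeR R).
Local Notation T2 := (T1 * T1)%type.
Local Notation T3 := (T1 * T1 * T1)%type.
Local Notation lam := (@lam R).
Local Notation haar := (@haar R).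
Local Notation haar2 := (@haar2 R).
Local Notation haar3 := (@haar3 R).

Lemma continuous_measurable (g : R -> R) : continuous g -> measurable_fun [set: T1] (fun y : T1 => g y).
Proof. by move=> cg; exact: continuous_measurable_fun. Qed.

Lemma haar2_integral (G : T2 -> \bar R) : measurable_fun setT G -> (forall p, 0 <= G p) ->
  \int[haar2]_p G p = \int[haar]_x \int[haar]_y G (x, y).
Proof. by rewrite haar2.unlock; exact: fubini_tonelli1. Qed.

Lemma haar3_integral (G : T3 -> \bar R) : measurable_fun setT G -> (forall p, 0 <= G p) ->
  \int[haar3]_q G q = \int[haar2]_p \int[lam]_z G (p, z).
Proof. by rewrite haar3.unlock; exact: fubini_tonelli1. Qed.

Lemma measurable_translate (a : R) : measurable_fun [set: T1] (fun x : T1 => (x + a)%R).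
Proof. exact: measurable_funD. Qed.

(** Uniqueness of Lebesgue measure: the pushforward agrees with it on half-open intervals. *)
Lemma lebesgue_translate (a : R) (A : set T1) : measurable A ->
  pushforward lam (fun x : T1 => (x + a)%R) A = lam A.
Proof.
move=> mA; pose mT : measurable_fun setT (fun x : T1 => (x + a)%R) := measurable_translate a.
rewrite lam.unlock; apply/esym.
apply: (@lebesgue_measure_unique R [the measure _ _ of pushforward lebesgue_measure (fun x : T1 => (x + a)%R : T1)]) => // X [[b c] _ <-] /=.
rewrite /pushforward (_ : _ @^-1` _ = `](b - a)%R, (c - a)%R]%classic); last first.
  by apply/seteqP; split=> x /=; rewrite !in_itv /= ltrBlDr lerBrDr.
rewrite !lebesgue_measure_itv /= !lte_fin ltrD2r; case: ifP => // _.
by rewrite -!EFinB; congr EFin; ring.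
Qed.

Lemma ge0_integral_translate (g : T1 -> \bar R) (a : R) :
  measurable_fun setT g -> (forall x, 0 <= g x) ->
  \int[lam]_x g (x + a)%R = \int[lam]_x g x.
Proof.
move=> mg g0; have mT := measurable_translate a.
rewrite -[RHS](@eq_measure_integral _ _ _ setT lam [the measure _ _ of pushforward lam (fun x : T1 => (x + a)%R : T1)]).
  by rewrite ge0_integral_pushforward.
by move=> A mA _; exact: lebesgue_translate.
Qed.

Lemma ge0_integral_translate_in (g : T1 -> \bar R) (a b c : R) :
  measurable_fun setT g -> (forall x, 0 <= g x) ->
  \int[lam]_(x in `[b, c[) g (x + a)%R = \int[lam]_(x in `[(b + a)%R, (c + a)%R[) g x.
Proof.
move=> mg g0.
rewrite integral_mkcond [RHS]integral_mkcond -[RHS](ge0_integral_translate a).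
- apply: eq_integral => x _ /=; rewrite !patchE.
  by congr (if _ then _ else _); apply/idP/idP; rewrite !inE /= !in_itv /= lerD2r ltrD2r.
- by apply/(measurable_restrictT g) => //; apply: measurable_funTS.
- by move=> x; apply: erestrict_ge0 => y _; exact: g0.
Qed.

Lemma circ_integralE (g : T1 -> \bar R) :
  measurable_fun setT g -> (forall x, 0 <= g x) ->
  \int[haar]_x g x = \int[lam]_(x in `[0%R, 1%R[) g x.
Proof.
move=> mg g0; rewrite haar.unlock lam.unlock integral_uniform// subr0 invr1 mul1e integral_itv_bndo_bndc//.
by apply: measurable_funTS.
Qed.

Definition ecirc (g : T1 -> \bar R) := forall x (z : int), g (x + z%:~R)%R = g x.

(** Only the fractional part s of the translation matters. The domain [0, 1[ becomes [s, 1 + s[,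
    which is cut at 1, and periodicity brings [1, 1 + s[ back to [0, s[. *)
Lemma circ_translate (g : T1 -> \bar R) (a : R) : ecirc g ->
  measurable_fun setT g -> (forall x, 0 <= g x) ->
  \int[haar]_x g (x + a)%R = \int[haar]_x g x.
Proof.
move=> pg mg g0.
have mga : measurable_fun setT (fun x : T1 => g (x + a)%R).
  by apply: measurableT_comp => //; exact: measurable_translate.
rewrite !circ_integralE//.
pose s := (a - (Num.floor a)%:~R)%R.
have /andP[f1 f2] := floor_itv a; rewrite intrD in f2.
have s0 : (0 <= s)%R by rewrite /s; lra.
have s1 : (s < 1)%R by rewrite /s; lra.
have -> : \int[lam]_(x in `[0%R, 1%R[) g (x + a)%R = \int[lam]_(x in `[0%R, 1%R[) g (x + s)%R.
  by apply: eq_integral => x _; rewrite /s -(pg (_ + a)%R (- Num.floor a)%R) mulrNz addrA.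
rewrite ge0_integral_translate_in// add0r.
have -> : `[s, (1 + s)%R[%classic = `[s, 1%R[%classic `|` `[1%R, (1 + s)%R[%classic.
  apply/seteqP; split=> x /=; rewrite !in_itv /=.
    by move=> /andP[h1 h2]; have [h|h] := ltP x 1%R; [left|right]; apply/andP; split.
  by case=> /andP[h1 h2]; apply/andP; split; lra.
have -> : `[0%R, 1%R[%classic = `[0%R, s[%classic `|` `[s, 1%R[%classic :> set R.
  apply/seteqP; split=> x /=; rewrite !in_itv /=.
    by move=> /andP[h1 h2]; have [h|h] := ltP x s; [left|right]; apply/andP; split.
  by case=> /andP[h1 h2]; apply/andP; split; lra.
rewrite !ge0_integral_setU//=.
- rewrite addeC; congr (_ + _).
  have := @ge0_integral_translate_in g 1%R 0%R s mg g0.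
  rewrite add0r (addrC s) => <-; apply: eq_integral => x _.
  by rewrite -[RHS](pg x 1%R).
- by apply: measurable_funTS.
- apply/disj_setPS => x /=; rewrite !in_itv /= => -[/andP[? ?] /andP[? ?]]; lra.
- by apply: measurable_funTS.
- apply/disj_setPS => x /=; rewrite !in_itv /= => -[/andP[? ?] /andP[? ?]]; lra.
Qed.

Definition etorus (G : T2 -> \bar R) := forall p (i j : int),
  G (p.1 + i%:~R, p.2 + j%:~R)%R = G p.

Variables (alpha beta : R).
Local Notation f := (skew_shift alpha beta).

Lemma measurable_skew : measurable_fun [set: T2] (f : T2 -> T2).
Proof.
apply/measurable_fun_pairP; split => /=.
  by apply: measurable_funD.
by apply: measurable_funD => //; exact: measurable_funD.
Qed.

Lemma skew_torus p (i j : int) : f (p.1 + i%:~R, p.2 + j%:~R)%R =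
  ((f p).1 + i%:~R, (f p).2 + (j + i)%:~R)%R.
Proof. by rewrite /skew_shift /= intrD; congr pair; ring. Qed.

Lemma etorus_skew G : etorus G -> etorus (G \o f).
Proof. by move=> tG p i j /=; rewrite skew_torus tG. Qed.

(** By Tonelli: over each x the skew shift translates the fiber by x + beta, and it translates the
    base by alpha. *)
Lemma torus_skew_integral (G : T2 -> \bar R) : etorus G ->
  measurable_fun setT G -> (forall p, 0 <= G p) ->
  \int[haar2]_p G (f p) = \int[haar2]_p G p.
Proof.
move=> tG mG G0.
have mGf : measurable_fun setT (G \o f).
  by apply: measurableT_comp => //; exact: measurable_skew.
rewrite (haar2_integral mGf); last by move=> x; exact: G0.
rewrite (haar2_integral mG G0).
rewrite -(@circ_translate (fubini_F haar G) alpha).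
- apply: eq_integral => x _; rewrite /fubini_F /=.
  rewrite -(@circ_translate (fun y => G (x + alpha, y)%R) (x + beta)%R).
  + by apply: eq_integral => y _; rewrite /skew_shift /= addrA.
  + by move=> y z; have := tG (x + alpha, y)%R 0%R z; rewrite /= addr0.
  + exact: measurable_fun_pair2.
  + by [].
- move=> x z; apply: eq_integral => y _.
  by have := tG (x, y)%R z 0%R; rewrite /= addr0.
- exact: measurable_fun_fubini_tonelli_F.
- by move=> x; exact: integral_ge0.
Qed.

Lemma torus_skew_iter_integral (G : T2 -> \bar R) n : etorus G ->
  measurable_fun setT G -> (forall p, 0 <= G p) ->
  \int[haar2]_p G (iter n f p) = \int[haar2]_p G p.
Proof.
elim: n G => // n IH G tG mG G0.
rewrite -[RHS](torus_skew_integral tG mG G0) -(IH (G \o f))//.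
- exact: etorus_skew.
- by apply: measurableT_comp => //; exact: measurable_skew.
- by move=> p; exact: G0.
Qed.

Lemma measurable_iter_skew n : measurable_fun [set: T2] (iter n f : T2 -> T2).
Proof.
elim: n => [|n IH]; first exact: measurable_id.
by apply: measurableT_comp => //; exact: measurable_skew.
Qed.

(** Tonelli again: a translation in each vertical line, then invariance of [haar2]. The translation
    [s] is an arbitrary measurable function because both the special flow and the skew product over
    a mode are of this form, with [s] a Birkhoff sum up to sign and a constant. *)
Lemma torus_flow_integral (G : T3 -> \bar R) n (s : T2 -> R) :
  (forall z, etorus (fun p => G (p, z))) ->
  measurable_fun setT G -> (forall q, 0 <= G q) -> measurable_fun setT s ->
  \int[haar3]_q G (iter n f q.1, q.2 - s q.1)%R = \int[haar3]_q G q.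
Proof.
move=> tG mG G0 ms.
pose H (q : T3) := G (iter n f q.1, q.2 - s q.1)%R.
have mT : measurable_fun [set: T3] (fun q : T3 => (iter n f q.1, q.2 - s q.1)%R).
  apply: measurable_fun_pair; first by apply: measurableT_comp => //; exact: measurable_iter_skew.
  by apply: measurable_funB => //; apply: measurableT_comp.
have mH : measurable_fun setT H by apply: measurableT_comp mG mT.
rewrite (haar3_integral mH)//; last by move=> x; exact: G0.
rewrite (haar3_integral mG G0).
rewrite -(@torus_skew_iter_integral (fubini_F lam G) n).
- apply: eq_integral => p _; rewrite /fubini_F /H /=.
  rewrite -(@ge0_integral_translate (fun z => G (iter n f p, z)) (- s p))//.
  exact: measurable_fun_pair2.
- by move=> p i j; apply: eq_integral => z _; exact: tG.
- exact: measurable_fun_fubini_tonelli_F.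
- by move=> x; exact: integral_ge0.
Qed.

End haar.

(** * Sublevel sets of trigonometric polynomials *)

(** Newton's divided differences: dividing q - q(z 0) by X - z 0 leaves a polynomial of lower
    degree, bounded by 2 * del / s at the remaining points. The constant depends only on the
    separation s and the degree. *)
Lemma newton_coef_bound (C : numFieldType) (s : C) n : 0 < s ->
  exists2 K : C, 0 <= K & forall (del : C) (z : nat -> C) (q : {poly C}), 0 <= del ->
    (size q <= n.+1)%N -> (forall i, (i <= n)%N -> `|z i| <= 1) ->
    (forall i j, (i < j <= n)%N -> s <= `|z j - z i|) ->
    (forall i, (i <= n)%N -> `|q.[z i]| <= del) -> forall k, `|q`_k| <= K * del.
Proof.
move=> s0; elim: n => [|n [K K0 IH]].
  exists 1 => // del z q d0 sq _ _ qd k; rewrite mul1r.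
  rewrite (size1_polyC sq) coefC; case: eqP => _; last by rewrite normr0.
  by have := qd 0%N isT; rewrite (size1_polyC sq) hornerC coefC.
(* The 1 accounts for the value at z 0; the quotient enters twice, once multiplied by X and once by
   z 0, whose modulus is at most 1. *)
exists (1 + 2 * (K * (2 / s))).
  by rewrite addr_ge0// !mulr_ge0// invr_ge0 ltW.
move=> del z q d0 sq z1 zs qd k.
pose v := q.[z 0%N].
have /factor_theorem[r rE] : root (q - v%:P) (z 0%N).
  by rewrite rootE hornerD hornerN hornerC subrr.
have qE : q = v%:P + r * ('X - (z 0%N)%:P) by rewrite -rE addrC subrK.
have sr : (size r <= n.+1)%N.
  have [->|r0] := eqVneq r 0; first by rewrite size_poly0.
  have : (size (q - v%:P)%R = (size r).+1)%N.
    by rewrite rE size_Mmonic ?monicXsubC// size_XsubC addn2.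
  move=> E; rewrite -ltnS -E.
  apply: leq_trans (size_polyD _ _) _; rewrite geq_max sq size_polyN.
  by rewrite (leq_trans (size_polyC_leq1 _)).
have rd i : (i <= n)%N -> `|r.[z i.+1]| <= 2 / s * del.
  move=> i_n; have zi := zs 0%N i.+1 i_n.
  have z0 : 0 < `|z i.+1 - z 0%N| by apply: lt_le_trans zi.
  have E : r.[z i.+1] * (z i.+1 - z 0%N) = q.[z i.+1] - v.
    by rewrite [in RHS]qE hornerD hornerM hornerC hornerXsubC [v + _]addrC addrK.
  have : `|r.[z i.+1]| * `|z i.+1 - z 0%N| <= 2 * del.
    rewrite -normrM E (_ : 2 * del = del + del); last by ring.
    by apply: le_trans (ler_normB _ _) _; apply: lerD; apply: qd.
  rewrite -ler_pdivlMr// => /le_trans; apply.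
  by rewrite [leRHS]mulrAC; apply: ler_wpM2l; rewrite ?mulr_ge0// lef_pV2.
have rk k' : `|r`_k'| <= K * (2 / s * del).
  apply: (IH _ (fun i => z i.+1)) => //.
  - by rewrite !mulr_ge0// invr_ge0 ltW.
  - by move=> i i_n; apply: z1.
  - by move=> i j /andP[ij jn]; apply: zs; rewrite ltnS ij.
have B0 : 0 <= K * (2 / s * del) by rewrite !mulr_ge0// invr_ge0 ltW.
rewrite qE mulrBr coefD coefB coefC coefMX coefMC.
have -> : (1 + 2 * (K * (2 / s))) * del = del + (K * (2 / s * del) + K * (2 / s * del)) by ring.
apply: le_trans (ler_normD _ _) _; apply: lerD.
  by case: eqP => _; [exact: qd | rewrite normr0].
apply: le_trans (ler_normB _ _) _; apply: lerD.
  by case: eqP => _; rewrite ?normr0.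
rewrite normrM -[leRHS]mulr1; apply: ler_pM => //; exact: z1.
Qed.

Section trig_poly.
Context {R : realType}.
Local Open Scope complex_scope.
Implicit Types (a b : nat -> R) (x y : R).

Definition trig_sum d a b y : R :=
  \sum_(k < d) (a k * cos (2 * pi * k.+1%:R * y) + b k * sin (2 * pi * k.+1%:R * y)).

Definition trig_norm d a b : R := \sum_(k < d) (`|a k| + `|b k|).

Definition cexp y : R[i] := cos (2 * pi * y) +i* sin (2 * pi * y).

Lemma cexpX n y : cexp y ^+ n = cos (2 * pi * n%:R * y) +i* sin (2 * pi * n%:R * y).
Proof.
elim: n => [|n IH]; first by rewrite expr0 mulr0 mul0r cos0 sin0.
rewrite exprS IH /cexp; have -> : 2 * pi * n.+1%:R * y = 2 * pi * y + 2 * pi * n%:R * y.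
  by rewrite -natr1; ring.
by rewrite cosD sinD; apply/eqP; rewrite eq_complex /= (addrC (sin _ * _)) !eqxx.
Qed.

Lemma le_normc s (w : R[i]) : 0 <= s -> s ^+ 2 <= Re w ^+ 2 + Im w ^+ 2 -> s%:C <= `|w|.
Proof.
move=> s0 sw; rewrite normc_def lecR -[leLHS](ger0_norm s0) -sqrtr_sqr.
by rewrite ler_sqrt// addr_ge0// sqr_ge0.
Qed.

Lemma normc_ge_Im (w : R[i]) : `|Im w|%:C <= `|w|.
Proof. by apply: le_normc => //; rewrite real_normK ?num_real// lerDr sqr_ge0. Qed.

Lemma normc_cexp y : `|cexp y| = 1.
Proof. by rewrite normc_def /= cos2Dsin2 sqrtr1. Qed.

(** The chord has length exactly 2 * [|sin (pi * (x - y))|]; half of it is enough. *)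
Lemma cexp_dist x y : `|sin (pi * (x - y))|%:C <= `|cexp x - cexp y|.
Proof.
apply: le_normc => //=; rewrite real_normK ?num_real//.
have -> : (cos (2 * pi * x) - cos (2 * pi * y)) ^+ 2 + (sin (2 * pi * x) - sin (2 * pi * y)) ^+ 2
   = (cos (2 * pi * x) ^+ 2 + sin (2 * pi * x) ^+ 2) + (cos (2 * pi * y) ^+ 2 + sin (2 * pi * y) ^+ 2)
    - 2 * cos (2 * pi * x - 2 * pi * y) by rewrite cosB; ring.
rewrite !cos2Dsin2 (_ : 2 * pi * x - 2 * pi * y = (pi * (x - y)) *+ 2); last first.
  by rewrite -mulr_natr; ring.
rewrite cos_mulr2n cos2sin2.
have := sqr_ge0 (sin (pi * (x - y))); lra.
Qed.

(** Each harmonic is a sum of two exponentials with conjugate coefficients; the shift of the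
    exponents by d makes them nonnegative. *)
Definition trig_cpoly d a b : {poly R[i]} :=
  \sum_(k < d) (((a k / 2) -i* (b k / 2)) *: 'X^(d + k.+1) +
                ((a k / 2) +i* (b k / 2)) *: 'X^(d - k.+1)).

Lemma trig_cpolyE d a b y : (trig_cpoly d a b).[cexp y] = cexp y ^+ d * (trig_sum d a b y)%:C.
Proof.
rewrite /trig_cpoly horner_sum /trig_sum rmorph_sum /= mulr_sumr.
apply: eq_bigr => k _; rewrite hornerD !hornerZ !hornerXn.
have -> : cexp y ^+ (d - k.+1) = cexp y ^+ d * (cexp y ^+ k.+1)^*.
  have := subnK (ltn_ord k); set m := (d - k.+1)%N => E.
  have -> : cexp y ^+ d = cexp y ^+ m * cexp y ^+ k.+1 by rewrite -exprD E.
  by rewrite -mulrA -sqr_normc normrX normc_cexp !expr1n mulr1.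
rewrite exprD !(mulrCA _ (cexp y ^+ d)) -mulrDr; congr (_ * _).
rewrite cexpX; apply/eqP; rewrite eq_complex /=; by apply/andP; split; apply/eqP; field.
Qed.

Lemma trig_cpoly_size d a b : (size (trig_cpoly d a b) <= (2 * d).+1)%N.
Proof.
apply/leq_sizeP => j jd; rewrite coef_sum big1// => k _.
rewrite coefD !coefZ !coefXn.
have /= kd := ltn_ord k.
have -> : (j == (d + k.+1)%N) = false by apply/eqP; lia.
have -> : (j == (d - k.+1)%N) = false by apply/eqP; lia.
by rewrite !mulr0 addr0.
Qed.

Lemma trig_cpoly_coef d a b k : (k < d)%N ->
  (trig_cpoly d a b)`_(d + k.+1) = (a k / 2) -i* (b k / 2).
Proof.
move=> kd; rewrite coef_sum (bigD1 (Ordinal kd))//= big1 ?addr0.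
  rewrite coefD !coefZ !coefXn eqxx mulr1.
  have -> : ((d + k.+1)%N == (d - k.+1)%N) = false by apply/eqP; lia.
  by rewrite mulr0 addr0.
move=> i ik; rewrite coefD !coefZ !coefXn.
have -> : ((d + k.+1)%N == (d + i.+1)%N) = false.
  by rewrite eqn_add2l eqSS eq_sym; apply/negbTE.
have -> : ((d + k.+1)%N == (d - i.+1)%N) = false by apply/eqP; lia.
by rewrite !mulr0 addr0.
Qed.

(* After multiplication by a power of [cexp y], a trigonometric polynomial
   becomes a polynomial, whose coefficients are controlled by its values at
   well separated points through Newton interpolation. *)
Lemma trig_remez d (s : R) : 0 < s -> exists2 K : R, 0 <= K & forall del a b (y : nat -> R), 0 <= del ->
  (forall i j, (i < j <= 2 * d)%N -> s <= `|sin (pi * (y j - y i))|) ->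
  (forall i, (i <= 2 * d)%N -> `|trig_sum d a b (y i)| <= del) ->
  trig_norm d a b <= K * del.
Proof.
move=> s0.
have s0' : 0 < s%:C :> R[i] by rewrite ltcR.
have [K K0 HK] := @newton_coef_bound R[i] s%:C (2 * d) s0'.
have KE : K = (Re K)%:C by move: K0; case: K {HK} => u v; rewrite lecE /= => /andP[/eqP E _]; rewrite E.
have K0' : 0 <= Re K by move: K0; rewrite KE lecR.
exists (d%:R * (4 * Re K)); first by rewrite !mulr_ge0.
move=> del a b y d0 ys yd.
have C k : `|(trig_cpoly d a b)`_k| <= K * del%:C.
  apply: (HK _ (fun i => cexp (y i))) => //.
  - by rewrite lecR.
  - exact: trig_cpoly_size.
  - by move=> i _; rewrite normc_cexp.
  - move=> i j ij; apply: le_trans (cexp_dist _ _).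
    by rewrite lecR ys.
  - move=> i /yd; rewrite trig_cpolyE normrM normrX normc_cexp expr1n mul1r.
    by rewrite normc_def /= expr0n addr0 sqrtr_sqr lecR.
have ak k : (k < d)%N -> `|a k| + `|b k| <= 4 * Re K * del.
  move=> kd; have := C (d + k.+1)%N; rewrite trig_cpoly_coef// => H.
  have := le_trans (normc_ge_Re _) H; have := le_trans (normc_ge_Im _) H.
  rewrite KE -rmorphM !lecR /= normrN !normrM (@gtr0_norm _ 2^-1)//.
  by move=> *; lra.
rewrite /trig_norm (_ : d%:R * _ * _ = \sum_(k < d) (4 * Re K * del)).
  by apply: ler_sum => k _; exact: ak.
by rewrite sumr_const_ord; ring.
Qed.

End trig_poly.

Section sublevel.
Context {R : realType}.
Local Notation T1 := (measurableTypeR R).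
Local Open Scope ereal_scope.

Lemma haarE (A : set T1) : measurable A ->
  haar A = lam (A `&` `[0%R, 1%R[%classic).
Proof.
move=> mA; rewrite -[A in LHS]setIT -integral_indic// circ_integralE.
- by rewrite integral_indic.
- by apply/measurable_EFinP; exact: measurable_indic.
- by move=> x; rewrite lee_fin.
Qed.

Lemma lam_itv (b0 b1 : bool) (a b : R) : (a <= b)%R ->
  lam [set` Interval (BSide b0 a) (BSide b1 b)] = (b - a)%:E.
Proof.
move=> ab; rewrite lam.unlock; apply: (eq_trans (lebesgue_measure_itv _)) => /=.
rewrite lte_fin; case: ifPn => //; rewrite -leNgt => ba.
by rewrite (_ : a = b) ?subrr//; apply/eqP; rewrite eq_le ab.
Qed.

Lemma measurable_sin_lt (c s : R) :
  measurable ([set y | (`|sin (pi * (y - c))| < s)%R] : set T1).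
Proof.
have mg : measurable_fun [set: T1] (fun y : T1 => `|sin (pi * (y - c))|%R).
  apply: measurableT_comp => //; apply: measurableT_comp.
    exact: continuous_measurable_fun (@continuous_sin R).
  by apply: measurable_funM => //; exact: measurable_funD.
rewrite (_ : [set _ | _] = setT `&` [set y : T1 | (`|sin (pi * (y - c))| < s)%R]); last by rewrite setTI.
exact: measurable_fun_ltr.
Qed.

Lemma sin_small_measure (e : R) : (0 < e)%R -> exists2 s : R, (0 < s)%R &
  forall c : R, haar [set y : T1 | (`|sin (pi * (y - c))| < s)%R] <= e%:E.
Proof.
move=> e0; pose e' : R := Num.min (e / 2)%R (1 / 4)%R.
have e'0 : (0 < e')%R by rewrite lt_min divr_gt0//=; lra.
have e'4 : (e' <= 1 / 4)%R by rewrite ge_min lexx orbT.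
have e'e : (e' <= e / 2)%R by rewrite ge_min lexx.
have [s s0 Hs] := sin_pi_small e'0.
exists s => // c.
have -> : haar [set y : T1 | (`|sin (pi * (y - c))| < s)%R] =
          haar [set y : T1 | (`|sin (pi * (y - 0))| < s)%R].
  rewrite -[X in haar X = _]setIT -[X in _ = haar X]setIT -!integral_indic//; first last.
  - exact: measurable_sin_lt.
  - exact: measurable_sin_lt.
  rewrite -[RHS](@circ_translate _ _ (- c)%R)//.
  - by apply: eq_integral => x _; rewrite !indicE; congr ((_ _)%:R%:E); apply/idP/idP; rewrite !inE /= subr0.
  - move=> x z; rewrite !indicE; congr ((_ _)%:R%:E).
    by apply/idP/idP; rewrite !inE /= !subr0 sin_pi_periodz.
  - by apply/measurable_EFinP; apply: measurable_indic; exact: measurable_sin_lt.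
rewrite haarE; last exact: measurable_sin_lt.
apply: (@le_trans _ _ (lam (`[0%R, e']%classic `|` `[(1 - e')%R, 1%R]%classic))).
  apply: le_measure; rewrite ?inE.
  - apply: measurableI => //; exact: measurable_sin_lt.
  - exact: measurableU.
  - move=> y [/= /ltW /Hs [z]]; rewrite subr0 in_itv /= => yz /andP[y0 y1].
    have [z0|z0] := leP z 0%R.
      left; rewrite /= in_itv /= y0 /=.
      have : (z%:~R <= 0 :> R)%R by rewrite (ler_int _ z 0).
      by move: yz; rewrite ler_norml => /andP[? ?] ?; lra.
    right; rewrite /= in_itv /= (ltW y1) andbT.
    have : (1 <= z%:~R :> R)%R by rewrite (ler_int _ 1 z) -gtz0_ge1.
    by move: yz; rewrite ler_norml => /andP[? ?] ?; lra.
apply: le_trans (measureU2 _ _ _) _ => //.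
apply: (@le_trans _ _ ((e' - 0)%:E + (1 - (1 - e'))%:E)); last by rewrite -EFinD lee_fin; lra.
by apply: leeD; rewrite le_eqVlt; apply/orP; left; apply/eqP; apply: lam_itv; lra.
Qed.

(** Every point of [l] excludes an arc of measure at most e, and together these arcs are too small
    to cover Z. *)
Lemma separated_point (Z : set T1) (s e : R) (l : seq R) : measurable Z -> (0 <= e)%R ->
  (forall c : R, haar [set y : T1 | (`|sin (pi * (y - c))| < s)%R] <= e%:E) ->
  ((size l)%:R * e)%:E < haar Z ->
  exists2 y, Z y & forall c, c \in l -> (s <= `|sin (pi * (y - c))|)%R.
Proof.
move=> mZ e0 He; elim: l Z mZ => [|c l IH] Z mZ /= HZ.
  have [/eqP Z0|/set0P[y Zy]] := boolP (Z == set0); last by exists y.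
  by move: HZ; rewrite Z0 measure0 mul0r ltxx.
pose B := [set y : T1 | (`|sin (pi * (y - c))| < s)%R].
have mB : measurable B by exact: measurable_sin_lt.
have [||y [Zy yB] Hy] := IH (Z `\` B).
- exact: measurableD.
- have : haar Z <= haar (Z `\` B) + haar B.
    rewrite (measureDI _ mZ mB); apply: leeD2l.
    by apply: le_measure; rewrite ?inE//; exact: measurableI.
  have /= := He c; rewrite -/B => HB.
  rewrite -natr1 mulrDl mul1r EFinD in HZ => H.
  rewrite -(@lteD2rE _ (e%:E))//; apply: lt_le_trans HZ _; apply: le_trans H _.
  exact: leeD2l.
- exists y => // c'; rewrite inE => /predU1P[->|/Hy//].
  by rewrite leNgt; apply/negP.
Qed.

Lemma separated_points (Z : set T1) (s e : R) n : measurable Z -> (0 <= e)%R ->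
  (forall c : R, haar [set y : T1 | (`|sin (pi * (y - c))| < s)%R] <= e%:E) ->
  (n%:R * e)%:E < haar Z ->
  exists y : nat -> R, (forall i, (i <= n)%N -> Z (y i)) /\
    forall i j, (i < j <= n)%N -> (s <= `|sin (pi * (y j - y i))|)%R.
Proof.
move=> mZ e0 He; elim: n => [|n IH] HZ.
  have [|y Zy _] := @separated_point Z s e [::] mZ e0 He; first exact: HZ.
  exists (fun _ => y); split => // i j; rewrite leqn0 => /andP[ij /eqP j0].
  by rewrite j0 in ij.
have [|y [Zy ys]] := IH.
  by apply: le_lt_trans HZ; rewrite lee_fin ler_wpM2r// ler_nat.
have [|y' Zy' Hy'] := @separated_point Z s e [seq y i | i <- iota 0 n.+1] mZ e0 He.
  by rewrite size_map size_iota.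
exists (fun i => if (i <= n)%N then y i else y'); split=> [i|i j].
  by case: ifPn => [/Zy//|].
move=> /andP[ij jn]; have i_n : (i <= n)%N by rewrite -ltnS (leq_trans ij).
rewrite i_n; case: ifPn => [jn'|_]; first by apply: ys; rewrite ij.
by apply: Hy'; apply: map_f; rewrite mem_iota add0n /= ltnS.
Qed.

Lemma continuous_trig_sum d (a b : nat -> R) : continuous (trig_sum d a b : R -> R).
Proof.
apply: continuous_big => [|k _ y]; first exact: add_continuous.
by apply: cvgD; apply: cvgM; [exact: cvg_cst| |exact: cvg_cst|];
  apply: (continuous_comp (f := fun y : R => 2 * pi * k.+1%:R * y)%R);
  [exact: mulrl_continuous|exact: continuous_cos|exact: mulrl_continuous|exact: continuous_sin].
Qed.

(** A larger sublevel set would contain 2 * d + 1 points separated by s, where s depends only on d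
    and e. By [trig_remez] the norm would then be at most K * del times itself, and [del] is chosen
    with K * del < 1. *)
Lemma trig_sublevel d (e : R) : (0 < e)%R -> exists2 del : R, (0 < del)%R &
  forall a b : nat -> R, (0 < trig_norm d a b)%R ->
  haar [set y : T1 | (`|trig_sum d a b y| <= del * trig_norm d a b)%R] <= e%:E.
Proof.
move=> e0; pose e' := (e / (2 * d).+1%:R)%R.
have e'0 : (0 < e')%R by rewrite divr_gt0.
have [s s0 Hs] := sin_small_measure e'0.
have [K K0 HK] := @trig_remez R d s s0.
exists (1 / (2 * (K + 1)))%R; first by rewrite divr_gt0// mulr_gt0// ltr_wpDl.
move=> a b ab0; rewrite leNgt; apply/negP => H.
set Z := [set y | _] in H.
have mZ : measurable Z.
  rewrite (_ : Z = setT `&` [set y : T1 | (`|trig_sum d a b y| <= 1 / (2 * (K + 1)) * trig_norm d a b)%R]); last by rewrite setTI.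
  apply: measurable_fun_ler => //; apply: measurableT_comp => //.
  exact: continuous_measurable (@continuous_trig_sum d a b).
have [|y [Zy ys]] := @separated_points Z s e' (2 * d)%N mZ (ltW e'0) Hs.
  apply: le_lt_trans H; rewrite lee_fin /e' mulrCA -[leRHS]mulr1 ler_wpM2l ?(ltW e0)//.
  by rewrite ler_pdivrMr// mul1r ler_nat.
have K1 : (0 < K + 1)%R by rewrite ltr_wpDl.
have := HK (1 / (2 * (K + 1)) * trig_norm d a b)%R a b y _ ys Zy.
have d0 : (0 <= 1 / (2 * (K + 1)) * trig_norm d a b)%R.
  by rewrite mulr_ge0 ?(ltW ab0)// divr_ge0// mulr_ge0// ltW.
move=> /(_ d0); apply/negP; rewrite -ltNge.
have : (K * (1 / (2 * (K + 1))) < 1)%R.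
  by rewrite mul1r ltr_pdivrMr ?mulr_gt0// mul1r; lra.
move=> KK; rewrite mulrA -[ltRHS]mul1r ltr_pM2r//.
Qed.

End sublevel.

(** * Discrete Fourier coefficients *)

Section grid_projection.
Context {R : realType}.
Implicit Types (x y th : R) (h : R -> R) (m k : nat).

Lemma grid_cos_phase m (z : int) th : (0 < `|z| < m)%N ->
  \sum_(q < m) cos (2 * pi * (z%:~R * (q%:R / m%:R)) + th) = 0.
Proof.
move=> zm; have p0 := pi_gt0 R.
have z0 : z%:~R != 0 :> R.
  by rewrite intr_eq0; move: zm; case: eqP => // ->.
rewrite -[RHS](@grid_cos_sum R m z (- th / (2 * pi * z%:~R)) zm).
apply: eq_bigr => q _; rewrite -[RHS]cosN; congr cos.
have m0 : m%:R != 0 :> R.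
  by rewrite pnatr_eq0; case: m q zm => // -[].
have p0' : (pi : R) != 0 by rewrite gt_eqF.
have c0 : 2 * pi * z%:~R != 0 :> R by rewrite !mulf_neq0.
set c := 2 * pi * z%:~R in c0 *.
transitivity (c * (q%:R / m%:R) + th); first by rewrite /c; ring.
transitivity (- (c * (- th / c - q%:R / m%:R))); last by rewrite {1}/c; ring.
by field; rewrite ?c0 ?m0.
Qed.

(** Discrete projection onto the frequency k. The bound on k0 + k excludes aliasing, so that of the
    two product-to-sum terms only the difference frequency for k0 = k survives. *)
Lemma grid_projection m k0 k th y : (0 < k)%N -> (k0 + k < m)%N ->
  2 / m%:R * \sum_(q < m) cos (2 * pi * (k0%:R * (q%:R / m%:R)) + th) *
     cos (2 * pi * (k%:R * (y - q%:R / m%:R))) =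
  if k0 == k then cos (2 * pi * (k%:R * y) + th) else 0.
Proof.
move=> k_0 km.
have m0 : m%:R != 0 :> R by rewrite pnatr_eq0; case: m km.
have E q : cos (2 * pi * (k0%:R * (q%:R / m%:R)) + th) * cos (2 * pi * (k%:R * (y - q%:R / m%:R))) =
  2^-1 * cos (2 * pi * ((k0%:Z - k%:Z)%:~R * (q%:R / m%:R)) + (th + 2 * pi * (k%:R * y))) +
  2^-1 * cos (2 * pi * ((k0%:Z + k%:Z)%:~R * (q%:R / m%:R)) + (th - 2 * pi * (k%:R * y))).
  set u := 2 * pi * (k0%:R * _) + th; set v := 2 * pi * (k%:R * (y - _)).
  have -> : 2 * pi * ((k0%:Z - k%:Z)%:~R * (q%:R / m%:R)) + (th + 2 * pi * (k%:R * y)) = u + v.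
    by rewrite /u /v intrD mulrNz; ring.
  have -> : 2 * pi * ((k0%:Z + k%:Z)%:~R * (q%:R / m%:R)) + (th - 2 * pi * (k%:R * y)) = u - v.
    by rewrite /u /v intrD; ring.
  by rewrite (cosD u v) (cosB u v); field.
under eq_bigr do rewrite E.
rewrite big_split /= -!mulr_sumr [X in _ + _ * X]grid_cos_phase; last by lia.
rewrite mulr0 addr0; case: eqP => [->|k0k].
  under eq_bigr do rewrite subrr mul0r mulr0 add0r addrC.
  by rewrite sumr_const_ord; field.
rewrite grid_cos_phase ?mulr0//.
by apply/andP; split; lia.
Qed.

Lemma grid_mean m k0 th : (k0 < m)%N ->
  m%:R^-1 * \sum_(q < m) cos (2 * pi * (k0%:R * (q%:R / m%:R)) + th) =
  if k0 == 0%N then cos th else 0.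
Proof.
move=> km; have m0 : m%:R != 0 :> R by rewrite pnatr_eq0; case: m km.
case: eqP => [->|/eqP k0N].
  under eq_bigr do rewrite mul0r mulr0 add0r.
  by rewrite sumr_const_ord; field.
by rewrite (@grid_cos_phase m k0%:Z) ?mulr0//= lt0n k0N.
Qed.

(** A trigonometric polynomial of degree d is determined by 2 * d + 1 samples. Expressing its
    coefficients through samples rather than integrals makes the coefficients of Phi (x, .) finite
    combinations of values of Phi, so their continuity and periodicity in x are immediate. *)
Definition dft_mean d h : R := (2 * d).+1%:R^-1 * \sum_(q < (2 * d).+1) h (q%:R / (2 * d).+1%:R).
Definition dft_cos d h k : R := 2 / (2 * d).+1%:R *
  \sum_(q < (2 * d).+1) h (q%:R / (2 * d).+1%:R) * cos (2 * pi * (k.+1%:R * (q%:R / (2 * d).+1%:R))).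
Definition dft_sin d h k : R := 2 / (2 * d).+1%:R *
  \sum_(q < (2 * d).+1) h (q%:R / (2 * d).+1%:R) * sin (2 * pi * (k.+1%:R * (q%:R / (2 * d).+1%:R))).

Lemma dft_proj d h k y : dft_cos d h k * cos (2 * pi * k.+1%:R * y) + dft_sin d h k * sin (2 * pi * k.+1%:R * y)
  = 2 / (2 * d).+1%:R * \sum_(q < (2 * d).+1) h (q%:R / (2 * d).+1%:R) *
     cos (2 * pi * (k.+1%:R * (y - q%:R / (2 * d).+1%:R))).
Proof.
rewrite /dft_cos /dft_sin -!mulrA -mulrDr; congr (_ * _); rewrite -mulrDr; congr (_ * _).
rewrite !mulr_suml -big_split /=; apply: eq_bigr => q _.
rewrite (_ : 2 * pi * (k.+1%:R * (y - q%:R / (2 * d).+1%:R)) =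
  2 * (pi * (k.+1%:R * y)) - 2 * pi * (k.+1%:R * (q%:R / (2 * d).+1%:R))); last by ring.
by rewrite cosB; ring.
Qed.

Lemma trig_poly_dft d h : trig_poly_deg d h ->
  forall y, h y = dft_mean d h + trig_sum d (dft_cos d h) (dft_sin d h) y.
Proof.
move=> [a [b hE]] y; set m := (2 * d).+1.
(* Cosines and sines are treated together, as cosines of phase 0 or - pi / 2. *)
pose c k (th : bool) : R := if th then b k else a k.
pose ph (th : bool) : R := if th then - (pi / 2) else 0.
have hE' x : h x = \sum_(k < d.+1) \sum_(th : bool) c k th * cos (2 * pi * (k%:R * x) + ph th).
  rewrite hE; apply: eq_bigr => k _; rewrite big_bool /= addrC /c /ph addr0.
  by rewrite cosBpihalf !mulrA.
have -> : dft_mean d h = \sum_(k < d.+1) \sum_(th : bool) c k th *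
    (if (k : nat) == 0%N then cos (ph th) else 0).
  rewrite /dft_mean; under eq_bigr do rewrite hE'.
  rewrite exchange_big mulr_sumr /=; apply: eq_bigr => k _.
  rewrite exchange_big mulr_sumr /=; apply: eq_bigr => th _.
  rewrite -mulr_sumr mulrCA grid_mean// -/m.
  by have /= := ltn_ord k; rewrite /m; lia.
have -> : trig_sum d (dft_cos d h) (dft_sin d h) y = \sum_(k < d.+1) \sum_(th : bool) c k th *
    (if (k : nat) == 0%N then 0 else cos (2 * pi * (k%:R * y) + ph th)).
  rewrite /trig_sum; under eq_bigr do rewrite dft_proj.
  under eq_bigr => k _.
    have -> : 2 / m%:R * \sum_(q < m) h (q%:R / m%:R) * cos (2 * pi * (k.+1%:R * (y - q%:R / m%:R))) =
      \sum_(k0 < d.+1) \sum_(th : bool) c k0 th *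
        (if (k0 : nat) == k.+1 then cos (2 * pi * (k.+1%:R * y) + ph th) else 0).
      under eq_bigr do rewrite hE' mulr_suml.
      rewrite exchange_big mulr_sumr /=; apply: eq_bigr => k0 _.
      under eq_bigr do rewrite mulr_suml.
      rewrite exchange_big mulr_sumr /=; apply: eq_bigr => th _.
      under eq_bigr do rewrite -mulrA.
      rewrite -mulr_sumr mulrCA grid_projection//.
      by have /= := ltn_ord k0; have /= := ltn_ord k; rewrite /m; lia.
    over.
  rewrite exchange_big /= big_ord_recl [RHS]big_ord_recl /=.
  rewrite big1 ?add0r; last by move=> k _; rewrite big1// => th _; rewrite mulr0.
  rewrite [X in _ = X + _]big1 ?add0r; last by move=> th _; rewrite mulr0.
  apply: eq_bigr => k0 _; rewrite (bigD1 k0)//= [X in _ + X]big1 ?addr0.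
    by apply: eq_bigr => th _; rewrite eqxx.
  move=> k kk0; rewrite big1// => th _; rewrite /bump /= add1n eqSS ifN ?mulr0//.
  by rewrite eq_sym; exact: kk0.
rewrite hE' -big_split; apply: eq_bigr => k _ /=.
rewrite -big_split; apply: eq_bigr => th _ /=; rewrite -mulrDr; congr (_ * _).
by case: eqP => [->|]; rewrite ?mul0r ?mulr0 ?add0r ?addr0.
Qed.

Lemma dft_cos_bound d h k B : (forall y, `|h y| <= B) -> `|dft_cos d h k| <= 2 * B.
Proof.
move=> hB; have m0 : 0 < (2 * d).+1%:R :> R by [].
rewrite /dft_cos normrM ger0_norm ?divr_ge0// mulrAC ler_pdivrMr//.
rewrite -[leRHS]mulrA ler_pM2l// -sumr_const_ord (le_trans (ler_norm_sum _ _ _))//.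
by apply: ler_sum => q _; rewrite normrM -[leRHS]mulr1 ler_pM// cos_max.
Qed.

Lemma dft_sin_bound d h k B : (forall y, `|h y| <= B) -> `|dft_sin d h k| <= 2 * B.
Proof.
move=> hB; have m0 : 0 < (2 * d).+1%:R :> R by [].
rewrite /dft_sin normrM ger0_norm ?divr_ge0// mulrAC ler_pdivrMr//.
rewrite -[leRHS]mulrA ler_pM2l// -sumr_const_ord (le_trans (ler_norm_sum _ _ _))//.
by apply: ler_sum => q _; rewrite normrM -[leRHS]mulr1 ler_pM// sin_max.
Qed.

Lemma trig_poly_deg_sum d a b : trig_poly_deg d (trig_sum d a b : R -> R).
Proof.
exists (fun k => if k is k'.+1 then a k' else 0), (fun k => if k is k'.+1 then b k' else 0) => x.
by rewrite big_ord_recl /= !mul0r !add0r.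
Qed.

Lemma dft_mean_trig_sum d a b : dft_mean d (trig_sum d a b : R -> R) = 0.
Proof.
have E y : trig_sum d a b y = \sum_(k < d) (a k * cos (2 * pi * (k.+1%:R * y) + 0) +
    b k * cos (2 * pi * (k.+1%:R * y) - pi / 2)).
  by apply: eq_bigr => k _; rewrite addr0 cosBpihalf !mulrA.
rewrite /dft_mean; under eq_bigr do rewrite E.
rewrite exchange_big mulr_sumr /= big1// => k _.
have := ltn_ord k => kd.
have km : (k.+1 < (2 * d).+1)%N by lia.
have G th : \sum_(q < (2 * d).+1) cos (2 * pi * (k.+1%:R * (q%:R / (2 * d).+1%:R)) + th) = 0 :> R.
  by apply: (@grid_cos_phase _ k.+1%:Z).
by rewrite big_split /= -!mulr_sumr !G !mulr0 addr0 mulr0.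
Qed.

Lemma trig_norm_bound d a b B : (forall y, `|trig_sum d a b y : R| <= B) ->
  trig_norm d (dft_cos d (trig_sum d a b)) (dft_sin d (trig_sum d a b)) <= 4 * d%:R * B.
Proof.
move=> hB; rewrite /trig_norm (_ : 4 * d%:R * B = \sum_(k < d) (2 * B + 2 * B)).
  by apply: ler_sum => k _; apply: lerD; [exact: dft_cos_bound|exact: dft_sin_bound].
by rewrite sumr_const_ord; ring.
Qed.

End grid_projection.

(** * Fourier modes in the fibers *)

Section trig_derive.
Context {R : realType}.
Implicit Types (x y : R) (a b : nat -> R).

Global Instance is_derive_trig_sum d a b y : is_derive y 1 (trig_sum d a b : R -> R)
  (trig_sum d (fun k => 2 * pi * k.+1%:R * b k) (fun k => - (2 * pi * k.+1%:R * a k)) y).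
Proof.
have E k (c : R) : is_derive y 1 (fun y : R => c * y) c.
  have H : is_derive y 1 (c *: (@id R)) (c *: (1 : R)) by apply: is_deriveZ.
  by apply: is_derive_eq; rewrite /GRing.scale /= mulr1.
rewrite /trig_sum (_ : (fun y => _) = \sum_(k < d) (fun y : R => a k * cos (2 * pi * k.+1%:R * y) + b k * sin (2 * pi * k.+1%:R * y))); last first.
  by apply/funext => z; rewrite fct_sumE.
apply: is_derive_sum => k; set c := 2 * pi * k.+1%:R.
have Hc : is_derive y 1 (fun y : R => cos (c * y)) (- sin (c * y) * c).
  by apply: (@is_derive1_comp _ cos (fun y => c * y)); exact: E.
have Hs : is_derive y 1 (fun y : R => sin (c * y)) (cos (c * y) * c).
  by apply: (@is_derive1_comp _ sin (fun y => c * y)); exact: E.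
have H : is_derive y 1 (a k *: (fun y : R => cos (c * y)) + b k *: (fun y : R => sin (c * y)))
   (a k *: (- sin (c * y) * c) + b k *: (cos (c * y) * c)).
  by apply: is_deriveD.
apply: is_derive_eq; rewrite /GRing.scale /=; ring.
Qed.

Lemma integral_derive (F g : R -> R) (u v : R) : u < v ->
  (forall y, is_derive y 1 F (g y)) -> continuous g ->
  (\int[lebesgue_measure]_(y in `[u, v]) (g y)%:E = (F v - F u)%:E)%E.
Proof.
move=> uv dF cg; have cF : continuous F.
  by move=> y; apply/differentiable_continuous/derivable1_diffP; have := dF y; case.
rewrite (continuous_FTC2 (F := F)) //.
- exact: continuous_subspaceT.
- split=> [y _| |].
  + by have := dF y; case.
  + exact/cvg_at_right_filter/cF.
  + exact/cvg_at_left_filter/cF.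
- by move=> y _; rewrite derive1E; have := dF y; case => _ ->.
Qed.

Lemma integral_trig_sum d a b :
  (\int[lebesgue_measure]_(y in `[0%R, 1%R]) (trig_sum d a b y : R)%:E = 0)%E.
Proof.
pose a' k : R := - b k / (2 * pi * k.+1%:R); pose b' k : R := a k / (2 * pi * k.+1%:R).
have p0 : (pi : R) != 0 by rewrite gt_eqF// pi_gt0.
have D y : is_derive y 1 (trig_sum d a' b' : R -> R) (trig_sum d a b y).
  have := is_derive_trig_sum d a' b' y.
  rewrite (_ : trig_sum d (fun k => 2 * pi * k.+1%:R * b' k) _ y = trig_sum d a b y)//.
  apply: eq_bigr => k _; rewrite /a' /b'.
  have c0 : 2 * pi * k.+1%:R != 0 :> R by rewrite !mulf_neq0// pnatr_eq0.
  by set c := 2 * pi * k.+1%:R in c0 *; field.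
rewrite (integral_derive ltr01 D (@continuous_trig_sum _ d a b)).
rewrite (_ : trig_sum d a' b' 1 = trig_sum d a' b' 0) ?subrr//.
apply: eq_bigr => k _; rewrite mulr1 mulr0.
have -> : 2 * pi * k.+1%:R = 0 + 2 * pi * (k.+1%:Z)%:~R :> R by rewrite add0r.
by rewrite cos_periodz sin_periodz.
Qed.

Lemma fiber_mean_dft d (Phi : R * R -> R) x : trig_poly_deg d (fun y => Phi (x, y)) ->
  fiber_mean Phi x = dft_mean d (fun y => Phi (x, y)).
Proof.
move=> /trig_poly_dft E; rewrite /fiber_mean /Rintegral.
under eq_integral do rewrite E EFinD.
set c := dft_mean _ _.
rewrite integralD//=; last 2 first.
- apply: continuous_compact_integrable; first exact: segment_compact.
  by apply: continuous_subspaceT; exact: cst_continuous.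
- apply: continuous_compact_integrable; first exact: segment_compact.
  by apply: continuous_subspaceT; exact: continuous_trig_sum.
rewrite integral_trig_sum integral_cst//= lebesgue_measure_itv /= lte_fin ltr01.
by rewrite -EFinB subr0 -EFinM mulr1 adde0.
Qed.

End trig_derive.

Section torus_invariance.
Context {R : realType} (alpha beta : R).
Local Notation f := (skew_shift alpha beta).

Lemma torus_invariantP (G : R * R -> R) : torus_invariant G <->
  forall p (i j : int), G (p.1 + i%:~R, p.2 + j%:~R) = G p.
Proof.
split=> H; first by move=> p i j; apply/esym/H; exists i, j.
by move=> p p' [i [j ->]]; rewrite H.
Qed.

Lemma torus_eq_skew p p' : torus_eq p p' -> torus_eq (f p) (f p').
Proof.
move=> [i [j ->]]; exists i, (j + i); rewrite /skew_shift /= intrD.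
by congr pair; ring.
Qed.

Lemma torus_eq_iter n p p' : torus_eq p p' -> torus_eq (iter n f p) (iter n f p').
Proof. by move=> H; elim: n => //= n IH; exact: torus_eq_skew. Qed.

Lemma torus_invariant_birkhoff (G : R * R -> R) n : torus_invariant G ->
  torus_invariant (birkhoff f G n).
Proof.
move=> H p p' pp'; apply: eq_bigr => k _; apply: H; exact: torus_eq_iter.
Qed.

End torus_invariance.

Section fourier_modes.
Context {R : realType} (alpha beta : R).
Local Notation f := (skew_shift alpha beta).
Variables (d : nat) (a b : nat -> R -> R).
Hypothesis (ia : irrational alpha).
Hypothesis (ca : forall k, continuous (a k)) (cb : forall k, continuous (b k)).
Hypothesis (pa : forall k, circle_fun (a k)) (pb : forall k, circle_fun (b k)).

Definition mode k (p : R * R) : R :=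
  a k p.1 * cos (2 * pi * k.+1%:R * p.2) + b k p.1 * sin (2 * pi * k.+1%:R * p.2).

Definition mode_sum (p : R * R) : R := \sum_(k < d) mode k p.

Lemma torus_invariant_mode k : torus_invariant (mode k).
Proof.
apply/torus_invariantP => p i j; rewrite /mode /= pa pb.
have -> : 2 * pi * k.+1%:R * (p.2 + j%:~R) = 2 * pi * k.+1%:R * p.2 + 2 * pi * (k.+1%:Z * j)%:~R.
  by rewrite intrM -pmulrn; ring.
by rewrite cos_periodz sin_periodz.
Qed.

Lemma unif_mean_mode_k k : unif_mean f (mode k) 0.
Proof.
have [Ba _ HBa] := circle_fun_bounded (pa k) (@ca k).
have [Bb _ HBb] := circle_fun_bounded (pb k) (@cb k).
have H1 := @unif_mean_mode R alpha beta ia (a k) k.+1%:Z 0 Ba (continuous_circle_ucont (pa k) (@ca k)) HBa isT.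
have H2 := @unif_mean_mode R alpha beta ia (b k) k.+1%:Z (- (1 / 4)) Bb (continuous_circle_ucont (pb k) (@cb k)) HBb isT.
have := unif_meanD H1 H2; rewrite addr0; set F := (fun p => _ + _).
rewrite (_ : F = mode k)//; apply/funext => p; rewrite /F /mode -pmulrn addr0 !mulrA.
by congr (_ + _ * _); rewrite -cosBpihalf; congr cos; field.
Qed.

Lemma unif_mean_mode_sum : unif_mean f mode_sum 0.
Proof.
rewrite (_ : 0 = \sum_(k < d) (0 : R)); last by rewrite big1.
by apply: unif_mean_sum => k; exact: unif_mean_mode_k.
Qed.

(** The coefficients in y of the Birkhoff sum of a mode, read off as its values at y = 0 and at a
    quarter of a period. *)
Definition modeA k n x : R := birkhoff f (mode k) n (x, 0).
Definition modeB k n x : R := birkhoff f (mode k) n (x, 1 / (4 * k.+1%:R)).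

(** Along an orbit y is translated by an amount depending on x and the time only, so every term of
    the sum stays in the span of the same cosine and sine. *)
Lemma birkhoff_mode k n x y : birkhoff f (mode k) n (x, y) =
  modeA k n x * cos (2 * pi * k.+1%:R * y) + modeB k n x * sin (2 * pi * k.+1%:R * y).
Proof.
rewrite /modeA /modeB /birkhoff !mulr_suml -big_split /=; apply: eq_bigr => i _.
rewrite !iter_skew /mode /=.
set c := 2 * pi * k.+1%:R; set A := a k _; set B := b k _.
have -> : c * (y + i%:R * x + skew_drift alpha beta i) = c * y + c * (i%:R * x + skew_drift alpha beta i) by ring.
have -> : c * (0 + i%:R * x + skew_drift alpha beta i) = c * (i%:R * x + skew_drift alpha beta i) by ring.
have -> : c * (1 / (4 * k.+1%:R) + i%:R * x + skew_drift alpha beta i) = c * (i%:R * x + skew_drift alpha beta i) + pi / 2.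
  by rewrite /c; field.
by rewrite cosDpihalf sinDpihalf cosD sinD; ring.
Qed.

Lemma birkhoff_mode_sum n x y : birkhoff f mode_sum n (x, y) =
  trig_sum d (fun k => modeA k n x) (fun k => modeB k n x) y.
Proof.
rewrite /birkhoff /mode_sum exchange_big /=; apply: eq_bigr => k _.
exact: birkhoff_mode.
Qed.

Lemma continuous_birkhoff_mode k n y : continuous (fun x : R => birkhoff f (mode k) n (x, y)).
Proof.
apply: continuous_big => [|i _]; first exact: add_continuous.
rewrite (_ : (fun x => _) = (fun x => a k (x + i%:R * alpha) *
    cos (2 * pi * k.+1%:R * (y + i%:R * x + skew_drift alpha beta i)) +
  b k (x + i%:R * alpha) * sin (2 * pi * k.+1%:R * (y + i%:R * x + skew_drift alpha beta i)))); last first.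
  by apply/funext => x; rewrite iter_skew.
move=> x.
have c1 : {for x, continuous (fun x : R => x + i%:R * alpha)}.
  by apply: cvgD; [exact: cvg_id|exact: cvg_cst].
have c2 : {for x, continuous (fun x : R => 2 * pi * k.+1%:R * (y + i%:R * x + skew_drift alpha beta i))}.
  apply: cvgM; first exact: cvg_cst.
  apply: cvgD; last exact: cvg_cst.
  by apply: cvgD; [exact: cvg_cst|apply: cvgM; [exact: cvg_cst|exact: cvg_id]].
apply: cvgD; apply: cvgM.
- exact: (continuous_comp c1 (@ca _ _)).
- exact: (continuous_comp c2 (@continuous_cos _ _)).
- exact: (continuous_comp c1 (@cb _ _)).
- exact: (continuous_comp c2 (@continuous_sin _ _)).
Qed.

Lemma circle_fun_birkhoff_mode k n y : circle_fun (fun x : R => birkhoff f (mode k) n (x, y)).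
Proof.
move=> x z; have /torus_invariantP H := torus_invariant_birkhoff alpha beta n (@torus_invariant_mode k).
by have := H (x, y) z 0; rewrite /= addr0.
Qed.

Definition amplitude n x : R := trig_norm d (fun k => modeA k n x) (fun k => modeB k n x).

Lemma continuous_amplitude n : continuous (amplitude n).
Proof.
apply: continuous_big => [|k _ x]; first exact: add_continuous.
apply: cvgD.
  exact: (continuous_comp (@continuous_birkhoff_mode k n 0 x) (@norm_continuous _ _ _)).
exact: (continuous_comp (@continuous_birkhoff_mode k n _ x) (@norm_continuous _ _ _)).
Qed.

End fourier_modes.

(** * Growth of the Birkhoff sums of a mode *)

Section haar_real.
Context {R : realType}.
Local Notation T1 := (measurableTypeR R).
Implicit Types (A B : set T1).

Definition hr A : R := fine (haar A).

Lemma hrE A : measurable A -> haar A = (hr A)%:E.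
Proof. by move=> mA; rewrite /hr fineK// fin_num_measure. Qed.

Lemma hr_ge0 A : 0 <= hr A.
Proof. by rewrite /hr fine_ge0. Qed.

Lemma hr_le A B : measurable A -> measurable B -> A `<=` B -> hr A <= hr B.
Proof.
move=> mA mB AB; rewrite -lee_fin -!hrE//; apply: le_measure => //; by rewrite inE.
Qed.

Lemma hr_le1 A : measurable A -> hr A <= 1.
Proof. by move=> mA; rewrite -lee_fin -hrE// probability_le1. Qed.

Lemma hr_setDI A B : measurable A -> measurable B -> hr A = hr (A `\` B) + hr (A `&` B).
Proof.
move=> mA mB; apply: EFin_inj; rewrite EFinD -!hrE//; first exact: measureDI.
- exact: measurableI.
- exact: measurableD.
Qed.

Lemma hr_leU A B : measurable A -> measurable B -> hr (A `|` B) <= hr A + hr B.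
Proof.
move=> mA mB; rewrite -lee_fin EFinD -!hrE//; last exact: measurableU.
exact: measureU2.
Qed.

(** Each new set meets the union of its k predecessors in measure at most h * k, hence enlarges it
    by at least e - h * k; the total never exceeds 1. *)
Lemma hr_bonferroni (B : nat -> set T1) (n : nat) (e h : R) : (forall i, measurable (B i)) ->
  (forall i, (i < n)%N -> e <= hr (B i)) ->
  (forall i j, (i < j < n)%N -> hr (B i `&` B j) <= h) -> 0 <= h ->
  e * n%:R - h * n%:R ^+ 2 <= 1.
Proof.
move=> mB Be Bh.
move=> h0.
pose U k := \bigcup_(i < k) B i.
have mU k : measurable (U k) by apply: bigcup_measurable.
have US k : U k.+1 = U k `|` B k by rewrite /U bigcup_mkord big_ord_recr -bigcup_mkord.
have UB k j : (k <= j < n)%N -> hr (U k `&` B j) <= h * k%:R.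
  elim: k => [|k IH] kj.
    by rewrite /U bigcup_mkord big_ord0 set0I /hr measure0 mulr0.
  rewrite US setIUl -natr1 mulrDr mulr1; apply: le_trans (hr_leU _ _) _.
  - exact: measurableI.
  - exact: measurableI.
  - by apply: lerD; [apply: IH; lia|apply: Bh].
have H k : (k <= n)%N -> e * k%:R - h * k%:R ^+ 2 <= hr (U k).
  elim: k => [|k IH] kn; first by rewrite mulr0 expr0n mulr0 subr0 hr_ge0.
  have -> : hr (U k.+1) = hr (U k) + hr (B k) - hr (U k `&` B k).
    have := hr_setDI (mU k.+1) (mU k); rewrite US setUK => ->.
    have -> : (U k `|` B k) `\` U k = B k `\` U k by rewrite setDUl setDv set0U.
    by rewrite (hr_setDI (mB k) (mU k)) (setIC (B k)); ring.
  have := IH (ltnW kn); have := Be k kn; have := UB k k.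
  rewrite leqnn kn => /(_ isT) u v w.
  have hk : 0 <= h * k%:R by rewrite mulr_ge0.
  rewrite -natr1.
  have -> : e * (k%:R + 1) - h * (k%:R + 1) ^+ 2 = (e * k%:R - h * k%:R ^+ 2) + e - h * k%:R - (h * k%:R + h) by ring.
  lra.
apply: le_trans (H n _) (hr_le1 _) => //.
Qed.

Lemma haar_translate A (s : R) : measurable A -> (forall x (z : int), A (x + z%:~R) <-> A x) ->
  hr [set x | A (x + s)] = hr A.
Proof.
move=> mA pA; rewrite /hr; congr fine.
have mAs : measurable ([set x | A (x + s)] : set T1).
  by rewrite -[X in measurable X]setTI; exact: (measurable_translate s).
rewrite -[X in haar X = _]setIT -[X in _ = haar X]setIT -!integral_indic//.
rewrite -[RHS](@circ_translate _ _ s)//.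
- by move=> x z; rewrite !indicE; congr ((_ _)%:R%:E); apply/idP/idP; rewrite !inE => /pA.
- by apply/measurable_EFinP; exact: measurable_indic.
Qed.

Lemma measurable_affine (x c : R) : measurable_fun [set: T1] (fun s : T1 => (x + s * c : T1)).
Proof. by apply: measurable_funD => //; exact: measurable_funM. Qed.

(* averaging over the translations x |-> x + s / c, 0 <= s < 1 *)
Lemma haar_shear A (c e : R) : measurable A -> (forall x (z : int), A (x + z%:~R) <-> A x) ->
  (forall x : R, (haar [set s : T1 | A (x + s * c)%R] <= e%:E)%E) -> hr A <= e.
Proof.
move=> mA pA H; rewrite -lee_fin -hrE//.
have mF : measurable_fun [set: (T1 * T1)%type] (fun q : T1 * T1 => (\1_A (q.1 + q.2 * c)%R)%:E : \bar R).
  apply/measurable_EFinP; apply: (measurableT_comp (measurable_indic mA)).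
  by apply: measurable_funD => //; apply: measurable_funM.
have -> : haar A = (\int[haar]_s \int[haar]_x (\1_A (x + s * c)%R : R)%:E)%E.
  have E (s : T1) : (\int[haar]_x (\1_A (x + s * c)%R : R)%:E = haar A)%E.
    rewrite -[X in _ = haar X]setIT -integral_indic//.
    apply: (@circ_translate _ (fun x => (\1_A x)%:E) (s * c)) => //.
    - by move=> x z; rewrite !indicE; congr ((_ _)%:R%:E); apply/idP/idP; rewrite !inE => /pA.
    - by apply/measurable_EFinP; exact: measurable_indic.
  by under eq_integral do rewrite E; rewrite integral_cst// [X in (_ * X)%E]probability_setT mule1.
rewrite -(fubini_tonelli (fun q : T1 * T1 => (\1_A (q.1 + q.2 * c)%R)%:E))//.
apply: (@le_trans _ _ (\int[haar]_x e%:E)%E).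
  apply: ge0_le_integral => //.
  - by move=> x _; apply: integral_ge0 => s _; rewrite lee_fin.
  - by apply: (measurable_fun_fubini_tonelli_F (m2 := haar) (fun q : T1 * T1 => (\1_A (q.1 + q.2 * c)%R)%:E)).
  - move=> x _; apply: le_trans (H x); rewrite le_eqVlt; apply/orP; left; apply/eqP.
    rewrite -[X in _ = haar X]setIT -integral_indic//.
    by rewrite -[X in measurable X]setTI; exact: (measurable_affine x c).
by rewrite integral_cst// [X in (_ * X)%E]probability_setT mule1.
Qed.

End haar_real.

(** * Sets where the coefficients of a mode are small: decoupling and decay *)

Section growth.
Context {R : realType} (alpha beta : R).
Local Notation f := (skew_shift alpha beta).
Local Notation T1 := (measurableTypeR R).
Variables (a b : nat -> R -> R) (l : nat).
Hypothesis (ca : forall k, continuous (a k)) (cb : forall k, continuous (b k)).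
Hypothesis (pa : forall k, circle_fun (a k)) (pb : forall k, circle_fun (b k)).
Local Notation psi := (mode a b l).
Local Notation A := (modeA alpha beta a b l).
Local Notation B := (modeB alpha beta a b l).

Definition small n (K : R) : set T1 := [set x | `|A n x| <= K /\ `|B n x| <= K].

Let cA n : continuous (A n).
Proof. exact: continuous_birkhoff_mode. Qed.
Let cB n : continuous (B n).
Proof. exact: continuous_birkhoff_mode. Qed.
Let pA n : circle_fun (A n).
Proof. exact: circle_fun_birkhoff_mode. Qed.
Let pB n : circle_fun (B n).
Proof. exact: circle_fun_birkhoff_mode. Qed.

Lemma measurable_small n K : measurable (small n K).
Proof.
have -> : small n K = [set x : T1 | `|A n x| <= K] `&` [set x : T1 | `|B n x| <= K] by [].
have H (g : R -> R) : continuous g -> measurable ([set x : T1 | `|g x| <= K]).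
  move=> cg; rewrite -[X in measurable X]setTI; apply: measurable_fun_ler => //.
  by apply: measurableT_comp => //; exact: continuous_measurable.
by apply: measurableI; apply: H.
Qed.

Lemma small_periodic n K x (z : int) : small n K (x + z%:~R) <-> small n K x.
Proof. by rewrite /small /= pA pB. Qed.

Lemma small_le n K K' : K <= K' -> small n K `<=` small n K'.
Proof. by move=> KK' x [h1 h2]; split; apply: le_trans KK'. Qed.

Lemma small_birkhoff n K x y : small n K x -> `|birkhoff f psi n (x, y)| <= 2 * K.
Proof.
move=> [h1 h2]; rewrite birkhoff_mode (_ : 2 * K = K + K); last by ring.
apply: le_trans (ler_normD _ _) _; rewrite !normrM; apply: lerD.
  by rewrite -[leRHS]mulr1; apply: ler_pM => //; exact: cos_max.
by rewrite -[leRHS]mulr1; apply: ler_pM => //; exact: sin_max.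
Qed.

(* If the sums over N steps are small at x and at x + k alpha, the cocycle
   identity bounds the sums over k steps along the fiber over the N-th iterate
   of x. Shearing by x |-> x + s / N moves that fiber across the whole circle
   while the sums over k steps barely change. *)
Lemma decoupling (K e : R) : 0 <= K -> 0 < e -> exists2 S : R, 0 < S & forall k, exists N0 : nat,
  forall N, (N0 <= N)%N ->
  hr ((small N K `&` [set x | small N K (x + k%:R * alpha)]) `\` small k S) <= e.
Proof.
move=> K0 e0; have [s s0 Hs] := sin_small_measure e0.
pose L : R := l.+1%:R; have L0 : 0 < L by rewrite ltr0n.
(* Chosen for the final contradiction, where (S - 4 * K - 3) * s = 2 * (8 * K + 4) + s has to exceed
   8 * K + 4. *)
pose S := 2 * (8 * K + 4) / s + (4 * K + 4).
have S0 : 0 < S by rewrite /S ltr_wpDl ?divr_ge0// ?(ltW s0)//; lra.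
exists S => // k.
have h12 : 0 < 1 / 2 :> R by lra.
have [dA dA0 HA] := continuous_circle_ucont (pA k) (@cA k) h12.
have [dB dB0 HB] := continuous_circle_ucont (pB k) (@cB k) h12.
pose dm := Num.min dA dB.
have dm0 : 0 < dm by rewrite lt_min dA0.
have [r r0 Hr] : exists2 r : R, 0 < r & forall v, `|v| < r -> `|sin (pi * v)| <= dm.
  have /cvgrPdist_lt /(_ dm dm0) /nbhs_ballP[r /= r0 H] :
      (fun v : R => sin (pi * v)) x @[x --> (0 : R)] --> sin (pi * 0 : R).
    exact: (continuous_comp (@mulrl_continuous _ pi 0) (@continuous_sin _ _)).
  exists r => // v vr; have := H v; rewrite /ball /= sub0r normrN => /(_ vr).
  by rewrite mulr0 sin0 sub0r normrN => /ltW.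
pose N0 := (Num.truncn (1 / r)).+1.
exists N0 => N NN0.
have N_gt0 : 0 < N%:R :> R by rewrite ltr0n (leq_trans _ NN0).
set F := _ `\` _.
have mF : measurable F.
  apply: measurableD; last exact: measurable_small.
  apply: measurableI; first exact: measurable_small.
  rewrite -[X in measurable X]setTI.
  exact: (measurable_translate (k%:R * alpha)) (measurable_small N K).
have pF x (z : int) : F (x + z%:~R) <-> F x.
  rewrite /F /= (addrAC x) !small_periodic; tauto.
(* Displacing x by s / (L * N) displaces the N-th iterate vertically by s / L, so it sweeps exactly
   one period of the mode as s runs through [0, 1[. *)
apply: (@haar_shear _ F (1 / (L * N%:R))) => // x.
have clos (u t : R) : 0 <= t < 1 ->
    `|A k (u + t * (1 / (L * N%:R))) - A k u| <= 1 / 2 /\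
    `|B k (u + t * (1 / (L * N%:R))) - B k u| <= 1 / 2.
  move=> /andP[t0 t1].
  have sm : `|sin (pi * (u + t * (1 / (L * N%:R)) - u))| <= Num.min dA dB.
    rewrite [u + _]addrC addrK; apply: Hr.
    rewrite ger0_norm; last by rewrite mulr_ge0// divr_ge0// mulr_ge0// ltW.
    apply: (@lt_le_trans _ _ (1 * (1 / (L * N%:R)))).
      by rewrite ltr_pM2r// divr_gt0// mulr_gt0.
    rewrite !mul1r -[leRHS]invrK lef_pV2 ?posrE ?invr_gt0 ?mulr_gt0//.
    have Nr : r^-1 <= N%:R.
      by rewrite -div1r; apply: le_trans (ltW (truncnS_gt _)) _; rewrite ler_nat.
    apply: le_trans Nr _; rewrite ler_peMl// ?(ltW N_gt0)//.
    by rewrite /L ler1n.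
  move: sm; rewrite le_min => /andP[smA smB].
  by split; [exact: HA|exact: HB].
pose W := [set s : T1 | F (x + s * (1 / (L * N%:R)))].
have mW : measurable W.
  by rewrite /W -[X in measurable X]setTI; exact: (measurable_affine x (1 / (L * N%:R))).
rewrite -/W (haarE mW).
have [/eqP W0|/set0P[t0 [Wt0 t0i]]] := boolP (W `&` `[0, 1[%classic == set0).
  by rewrite W0 measure0 lee_fin ltW.
rewrite /= in_itv /= in t0i.
apply: le_trans (Hs t0); rewrite haarE; last exact: measurable_sin_lt.
apply: le_measure; rewrite ?inE.
- exact: measurableI.
- by apply: measurableI => //; exact: measurable_sin_lt.
move=> t [Wt ti]; split => //=; rewrite /= in_itv /= in ti.
pose D := N%:R * x + skew_drift alpha beta N.
pose P y := birkhoff f psi k (x + N%:R * alpha, y).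
have PE y : P y = A k (x + N%:R * alpha) * cos (2 * pi * L * y) + B k (x + N%:R * alpha) * sin (2 * pi * L * y).
  exact: birkhoff_mode.
have diff (w : R) : 0 <= w < 1 -> forall u y',
    `|birkhoff f psi k (u + w * (1 / (L * N%:R)), y') - birkhoff f psi k (u, y')| <= 1.
  move=> wi u y'; rewrite !birkhoff_mode; have [cl1 cl2] := clos u w wi.
  set cc := cos _; set ss := sin _.
  rewrite (_ : _ - _ = (A k (u + w * (1 / (L * N%:R))) - A k u) * cc + (B k (u + w * (1 / (L * N%:R))) - B k u) * ss); last by ring.
  apply: le_trans (ler_normD _ _) _; rewrite !normrM.
  have := ler_pM (normr_ge0 _) (normr_ge0 _) cl1 (cos_max (2 * pi * L * y')).
  have := ler_pM (normr_ge0 _) (normr_ge0 _) cl2 (sin_max (2 * pi * L * y')).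
  by rewrite -/cc -/ss; lra.
(* Smallness of the N-sums at both ends gives 4 * K through [birkhoff_comm]; undoing the shear in
   each of the two k-sums costs at most 1. *)
have key (w : R) : W w -> 0 <= w < 1 -> forall y,
   `|P (y + D + w / L) - birkhoff f psi k (x, y)| <= 4 * K + 2.
  move=> Wr ri y; set xr := x + w * (1 / (L * N%:R)).
  have [[Fr1 Fr2] Fr3] : F xr by exact: Wr.
  have := birkhoff_comm f psi N k (xr, y).
  rewrite !iter_skew /=.
  set q := (xr + k%:R * alpha, _); set q' := (xr + N%:R * alpha, _) => E.
  have b1 : `|birkhoff f psi k q' - birkhoff f psi k (xr, y)| <= 4 * K.
    rewrite -E (_ : 4 * K = 2 * K + 2 * K); last by ring.
    by apply: le_trans (ler_normB _ _) _; apply: lerD; exact: small_birkhoff.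
  have := diff w ri x y; rewrite -/xr => d1.
  have := diff w ri (x + N%:R * alpha) (y + D + w / L); rewrite -/(P _).
  have -> : birkhoff f psi k (x + N%:R * alpha + w * (1 / (L * N%:R)), y + D + w / L) = birkhoff f psi k q'.
    rewrite /q' /xr; congr (birkhoff _ _ _ (_, _)); first by ring.
    have L0' : L != 0 by rewrite gt_eqF.
    have N_0' : N%:R != 0 :> R by rewrite gt_eqF.
    have -> : w * (1 / (L * N%:R)) = (w / L) / N%:R by rewrite mul1r invfM mulrA.
    by set wL := w / L; rewrite /D; field.
  move: b1 d1; rewrite !ler_norml => /andP[? ?] /andP[? ?] /andP[? ?].
  by apply/andP; split; lra.
(* The sheared point at t0 lies outside [small k S], so its k-sum exceeds S somewhere on the fiber,
   and [key] transfers this to the fiber over the N-th iterate. *)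
have big : S - 4 * K - 3 < `|A k (x + N%:R * alpha)| + `|B k (x + N%:R * alpha)|.
  have [_ nsm] : F (x + t0 * (1 / (L * N%:R))) by exact: Wt0.
  have [y Hy] : exists y, S < `|birkhoff f psi k (x + t0 * (1 / (L * N%:R)), y)|.
    apply: contrapT => /forallNP H; apply: nsm.
    by split; rewrite leNgt; apply/negP; exact: H.
  have := key t0 Wt0 t0i y; have := diff t0 t0i x y; move: Hy.
  set u := birkhoff _ _ _ _; set v := birkhoff _ _ _ _; set w := P _ => Hu d1 d2.
  have PAB : `|w| <= `|A k (x + N%:R * alpha)| + `|B k (x + N%:R * alpha)|.
    rewrite /w PE; apply: le_trans (ler_normD _ _) _; rewrite !normrM; apply: lerD.
      by rewrite -[leRHS]mulr1; apply: ler_pM => //; exact: cos_max.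
    by rewrite -[leRHS]mulr1; apply: ler_pM => //; exact: sin_max.
  apply: lt_le_trans PAB.
  have h1 : `|u| <= `|u - v| + `|v| by rewrite -{1}(subrK v u); exact: ler_normD.
  have h2 : `|v| <= `|w - v| + `|w| by rewrite distrC -{1}(subrK w v); exact: ler_normD.
  lra.
(* Both phases are compared with the same k-sum at (x, y). A mode with large coefficients can change
   this little between two phases only if t is close to t0. *)
have trig : forall y, `|P (y + D + t / L) - P (y + D + t0 / L)| <= 8 * K + 4.
  move=> y; have := key t Wt ti y; have := key t0 Wt0 t0i y.
  rewrite !ler_norml => /andP[? ?] /andP[? ?].
  by apply/andP; split; lra.
(* Centering the two phases at 0 isolates the sine coefficient; centering them a quarter of a period
   further isolates the cosine coefficient. *)
have T1' : 2 * (`|B k (x + N%:R * alpha)| * `|sin (pi * (t - t0))|) <= 8 * K + 4.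
  apply: le_trans (trig (- D - (t + t0) / (2 * L))); rewrite !PE.
  set Bk := B k _; set Ak := A k _.
  have -> : 2 * pi * L * (- D - (t + t0) / (2 * L) + D + t / L) = pi * (t - t0).
    by field; rewrite ?(gt_eqF L0) ?pnatr_eq0.
  have -> : 2 * pi * L * (- D - (t + t0) / (2 * L) + D + t0 / L) = - (pi * (t - t0)).
    by field; rewrite ?(gt_eqF L0) ?pnatr_eq0.
  rewrite cosN sinN; set cc := cos _; set ss := sin _.
  rewrite (_ : Ak * cc + Bk * ss - (Ak * cc + Bk * - ss) = 2 * (Bk * ss)); last by ring.
  by rewrite !normrM (@ger0_norm _ 2).
have T2' : 2 * (`|A k (x + N%:R * alpha)| * `|sin (pi * (t - t0))|) <= 8 * K + 4.
  apply: le_trans (trig (1 / (4 * L) - D - (t + t0) / (2 * L))); rewrite !PE.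
  set Bk := B k _; set Ak := A k _.
  have -> : 2 * pi * L * (1 / (4 * L) - D - (t + t0) / (2 * L) + D + t / L) = pi * (t - t0) + pi / 2.
    by field; rewrite ?(gt_eqF L0) ?pnatr_eq0.
  have -> : 2 * pi * L * (1 / (4 * L) - D - (t + t0) / (2 * L) + D + t0 / L) = - (pi * (t - t0)) + pi / 2.
    by field; rewrite ?(gt_eqF L0) ?pnatr_eq0.
  rewrite !cosDpihalf !sinDpihalf cosN sinN; set cc := cos _; set ss := sin _.
  rewrite (_ : Ak * - ss + Bk * cc - (Ak * - - ss + Bk * cc) = - (2 * (Ak * ss))); last by ring.
  by rewrite normrN !normrM (@ger0_norm _ 2).
rewrite ltNge; apply/negP => sle.
have : (S - 4 * K - 3) * s <= 8 * K + 4.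
  set u := `|sin (pi * (t - t0))| in T1' T2' sle.
  apply: (@le_trans _ _ ((`|A k (x + N%:R * alpha)| + `|B k (x + N%:R * alpha)|) * u)); last lra.
  apply: ler_pM => //; [|exact: ltW|exact: ltW].
  have E0 : 0 <= 2 * (8 * K + 4) / s by apply: divr_ge0; [lra|exact: ltW].
  by rewrite /S; lra.
rewrite /S (_ : _ * s = 2 * (8 * K + 4) + s); last by field; rewrite (gt_eqF s0).
by lra.
Qed.

Lemma sum_shift_le (g : nat -> R) (c n0 n : nat) : (forall j, 0 <= g j) -> (c <= n0)%N ->
  \sum_(n0 <= k < n) g (k - c)%N <= \sum_(j < n) g j.
Proof.
move=> g0 cn0; have [nn0|n0n] := leqP n n0.
  by rewrite big_geq// sumr_ge0.
rewrite -(subnK (ltnW n0n)) addnC; elim: (n - n0)%N => [|i IH].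
  by rewrite addn0 big_geq// sumr_ge0.
rewrite addnS big_nat_recr ?leq_addr//=.
have mono m : (m <= (n0 + i))%N -> \sum_(j < m) g j + g m <= \sum_(j < (n0 + i).+1) g j.
  move=> mi; rewrite -!(big_mkord xpredT g) -big_nat_recr//=.
  by rewrite (@big_cat_nat _ _ _ m.+1 0%N (n0 + i).+1)//= lerDl sumr_ge0.
have shift m : \sum_(n0 <= k < n0 + m) g (k - c)%N <= \sum_(j < (n0 + m) - c) g j.
  elim: m => [|m IHm]; first by rewrite addn0 big_geq// sumr_ge0.
  rewrite addnS big_nat_recr ?leq_addr//= subSn; last by rewrite (leq_trans cn0)// leq_addr.
  by rewrite big_ord_recr /=; apply: lerD.
by apply: le_trans (mono _ (leq_subr c _)); apply: lerD.
Qed.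

(** A greedy choice. If every candidate beyond n0 had a bad difference with one of the earlier
    choices, summing over the candidates below n would bound the average of g from below. *)
Lemma good_differences (g : nat -> R) (eta : R) (m : nat) : 0 < eta -> (forall j, 0 <= g j) ->
  (forall (e : R) n0, 0 < e -> exists2 n, (n0 <= n)%N & \sum_(j < n) g j <= e * n%:R) ->
  exists k : nat -> nat, forall i j, (i < j < m)%N -> (k i < k j)%N /\ g (k j - k i)%N <= eta.
Proof.
move=> eta0 g0 H; elim: m => [|m [k Hk]]; first by exists id => i j; rewrite ltn0 andbF.
pose n0 := (\sum_(i < m) (k i).+1)%N.
have kn0 i : (i < m)%N -> (k i < n0)%N.
  by move=> im; rewrite /n0 (bigD1 (Ordinal im))//= addSn ltnS leq_addr.
(* More than half of the indices below n are candidates and each bad one contributes eta, while the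
   m shifted sums together stay below eta * n / 2. *)
have e0 : 0 < eta / (2 * m.+1%:R) by rewrite divr_gt0.
have [n nn Hn] := H _ (2 * n0).+1 e0.
have [kn [kn1 kn2]] : exists kn, (n0 <= kn)%N /\ forall i, (i < m)%N -> g (kn - k i)%N <= eta.
  apply: contrapT => /forallNP bad.
  have bad' kk : (n0 <= kk)%N -> eta <= \sum_(i < m) g (kk - k i)%N.
    move=> h; have /not_andP[//|/existsNP[i /not_implyP[im /negP]]] := bad kk.
    rewrite -ltNge => /ltW h'; rewrite (bigD1 (Ordinal im))//= (le_trans h')//.
    by rewrite lerDl sumr_ge0.
  have : \sum_(n0 <= kk < n) eta <= \sum_(n0 <= kk < n) \sum_(i < m) g (kk - k i)%N.
    by rewrite big_nat [leRHS]big_nat; apply: ler_sum => kk /andP[/bad'].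
  rewrite exchange_big /= => h.
  have : \sum_(i < m) \sum_(n0 <= kk < n) g (kk - k i)%N <= m%:R * (eta / (2 * m.+1%:R) * n%:R).
    apply: (@le_trans _ _ (\sum_(i < m) (eta / (2 * m.+1%:R) * n%:R))).
      apply: ler_sum => i _; apply: le_trans Hn.
      by apply: sum_shift_le => //; exact/ltnW/kn0.
    by rewrite sumr_const_ord mulrC.
  move=> /(le_trans h).
  rewrite (_ : \sum_(n0 <= kk < n) eta = eta * (n%:R - n0%:R)); last first.
    by rewrite sumr_const_nat -[LHS]mulr_natr natrB//; lia.
  apply/negP; rewrite -ltNge.
  have n2 : 2 * n0%:R + 1 <= n%:R :> R by rewrite -natrM natr1 ler_nat.
  apply: (@le_lt_trans _ _ (eta * (n%:R / 2))).
    rewrite (_ : m%:R * _ = eta * (n%:R * (m%:R / (2 * m.+1%:R)))); last by ring.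
    rewrite !ler_pM2l// ?ltr0n; last by lia.
    by rewrite ler_pdivrMr// mulrA mulVf// mul1r ler_nat.
  by rewrite ltr_pM2l//; lra.
exists (fun i => if (i < m)%N then k i else kn) => i j /andP[ij jm].
have im : (i < m)%N by rewrite (leq_trans ij).
rewrite im; case: ifPn => [jm'|_]; first by apply: Hk; rewrite ij.
by split; [apply: leq_trans (kn0 i im) kn1|exact: kn2].
Qed.

(* Bonferroni: if the N-small sets had measure >= e for large N, their
   translates by k_1 alpha, .., k_m alpha with pairwise differences of low
   recurrence would be almost disjoint. *)
Lemma growth :
  (forall K e n0, 0 <= K -> 0 < e ->
     exists2 n, (n0 <= n)%N & \sum_(j < n) hr (small j K) <= e * n%:R) ->
  forall K e, 0 < e -> exists N0 : nat, forall N, (N0 <= N)%N -> hr (small N K) <= e.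
Proof.
move=> H K e e0.
wlog K0 : K / 0 <= K.
  move=> Hw; have [N0 HN0] := Hw `|K| (normr_ge0 K).
  exists N0 => N /HN0; apply: le_trans; apply: hr_le; try exact: measurable_small.
  exact/small_le/ler_norm.
(* With the value of h below, e * m - h * m ^ 2 is at least 3 / 2, against the bound 1 of
   [hr_bonferroni]. *)
pose m := (Num.truncn (2 / e)).+1.
have m0 : 0 < m%:R :> R by rewrite ltr0n.
have me : 2 <= e * m%:R.
  by have := ltW (truncnS_gt (2 / e)); rewrite -/m ler_pdivrMr// mulrC.
pose h : R := 1 / (2 * m%:R ^+ 2).
have h0 : 0 < h by rewrite divr_gt0// mulr_gt0// exprn_gt0.
have h20 : 0 < h / 2 by rewrite divr_gt0.
have [S S0 HS] := decoupling K0 h20.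
have [k Hk] := @good_differences (fun j => hr (small j S)) (h / 2) m h20
  (fun j => hr_ge0 _) (fun e n0 e0 => H S e n0 (ltW S0) e0).
have [N1 HN1] := choice HS.
pose N0 := (\sum_(i < m) \sum_(j < m) N1 (k j - k i))%N.
exists N0 => N NN0; rewrite leNgt; apply/negP => big.
pose Bs i : set T1 := [set x | small N K (x + (k i)%:R * alpha)].
have mBs i : measurable (Bs i).
  by rewrite -[X in measurable X]setTI; exact: (measurable_translate _) (measurable_small N K).
have hrBs i : hr (Bs i) = hr (small N K).
  by apply: haar_translate; [exact: measurable_small|move=> x z; exact: small_periodic].
have pair i j : (i < j < m)%N -> hr (Bs i `&` Bs j) <= h.
  move=> ijm; have [kij gk] := Hk i j ijm; have /andP[ij jm] := ijm.
  have Nk : (N1 (k j - k i) <= N)%N.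
    apply: leq_trans NN0; have im := ltn_trans ij jm.
    by rewrite /N0 (bigD1 (Ordinal im))//= (bigD1 (Ordinal jm))//= -addnA leq_addr.
  pose E := small N K `&` [set x | small N K (x + (k j - k i)%:R * alpha)].
  have mE : measurable E.
    apply: measurableI; first exact: measurable_small.
    by rewrite -[X in measurable X]setTI; exact: (measurable_translate _) (measurable_small N K).
  have -> : Bs i `&` Bs j = [set x | E (x + (k i)%:R * alpha)].
    apply/seteqP; split => x; rewrite /Bs /E /= natrB; try exact: ltnW.
      by case=> h1 h2; split => //; move: h2; congr (small N K _); ring.
    by case=> h1 h2; split => //; move: h2; congr (small N K _); ring.
  rewrite haar_translate//; last first.
    by move=> x z; rewrite /E /= (addrAC x) !small_periodic.
  rewrite (hr_setDI mE (measurable_small (k j - k i) S)).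
  rewrite (_ : h = h / 2 + h / 2); last by field.
  apply: lerD; first exact: HN1.
  by apply: le_trans gk; apply: hr_le; [apply: measurableI => //|..]; rewrite ?subIsetr//; exact: measurable_small.
have Be i : (i < m)%N -> e <= hr (Bs i) by move=> _; rewrite hrBs ltW.
have := hr_bonferroni mBs Be pair (ltW h0); apply/negP; rewrite -ltNge.
have -> : h * m%:R ^+ 2 = 1 / 2 by rewrite /h; field; rewrite gt_eqF.
by lra.
Qed.

End growth.

(** * Extension from a generating pi-system *)

(** The exhausting sequences turn cylinders over generating sets into countable unions of
    rectangles, so both projections are measurable for the generated sigma-algebra. *)
Lemma prod_generator d1 d2 (T1 : measurableType d1) (T2 : measurableType d2)
    (G1 : set (set T1)) (G2 : set (set T2)) (E1 : nat -> set T1) (E2 : nat -> set T2) :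
  @measurable _ T1 = <<s G1 >> -> @measurable _ T2 = <<s G2 >> ->
  (forall n, G1 (E1 n)) -> (forall n, G2 (E2 n)) ->
  \bigcup_n E1 n = setT -> \bigcup_n E2 n = setT ->
  @measurable _ (T1 * T2)%type =
    <<s [set X | exists A B, [/\ G1 A, G2 B & X = A `*` B] ] >>.
Proof.
move=> m1 m2 GE1 GE2 U1 U2.
have mG1 A : G1 A -> measurable A by rewrite m1; exact: sub_gen_smallest.
have mG2 A : G2 A -> measurable A by rewrite m2; exact: sub_gen_smallest.
set G := [set X | _].
apply/seteqP; split; last first.
  apply: smallest_sub; first exact: sigma_algebra_measurable.
  by move=> X [A [B [GA GB ->]]]; apply: measurableX; [exact: mG1|exact: mG2].
pose T' := g_sigma_algebraType G.
have GM X : G X -> @measurable _ T' X by exact: sub_gen_smallest.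
have mid : measurable_fun [set: T'] (id : T' -> (T1 * T2)%type).
  apply/measurable_fun_pairP; split.
    apply: (measurability G1) => // _ [A GA <-] /=; rewrite setTI.
    rewrite (_ : _ @^-1` A = \bigcup_n (A `*` E2 n)).
      by apply: bigcupT_measurable => n; apply: GM; exists A, (E2 n).
    apply/seteqP; split => [[x y] /= Ax|[x y] [n _ []]//].
    by have : [set: T2] y by []; rewrite -U2 => -[n _ Ey]; exists n.
  apply: (measurability G2) => // _ [A GA <-] /=; rewrite setTI.
  rewrite (_ : _ @^-1` A = \bigcup_n (E1 n `*` A)).
    by apply: bigcupT_measurable => n; apply: GM; exists (E1 n), A.
  apply/seteqP; split => [[x y] /= Ax|[x y] [n _ []]//].
  by have : [set: T1] x by []; rewrite -U1 => -[n _ Ey]; exists n.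
by move=> X mX; have := mid measurableT X mX; rewrite setTI.
Qed.

(** The sets on which the limit holds form a lambda-system. For increasing unions convergence of
    additive functionals alone would not suffice: the domination by C * m bounds the part still
    missing from the union uniformly in i. *)
Lemma dynkin_limit d (T : measurableType d) (R : realType) (m : {measure set T -> \bar R})
    (Om : set T) (G : set (set T)) (I : Type) (F : set_system I) (L : I -> set T -> R) (C kap : R) :
  Filter F -> measurable Om -> (m Om < +oo)%E ->
  @measurable _ T = <<s G >> -> setI_closed G ->
  (forall i A B, measurable A -> measurable B -> A `&` B = set0 -> L i (A `|` B) = L i A + L i B) ->
  (forall i A, measurable A -> 0 <= L i A) ->
  (\forall i \near F, forall A, measurable A -> L i A <= C * fine (m (A `&` Om))) ->
  (L i setT @[i --> F] --> kap * fine (m Om)) ->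
  (forall A, G A -> L i A @[i --> F] --> kap * fine (m (A `&` Om))) ->
  forall A, measurable A -> L i A @[i --> F] --> kap * fine (m (A `&` Om)).
Proof.
move=> FF mOm fOm mG GI LU L0 LC LT LG.
have fin A : measurable A -> m (A `&` Om) \is a fin_num.
  move=> mA; rewrite ge0_fin_numE//; apply: le_lt_trans fOm.
  by apply: le_measure; rewrite ?inE//; exact: measurableI.
pose H := [set A | measurable A /\ L i A @[i --> F] --> kap * fine (m (A `&` Om))].
suff GH : <<s G >> `<=` H by move=> A; rewrite mG => /GH [].
apply: (lambda_system_subset GI); last by move=> *; exact: subsetT.
  split.
  - by move=> A _; exact: subsetT.
  - by split=> //; rewrite setTI.
  - move=> B A AB [mB hB] [mA hA]; have mD : measurable (B `\` A) by exact: measurableD.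
    split => //.
    have -> : fine (m ((B `\` A) `&` Om)) = fine (m (B `&` Om)) - fine (m (A `&` Om)).
      have E : m (B `&` Om) = (m ((B `\` A) `&` Om) + m (A `&` Om))%E.
        rewrite -measureU; [|exact: measurableI|exact: measurableI|].
          by rewrite -setIUl setUC setDUK || rewrite -setIUl setUC (setUC A) setDUK.
        by rewrite setIACA setDE -!setIA; apply/seteqP; split => x //= [_ []] // nA []; tauto.
      by rewrite E fineD ?fin// addrK.
    rewrite mulrBr (_ : (fun i => L i _) = (fun i => L i B - L i A)); first exact: cvgB.
    apply/funext => i; rewrite -[in RHS](setDUK AB) LU//; last by rewrite setDE setIA setIC setIA setICl set0I.
    by rewrite addrC addKr || (rewrite addrAC subrr add0r).
  - move=> A ndA hA; have mA n : measurable (A n) by have [] := hA n.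
    have mU : measurable (\bigcup_n A n) by exact: bigcupT_measurable.
    split=> //; set U := \bigcup_n A n in mU *.
    have cvm : fine (m (A n `&` Om)) @[n --> \oo] --> fine (m (U `&` Om)).
      apply: fine_cvg; rewrite fineK ?fin// /U setI_bigcupl.
      apply: nondecreasing_cvg_mu => //.
      - by move=> n; exact: measurableI.
      - by rewrite -setI_bigcupl; exact: measurableI.
      - by move=> i j ij; apply/subsetPset; apply: setSI; apply/subsetPset; exact: ndA.
    apply/cvgrPdist_le => e e0.
    have C0 : 0 < `|C| + 1 by rewrite ltr_wpDl.
    have k0 : 0 < `|kap| + 1 by rewrite ltr_wpDl.
    have D0 : 0 < (e / 3) / (`|C| + 1) by rewrite !divr_gt0.
    have E0 : 0 < (e / 3) / (`|kap| + 1) by rewrite !divr_gt0.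
    move/cvgrPdist_le : (cvm) => /(_ _ D0)[n1 _ H1].
    move/cvgrPdist_le : (cvm) => /(_ _ E0)[n2 _ H2].
    pose n := maxn n1 n2.
    have {}H1 := H1 n (leq_maxl _ _); have {}H2 := H2 n (leq_maxr _ _).
    have [_ /cvgrPdist_le Hn] := hA n.
    have e30 : 0 < e / 3 by rewrite divr_gt0.
    have := Hn _ e30; apply: filterS2 LC => i LCi Hi.
    have AU : A n `<=` U by exact: bigcup_sup.
    have mD : measurable (U `\` A n) by exact: measurableD.
    have LUE : L i U = L i (A n) + L i (U `\` A n).
      by rewrite -LU ?setDUK// setDE setIA setIC setIA setICl set0I.
    have mE : fine (m ((U `\` A n) `&` Om)) = fine (m (U `&` Om)) - fine (m (A n `&` Om)).
      have E : m (U `&` Om) = (m ((U `\` A n) `&` Om) + m (A n `&` Om))%E.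
        rewrite -measureU; [|exact: measurableI|exact: measurableI|].
          by rewrite -setIUl setUC setDUK || rewrite -setIUl setUC (setUC A) setDUK.
        by rewrite setIACA setDE -!setIA; apply/seteqP; split => x //= [_ []] // nA []; tauto.
      by rewrite E fineD ?fin// addrK.
    have h1 : L i (U `\` A n) <= e / 3.
      apply: le_trans (LCi _ mD) _; rewrite mE.
      apply: le_trans (ler_norm _) _; rewrite normrM.
      apply: (@le_trans _ _ ((`|C| + 1) * ((e / 3) / (`|C| + 1)))).
        by apply: ler_pM => //; rewrite lerDl.
      by rewrite mulrCA divff ?mulr1// gt_eqF.
    have h2 : `|kap * fine (m (U `&` Om)) - kap * fine (m (A n `&` Om))| <= e / 3.
      rewrite -mulrBr normrM.
      apply: (@le_trans _ _ ((`|kap| + 1) * ((e / 3) / (`|kap| + 1)))).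
        by apply: ler_pM => //; rewrite lerDl.
      by rewrite mulrCA divff ?mulr1// gt_eqF.
    have h3 := L0 i _ mD.
    rewrite LUE; move: h2 Hi; rewrite !ler_norml => /andP[? ?] /andP[? ?].
    by apply/andP; split; lra.
move=> A GA; split; last exact: LG.
by rewrite mG; exact: sub_gen_smallest.
Qed.

(** * Indicators of arcs of the circle and their Fejer means *)

Section frac.
Context {R : realType}.
Local Notation T1 := (measurableTypeR R).
Implicit Types (x y b : R).

Definition frac x : R := x - (Num.floor x)%:~R.

Lemma frac_itv x : 0 <= frac x < 1.
Proof.
have /andP[f1 f2] := floor_itv x; rewrite intrD in f2.
by rewrite /frac; lra.
Qed.

Lemma fracDz x (z : int) : frac (x + z%:~R) = frac x.
Proof. by rewrite /frac floorDrz ?intr_int// intrKfloor intrD; ring. Qed.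

Lemma frac_id x : 0 <= x < 1 -> frac x = x.
Proof. by move=> x01; rewrite /frac (floor_def (m := 0)) ?subr0// add0r. Qed.

Lemma measurable_frac : measurable_fun [set: T1] (frac : T1 -> T1).
Proof.
apply: measurable_funB => //.
have H : measurable_fun [set: R] (fun x : R => (Num.floor x)%:~R : R).
  by apply: nondecreasing_measurable => // x y xy; rewrite ler_int; exact: le_floor.
exact: H.
Qed.

Definition ind b x : R := (frac x < b)%R%:R.

Lemma ind_ge0 b x : 0 <= ind b x. Proof. exact: ler0n. Qed.

Lemma ind_le1 b x : ind b x <= 1. Proof. by rewrite /ind; case: (_ < _). Qed.

Lemma ind_norm b x : `|ind b x| <= 1.
Proof. by rewrite ger0_norm ?ind_ge0// ind_le1. Qed.

Lemma ind_circ b : circle_fun (ind b).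
Proof. by move=> x z; rewrite /ind fracDz. Qed.

Lemma measurable_ind b : measurable_fun [set: T1] (ind b : T1 -> R).
Proof.
have -> : ind b = (\1_[set x : T1 | frac x < b] : T1 -> R).
  apply/funext => x; rewrite indicE /ind; have [h|h] := boolP (frac x < b).
    by rewrite mem_set.
  by rewrite memNset //=; exact/negP.
apply: measurable_indic; rewrite -[X in measurable X]setTI.
apply: measurable_fun_ltr => //; exact: measurable_frac.
Qed.

Lemma ind_locally_constant b (s : R) : 0 < s -> 0 <= b <= 1 -> exists2 del : R, 0 < del &
  forall x y, s <= `|sin (pi * x)| -> s <= `|sin (pi * (x - b))| ->
    `|sin (pi * (x - y))| <= del -> ind b x = ind b y.
Proof.
move=> s0 /andP[b0 b1].
have [r r0 Hr] : exists2 r : R, 0 < r & forall v, `|v| < r -> `|sin (pi * v)| < s.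
  have /cvgrPdist_lt /(_ s s0) /nbhs_ballP[r /= r0 H] :
      (fun v : R => sin (pi * v)) x @[x --> (0 : R)] --> sin (pi * 0 : R).
    exact: (continuous_comp (@mulrl_continuous _ pi 0) (@continuous_sin _ _)).
  exists r => // v vr; have := H v; rewrite /ball /= sub0r normrN => /(_ vr).
  by rewrite mulr0 sin0 sub0r normrN.
pose r' := Num.min (r / 2) (1 / 4).
have r'0 : 0 < r' by rewrite lt_min divr_gt0//=; lra.
have r'r : r' < r by rewrite gt_min; apply/orP; left; lra.
have r'4 : r' <= 1 / 4 by rewrite ge_min lexx orbT.
have [del del0 Hdel] := sin_pi_small r'0.
exists del => // x y sx sxb /Hdel[z xyz].
have /andP[x0 x1] := frac_itv x.
have nsx v : `|frac x - v| <= r' -> s <= `|sin (pi * (frac x - v))| -> False.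
  by move=> h1 h2; have := Hr _ (le_lt_trans h1 r'r); rewrite ltNge h2.
have E0 : s <= `|sin (pi * (frac x - 0))|.
  by rewrite subr0 /frac -mulrNz sin_pi_periodz.
have E1 : s <= `|sin (pi * (frac x - 1))|.
  rewrite (_ : frac x - 1 = x + (- (Num.floor x + 1))%:~R) ?sin_pi_periodz//.
  by rewrite mulrNz intrD /frac; ring.
have Eb : s <= `|sin (pi * (frac x - b))|.
  by rewrite /frac addrAC -mulrNz sin_pi_periodz.
have {}nsx v : s <= `|sin (pi * (frac x - v))| -> r' < `|frac x - v|.
  by move=> h2; rewrite ltNge; apply/negP => h1; exact: (nsx v).
have {}E0 := nsx _ E0; have {}E1 := nsx _ E1; have {}Eb := nsx _ Eb.
pose y0 := frac x + (y - x + z%:~R).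
have y0y : frac y = frac y0.
  rewrite (_ : y0 = y + (z - Num.floor x)%:~R) ?fracDz//.
  by rewrite /y0 /frac intrD mulrNz; ring.
have y0x : `|frac x - y0| <= r'.
  by rewrite /y0 (_ : _ - _ = x - y - z%:~R); last by ring.
rewrite /ind y0y.
move: E0 E1 Eb y0x; set u := frac x in x0 x1 *.
rewrite subr0 (ger0_norm x0) (ler0_norm (_ : u - 1 <= 0)); last by lra.
rewrite ler_norml => E0 E1 Eb /andP[h1 h2].
have y01 : 0 <= y0 < 1 by apply/andP; split; lra.
rewrite (frac_id y01); congr (_%:R).
have [ub|ub] := ltP u b.
  by rewrite ltr0_norm in Eb; last lra; rewrite (_ : y0 < b); last lra.
by rewrite ger0_norm in Eb; last lra; rewrite (_ : (y0 < b) = false)//; apply/negbTE; rewrite -leNgt; lra.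
Qed.

(** The exceptional set consists of small arcs around the jumps 0 and b; elsewhere [ind b] is
    locally constant and only the tail of the Fejer kernel contributes. *)
Lemma ind_fejer_approx b (e : R) : 0 <= b <= 1 -> 0 < e -> exists (m : nat) (Z : set T1),
  [/\ measurable Z, (forall x (z : int), Z (x + z%:~R) <-> Z x), hr Z <= e,
      (forall x, `|fejer (ind b) m x| <= 1) &
      forall x, ~ Z x -> `|ind b x - fejer (ind b) m x| <= e].
Proof.
move=> b01 e0; have e20 : 0 < e / 2 by rewrite divr_gt0.
have [s s0 Hs] := sin_small_measure e20.
have [del del0 Hdel] := ind_locally_constant s0 b01.
pose m := (Num.truncn (4 / (e * del ^+ 2))).+1.
pose Z c := [set x : T1 | `|sin (pi * (x - c))| < s].
have mZ c : measurable (Z c) by exact: measurable_sin_lt.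
have m0 : 0 < m%:R :> R by rewrite ltr0n.
exists m, (Z 0 `|` Z b); split.
- exact: measurableU.
- have h c x (z : int) : Z c (x + z%:~R) = Z c x by rewrite /Z /= (addrAC x) sin_pi_periodz.
  by move=> x z; rewrite /setU /mkset !h.
- apply: le_trans (hr_leU _ _) _ => //.
  have h c : hr (Z c) <= e / 2 by rewrite -lee_fin -hrE//; exact: Hs.
  by have := h 0; have := h b; lra.
- by move=> x; apply: fejer_norm => // y; exact: ind_norm.
- move=> x /not_orP[/negP]; rewrite -leNgt subr0 => h1 /negP; rewrite -leNgt => h2.
  rewrite distrC; apply: le_trans (fejer_approx (e := 0) _ del0 _ (@ind_norm b) _) _ => //.
    by move=> y hy; rewrite (Hdel x y)// subrr normr0.
  rewrite add0r mulr1 ler_pdivrMr ?mulr_gt0 ?exprn_gt0//.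
  have := ltW (truncnS_gt (4 / (e * del ^+ 2))); rewrite -/m.
  by rewrite ler_pdivrMr ?mulr_gt0 ?exprn_gt0//; lra.
Qed.

End frac.

(** * Means of bounded measurable functions *)

Section bounded_measurable.
Context {d : measure_display} {T : measurableType d} {R : realType}.
Implicit Types (g h : T -> R) (A : set T).

(** Bounded measurable functions are integrable for every probability and stable under the
    operations used here, so no further integrability condition has to be carried along. *)
Definition bmeas g := measurable_fun [set: T] g /\ exists B : R, forall p, `|g p| <= B.

Lemma bmeas_bound g (B : R) : measurable_fun [set: T] g -> (forall p, `|g p| <= B) -> bmeas g.
Proof. by move=> mg gB; split=> //; exists B. Qed.

Lemma bmeas_cst (c : R) : bmeas (fun _ => c).
Proof. by apply: bmeas_bound => // p; exact: lexx. Qed.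

Lemma bmeasD g h : bmeas g -> bmeas h -> bmeas (fun p => g p + h p).
Proof.
move=> [mg [B gB]] [mh [C hC]]; apply: (@bmeas_bound _ (B + C)); first exact: measurable_funD.
by move=> p; apply: le_trans (ler_normD _ _) _; exact: lerD.
Qed.

Lemma bmeasM g h : bmeas g -> bmeas h -> bmeas (fun p => g p * h p).
Proof.
move=> [mg [B gB]] [mh [C hC]]; apply: (@bmeas_bound _ (B * C)); first exact: measurable_funM.
by move=> p; rewrite normrM; exact: ler_pM.
Qed.

Lemma bmeasB g h : bmeas g -> bmeas h -> bmeas (fun p => g p - h p).
Proof.
move=> [mg [B gB]] [mh [C hC]]; apply: (@bmeas_bound _ (B + C)); first exact: measurable_funB.
by move=> p; apply: le_trans (ler_normB _ _) _; exact: lerD.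
Qed.

Lemma bmeas_norm g : bmeas g -> bmeas (fun p => `|g p|).
Proof.
move=> [mg [B gB]]; apply: (@bmeas_bound _ B); first exact: measurableT_comp.
by move=> p; rewrite normr_id.
Qed.

Lemma bmeas_sum (I : Type) (s : seq I) (g : I -> T -> R) :
  (forall i, bmeas (g i)) -> bmeas (fun p => \sum_(i <- s) g i p).
Proof.
move=> H; elim: s => [|i s IH].
  by rewrite (_ : (fun _ => _) = fun _ => 0); [exact: bmeas_cst|apply/funext => p; rewrite big_nil].
rewrite (_ : (fun _ => _) = fun p => g i p + \sum_(j <- s) g j p); first exact: bmeasD.
by apply/funext => p; rewrite big_cons.
Qed.

Lemma bmeas_indic A : measurable A -> bmeas (\1_A : T -> R).
Proof.
move=> mA; apply: (@bmeas_bound _ 1); first exact: measurable_indic.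
by move=> p; rewrite indicE; case: (_ \in _); rewrite ?normr1 ?normr0.
Qed.

Variable P : probability T R.

Lemma bmeas_integrable g : bmeas g -> P.-integrable setT (EFin \o g).
Proof.
move=> [mg [B gB]]; apply: measurable_bounded_integrable => //.
  exact: fin_num_fun_lty.
exists B; split; first exact: num_real.
by move=> x Bx p _; apply: le_trans (gB p) _; exact: ltW.
Qed.

Definition mean g : R := \int[P]_p g p.

Lemma meanE g : bmeas g -> (\int[P]_p (g p)%:E)%E = (mean g)%:E.
Proof. by move=> bg; rewrite /mean /Rintegral fineK//; apply: integrable_fin_num => //; exact: bmeas_integrable. Qed.

Lemma mean_cst (c : R) : mean (fun _ => c) = c.
Proof. by rewrite /mean Rintegral_cst// [X in fine X](probability_setT P) mulr1. Qed.

Lemma meanD g h : bmeas g -> bmeas h -> mean (fun p => g p + h p) = mean g + mean h.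
Proof. by move=> bg bh; rewrite /mean RintegralD//; exact: bmeas_integrable. Qed.

Lemma meanB g h : bmeas g -> bmeas h -> mean (fun p => g p - h p) = mean g - mean h.
Proof. by move=> bg bh; rewrite /mean RintegralB//; exact: bmeas_integrable. Qed.

Lemma meanZ g (c : R) : bmeas g -> mean (fun p => c * g p) = c * mean g.
Proof. by move=> bg; rewrite /mean RintegralZl//; exact: bmeas_integrable. Qed.

Lemma mean_sum (I : Type) (s : seq I) (g : I -> T -> R) : (forall i, bmeas (g i)) ->
  mean (fun p => \sum_(i <- s) g i p) = \sum_(i <- s) mean (g i).
Proof.
move=> H; elim: s => [|i s IH].
  by rewrite big_nil -[RHS](mean_cst 0); congr mean; apply/funext => p; rewrite big_nil.
rewrite big_cons -IH -meanD//; last exact: bmeas_sum.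
by congr mean; apply/funext => p; rewrite big_cons.
Qed.

Lemma mean_le g h : bmeas g -> bmeas h -> (forall p, g p <= h p) -> mean g <= mean h.
Proof. by move=> bg bh gh; apply: le_Rintegral => //; exact: bmeas_integrable. Qed.

Lemma mean_norm g : bmeas g -> `|mean g| <= mean (fun p => `|g p|).
Proof. by move=> bg; apply: le_normr_Rintegral => //; exact: bmeas_integrable. Qed.

Lemma mean_norm_le g (B : R) : bmeas g -> (forall p, `|g p| <= B) -> `|mean g| <= B.
Proof.
move=> bg gB; apply: le_trans (mean_norm bg) _.
rewrite -[leRHS]mean_cst; apply: mean_le => //; [exact: bmeas_norm|exact: bmeas_cst].
Qed.

Lemma mean_indic A : measurable A -> mean \1_A = fine (P A).
Proof. by move=> mA; rewrite /mean /Rintegral integral_indic// setIT. Qed.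

Lemma mean_dist g h g' : bmeas g -> bmeas h -> bmeas g' ->
  (forall p, `|g p - h p| <= g' p) -> `|mean g - mean h| <= mean g'.
Proof.
move=> bg bh bg' H; rewrite -meanB//; apply: le_trans (mean_norm _) _; first exact: bmeasB.
by apply: mean_le => //; apply/bmeas_norm/bmeasB.
Qed.

End bounded_measurable.

Section haar_means.
Context {R : realType}.
Local Notation T1 := (measurableTypeR R).
Local Notation T2 := (T1 * T1)%type.
Implicit Types (G : T2 -> R) (g : T1 -> R).

(** Adding a constant reduces statements about means to nonnegative functions, where Tonelli's
    theorem applies. *)
Lemma bmeas_ge0_shift d (T : measurableType d) (g : T -> R) : bmeas g ->
  exists B : R, (forall p, 0 <= g p + B) /\ bmeas (fun p => g p + B).
Proof.
move=> bg; have [mg [B gB]] := bg; exists B; split; last by apply: bmeasD => //; exact: bmeas_cst.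
by move=> p; have := gB p; rewrite ler_norml => /andP[? _]; lra.
Qed.

Lemma bmeas_pair2 G x : bmeas G -> bmeas (fun y : T1 => G (x, y)).
Proof.
move=> [mG [B GB]]; apply: (@bmeas_bound _ _ _ _ B) => //.
exact: (measurableT_comp mG (pair1_measurable x)).
Qed.

Lemma bmeas_fiber_mean G : bmeas G -> bmeas (fun x : T1 => mean haar (fun y => G (x, y))).
Proof.
move=> bG; have [B [G0 [mGB _]]] := bmeas_ge0_shift bG; have [_ [C GC]] := bG.
apply: (@bmeas_bound _ _ _ _ C); last by move=> x; apply: mean_norm_le => //; exact: bmeas_pair2.
have H : measurable_fun [set: T1] (fun x : T1 => mean haar (fun y => G (x, y) + B)).
  have -> : (fun x : T1 => mean haar (fun y => G (x, y) + B)) =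
      fine \o fubini_F haar (fun p : T2 => (G p + B)%:E) by [].
  apply: (measurableT_comp (fine_measurable measurableT)).
  apply: measurable_fun_fubini_tonelli_F; first exact/measurable_EFinP.
  by move=> p; rewrite lee_fin.
rewrite (_ : (fun x => _) = fun x : T1 => mean haar (fun y => G (x, y) + B) - B).
  exact: measurable_funB.
apply/funext => x; rewrite meanD ?mean_cst ?addrK//; [exact: bmeas_pair2|exact: bmeas_cst].
Qed.

Lemma mean_haar2 G : bmeas G -> mean haar2 G = mean haar (fun x => mean haar (fun y => G (x, y))).
Proof.
move=> bG; have [B [G0 bGB]] := bmeas_ge0_shift bG.
apply: (@addIr _ B); rewrite -[in LHS](mean_cst haar2 B) -[in RHS](mean_cst haar B).
have c2 : bmeas (fun _ : T2 => B) by exact: bmeas_cst.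
have c1 : bmeas (fun _ : T1 => B) by exact: bmeas_cst.
rewrite -!meanD//; last exact: bmeas_fiber_mean.
apply: EFin_inj; rewrite -!meanE//; last by apply: bmeasD => //; exact: bmeas_fiber_mean.
rewrite haar2_integral; last 2 first.
- by apply/measurable_EFinP; case: bGB.
- by move=> p; rewrite lee_fin.
apply: eq_integral => x _; rewrite meanE; last exact: (bmeas_pair2 x bGB).
by rewrite meanD ?mean_cst//; exact: bmeas_pair2.
Qed.

Lemma mean_torus_iter (alpha beta : R) n G : torus_invariant G -> bmeas G ->
  mean haar2 (fun p => G (iter n (skew_shift alpha beta) p)) = mean haar2 G.
Proof.
move=> tG bG; have [B [G0 bGB]] := bmeas_ge0_shift bG.
have c2 : bmeas (fun _ : T2 => B) by exact: bmeas_cst.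
have mf := @measurable_iter_skew R alpha beta n.
have bGf : bmeas (fun p : T2 => G (iter n (skew_shift alpha beta) p)).
  case: bG => [mG [C GC]]; apply: (@bmeas_bound _ _ _ _ C) => //.
  exact: (measurableT_comp mG mf).
apply: (@addIr _ (mean haar2 (fun _ : T2 => B))); rewrite -!meanD//.
apply: EFin_inj; rewrite -!meanE//; last exact: bmeasD.
apply: (@torus_skew_iter_integral R alpha beta (fun p => (G p + B)%:E) n).
- by move=> p i j; have /torus_invariantP -> := tG.
- by apply/measurable_EFinP; case: bGB.
- by move=> p; rewrite lee_fin.
Qed.

Lemma mean_haar2_fst g : bmeas g -> mean haar2 (fun p : T2 => g p.1) = mean haar g.
Proof.
move=> bg; rewrite mean_haar2.
  by congr mean; apply/funext => x /=; rewrite mean_cst.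
case: bg => [mg [B gB]]; apply: (@bmeas_bound _ _ _ _ B) => //.
exact: (measurableT_comp mg measurable_fst).
Qed.

Lemma mean_haar2_snd g : bmeas g -> mean haar2 (fun p : T2 => g p.2) = mean haar g.
Proof.
move=> bg; rewrite mean_haar2; first exact: (mean_cst haar (mean haar g)).
case: bg => [mg [B gB]]; apply: (@bmeas_bound _ _ _ _ B) => //.
exact: (measurableT_comp mg measurable_snd).
Qed.

End haar_means.

Section fejer_trig.
Context {R : realType}.
Local Notation T1 := (measurableTypeR R).
Local Notation T2 := (T1 * T1)%type.

Lemma trig_poly_deg_cos d (z : int) (c th : R) : (`|z| <= d)%N ->
  trig_poly_deg d (fun x : R => c * cos (2 * pi * (z%:~R * x + th))).
Proof.
move=> zd; pose s : R := if (0 <= z)%R then 1 else -1.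
exists (fun k => if k == `|z|%N then c * cos (2 * pi * th) else 0),
       (fun k => if k == `|z|%N then - (c * s * sin (2 * pi * th)) else 0) => x.
have zd' : (`|z| < d.+1)%N by [].
rewrite (bigD1 (Ordinal zd'))//= eqxx big1 ?addr0; last first.
  move=> i; rewrite -val_eqE /= => /negbTE iz.
  by rewrite iz !mul0r addr0.
rewrite mulrDr cosD.
have zE : z%:~R = s * `|z|%N%:R :> R.
  rewrite /s [in RHS]pmulrn abszE; case: (leP 0%R z) => z0; first by rewrite mul1r ger0_norm.
  by rewrite mulN1r -mulrNz ltr0_norm// opprK.
have -> : 2 * pi * (z%:~R * x) = s * (2 * pi * `|z|%N%:R * x) by rewrite zE; ring.
rewrite /s; case: (0 <= z)%R; first by rewrite !mul1r; ring.
by rewrite !mulN1r cosN sinN; ring.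
Qed.

Lemma trig_poly_deg_big d (I : Type) (s : seq I) (h : I -> R -> R) :
  (forall i, trig_poly_deg d (h i)) -> trig_poly_deg d (fun x => \sum_(i <- s) h i x).
Proof.
move=> H; elim: s => [|i s [a [b E]]].
  exists (fun=> 0), (fun=> 0) => x; rewrite big_nil big1// => k _.
  by rewrite !mul0r addr0.
have [a' [b' E']] := H i.
exists (fun k => a' k + a k), (fun k => b' k + b k) => x.
rewrite big_cons E E' -big_split /=; apply: eq_bigr => k _; ring.
Qed.

Lemma fejer_trig_poly_deg (g : R -> R) m : trig_poly_deg m (fejer g m).
Proof.
rewrite (_ : fejer g m = fun x => \sum_(q < m) \sum_(i < m) \sum_(j < m)
    m%:R^-1 * (g (q%:R / m%:R) * m%:R^-1) *
    cos (2 * pi * ((i%:Z - j%:Z)%:~R * x - ((i%:R - j%:R) * (q%:R / m%:R)))));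
  last by apply/funext => x; exact: fejer_sum.
apply: trig_poly_deg_big => q; apply: trig_poly_deg_big => i; apply: trig_poly_deg_big => j.
apply: trig_poly_deg_cos.
by have := ltn_ord i; have := ltn_ord j; lia.
Qed.

Lemma continuous_trig_poly_deg d (h : R -> R) : trig_poly_deg d h -> continuous h.
Proof.
move=> /trig_poly_dft E; rewrite (_ : h = fun y => dft_mean d h + trig_sum d (dft_cos d h) (dft_sin d h) y).
  by move=> y; apply: cvgD; [exact: cvg_cst|exact: continuous_trig_sum].
by apply/funext => y; exact: E.
Qed.

Lemma continuous_fejer (g : R -> R) m : continuous (fejer g m).
Proof. exact/continuous_trig_poly_deg/fejer_trig_poly_deg. Qed.

Lemma circle_fun_trig_poly_deg d (h : R -> R) : trig_poly_deg d h -> circle_fun h.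
Proof.
move=> [a [b E]] x z; rewrite !E; apply: eq_bigr => k _.
have -> : 2 * pi * k%:R * (x + z%:~R) = 2 * pi * k%:R * x + 2 * pi * (k%:Z * z)%:~R.
  by rewrite intrM -pmulrn; ring.
by rewrite cos_periodz sin_periodz.
Qed.

Lemma bmeas_ind b : bmeas (ind b : T1 -> R).
Proof. by apply: (@bmeas_bound _ _ _ _ 1); [exact: measurable_ind|exact: ind_norm]. Qed.

Lemma bmeas_fst (g : T1 -> R) : bmeas g -> bmeas (fun p : T2 => g p.1).
Proof.
case=> [mg [B gB]]; apply: (@bmeas_bound _ _ _ _ B) => //.
exact: (measurableT_comp mg measurable_fst).
Qed.

Lemma bmeas_snd (g : T1 -> R) : bmeas g -> bmeas (fun p : T2 => g p.2).
Proof.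
case=> [mg [B gB]]; apply: (@bmeas_bound _ _ _ _ B) => //.
exact: (measurableT_comp mg measurable_snd).
Qed.

Lemma ind_fejer_mean (b e : R) : 0 <= b <= 1 -> 0 < e -> exists m : nat,
  (forall x, `|fejer (ind b) m x| <= 1) /\
  mean haar (fun x => `|ind b x - fejer (ind b) m x|) <= e.
Proof.
move=> b01 e0; have e3 : 0 < e / 3 by rewrite divr_gt0.
have [m [Z [mZ _ hZ f1 HZ]]] := ind_fejer_approx b01 e3.
exists m; split=> //.
have bf : bmeas (fejer (ind b) m : T1 -> R).
  by apply: (@bmeas_bound _ _ _ _ 1) => //; apply: continuous_measurable; exact: continuous_fejer.
have bZ : bmeas (\1_Z : T1 -> R) by exact: bmeas_indic.
have b2Z : bmeas (fun x : T1 => 2 * \1_Z x : R) by apply: bmeasM => //; exact: bmeas_cst.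
apply: (@le_trans _ _ (mean haar (fun x : T1 => e / 3 + 2 * \1_Z x))).
  apply: mean_le.
  - by apply/bmeas_norm/bmeasB => //; exact: bmeas_ind.
  - by apply: bmeasD => //; exact: bmeas_cst.
  - move=> x; rewrite indicE; have [Zx|nZx] := pselect (Z x).
      rewrite mem_set//= mulr1; apply: le_trans (ler_normB _ _) _.
      by have := f1 x; have := ind_norm b x; lra.
    by rewrite memNset//= mulr0 addr0; exact: HZ.
rewrite meanD//; last exact: bmeas_cst.
rewrite mean_cst meanZ// mean_indic//; have := hZ; rewrite /hr; lra.
Qed.

Lemma quadrant_fejer_mean (b1 b2 e : R) : 0 <= b1 <= 1 -> 0 <= b2 <= 1 -> 0 < e -> exists m1 m2 : nat,
  [/\ forall x, `|fejer (ind b1) m1 x| <= 1, forall x, `|fejer (ind b2) m2 x| <= 1 &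
  mean haar2 (fun p => `|ind b1 p.1 * ind b2 p.2 - fejer (ind b1) m1 p.1 * fejer (ind b2) m2 p.2|) <= e].
Proof.
move=> b1P b2P e0; have e2 : 0 < e / 2 by rewrite divr_gt0.
have [m1 [f1 H1]] := ind_fejer_mean b1P e2; have [m2 [f2 H2]] := ind_fejer_mean b2P e2.
exists m1, m2; split => //.
have bf1 : bmeas (fejer (ind b1) m1 : T1 -> R).
  by apply: (@bmeas_bound _ _ _ _ 1) => //; apply: continuous_measurable; exact: continuous_fejer.
have bf2 : bmeas (fejer (ind b2) m2 : T1 -> R).
  by apply: (@bmeas_bound _ _ _ _ 1) => //; apply: continuous_measurable; exact: continuous_fejer.
have i1 := bmeas_ind b1; have i2 := bmeas_ind b2.
have d1 := bmeas_norm (bmeasB i1 bf1); have d2 := bmeas_norm (bmeasB i2 bf2).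
apply: (@le_trans _ _ (mean haar2 (fun p : T2 => `|ind b1 p.1 - fejer (ind b1) m1 p.1| + `|ind b2 p.2 - fejer (ind b2) m2 p.2|))).
  apply: mean_le.
  - by apply/bmeas_norm/bmeasB; apply: bmeasM; (apply: bmeas_fst || apply: bmeas_snd).
  - by apply: bmeasD; [exact: (bmeas_fst d1)|exact: (bmeas_snd d2)].
  - move=> [x y] /=; set u := ind b1 x; set v := ind b2 y; set g := fejer _ _ x; set h := fejer _ _ y.
    rewrite (_ : u * v - g * h = (u - g) * v + g * (v - h)); last by ring.
    apply: le_trans (ler_normD _ _) _; rewrite (normrM (u - g) v) (normrM g); apply: lerD.
      by rewrite ler_piMr// ind_norm.
    by rewrite ler_piMl//; exact: f1.
rewrite meanD; [|exact: (bmeas_fst d1)|exact: (bmeas_snd d2)].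
rewrite (mean_haar2_fst d1) (mean_haar2_snd d2); lra.
Qed.

End fejer_trig.

(** * Quadrants as a pi-system generating the Borel sets *)

Section generators.
Context {R : realType}.
Local Notation T1 := (measurableTypeR R).
Local Notation T2 := (T1 * T1)%type.
Local Notation T3 := (T1 * T1 * T1)%type.

Definition ray : set (set T1) := [set A | exists x : R, A = `]-oo, x[%classic].
Definition quadrant2 : set (set T2) := [set X | exists A B, [/\ ray A, ray B & X = A `*` B]].
Definition quadrant3 : set (set T3) := [set X | exists A B, [/\ quadrant2 A, ray B & X = A `*` B]].

Lemma ray_generates : @measurable _ T1 = <<s ray >>.
Proof. exact: RGenInftyO.measurableE. Qed.

Lemma ray_cover : \bigcup_n (`]-oo, (n%:R : R)[%classic : set T1) = setT.
Proof.
apply/seteqP; split => // x _; exists (Num.truncn `|x|).+1 => //=.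
rewrite in_itv /=; apply: le_lt_trans (ler_norm x) _; exact: truncnS_gt.
Qed.

Lemma quadrant2_generates : @measurable _ T2 = <<s quadrant2 >>.
Proof.
apply: (@prod_generator _ _ _ _ ray ray (fun n => `]-oo, n%:R[%classic) (fun n => `]-oo, n%:R[%classic)).
- exact: ray_generates.
- exact: ray_generates.
- by move=> n; exists n%:R.
- by move=> n; exists n%:R.
- exact: ray_cover.
- exact: ray_cover.
Qed.

Lemma quadrant3_generates : @measurable _ T3 = <<s quadrant3 >>.
Proof.
apply: (@prod_generator _ _ _ _ quadrant2 ray
  (fun n => `]-oo, n%:R[%classic `*` `]-oo, n%:R[%classic) (fun n => `]-oo, n%:R[%classic)).
- exact: quadrant2_generates.
- exact: ray_generates.
- by move=> n; exists `]-oo, n%:R[%classic, `]-oo, n%:R[%classic; split => //; exists n%:R.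
- by move=> n; exists n%:R.
- apply/seteqP; split => // -[x y] _; exists (maxn (Num.truncn `|x|) (Num.truncn `|y|)).+1 => //=.
  have h (z : R) (n : nat) : (Num.truncn `|z| <= n)%N -> z < n.+1%:R.
    move=> zn; apply: le_lt_trans (ler_norm z) _; apply: lt_le_trans (truncnS_gt _) _.
    by rewrite ler_nat.
  by split; rewrite in_itv /=; apply: h; [exact: leq_maxl|exact: leq_maxr].
- exact: ray_cover.
Qed.

Lemma ray_setI : setI_closed ray.
Proof.
move=> _ _ [x ->] [y ->]; exists (Num.min x y).
by apply/seteqP; split => z /=; rewrite !in_itv /= lt_min; [case=> -> ->|move=> /andP[]].
Qed.

Lemma quadrant2_setI : setI_closed quadrant2.
Proof.
move=> _ _ [A [B [rA rB ->]]] [A' [B' [rA' rB' ->]]].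
exists (A `&` A'), (B `&` B'); split; [exact: ray_setI|exact: ray_setI|].
by apply/seteqP; split => -[x y] /= [[? ?] [? ?]].
Qed.

Lemma quadrant3_setI : setI_closed quadrant3.
Proof.
move=> _ _ [A [B [rA rB ->]]] [A' [B' [rA' rB' ->]]].
exists (A `&` A'), (B `&` B'); split; [exact: quadrant2_setI|exact: ray_setI|].
by apply/seteqP; split => -[x y] /= [[? ?] [? ?]].
Qed.

End generators.

Lemma mem_iff (T T' : Type) (A : set T) (B : set T') x y : (A x <-> B y) -> (x \in A) = (y \in B).
Proof.
move=> AB; have [Ax|nAx] := pselect (A x); first by rewrite !mem_set//; apply/AB.
by rewrite !memNset// => /AB.
Qed.

(** * Independence of invariant sets from quadrants *)

Section ergodicity.
Context {R : realType} (alpha beta : R).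
Hypothesis irr : irrational alpha.
Local Notation T1 := (measurableTypeR R).
Local Notation T2 := (T1 * T1)%type.
Local Notation f := (skew_shift alpha beta).

Definition frac2 (p : T2) : T2 := (frac p.1, frac p.2).

Lemma measurable_frac2 : measurable_fun [set: T2] frac2.
Proof.
apply/measurable_fun_pairP; split.
  exact: (measurableT_comp measurable_frac measurable_fst).
exact: (measurableT_comp measurable_frac measurable_snd).
Qed.

Lemma frac2_torus p (i j : int) : frac2 (p.1 + i%:~R, p.2 + j%:~R) = frac2 p.
Proof. by rewrite /frac2 /= !fracDz. Qed.

Definition torus_set (A : set T2) := forall p (i j : int), A (p.1 + i%:~R, p.2 + j%:~R) <-> A p.

Lemma torus_invariant_indic A : torus_set A -> torus_invariant (\1_A : T2 -> R).
Proof.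
move=> tA; apply/torus_invariantP => p i j; rewrite !indicE; congr (nat_of_bool _)%:R.
exact/mem_iff/tA.
Qed.

(** By invariance of A and of the measure, G may be replaced by its average over n steps, which
    tends to mu uniformly. With A the whole torus this identifies mu as the Haar mean of G; for
    general A it is the seed of ergodicity. *)
Lemma invariant_mean (A : set T2) (G : T2 -> R) (mu : R) : measurable A -> torus_set A ->
  (forall p, A (f p) <-> A p) -> torus_invariant G -> bmeas G -> unif_mean f G mu ->
  mean haar2 (fun p => \1_A p * G p) = mu * mean haar2 \1_A.
Proof.
move=> mA tA iA tG bG uG.
have b1 : bmeas (\1_A : T2 -> R) by exact: bmeas_indic.
have bAG : bmeas (fun p : T2 => \1_A p * G p) by exact: bmeasM.
have iAn n p : \1_A (iter n f p) = \1_A p :> R.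
  rewrite !indicE; congr (nat_of_bool _)%:R.
  elim: n => // n IH; rewrite iterS -IH.
  exact/mem_iff/iA.
have tAG : torus_invariant (fun p : T2 => \1_A p * G p).
  by move=> p p' pp'; rewrite (torus_invariant_indic tA pp') (tG _ _ pp').
have bi n : bmeas (fun p : T2 => G (iter n f p)).
  case: bG => [mG [C GC]]; apply: (@bmeas_bound _ _ _ _ C) => //.
  exact: (measurableT_comp mG (@measurable_iter_skew R alpha beta n)).
have H n : mean haar2 (fun p => \1_A p * birkhoff f G n p) = mean haar2 (fun p => \1_A p * G p) * n%:R.
  rewrite -sumr_const_ord.
  have -> : (fun p => \1_A p * birkhoff f G n p) = fun p => \sum_(i < n) \1_A p * G (iter i f p).
    by apply/funext => p; rewrite mulr_sumr.
  rewrite mean_sum; last by move=> i; exact: bmeasM.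
  apply: eq_bigr => i _; rewrite -(mean_torus_iter alpha beta i tAG bAG).
  by congr mean; apply/funext => p; rewrite iAn.
apply/eqP; rewrite -subr_eq0 -normr_le0; apply/ler_addgt0Pr => e e0; rewrite add0r.
have [n0 /(_ n0.+1 (leqnSn _)) Hn] := uG e e0.
have n1 : 0 < n0.+1%:R :> R by rewrite ltr0n.
rewrite -(ler_pM2r n1) -[in leLHS](gtr0_norm n1) -normrM mulrBl -H mulrAC.
have bb : bmeas (fun p : T2 => birkhoff f G n0.+1 p) by exact: bmeas_sum.
rewrite -meanZ// [leRHS](_ : _ = mean haar2 (fun _ : T2 => e * n0.+1%:R)); last by rewrite mean_cst.
apply: mean_dist.
- exact: bmeasM.
- by apply: bmeasM => //; exact: bmeas_cst.
- exact: bmeas_cst.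
- move=> p; rewrite mulrC -mulrBl normrM.
  apply: le_trans (Hn p); rewrite ler_piMr// indicE; case: (_ \in _); by rewrite ?normr1 ?normr0.
Qed.

Lemma torus_invariant_quadrant b1 b2 : torus_invariant (fun p : T2 => ind b1 p.1 * ind b2 p.2).
Proof. by apply/torus_invariantP => p i j /=; rewrite !ind_circ. Qed.

Lemma bmeas_fejer2 m1 m2 b1 b2 : (forall x, `|fejer (ind b1) m1 x| <= 1) ->
  (forall x, `|fejer (ind b2) m2 x| <= 1) ->
  bmeas (fun p : T2 => fejer (ind b1) m1 p.1 * fejer (ind b2) m2 p.2 : R).
Proof.
move=> f1 f2; apply: bmeasM.
  apply: bmeas_fst; apply: (@bmeas_bound _ _ _ _ 1) => //.
  by apply: continuous_measurable; exact: continuous_fejer.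
apply: bmeas_snd; apply: (@bmeas_bound _ _ _ _ 1) => //.
by apply: continuous_measurable; exact: continuous_fejer.
Qed.

Lemma torus_invariant_fejer2 m1 m2 (g1 g2 : R -> R) :
  torus_invariant (fun p : R * R => fejer g1 m1 p.1 * fejer g2 m2 p.2).
Proof.
apply/torus_invariantP => p i j /=.
by rewrite !(circle_fun_trig_poly_deg (@fejer_trig_poly_deg R _ _)).
Qed.

(** Uniform means are available for products of Fejer means only. Such a product is close to the
    indicator in mean, which is enough since both sides are continuous for that norm. *)
Lemma invariant_quadrant (A : set T2) b1 b2 : measurable A -> torus_set A ->
  (forall p, A (f p) <-> A p) -> 0 <= b1 <= 1 -> 0 <= b2 <= 1 ->
  mean haar2 (fun p => \1_A p * (ind b1 p.1 * ind b2 p.2)) =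
  mean haar2 (fun p => ind b1 p.1 * ind b2 p.2) * mean haar2 \1_A.
Proof.
move=> mA tA iA b1P b2P.
have bA : bmeas (\1_A : T2 -> R) by exact: bmeas_indic.
have bI : bmeas (fun p : T2 => ind b1 p.1 * ind b2 p.2).
  by apply: bmeasM; [apply: bmeas_fst; exact: bmeas_ind|apply: bmeas_snd; exact: bmeas_ind].
have A01 p : `|\1_A p : R| <= 1 by rewrite indicE; case: (_ \in _); rewrite ?normr1 ?normr0.
apply/eqP; rewrite -subr_eq0 -normr_le0; apply/ler_addgt0Pr => e e0; rewrite add0r.
have e2 : 0 < e / 2 by rewrite divr_gt0.
have [m1 [m2 [f1 f2 H]]] := quadrant_fejer_mean b1P b2P e2.
have bG := bmeas_fejer2 f1 f2.
have tG := torus_invariant_fejer2 m1 m2 (ind b1) (ind b2).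
have [mu uG] := unif_mean_fejer_fejer beta irr (ind b1) m1 (ind b2) m2.
have HA := invariant_mean mA tA iA tG bG uG.
have mT : measurable [set: T2] by [].
have HT := invariant_mean mT (fun _ _ _ => iff_refl _) (fun _ => iff_refl _) tG bG uG.
have T1E : (\1_[set: T2] : T2 -> R) = fun _ => 1 by apply/funext => p; rewrite indicT.
rewrite T1E mean_cst mulr1 in HT.
set G := (fun p : T2 => _) in bG HA HT H; set I2 := (fun p : T2 => _) in bI *.
have {}HT : mean haar2 G = mu by rewrite -HT; congr mean; apply/funext => p; rewrite mul1r.
have e1 : `|mean haar2 I2 - mean haar2 G| <= e / 2.
  by apply: le_trans H; apply: mean_dist => //; exact/bmeas_norm/bmeasB.
have e1' : `|mean haar2 (fun p => \1_A p * I2 p) - mean haar2 (fun p => \1_A p * G p)| <= e / 2.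
  apply: le_trans H; apply: mean_dist => //; [exact: bmeasM|exact: bmeasM|exact/bmeas_norm/bmeasB|].
  by move=> p; rewrite -mulrBr normrM ler_piMl.
rewrite (_ : _ - _ = (mean haar2 (fun p => \1_A p * I2 p) - mean haar2 (fun p => \1_A p * G p)) -
  (mean haar2 I2 - mean haar2 G) * mean haar2 \1_A); last by rewrite HA HT; ring.
apply: le_trans (ler_normB _ _) _; rewrite normrM.
have : `|mean haar2 (\1_A : T2 -> R)| <= 1 by exact: mean_norm_le.
move=> h; have := ler_piMr (normr_ge0 (mean haar2 I2 - mean haar2 G)) h; lra.
Qed.

End ergodicity.

(** * Comparison with Lebesgue measure, ergodicity *)

Section lebesgue_haar.
Context {R : realType}.
Local Notation T1 := (measurableTypeR R).
Local Notation T2 := (T1 * T1)%type.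
Local Notation T3 := (T1 * T1 * T1)%type.
Local Open Scope ereal_scope.

Lemma measurable_unit_square : measurable (unit_square : set T2).
Proof. by apply: measurableX; exact: measurable_itv. Qed.

Lemma integral_unit_square (g : T2 -> \bar R) : measurable_fun setT g -> (forall p, 0 <= g p) ->
  \int[leb2]_(p in (unit_square : set T2)) g p = \int[haar2]_p g p.
Proof.
move=> mg g0; rewrite integral_mkcond haar2_integral//.
have mgU : measurable_fun setT (g \_ (unit_square : set T2)).
  by apply/(measurable_restrictT g); [exact: measurable_unit_square|exact: measurable_funTS].
have gU0 p : 0 <= (g \_ (unit_square : set T2)) p by apply: erestrict_ge0 => q _; exact: g0.
rewrite /leb2 (fubini_tonelli1 _ mgU gU0) circ_integralE; last 2 first.
- exact: measurable_fun_fubini_tonelli_F.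
- by move=> x; apply: integral_ge0.
rewrite [RHS]integral_mkcond lam.unlock; apply: eq_integral => x _.
rewrite patchE /fubini_F; case: ifPn => x01.
  rewrite circ_integralE//; last exact: (measurable_fun_pair2 x mg).
  rewrite lam.unlock [RHS]integral_mkcond; apply: eq_integral => y _.
  rewrite !patchE; congr (if _ then _ else _).
  by apply/idP/idP; rewrite !inE; [case|move=> ?; split => //; exact: set_mem].
rewrite integral0_eq// => y _; rewrite patchE memNset// => -[/= h _].
by move: x01; rewrite mem_set.
Qed.

Lemma haar2_leb2 (A : set T2) : measurable A -> haar2 A = leb2 (A `&` unit_square).
Proof.
move=> mA.
have -> : haar2 A = \int[haar2]_p (\1_A p)%:E by rewrite integral_indic// setIT.
rewrite -integral_unit_square; last 2 first.
- by apply/measurable_EFinP; exact: measurable_indic.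
- by move=> p; rewrite lee_fin.
by rewrite integral_indic//; exact: measurable_unit_square.
Qed.

Lemma haar2_unit_square (A : set T2) : measurable A -> haar2 (A `&` unit_square) = haar2 A.
Proof.
move=> mA; rewrite !haar2_leb2//; first by rewrite -setIA setIid.
by apply: measurableI => //; exact: measurable_unit_square.
Qed.

Lemma haar3_leb3 (A : set T3) : measurable A ->
  haar3 A = leb3 (A `&` (unit_square `*` setT)).
Proof.
move=> mA; have mU : measurable (unit_square `*` setT : set T3).
  by apply: measurableX => //; exact: measurable_unit_square.
have mx : measurable_fun setT (fun p : T2 => lam (xsection A p)) by exact: measurable_fun_xsection.
have -> : haar3 A = \int[haar2]_p lam (xsection A p) by rewrite haar3.unlock.
rewrite -integral_unit_square// integral_mkcond; apply: eq_integral => p _.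
rewrite patchE; case: ifPn => pU.
  by rewrite lam.unlock; congr lebesgue_measure; apply/seteqP; split => z;
    rewrite /xsection /= !inE; [move=> ?; split => //; split => //; exact: set_mem|case].
rewrite /= (_ : xsection _ _ = set0) ?measure0//; apply/seteqP; split => z //.
by rewrite /xsection /= inE => -[_ [/= h _]]; move: pU; rewrite mem_set.
Qed.

End lebesgue_haar.

Section ergodic_sets.
Context {R : realType} (alpha beta : R).
Hypothesis irr : irrational alpha.
Local Notation T1 := (measurableTypeR R).
Local Notation T2 := (T1 * T1)%type.
Local Notation f := (skew_shift alpha beta).

Lemma fine_haar2_bound (A B : set T2) : measurable A -> measurable B -> A `<=` B ->
  fine (haar2 A) <= fine (haar2 B).
Proof.
move=> mA mB AB; apply: fine_le; [exact: fin_num_measure|exact: fin_num_measure|].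
by apply: le_measure; rewrite ?inE.
Qed.

(** On [0, 1[ the conditions x < b and x < [clamp b] coincide, so [ind (clamp b)] represents an
    arbitrary ray on the fundamental domain. *)
Definition clamp (b : R) : R := Num.min 1 (Num.max 0 b).

Lemma clampP b : 0 <= clamp b <= 1.
Proof. by rewrite /clamp le_min ge_min lexx le_max lexx ler01. Qed.

Lemma frac_clamp (x b : R) : 0 <= x < 1 -> (frac x < clamp b) = (x < b).
Proof.
move=> x01; rewrite frac_id// /clamp.
move: x01 => /andP[x0 x1]; apply/idP/idP; rewrite lt_min lt_max.
  by move=> /andP[_ /orP[]] //; rewrite ltNge x0.
by rewrite x1 /= => ->; rewrite orbT.
Qed.

(** [dynkin_limit], applied to a constant sequence, extends independence from quadrants to
    independence from all Borel sets. A is then independent of itself, and its measure equals its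
    own square. *)
Lemma ergodic_set (A : set T2) : measurable A -> torus_set A -> (forall p, A (f p) <-> A p) ->
  haar2 A = 0%E \/ haar2 A = 1%E.
Proof.
move=> mA tA iA.
have bA : bmeas (\1_A : T2 -> R) by exact: bmeas_indic.
pose L (n : nat) B := fine (haar2 (A `&` B)).
have H B : measurable B -> L n B @[n --> \oo] --> fine (haar2 A) * fine (haar2 (B `&` setT)).
  apply: (@dynkin_limit _ _ _ haar2 setT quadrant2 _ _ L 1) => //.
  - by apply: le_lt_trans (probability_le1 _ _) _ => //; rewrite ltry.
  - exact: quadrant2_generates.
  - exact: quadrant2_setI.
  - move=> i B' C mB mC BC; rewrite /L setIUr measureU//; [|exact: measurableI|exact: measurableI|].
      by rewrite fineD//; apply: fin_num_measure; exact: measurableI.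
    by rewrite setIACA BC setI0.
  - by move=> i B' mB; rewrite /L fine_ge0.
  - apply: nearW => i B' mB; rewrite /L setIT mul1r; apply: fine_haar2_bound => //.
    exact: measurableI.
  - rewrite /L setIT [X in _ * fine X](probability_setT haar2) mulr1; exact: cvg_cst.
  - move=> _ [_ [_ [[x ->] [y ->] ->]]].
    set Q0 := _ `*` _; have mB : measurable Q0 by apply: measurableX; exact: measurable_itv.
    rewrite /L setIT; suff -> : fine (haar2 (A `&` Q0)) = fine (haar2 A) * fine (haar2 Q0) by exact: cvg_cst.

    have := invariant_quadrant irr mA tA iA (clampP x) (clampP y).
    pose Q := [set p : T2 | frac p.1 < clamp x] `&` [set p : T2 | frac p.2 < clamp y].
    have mQ : measurable Q.
      apply: measurableI.
      + rewrite -[X in measurable X]setTI; apply: measurable_fun_ltr => //.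
        exact: (measurableT_comp measurable_frac measurable_fst).
      + rewrite -[X in measurable X]setTI; apply: measurable_fun_ltr => //.
        exact: (measurableT_comp measurable_frac measurable_snd).
    have indQ p : ind (clamp x) p.1 * ind (clamp y) p.2 = \1_Q p :> R.
      rewrite indicE /ind -natrM mulnb; congr (nat_of_bool _)%:R.
      by apply/idP/idP; rewrite inE /Q /= => /andP.
    have QB p : unit_square p -> Q p <-> Q0 p.
      case: p => u v [/= u01 v01]; rewrite /Q /Q0 /= !in_itv /=.
      by rewrite !frac_clamp.
    have E (C : set T2) : measurable C -> haar2 (C `&` Q) = haar2 (C `&` Q0).
      move=> mC; rewrite -[LHS]haar2_unit_square ?[RHS]haar2_unit_square; [|exact: measurableI..].
      rewrite -[RHS]haar2_unit_square; last exact: measurableI.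
      by congr (haar2 _); apply/seteqP; split => p [[Cp Qp] Up]; split => //; split => //; apply/(QB p Up).
    have -> : (fun p : T2 => \1_A p * (ind (clamp x) p.1 * ind (clamp y) p.2)) = (\1_(A `&` Q) : T2 -> R).
      by apply/funext => p; rewrite indQ indicI.
    have -> : (fun p : T2 => ind (clamp x) p.1 * ind (clamp y) p.2) = (\1_Q : T2 -> R).
      by apply/funext => p; rewrite indQ.
    rewrite !mean_indic//; last exact: measurableI.
    by rewrite E// -(setTI Q) E// setTI mulrC.
have {}H := H A mA.
have : L 0 A @[n --> \oo] --> L 0 A by exact: cvg_cst.
move=> /(cvg_unique (@norm_hausdorff _ R)) /(_ H).
rewrite /L setIid setIT => E.
have fA : haar2 A \is a fin_num by exact: fin_num_measure.
have /eqP : fine (haar2 A) * (1 - fine (haar2 A)) = 0 by rewrite mulrBr mulr1 -E subrr.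
rewrite mulf_eq0 => /orP[/eqP h|]; [left|rewrite subr_eq0 => /eqP h; right].
  by rewrite -(fineK fA) h.
by rewrite -(fineK fA) -h.
Qed.

End ergodic_sets.

(** * Recurrence and coboundaries *)

Lemma birkhoff_ge0 (R : realType) (T : Type) (F : T -> T) (v : T -> R) n q :
  (forall q, 0 <= v q) -> 0 <= birkhoff F v n q.
Proof. by move=> v0; apply: sumr_ge0. Qed.

Lemma birkhoff_le_n (R : realType) (T : Type) (F : T -> T) (v : T -> R) n q :
  (forall q, v q <= 1) -> birkhoff F v n q <= n%:R.
Proof.
move=> v1; rewrite -[leRHS]mul1r -sumr_const_ord; exact: ler_sum.
Qed.

Lemma birkhoff_le_add (R : realType) (T : Type) (F : T -> T) (v : T -> R) m n q :
  (forall q, 0 <= v q) -> (m <= n)%N -> birkhoff F v m q <= birkhoff F v n q.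
Proof. by move=> v0 mn; rewrite -(subnK mn) addnC birkhoff_add lerDl birkhoff_ge0. Qed.

(* Cover the visits to [E] before time [L] greedily by blocks on which the
   average of [v] exceeds [c]. *)
Lemma maximal_birkhoff (R : realType) (T : Type) (F : T -> T) (v : T -> R) (c : R) (N : nat)
    (E : set T) : 0 <= c -> (forall q, 0 <= v q) ->
  (forall q, E q -> exists n, (0 < n <= N)%N /\ c * n%:R < birkhoff F v n q) ->
  forall L q, c * birkhoff F \1_E L q <= birkhoff F v (L + N) q.
Proof.
move=> c0 v0 HE L; elim/ltn_ind: L => -[|L] IH q.
  by rewrite birkhoff0 mulr0 birkhoff_ge0.
have I1 (p : T) : (\1_E p : R) <= 1 by rewrite indicE; case: (_ \in _).
have [Eq|nEq] := pselect (E q); last first.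
  rewrite birkhoffS indicE memNset//= add0r addSn birkhoffS.
  apply: le_trans (IH L (ltnSn _) (F q)) _; by rewrite lerDr.
have [n [/andP[n0 nN] Hn]] := HE q Eq.
have Ib m p : birkhoff F \1_E m p <= m%:R :> R.
  exact: birkhoff_le_n.
have [nL|Ln] := leqP n L.+1; last first.
  apply: (@le_trans _ _ (c * n%:R)).
    by apply: ler_wpM2l => //; apply: le_trans (Ib _ _) _; rewrite ler_nat ltnW.
  apply: (le_trans (ltW Hn)); apply: birkhoff_le_add => //.
  by rewrite (leq_trans nN)// leq_addl.
rewrite -{1}(subnKC nL) birkhoff_add -{2}(subnKC nL) -addnA birkhoff_add mulrDr.
apply: lerD; last by apply: IH; lia.
by apply: le_trans (ltW Hn); apply: ler_wpM2l.
Qed.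

Lemma measure_mono d (T : measurableType d) (R : realType) (m : {measure set T -> \bar R})
    (A B : set T) : measurable A -> measurable B -> A `<=` B -> (m A <= m B)%E.
Proof. by move=> mA mB AB; apply: le_measure => //; apply/mem_set. Qed.

Section recurrence.
Context {R : realType} (alpha beta : R).
Local Notation f := (skew_shift alpha beta).
Local Notation T1 := (measurableTypeR R).
Local Notation T2 := (T1 * T1)%type.
Local Notation T3 := (T1 * T1 * T1)%type.
Variable psi : R * R -> R.
Hypothesis (irr : irrational alpha) (tpsi : torus_invariant psi).
Hypothesis mpsi : measurable_fun [set: T2] (psi : T2 -> R).

Definition skew_product (q : T3) : T3 := (f q.1, q.2 + psi q.1).
Local Notation F := skew_product.

Lemma iter_skew_product n (q : T3) : iter n F q = (iter n f q.1, q.2 + birkhoff f psi n q.1).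
Proof.
elim: n => [|n IH]; first by rewrite birkhoff0 addr0; case: q.
by rewrite iterS IH /F /= birkhoffSr addrA.
Qed.

Lemma measurable_birkhoff_psi n : measurable_fun [set: T2] (birkhoff f psi n : T2 -> R).
Proof.
apply: measurable_sum => i; apply: measurableT_comp => //; exact: measurable_iter_skew.
Qed.

Lemma measurable_iter_skew_product n : measurable_fun [set: T3] (iter n F : T3 -> T3).
Proof.
rewrite (_ : iter n F = fun q : T3 => (iter n f q.1, q.2 + birkhoff f psi n q.1)); last first.
  by apply/funext => q; exact: iter_skew_product.
apply: measurable_fun_pair; first by apply: measurableT_comp => //; exact: measurable_iter_skew.
apply: measurable_funD => //; apply: measurableT_comp => //; exact: measurable_birkhoff_psi.
Qed.

Definition torus_set3 (A : set T3) := forall q (i j : int),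
  A (q.1.1 + i%:~R, q.1.2 + j%:~R, q.2) <-> A q.

Lemma haar3_iter (A : set T3) n : measurable A -> torus_set3 A ->
  (\int[haar3]_q (\1_A (iter n F q))%:E = haar3 A)%E.
Proof.
move=> mA tA; rewrite -[A in RHS]setIT -integral_indic//.
have := @torus_flow_integral R alpha beta (fun q => (\1_A q)%:E) n (fun p => - birkhoff f psi n p).
move=> /(_ _ _ _ _)/wrap[].
- move=> z p i j; rewrite !indicE; congr (nat_of_bool _)%:R%:E.
  by apply/idP/idP; rewrite !inE => /(tA (p, z)).
- by apply/measurable_EFinP; exact: measurable_indic.
- by move=> q; rewrite lee_fin.
- by apply: measurable_funN; exact: measurable_birkhoff_psi.
by move=> <-; apply: eq_integral => q _; rewrite iter_skew_product opprK.
Qed.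

Lemma measurable_birkhoff_indic (A : set T3) n : measurable A ->
  measurable_fun [set: T3] (birkhoff F \1_A n : T3 -> R).
Proof.
move=> mA; apply: measurable_sum => i.
apply: (measurableT_comp (f := \1_A : T3 -> R)); first exact: measurable_indic.
exact: measurable_iter_skew_product.
Qed.

Lemma haar3_birkhoff (A : set T3) n : measurable A -> torus_set3 A ->
  (\int[haar3]_q (birkhoff F \1_A n q)%:E = n%:R%:E * haar3 A)%E.
Proof.
move=> mA tA; under eq_integral do rewrite -sumEFin.
rewrite ge0_integral_sum//; last first.
  move=> i; apply/measurable_EFinP; apply: (measurableT_comp (f := \1_A : T3 -> R)); first exact: measurable_indic.
  exact: measurable_iter_skew_product.
rewrite (eq_bigr (fun=> haar3 A)); last by move=> i _; exact: haar3_iter.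
by rewrite sumr_const card_ord mule_natl.
Qed.

Variables (r eta : R) (n0 : nat).
Hypothesis (r0 : 0 <= r) (eta0 : 0 < eta).
Definition tube (s : R) : set T3 := [set q | `|q.2| <= s].

Lemma measurable_tube s : measurable (tube s).
Proof.
rewrite -[X in measurable X]setTI; apply: measurable_fun_ler => //.
by apply: measurableT_comp.
Qed.

Lemma torus_set3_tube s : torus_set3 (tube s). Proof. by []. Qed.

Lemma haar3_tube s : 0 <= s -> haar3 (tube s) = (2 * s)%:E.
Proof.
move=> s0; rewrite -[tube s]setIT -integral_indic//; last exact: measurable_tube.
rewrite haar3_integral; last 2 first.
- by apply/measurable_EFinP; apply: measurable_indic; exact: measurable_tube.
- by move=> q; rewrite lee_fin.
have E p : (\int[lam]_z (\1_(tube s) (p, z) : R)%:E = (2 * s)%:E)%E.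
  have mI : measurable (`[- s, s]%classic : set T1) by exact: measurable_itv.
  rewrite (eq_integral (fun z => (\1_(`[- s, s]%classic : set T1) z)%:E)).
    rewrite integral_indic// setIT; apply: (eq_trans (lam_itv true false _)); first by lra.
    by congr EFin; ring.
  move=> z _; rewrite !indicE; congr (nat_of_bool _)%:R%:E.
  by apply/idP/idP; rewrite !inE /tube /= in_itv /= ler_norml.
under eq_integral do rewrite E.
by rewrite integral_cst// [X in (_ * X)%E](probability_setT haar2) mule1.
Qed.

Let v : T3 -> R := \1_(tube r).
Let S n q := birkhoff F v n q.

Let v01 q : 0 <= v q <= 1.
Proof. by rewrite /v indicE; case: (_ \in _); rewrite ?ler01 ?lexx. Qed.

Let v0 q : 0 <= v q. Proof. by case/andP: (v01 q). Qed.
Let v1 q : v q <= 1. Proof. by case/andP: (v01 q). Qed.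

Hypothesis Hrec : forall n, (n0 <= n)%N ->
  ((eta * n%:R)%:E <= \int[haar3]_(q in tube 1) (S n q)%:E)%E.

(** The bound eta / 8 leaves half of the recurrence rate to the exceptional set in
    [haar3_unbounded_set_gt0]; the bound 1 makes one step of the dynamics negligible in
    [unbounded_set_skew]. *)
Let c := Num.min (eta / 8) 1.
Let c_gt0 : 0 < c. Proof. by rewrite lt_min divr_gt0//= ltr01. Qed.
Let c1 : c <= 1. Proof. by rewrite ge_min lexx orbT. Qed.
Let ceta : c <= eta / 8. Proof. by rewrite ge_min lexx. Qed.

(* The points whose visits to the tube exceed the rate [c] by arbitrarily much:
   invariant, of finite measure by the maximal inequality and of positive
   measure by recurrence, so the medians of its fibers give a transfer
   function. *)
Definition unbounded_set : set T3 := [set q | forall M : nat, exists n, c * n%:R + M%:R < S n q].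
Local Notation D := unbounded_set.

Let mS n : measurable_fun [set: T3] (S n : T3 -> R).
Proof. by apply: measurable_birkhoff_indic; exact: measurable_tube. Qed.

Let above (M : R) n : set T3 := [set q | c * n%:R + M < S n q].

Let measurable_above M n : measurable (above M n).
Proof.
rewrite -[X in measurable X]setTI; apply: measurable_fun_ltr => //; exact: mS.
Qed.

Let DE : D = \bigcap_(M in [set: nat]) \bigcup_n above M%:R n.
Proof.
apply/seteqP; split => q.
  by move=> Dq M _; have [n Hn] := Dq M; exists n.
by move=> Hq M; have [n _ Hn] := Hq M I; exists n.
Qed.

Lemma measurable_unbounded_set : measurable D.
Proof. by rewrite DE; apply: bigcapT_measurable => M; apply: bigcupT_measurable. Qed.

Lemma birkhoff_tube_torus n (q : T3) (i j : int) : S n (q.1.1 + i%:~R, q.1.2 + j%:~R, q.2) = S n q.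
Proof.
apply: eq_bigr => k _; rewrite !iter_skew_product /v !indicE.
congr (nat_of_bool _)%:R; apply: mem_iff; rewrite /tube /=.
have -> // : birkhoff f psi k (q.1.1 + i%:~R, q.1.2 + j%:~R) = birkhoff f psi k q.1.
by apply/esym/torus_invariant_birkhoff => //; exists i, j.
Qed.

Lemma torus_unbounded_set : torus_set3 D.
Proof.
by move=> q i j; split => H M; have [n Hn] := H M; exists n; move: Hn; rewrite birkhoff_tube_torus.
Qed.

Lemma unbounded_set_skew q : D (F q) <-> D q.
Proof.
(* The margin 2 covers the visit gained or lost and the change of c * n when the starting point
   moves by one step. *)
split=> H M; have [n Hn] := H M.+2.
  exists n.+1; rewrite /S birkhoffS; have := v0 q; move: Hn; rewrite /S -!natr1; have := c1; lra.
case: n Hn => [|n]; first by rewrite /S birkhoff0 mulr0 add0r ltNge ler0n.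
rewrite /S birkhoffS => Hn; exists n; move: Hn; rewrite -!natr1; have := v1 q; have := c_gt0; lra.
Qed.

(** Integrated over the infinite space, the maximal inequality bounds c * L times the measure of
    [E N] by L + N times the measure 2 * r of the tube. Letting L grow removes N, and the bound 2 *
    r / c is uniform in N. *)
Lemma haar3_unbounded_set_lt_pinfty : (haar3 D < +oo)%E.
Proof.
pose E N := \bigcup_(n in [set n | (n <= N)%N]) above 0 n.
have mE N : measurable (E N) by apply: bigcup_measurable.
have tE N : torus_set3 (E N).
  by move=> q i j; split => -[n nN Hn]; exists n => //; move: Hn; rewrite /above /= birkhoff_tube_torus.
pose V := 2 * r; have V0 : 0 <= V by rewrite mulr_ge0.
have hE N : (c%:E * haar3 (E N) <= V%:E)%E.
  have key L : (c%:E * (L%:R%:E * haar3 (E N)) <= ((L + N)%:R * V)%:E)%E.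
    rewrite -haar3_birkhoff// -ge0_integralZl//; last 3 first.
    - by apply/measurable_EFinP; exact: measurable_birkhoff_indic.
    - by move=> q _; rewrite lee_fin birkhoff_ge0.
    - by rewrite lee_fin ltW.
    rewrite EFinM -haar3_tube// -(haar3_birkhoff _ (measurable_tube r) (@torus_set3_tube r)).
    apply: ge0_le_integral => //.
    - by move=> q _; rewrite -EFinM lee_fin mulr_ge0 ?birkhoff_ge0// ltW.
    - by apply/measurable_EFinP; apply: measurable_funM => //; exact: measurable_birkhoff_indic.
    - by apply/measurable_EFinP; exact: mS.
    - move=> q _; rewrite -EFinM lee_fin; apply: maximal_birkhoff => //; first exact: ltW.
      move=> p [n /= nN Hn]; exists n; rewrite nN andbT; split.
        by case: n Hn {nN} => //; rewrite /above /= /S birkhoff0 mulr0 add0r ltxx.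
      by move: Hn; rewrite /above /= addr0.
  have fin : haar3 (E N) \is a fin_num.
    rewrite ge0_fin_numE//; have := key 1%N; rewrite mul1e.
    have [->|//] := eqVneq (haar3 (E N)) +oo%E; last by rewrite ltey.
    by rewrite gt0_muley ?lte_fin// leye_eq.
  rewrite -(fineK fin) in key *; rewrite -EFinM lee_fin.
  apply/ler_addgt0Pr => e e0.
  pose L := (Num.truncn (N%:R * V / e)).+1.
  have L0 : 0 < L%:R :> R by rewrite ltr0n.
  have := key L; rewrite -!EFinM lee_fin.
  have : N%:R * V <= L%:R * e by rewrite -ler_pdivrMr// ltW// truncnS_gt.
  move=> h1 h2; rewrite -(ler_pM2l L0) mulrCA; apply: le_trans h2 _.
  by rewrite natrD; lra.
have ndE : nondecreasing_seq E.
  by move=> i j ij; apply/subsetPset => q [n ni Hn]; exists n => //=; exact: leq_trans ij.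
have mU : measurable (\bigcup_N E N) by exact: bigcupT_measurable.
have cvE := nondecreasing_cvg_mu (mu := haar3) mE mU ndE.
apply: (@le_lt_trans _ _ (V / c)%:E); last by rewrite ltry.
apply: (@le_trans _ _ (haar3 (\bigcup_N E N))).
  apply: measure_mono => //; first exact: measurable_unbounded_set.
  move=> q Dq; have [n Hn] := Dq 0; exists n => //; exists n => //=.
rewrite -(cvg_lim _ cvE)//; apply: lime_le; first by apply/cvg_ex; exists (haar3 (\bigcup_N E N)).
by apply: nearW => N /=; rewrite EFinM muleC lee_pdivlMl.
Qed.

(** Starting points in [tube 1], of measure 2, with at most 2 * c * n visits account for at most 4 *
    c * n of the eta * n expected visits. A set of measure at least eta / 2 thus exceeds the rate c
    by c * n, and the measure survives the decreasing intersection over M. *)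
Lemma haar3_unbounded_set_gt0 : (0 < haar3 D)%E.
Proof.
pose G M := tube 1 `&` \bigcup_n above M%:R n.
have mG M : measurable (G M) by apply: measurableI; [exact: measurable_tube|exact: bigcupT_measurable].
have h n : (n0 <= n)%N -> (0 < n)%N -> ((eta / 2)%:E <= haar3 (tube 1 `&` above (c * n%:R) n))%E.
  move=> nn0 n_gt0; have n1 : 0 < n%:R :> R by rewrite ltr0n.
  set B := _ `&` _; have mB : measurable B by apply: measurableI => //; exact: measurable_tube.
  have fB : haar3 B \is a fin_num.
    rewrite ge0_fin_numE//; apply: (@le_lt_trans _ _ (haar3 (tube 1))).
      by apply: measure_mono => //; [exact: measurable_tube|exact: subIsetl].
    by rewrite haar3_tube// ltry.
  have := Hrec nn0.
  have : (\int[haar3]_(q in tube 1) (S n q)%:E <= \int[haar3]_(q in tube 1) (2 * c * n%:R + n%:R * \1_B q)%:E)%E.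
    apply: ge0_le_integral => //.
    - exact: measurable_tube.
    - by move=> q _; rewrite lee_fin birkhoff_ge0.
    - by apply/measurable_EFinP/measurable_funTS; exact: mS.

    - apply/measurable_EFinP/measurable_funTS; apply: measurable_funD => //.
      by apply: measurable_funM => //; exact: measurable_indic.
    - move=> q tq; rewrite lee_fin indicE.
      have [a|na] := pselect (above (c * n%:R) n q).
        by rewrite mem_set//= mulr1 ler_wpDl ?birkhoff_le_n// !mulr_ge0// ltW.
      rewrite memNset; last by case.
      by move: na; rewrite /above /= => /negP; rewrite -leNgt mulr0 addr0; lra.
  have -> : (\int[haar3]_(q in tube 1) (2 * c * n%:R + n%:R * \1_B q)%:E = (4 * c * n%:R)%:E + n%:R%:E * haar3 B)%E.
    have mT := measurable_tube 1.
    have mI : measurable_fun (tube 1) (fun q : T3 => (\1_B q : R)%:E).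
      by apply/measurable_EFinP/measurable_funTS; exact: measurable_indic.
    under eq_integral do rewrite EFinD (EFinM n%:R).
    have p1 (q : T3) : tube 1 q -> (0 <= (2 * c * n%:R)%:E)%E by rewrite lee_fin !mulr_ge0// ltW.
    have p2 (q : T3) : tube 1 q -> (0 <= n%:R%:E * (\1_B q)%:E)%E by rewrite -EFinM lee_fin mulr_ge0.
    have mI' := measurable_funeM n%:R%:E mI.
    rewrite ge0_integralD// integral_cst// haar3_tube// ge0_integralZl//.
    rewrite integral_indic//.
    by rewrite /B -setIA setIC -setIA setIid setIC -EFinM; congr (EFin _ + _)%E; ring.
  move=> h1 h2; have := le_trans h2 h1.
  rewrite -(fineK fB) -EFinM -EFinD !lee_fin => h3.
  rewrite -(ler_pM2l n1); have := ler_wpM2r (ltW n1) ceta; lra.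
have hG M : ((eta / 2)%:E <= haar3 (G M))%E.
  pose n := (maxn n0 (Num.truncn (M%:R / c)).+1).
  have nM : M%:R <= c * n%:R.
    rewrite -ler_pdivrMl// mulrC; apply: le_trans (ltW (truncnS_gt _)) _.
    by rewrite ler_nat leq_maxr.
  have nn0 : (n0 <= n)%N by exact: leq_maxl.
  have n_gt0 : (0 < n)%N by rewrite leq_max orbT.
  apply: (@le_trans _ _ (haar3 (tube 1 `&` above (c * n%:R) n))).
    exact: h.
  apply: measure_mono => //; first by apply: measurableI => //; exact: measurable_tube.
  by move=> q [tq aq]; split => //; exists n => //; move: aq; rewrite /above /=; lra.
have cvG : haar3 (G M) @[M --> \oo] --> haar3 (\bigcap_M G M).
  apply: nonincreasing_cvg_mu => //.
  - apply: (@le_lt_trans _ _ (haar3 (tube 1))).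
      by apply: measure_mono => //; [exact: measurable_tube|exact: subIsetl].
    by rewrite haar3_tube// ltry.
  - exact: bigcapT_measurable.
  - move=> i j ij; apply/subsetPset => q [tq [n _ Hn]]; split => //; exists n => //.
    by apply: le_lt_trans Hn; rewrite lerD2l ler_nat.
apply: (@lt_le_trans _ _ (eta / 2)%:E); first by rewrite lte_fin divr_gt0.
apply: (@le_trans _ _ (haar3 (\bigcap_M G M))).
  rewrite -(cvg_lim _ cvG)//; apply: lime_ge; first by apply/cvg_ex; exists (haar3 (\bigcap_M G M)).
  exact: nearW.
apply: measure_mono => //; [exact: bigcapT_measurable|exact: measurable_unbounded_set|].
by rewrite DE => q Hq M _; have [] := Hq M I.
Qed.

Local Open Scope ereal_scope.

Let J (p : T2) : \bar R := lam (xsection D p).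
Let D' (t : R) : set T3 := D `&` (setT `*` `]-oo, t]%classic).
(** The mass of the fiber of [D] over p below height t: the distribution function whose median is
    taken. *)
Let N (p : T2) (t : R) : \bar R := lam (xsection (D' t) p).

Let mD : measurable D := measurable_unbounded_set.

Let mD' t : measurable (D' t).
Proof. by apply: measurableI => //; apply: measurableX => //; exact: measurable_itv. Qed.

Let mJ : measurable_fun setT J.
Proof. exact: measurable_fun_xsection. Qed.

Let mN t : measurable_fun setT (N ^~ t).
Proof. exact: measurable_fun_xsection. Qed.

Lemma xsection_translate (A : set T3) p p' (s : R) : measurable A ->
  (forall z, A (p', z + s)%R <-> A (p, z)) -> lam (xsection A p') = lam (xsection A p).
Proof.
move=> mA H; rewrite -(lebesgue_translate s); last exact: measurable_xsection.
congr (lam _); apply/seteqP; split => z; rewrite /xsection /= !inE => Az; exact/H.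
Qed.

Let J_torus p (i j : int) : J (p.1 + i%:~R, p.2 + j%:~R)%R = J p.
Proof.
by apply: (@xsection_translate _ _ _ 0%R) => // z; rewrite addr0; exact: (torus_unbounded_set (p, z)).
Qed.

Let J_skew p : J (f p) = J p.
Proof. by apply: (@xsection_translate _ _ _ (psi p)) => // z; exact: (unbounded_set_skew (p, z)). Qed.

Let N_torus p (i j : int) t : N (p.1 + i%:~R, p.2 + j%:~R)%R t = N p t.
Proof.
apply: (@xsection_translate _ _ _ 0%R) => // z; rewrite addr0.
by split=> -[Dz Tz]; split => //; apply/(torus_unbounded_set (p, z)).
Qed.

Let N_skew p t : N (f p) (t + psi p) = N p t.
Proof.
rewrite /N -(lebesgue_translate (psi p)); last exact: measurable_xsection.
congr (lam _); apply/seteqP; split => z; rewrite /xsection /= !inE /D' /= !in_itv /= lerD2r.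
  by case=> [/(unbounded_set_skew (p, z)) Dz [_ zt]].
by case=> [Dz [_ zt]]; split; [exact/(unbounded_set_skew (p, z))|].
Qed.

Definition good_fiber : set T2 := [set p | 0 < J p /\ J p < +oo].
Local Notation Gd := good_fiber.

Lemma measurable_good_fiber : measurable Gd.
Proof.
have -> : Gd = [set p | 0 < J p] `&` [set p | J p < +oo] by [].
apply: measurableI.
  by rewrite -[X in measurable X]setTI; exact: emeasurable_fun_o_infty.
by rewrite -[X in measurable X]setTI; exact: emeasurable_fun_infty_o.
Qed.

Let intJ : \int[haar2]_p J p = haar3 D.
Proof. by rewrite haar3.unlock. Qed.

(** The points whose fiber has infinite mass form an invariant set, and so do those with fiber of
    mass 0. By ergodicity each set is null or full, and full would contradict the finiteness,
    respectively the positivity, of the measure of [D]. *)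
Lemma haar2_good_fiber : haar2 (~` Gd) = 0.
Proof.
have mI : measurable [set p | J p = +oo].
  by rewrite -[X in measurable X]setTI; exact: (mJ measurableT (emeasurable_set1 +oo)).
have mZ : measurable [set p | J p = 0].
  by rewrite -[X in measurable X]setTI; exact: (mJ measurableT (emeasurable_set1 0)).
have tI (a : \bar R) : torus_set [set p | J p = a].
  by move=> p i j; rewrite /= J_torus.
have iI (a : \bar R) p : [set p | J p = a] (f p) <-> [set p | J p = a] p.
  by rewrite /= J_skew.
have J0 p : 0 <= J p by exact: measure_ge0.
have I0 : haar2 [set p | J p = +oo] = 0.
  have [//|I1] := ergodic_set irr mI (tI _) (iI _).
  have := haar3_unbounded_set_lt_pinfty; rewrite -intJ ltNge => /negP[].
  rewrite -[leLHS]mule1 -I1 -integral_cst//.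
  rewrite [leLHS](_ : _ = \int[haar2]_(p in [set p | J p = +oo]) J p); last first.
    by apply: eq_integral => p; rewrite inE.
  by apply: ge0_subset_integral => //; exact: measurable_funTS.
have Z0 : haar2 [set p | J p = 0] = 0.
  have [//|Z1] := ergodic_set irr mZ (tI _) (iI _).
  have := haar3_unbounded_set_gt0; rewrite -intJ lt0e => /andP[/eqP[]].
  have mC : measurable (~` [set p | J p = 0]) by exact: measurableC.
  have C0 : haar2 (~` [set p | J p = 0]) = 0 by rewrite probability_setC// Z1 subee.
  rewrite -(setUv [set p | J p = 0]) ge0_integral_setU//; last 2 first.
  - by rewrite setUv.
  - by rewrite disj_set2E setICr.
  rewrite integral0_eq// add0e; apply: null_set_integral => //; exact: measurable_funTS.
apply/eqP; rewrite -measure_le0.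
apply: (@le_trans _ _ (haar2 ([set p | J p = +oo] `|` [set p | J p = 0]))).
  apply: measure_mono; [apply: measurableC; exact: measurable_good_fiber|exact: measurableU|].
  move=> p /not_andP[/negP|/negP]; rewrite -leNgt; last by rewrite leye_eq => /eqP; left.
  by move=> h; right; apply/eqP; rewrite eq_le h J0.
apply: le_trans (measureU2 haar2 mI mZ) _; rewrite -[leRHS]adde0; apply: leeD.
  exact: (eq_ind_r (fun x => x <= 0) (lexx 0) I0).
exact: (eq_ind_r (fun x => x <= 0) (lexx 0) Z0).
Qed.

(* [u] cuts the fiber of [D] over [p] into two halves. *)
Let cut p (u : R) := Gd p /\ forall t : R, ((u < t)%R -> J p <= N p t + N p t) /\
  ((t < u)%R -> ~ J p <= N p t + N p t).

Let cut_unique p u u' : cut p u -> cut p u' -> u = u'.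
Proof.
move=> [_ Hu] [_ Hu']; apply/eqP; rewrite eq_le !leNgt; apply/andP; split; apply/negP => h.
  have [m m1 m2] : exists2 m : R, (u' < m)%R & (m < u)%R.
    by exists ((u + u') / 2)%R; lra.
  by have [_ /(_ m2)] := Hu m; have [/(_ m1)] := Hu' m.
have [m m1 m2] : exists2 m : R, (u < m)%R & (m < u')%R.
  by exists ((u + u') / 2)%R; lra.
by have [_ /(_ m2)] := Hu' m; have [/(_ m1)] := Hu m.
Qed.

Let N_le p t t' : (t <= t')%R -> N p t <= N p t'.
Proof.
move=> tt'; apply: measure_mono; [exact: measurable_xsection|exact: measurable_xsection|].
move=> z; rewrite /xsection /= !inE /D' /= !in_itv /= => -[Dz [_ zt]]; split => //; split => //.
exact: le_trans tt'.
Qed.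

(** The distribution function tends to the full mass upwards and to 0 downwards, so the heights with
    at least half of the mass below them have an infimum. *)
Let cut_exists p : Gd p -> exists u, cut p u.
Proof.
move=> Gp; have [J0 Joo] := Gp.
pose W := [set t : R | J p <= N p t + N p t].
have Jfin : J p \is a fin_num by rewrite ge0_fin_numE// ltW.
have mX t : measurable (xsection (D' t) p) by exact: measurable_xsection.
have W0 : W !=set0.
  have U : \bigcup_n xsection (D' n%:R) p = xsection D p.
    apply/seteqP; split => z; rewrite /xsection /=.
      by case=> n _; rewrite /= !inE => -[].
    rewrite inE => Dz; exists (Num.truncn `|z|).+1 => //=; rewrite inE /D'; split => //; split => //=.
    by rewrite in_itv /=; apply: le_trans (ler_norm z) _; apply/ltW/truncnS_gt.
  have cv : N p n%:R @[n --> \oo] --> J p.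
    rewrite /J -U; apply: nondecreasing_cvg_mu => //; first exact: bigcupT_measurable.
    move=> i j ij; apply/subsetPset => z; rewrite /xsection /= !inE /D' /= !in_itv /= => -[Dz [_ zi]].
    by split => //; split => //; apply: le_trans zi _; rewrite ler_nat.
  apply: contrapT => W0.
  have H n : N p n%:R + N p n%:R <= J p.
    by apply/ltW; rewrite ltNge; apply/negP => h; apply: W0; exists n%:R.
  have : lim ((N p n%:R + N p n%:R) @[n --> \oo]) <= J p.
    apply: lime_le; last exact: nearW.
    by apply/cvg_ex; exists (J p + J p); apply: cvgeD => //; rewrite fin_num_adde_defl.
  rewrite (cvg_lim _ (cvgeD _ cv cv))// ?fin_num_adde_defl//.
  by move: J0; rewrite -(fineK Jfin) -EFinD lee_fin lte_fin; lra.
have Wlb : has_lbound W.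
  have U : \bigcap_n xsection (D' (- n%:R)%R) p = set0.
    apply/seteqP; split => z // /(_ (Num.truncn `|z|).+1 I); rewrite /xsection /= inE /D' => -[_ [_ /=]].
    rewrite in_itv /= => h; have := truncnS_gt `|z|; have := ler_norm (- z); rewrite normrN; lra.
  have cv : N p (- n%:R)%R @[n --> \oo] --> 0.
    rewrite -(measure0 lam) -U; apply: nonincreasing_cvg_mu => //.
    - apply: le_lt_trans Joo; apply: measure_mono => //; first exact: measurable_xsection.
      by move=> z; rewrite /xsection /= !inE => -[].
    - exact: bigcapT_measurable.
    - move=> i j ij; apply/subsetPset => z; rewrite /xsection /= !inE /D' /= !in_itv /= => -[Dz [_ zi]].
      by split => //; split => //; apply: le_trans zi _; rewrite lerN2 ler_nat.
  apply: contrapT => Wlb.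
  have H n : J p <= N p (- n%:R)%R + N p (- n%:R)%R.
    rewrite leNgt; apply/negP => h; apply: Wlb; exists (- n%:R)%R => t Wt.
    rewrite leNgt; apply/negP => th; move: h; rewrite ltNge => /negP; apply.
    by apply: le_trans Wt _; apply: leeD; apply: N_le; exact: ltW.
  have : J p <= lim ((N p (- n%:R)%R + N p (- n%:R)%R) @[n --> \oo]).
    apply: lime_ge; last exact: nearW.
    by apply/cvg_ex; exists (0 + 0); apply: cvgeD.
  by rewrite (cvg_lim _ (cvgeD _ cv cv))// adde0 leNgt J0.
exists (inf W); split => // t; split => ht.
  have [w Ww wt] := inf_lt W0 ht.
  by apply: le_trans Ww _; apply: leeD; apply: N_le; exact: ltW.
by move=> Wt; have := ge_inf Wlb Wt; rewrite leNgt ht.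
Qed.

(** The value 0 over bad fibers is a default on a null set; the coboundary equation is asserted over
    good fibers only. *)
Definition median p : R := xget 0%R [set u | cut p u].

Let median_cut p : Gd p -> cut p (median p).
Proof. by move=> /cut_exists[u cu]; exact: (xgetPex 0%R (ex_intro _ u cu)). Qed.

Let medianN p : ~ Gd p -> median p = 0%R.
Proof. by move=> nG; rewrite /median xgetPN// => u [Gp _]. Qed.

Lemma torus_median : torus_invariant median.
Proof.
apply/torus_invariantP => p i j; rewrite /median; congr (xget _ _).
by apply/seteqP; split => u [Gp H]; (split; [by move: Gp; rewrite /Gd /= J_torus|]) => t;
  have := H t; rewrite J_torus !N_torus.
Qed.

Lemma good_fiber_skew p : Gd (f p) <-> Gd p.
Proof. by rewrite /Gd /= J_skew. Qed.

(** The skew product preserves [D] and maps the fiber over p to the fiber over f p by translation by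
    psi p; the median is translated along. *)
Lemma median_skew p : Gd p -> median (f p) = (median p + psi p)%R.
Proof.
move=> Gp; apply: (cut_unique (median_cut (iffRL (good_fiber_skew p) Gp))).
split=> [|t]; first exact/good_fiber_skew.
have [_ /(_ (t - psi p)%R)] := median_cut Gp.
have := N_skew p (t - psi p); rewrite subrK J_skew => ->.
by rewrite ltrBrDr ltrBlDr.
Qed.

(** Over good fibers the median is below t exactly when some rational below t already has half of
    the mass below it, a countable union of measurable conditions. *)
Lemma measurable_median : measurable_fun [set: T2] (median : T2 -> R).
Proof.
apply: (measurability _ (@ray_generates R)) => // _ [_ [t ->] <-] /=; rewrite setTI.
have mG := measurable_good_fiber.
pose B (r : rat) : set T2 := if (ratr r < t)%R then [set p | J p <= N p (ratr r) + N p (ratr r)] else set0.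
have -> : median @^-1` `]-oo, t[%classic =
    (Gd `&` \bigcup_(r in [set: rat]) B r) `|` (if (0 < t)%R then ~` Gd else set0).
  apply/seteqP; split => p; rewrite /= in_itv /=.
    have [Gp|nG] := pselect (Gd p).
      move=> ut; left; split => //; have [w] := rat_in_itvoo ut; rewrite in_itv /= => /andP[ur rt].
      exists w => //; rewrite /B rt; have [_ H] := median_cut Gp; exact: (H _).1.
    by rewrite medianN// => ->; right.
  case=> [[Gp [w _]]|].
    rewrite /B; case: ifPn => // rt /= Wr; have [_ H] := median_cut Gp.
    by rewrite ltNge; apply/negP => tu; apply: ((H (ratr w)).2 _ Wr); exact: lt_le_trans tu.
  by case: ifPn => // t0 nG; rewrite medianN.
apply: measurableU; last by case: ifP => _ //; exact: measurableC.
apply: measurableI => //; apply: bigcupT_measurable_rat => w; rewrite /B; case: ifP => // _.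
rewrite -[X in measurable X]setTI; apply: measurable_lee => //; exact: emeasurable_funD.
Qed.

End recurrence.

(** * The modes of the roof function *)

Section mode_coboundary.
Context {R : realType} (alpha beta : R).
Local Notation f := (skew_shift alpha beta).
Local Notation T1 := (measurableTypeR R).
Local Notation T2 := (T1 * T1)%type.
Local Notation T3 := (T1 * T1 * T1)%type.
Variables (a b : nat -> R -> R) (l : nat).
Hypothesis irr : irrational alpha.
Hypothesis (ca : forall k, continuous (a k)) (cb : forall k, continuous (b k)).
Hypothesis (pa : forall k, circle_fun (a k)) (pb : forall k, circle_fun (b k)).
Local Notation psi := (mode a b l).

Lemma measurable_mode : measurable_fun [set: T2] (psi : T2 -> R).
Proof.
have mc (g : R -> R) : continuous g -> measurable_fun [set: T2] (fun p : T2 => g p.1).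
  by move=> cg; apply: (measurableT_comp (f := g)); [exact: continuous_measurable|exact: measurable_fst].
have ms (g : R -> R) : continuous g -> measurable_fun [set: T2] (fun p : T2 => g (2 * pi * l.+1%:R * p.2)).
  move=> cg; apply: (measurableT_comp (f := g)); first exact: continuous_measurable.
  by apply: measurable_funM => //; exact: measurable_snd.
apply: measurable_funD; apply: measurable_funM.
- exact: mc.
- by apply: ms; exact: continuous_cos.
- exact: mc.
- by apply: ms; exact: continuous_sin.
Qed.

(** Over a point whose coefficients at time j are small, the skew product brings all of [tube 1]
    into [tube r] at time j. A positive frequency of such times is the recurrence hypothesis under
    which the median is a transfer function. *)
Lemma mode_coboundary K e n0 : 0 <= K -> 0 < e ->
  (forall n, (n0 <= n)%N -> e * n%:R <= \sum_(j < n) hr (small alpha beta a b l j K)) ->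
  exists u : R * R -> R, [/\ torus_invariant u, measurable_fun [set: T2] (u : T2 -> R) &
    exists2 Z : set T2, measurable Z /\ haar2 Z = 0%E & forall p, ~ Z p -> psi p = u (f p) - u p].
Proof.
move=> K0 e0 H; have tpsi := @torus_invariant_mode _ a b pa pb l.
have mpsi := measurable_mode.
(* An initial height of at most 1 plus a sum of at most 2 * K, by [small_birkhoff]. *)
pose r := 2 * K + 1; have r0 : 0 <= r by rewrite addr_ge0// mulr_ge0.
have Hrec n : (n0 <= n)%N -> ((e * n%:R)%:E <= \int[haar3]_(q in tube 1)
    (birkhoff (skew_product alpha beta psi) \1_(tube r) n q)%:E)%E.
  move=> /H h.
  pose B k : set T3 := [set q | small alpha beta a b l k K q.1.1] `&` tube 1.
  have mB k : measurable (B k).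
    apply: measurableI; last exact: measurable_tube.
    rewrite -[X in measurable X]setTI.
    have mf : measurable_fun [set: T3] (fun q : T3 => q.1.1) by apply: measurableT_comp.
    exact: (mf measurableT _ (measurable_small alpha beta l ca cb k K)).
  have hB k : haar3 (B k) = (2 * hr (small alpha beta a b l k K))%:E.
    rewrite -[B k]setIT -integral_indic//.
    rewrite haar3_integral; last 2 first.
    - by apply/measurable_EFinP; exact: measurable_indic.
    - by move=> q; rewrite lee_fin.
    have mS := measurable_small alpha beta l ca cb k K.
    have bS : bmeas (\1_(small alpha beta a b l k K) : T1 -> R) := bmeas_indic mS.
    have bc : bmeas (fun _ : T1 => 2 : R) by exact: bmeas_cst.
    rewrite (eq_integral (fun p : T2 => (2 * \1_(small alpha beta a b l k K) p.1)%:E)); last first.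
      move=> p _; have mI : measurable (`[-1, 1]%classic : set T1) by exact: measurable_itv.
      have Ip : \1_(small alpha beta a b l k K) p.1 = (p.1 \in small alpha beta a b l k K)%:R :> R by rewrite indicE.
      rewrite Ip; have [pS|pS] := boolP (p.1 \in small alpha beta a b l k K); rewrite ?mulr1 ?mulr0.
        rewrite (eq_integral (fun z => (\1_(`[-1, 1]%classic : set T1) z)%:E)).
          rewrite integral_indic// setIT; apply: (eq_trans (lam_itv true false _)); first by lra.
          by congr EFin; ring.
        move=> z _; rewrite !indicE; congr (nat_of_bool _)%:R%:E; apply: mem_iff.
        rewrite /B /tube /= in_itv /= -ler_norml; split; first by case.
        by move=> ?; split => //; exact: set_mem.
      rewrite integral0_eq// => z _; rewrite indicE memNset// => -[/= h' _].
      by move: pS; rewrite mem_set.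
    rewrite meanE; last by apply: bmeasM; [exact: bmeas_cst|exact: (bmeas_fst bS)].
    rewrite (@mean_haar2_fst _ (fun x => 2 * \1_(small alpha beta a b l k K) x)); last exact: bmeasM.
    by rewrite meanZ// mean_indic.
  apply: (@le_trans _ _ (\sum_(k < n) haar3 (B k))%E).
    under eq_bigr do rewrite hB.
    rewrite sumEFin lee_fin; apply: (le_trans h); apply: ler_sum => k _.
    by have := hr_ge0 (small alpha beta a b l k K); lra.
  under eq_integral do rewrite -sumEFin.
  rewrite ge0_integral_sum//; first last.
  - move=> k; apply/measurable_EFinP/measurable_funTS.
    apply: (measurableT_comp (f := \1_(tube r) : T3 -> R)); first by apply: measurable_indic; exact: measurable_tube.
    exact: measurable_iter_skew_product.
  - exact: measurable_tube.
  apply: lee_sum => k _; rewrite -[B k]setIT -integral_indic//.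
  rewrite [leRHS]integral_mkcond; apply: ge0_le_integral => //.
  - by apply/measurable_EFinP; exact: measurable_indic.
  - apply/(measurable_restrictT _ (measurable_tube 1)); apply/measurable_EFinP/measurable_funTS.
    apply: (measurableT_comp (f := \1_(tube r) : T3 -> R)); first by apply: measurable_indic; exact: measurable_tube.
    exact: measurable_iter_skew_product.
  - move=> q _; rewrite patchE indicE; have [[Bq tq]|nB] := pselect (B k q); last first.
      by rewrite memNset//; case: ifP => // _; rewrite lee_fin.
    rewrite mem_set// mem_set//= lee_fin indicE mem_set// iter_skew_product /tube /=.
    have := small_birkhoff (q.1.2) Bq; rewrite -surjective_pairing => h1.
    by apply: le_trans (ler_normD _ _) _; move: tq; rewrite /tube /= /r; lra.
exists (median alpha beta psi r e); split.
- exact: torus_median.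
- exact: measurable_median.
- exists (~` good_fiber alpha beta psi r e); first split.
  + by apply: measurableC; exact: measurable_good_fiber.
  + exact: (haar2_good_fiber irr tpsi mpsi r0 e0 Hrec).
  + by move=> p /contrapT Gp; rewrite (median_skew mpsi e0 Gp) addrC addKr.
Qed.

End mode_coboundary.

(** * Fourier coefficients of the roof and growth of the amplitude *)

Section roof.
Context {R : realType} (alpha beta : R) (d : nat) (Phi : R * R -> R).
Local Notation f := (skew_shift alpha beta).
Local Notation T1 := (measurableTypeR R).
Local Notation T2 := (T1 * T1)%type.
Hypothesis irr : irrational alpha.
Hypothesis PP : class_P_deg d Phi.

Let tPhi : torus_invariant Phi. Proof. by case: PP. Qed.
Let cPhi : continuous Phi. Proof. by case: PP. Qed.
Let dPhi x : trig_poly_deg d (fun y => Phi (x, y)). Proof. by case: PP. Qed.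

Definition roof_cos k x : R := dft_cos d (fun y => Phi (x, y)) k.
Definition roof_sin k x : R := dft_sin d (fun y => Phi (x, y)) k.
Local Notation ra := roof_cos.
Local Notation rb := roof_sin.

Lemma continuous_slice y : continuous (fun x : R => Phi (x, y)).
Proof.
move=> x; apply: (continuous_comp (f := fun x : R => (x, y)) (g := Phi)); last exact: cPhi.
exact: (cvg_pair (G := nbhs (x : R)) (H := nbhs y) (f := id) (g := fun=> y) cvg_id (cvg_cst y)).
Qed.

Lemma continuous_roof_cos k : continuous (ra k).
Proof.
move=> x; apply: cvgM; first exact: cvg_cst.
apply: (continuous_big (op := +%R)) => [|i _ z]; first exact: add_continuous.
by apply: cvgM; [exact: continuous_slice|exact: cvg_cst].
Qed.

Lemma continuous_roof_sin k : continuous (rb k).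
Proof.
move=> x; apply: cvgM; first exact: cvg_cst.
apply: (continuous_big (op := +%R)) => [|i _ z]; first exact: add_continuous.
by apply: cvgM; [exact: continuous_slice|exact: cvg_cst].
Qed.

Lemma slice_periodic x y (z : int) : Phi (x + z%:~R, y) = Phi (x, y).
Proof. by have /torus_invariantP /(_ (x, y) z 0) := tPhi; rewrite /= addr0. Qed.

Lemma circle_fun_roof_cos k : circle_fun (ra k).
Proof. by move=> x z; rewrite /ra /dft_cos; under eq_bigr do rewrite slice_periodic. Qed.

Lemma circle_fun_roof_sin k : circle_fun (rb k).
Proof. by move=> x z; rewrite /rb /dft_sin; under eq_bigr do rewrite slice_periodic. Qed.

Lemma fiber_centered_mode p : fiber_centered Phi p = mode_sum d ra rb p.
Proof.
rewrite /fiber_centered (fiber_mean_dft (dPhi p.1)) {1}[p]surjective_pairing.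
by rewrite (trig_poly_dft (dPhi p.1) p.2) addrC addKr.
Qed.

Lemma roof_decomposition p : Phi p = fiber_mean Phi p.1 + mode_sum d ra rb p.
Proof. by rewrite -fiber_centered_mode /fiber_centered addrC subrK. Qed.

Lemma roof_bounds : (forall p, 0 < Phi p) ->
  exists2 m : R, 0 < m & exists M : R, forall p, m <= Phi p <= M.
Proof.
move=> Phi0.
have cK : compact (`[0, 1]%classic `*` `[0, 1]%classic : set (R * R)).
  by apply: compact_setX; exact: segment_compact.
have fr p : exists2 p', (`[0, 1]%classic `*` `[0, 1]%classic) p' & Phi p = Phi p'.
  exists (frac p.1, frac p.2).
    have h (z : R) : 0 <= frac z <= 1 by have /andP[h1 h2] := frac_itv z; rewrite h1 ltW.
    by split; rewrite /= in_itv /=.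
  by apply: tPhi; exists (- Num.floor p.1), (- Num.floor p.2); rewrite !mulrNz.
have K0 : (`[0, 1]%classic `*` `[0, 1]%classic : set (R * R)) !=set0.
  by exists (0, 0); split; rewrite /= in_itv /= lexx ler01.
have cPK : {within (`[0, 1]%classic `*` `[0, 1]%classic : set (R * R)), continuous Phi}.
  exact: continuous_subspaceT.
have [p1 _ H1] := @compact_EVT_min (R * R)%type R Phi _ K0 cK cPK.
have [p2 _ H2] := @compact_EVT_max (R * R)%type R Phi _ K0 cK cPK.
exists (Phi p1); first exact: Phi0.
exists (Phi p2) => p; have [p' Kp' ->] := fr p.
by rewrite H1 ?H2//; exact/mem_set.
Qed.

(** If [mode_coboundary] applied to every mode, the sum of the transfer functions would make phi a
    coboundary. Some mode therefore has rare small coefficients, [growth] applies to it, and the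
    amplitude dominates its coefficients. *)
Lemma amplitude_growth : ~ measurable_coboundary f (fiber_centered Phi) ->
  forall K e : R, 0 < e -> exists N0 : nat, forall N, (N0 <= N)%N ->
    hr [set x : T1 | amplitude alpha beta d ra rb N x <= K] <= e.
Proof.
move=> nC.
have [l ld Hl] : exists2 l, (l < d)%N & forall K e n0, 0 <= K -> 0 < e ->
    exists2 n, (n0 <= n)%N & \sum_(j < n) hr (small alpha beta ra rb l j K) <= e * n%:R.
  apply: contrapT => H; apply: nC.
  have {H} H (l : 'I_d) : exists u : R * R -> R, [/\ torus_invariant u, measurable_fun [set: T2] (u : T2 -> R) &
      exists2 Z : set T2, measurable Z /\ haar2 Z = 0%E & forall p, ~ Z p -> mode ra rb l p = u (f p) - u p].
    apply: contrapT => HN; apply: H; exists l => // K e n0 K0 e0; apply: contrapT => H; apply: HN.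
    apply: (mode_coboundary irr continuous_roof_cos continuous_roof_sin circle_fun_roof_cos circle_fun_roof_sin K0 e0 (n0 := n0)).
    by move=> n nn0; rewrite leNgt; apply/negP => h; apply: H; exists n => //; exact: ltW.
  have [u Hu] := choice H.
  exists (fun p => \sum_(l < d) u l p); split.
  - by move=> p p' pp'; apply: eq_bigr => l _; have [tu _ _] := Hu l; exact: tu.
  - by apply: measurable_sum => l; have [_ mu _] := Hu l.
  - have {}Hu (l : 'I_d) : exists Z : set T2, [/\ measurable Z, haar2 Z = 0%E &
        forall p, ~ Z p -> mode ra rb l p = u l (f p) - u l p].
      by have [_ _ [Z [mZ Z0] HZ]] := Hu l; exists Z.
    have [Z HZ] := choice Hu.
    have mZ l : measurable (Z l) by have [] := HZ l.
    (* The finite family of null sets is continued by the empty set, so that countable unions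
       apply. *)
    pose Z' n : set T2 := oapp Z set0 (insub n : option 'I_d).
    pose ZU : set T2 := \bigcup_n Z' n.
    have mZ' n : measurable (Z' n) by rewrite /Z'; case: (insub n) => [l|]; [exact: mZ|exact: measurable0].
    have mZU : measurable ZU by exact: bigcupT_measurable.
    exists (ZU `&` unit_square); split.
    + by apply: measurableI => //; exact: measurable_unit_square.
    + rewrite -haar2_leb2//; apply/(negligibleP haar2 mZU); apply: negligible_bigcup => n.
      apply/(negligibleP haar2 (mZ' n)); rewrite /Z'; case: (insub n) => [l|]; last exact: measure0.
      by have [] := HZ l.
    + move=> p /= /not_implyP[Up nE]; split => //; apply: contrapT => nZ; apply: nE.
      rewrite fiber_centered_mode -sumrB; apply: eq_bigr => l _.
      by have [_ _] := HZ l; apply => Zp; apply: nZ; exists l => //; rewrite /Z' valK.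
move=> K e e0.
have [N0 HN0] := growth continuous_roof_cos continuous_roof_sin circle_fun_roof_cos circle_fun_roof_sin Hl K e0.
exists N0 => N /HN0; apply: le_trans; apply: hr_le.
- rewrite -[X in measurable X]setTI; apply: measurable_fun_ler => //.
  by apply: continuous_measurable; apply: continuous_amplitude; [exact: continuous_roof_cos|exact: continuous_roof_sin].
- exact: measurable_small continuous_roof_cos continuous_roof_sin _ _.
- move=> x /= aK; rewrite /small /=.
  have : `|modeA alpha beta ra rb l N x| + `|modeB alpha beta ra rb l N x| <= K.
    apply: le_trans aK; rewrite /amplitude /trig_norm (bigD1 (Ordinal ld))//= lerDl.
    by apply: sumr_ge0 => i _; rewrite addr_ge0.
  have := normr_ge0 (modeA alpha beta ra rb l N x); have := normr_ge0 (modeB alpha beta ra rb l N x).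
  by move=> h1 h2 h3; split; lra.
Qed.

End roof.

(** * Integration by parts in the fibers *)

Section trapezoid.
Context {R : realType}.
Implicit Types (u v a b : R).

(** A quadratic remainder settles differentiability without one-sided limits at the kinks; it is
    meant for the square of the positive part. *)
Lemma is_derive_quadratic (F : R -> R) x l K : (forall h, `|F (x + h) - F x - l * h| <= K * h ^+ 2) ->
  is_derive x 1 F l.
Proof.
move=> H.
have K0 : 0 <= K by have := le_trans (normr_ge0 _) (H 1); rewrite expr1n mulr1.
have C : (h^-1 *: (F (h *: (1 : R) + x) - F x)) @[h --> 0^'] --> l.
  apply/cvgrPdist_le => e e0.
  have K1 : 0 < K + 1 by rewrite ltr_wpDl.
  have eK : 0 < e / (K + 1) by rewrite divr_gt0.
  near=> h.
  have h0 : h != 0 by near: h; exact: nbhs_dnbhs_neq.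
  have hs : `|h| <= e / (K + 1) by near: h; exact: dnbhs0_le.
  rewrite /GRing.scale /= mulr1 (addrC h) distrC.
  rewrite (_ : _ - l = h^-1 * (F (x + h) - F x - l * h)); last by field.
  rewrite normrM normfV ler_pdivrMl ?normr_gt0//; apply: le_trans (H h) _.
  rewrite -real_normK ?num_real// expr2 mulrCA; apply: ler_wpM2l => //.
  apply: (@le_trans _ _ ((K + 1) * (e / (K + 1)))); last by rewrite mulrCA divff ?mulr1// gt_eqF.
  by apply: ler_pM => //; rewrite lerDl.
split; first by apply/cvg_ex; exists l.
by apply: (cvg_lim _ C).
Unshelve. all: by end_near.
Qed.

Definition pp u : R := Num.max u 0.

Lemma ppE u : (0 <= u /\ pp u = u) \/ (u <= 0 /\ pp u = 0).
Proof. by rewrite /pp; case: (leP u 0) => h; [right|left; split => //; exact: ltW]. Qed.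

Lemma continuous_pp : continuous pp.
Proof.
have -> : pp = fun u => (u + `|u|) / 2.
  apply/funext => u; case: (ppE u) => -[h ->]; [rewrite ger0_norm//|rewrite ler0_norm//]; lra.
move=> u; apply: cvgM; last exact: cvg_cst.
by apply: cvgD; [exact: cvg_id|exact: norm_continuous].
Qed.

Lemma is_derive_pp2 u : is_derive u 1 (fun v => pp v ^+ 2) (2 * pp u).
Proof.
apply: (@is_derive_quadratic _ _ _ 1) => h.
rewrite ler_norml; case: (ppE u) => -[h1 ->]; case: (ppE (u + h)) => -[h2 ->]; apply/andP; split; nra.
Qed.

(* The length of the set of z in [0, a[ with z + u in [0, b[. *)
Definition trapezoid a b u : R := pp (u + a) - pp u - pp (u + a - b) + pp (u - b).
(** The primitive that vanishes for u <= - a; beyond b it is constantly a * b, the area of the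
    trapezoid. *)
Definition trapezoid_prim a b u : R :=
  (pp (u + a) ^+ 2 - pp u ^+ 2 - pp (u + a - b) ^+ 2 + pp (u - b) ^+ 2) / 2.

Lemma is_derive_shift (F : R -> R) u c l : is_derive (u + c) 1 F l -> is_derive u 1 (fun v => F (v + c)) l.
Proof.
move=> dF; have E : is_derive u 1 (fun v : R => v + c) 1.
  have H : is_derive u 1 (id + cst c : R -> R) (1 + 0) by apply: is_deriveD.
  by rewrite addr0 in H; exact: H.
by rewrite -[l]mulr1; apply: (@is_derive1_comp _ F (fun v => v + c)).
Qed.

Lemma is_derive_trapezoid a b u : is_derive u 1 (trapezoid_prim a b) (trapezoid a b u).
Proof.
pose F v := pp v ^+ 2.
have D c : is_derive u 1 (fun v => F (v + c)) (2 * pp (u + c)).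
  by apply: is_derive_shift; exact: is_derive_pp2.
have H : is_derive u 1 ((2^-1 : R) *: ((fun v => F (v + a)) - F - (fun v => F (v + (a - b))) + (fun v => F (v - b))))
  ((2^-1 : R) *: (2 * pp (u + a) - 2 * pp u - 2 * pp (u + (a - b)) + 2 * pp (u - b))).
  apply: is_deriveZ.
  exact: (is_deriveD (is_deriveB (is_deriveB (D a) (is_derive_pp2 u)) (D (a - b))) (D (- b))).
rewrite (_ : trapezoid_prim a b = ((2^-1 : R) *: ((fun v => F (v + a)) - F - (fun v => F (v + (a - b))) + (fun v => F (v - b))))).
  by apply: is_derive_eq; rewrite /trapezoid /GRing.scale /= addrA; field.
apply/funext => v; transitivity (2^-1 * (F (v + a) - F v - F (v + (a - b)) + F (v - b))) => //.
by rewrite /trapezoid_prim /F addrA mulrC.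
Qed.

Lemma continuous_trapezoid a b : continuous (trapezoid a b).
Proof.
have H c : continuous (fun u : R => pp (u + c)).
  move=> u; apply: (continuous_comp (f := fun u : R => u + c)); last exact: continuous_pp.
  by apply: cvgD; [exact: cvg_id|exact: cvg_cst].
have Hab : continuous (fun u : R => pp (u + a - b)).
  by rewrite (_ : (fun u => pp (u + a - b)) = fun u => pp (u + (a - b))); [exact: H|apply/funext => v; rewrite addrA].
move=> u; apply: cvgD; last exact: H.
by apply: cvgB; [apply: cvgB; [exact: H|exact: continuous_pp]|exact: Hab].
Qed.

Lemma trapezoid_bounds a b u : 0 <= a -> 0 <= b -> 0 <= trapezoid a b u <= a.
Proof.
move=> a0 b0; rewrite /trapezoid.
case: (ppE (u + a)) => -[h1 ->]; case: (ppE u) => -[h2 ->]; case: (ppE (u + a - b)) => -[h3 ->];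
case: (ppE (u - b)) => -[h4 ->]; apply/andP; split; lra.
Qed.

Lemma trapezoid_lo a b u : 0 <= a -> 0 <= b -> u <= - a -> trapezoid a b u = 0 /\ trapezoid_prim a b u = 0.
Proof.
move=> a0 b0 h; rewrite /trapezoid /trapezoid_prim.
have E v : v <= 0 -> pp v = 0 by move=> v0; rewrite /pp; apply/max_idPr.
by rewrite !E; [split; rewrite ?expr0n /=; lra|lra..].
Qed.

Lemma trapezoid_hi a b u : 0 <= a -> 0 <= b -> b <= u -> trapezoid a b u = 0 /\ trapezoid_prim a b u = a * b.
Proof.
move=> a0 b0 h; rewrite /trapezoid /trapezoid_prim.
have E v : 0 <= v -> pp v = v by move=> v0; rewrite /pp; apply/max_idPl.
by rewrite !E; [split; field|lra..].
Qed.

(** A compactly supported function of integral zero, given together with its compactly supported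
    primitive: after integration by parts, too, only times n in a bounded window contribute. *)
Definition test_fun (k0 kap : R -> R) (C B : R) := [/\ continuous k0,
  (forall u, is_derive u 1 kap (k0 u)),
  (forall u, C < `|u| -> k0 u = 0 /\ kap u = 0) &
  (forall u, `|k0 u| <= B /\ `|kap u| <= B)].

Lemma test_fun_trapezoid a b : 0 <= a -> 0 <= b -> exists B, test_fun
  (fun u => trapezoid a b u - trapezoid a b (u - a))
  (fun u => trapezoid_prim a b u - trapezoid_prim a b (u - a)) (a + b) B.
Proof.
move=> a0 b0; exists (a + 40 * (a + b) ^+ 2); split.
- move=> u; apply: cvgB; first exact: continuous_trapezoid.
  apply: (continuous_comp (f := fun u : R => u - a)); last exact: continuous_trapezoid.
  by apply: cvgB; [exact: cvg_id|exact: cvg_cst].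
- move=> u; have := is_derive_trapezoid a b u.
  have := is_derive_shift (is_derive_trapezoid a b (u - a)) => D2 D1.
  exact: (is_deriveB D1 D2).
- move=> u; rewrite lter_normr => /orP[h|h].
    have [k1 p1] := @trapezoid_hi a b u a0 b0 ltac:(lra).
    have [k2 p2] := @trapezoid_hi a b (u - a) a0 b0 ltac:(lra).
    by rewrite k1 k2 p1 p2; split; lra.
  have [k1 p1] := @trapezoid_lo a b u a0 b0 ltac:(lra).
  have [k2 p2] := @trapezoid_lo a b (u - a) a0 b0 ltac:(lra).
  by rewrite k1 k2 p1 p2; split; lra.
- have s0 : 0 <= (a + b) ^+ 2 by exact: sqr_ge0.
  move=> u; split.
    have /andP[h1 h2] := trapezoid_bounds u a0 b0; have /andP[h3 h4] := trapezoid_bounds (u - a) a0 b0.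
    by rewrite ler_norml; apply/andP; split; lra.
  have [hi|lo] := leP (a + b) u.
    have [_ p1] := @trapezoid_hi a b u a0 b0 ltac:(lra).
    have [_ p2] := @trapezoid_hi a b (u - a) a0 b0 ltac:(lra).
    by rewrite p1 p2 subrr normr0; lra.
  have [lo'|hi'] := leP u (- a - b).
    have [_ p1] := @trapezoid_lo a b u a0 b0 ltac:(lra).
    have [_ p2] := @trapezoid_lo a b (u - a) a0 b0 ltac:(lra).
    by rewrite p1 p2 subrr normr0; lra.
  have E v : v <= 3 * (a + b) -> 0 <= pp v ^+ 2 <= 9 * (a + b) ^+ 2.
    by move=> v1; case: (ppE v) => -[h ->]; apply/andP; split; nra.
  rewrite /trapezoid_prim ler_norml.
  have /andP[? ?] := E (u + a) ltac:(lra); have /andP[? ?] := E u ltac:(lra).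
  have /andP[? ?] := E (u + a - b) ltac:(lra); have /andP[? ?] := E (u - b) ltac:(lra).
  have /andP[? ?] := E (u - a + a) ltac:(lra); have /andP[? ?] := E (u - a) ltac:(lra).
  have /andP[? ?] := E (u - a + a - b) ltac:(lra); have /andP[? ?] := E (u - a - b) ltac:(lra).
  by apply/andP; split; lra.
Qed.

(** Clamp the sequence to [u, v + m]: every visit to [u, v] raises the clamped value by at least m,
    and its total increase is at most v + m - u. *)
Lemma window_count (s : nat -> R) (m u v : R) N : 0 < m -> u <= v ->
  (forall n, m <= s n.+1 - s n) -> \sum_(n < N) ((u <= s n <= v)%R)%:R <= (v - u) / m + 1.
Proof.
move=> m0 uv sm.
pose cl x := Num.min (Num.max x u) (v + m).
have clE x : (cl x = u /\ x <= u) \/ (cl x = x /\ u <= x <= v + m) \/ (cl x = v + m /\ v + m <= x).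
  rewrite /cl; have [h1|h1] := leP x u.
    by left; split => //; apply/min_idPl; lra.
  have [h2|h2] := leP x (v + m); first by right; left; rewrite ltW.
  by right; right; split => //; exact: ltW.
have step n : m * ((u <= s n <= v)%R)%:R <= cl (s n.+1) - cl (s n).
  have h := sm n; have [/andP[h1 h2]|nw] := boolP (u <= s n <= v).
    rewrite mulr1; case: (clE (s n)) => [[-> ?]|[[-> /andP[? ?]]|[-> ?]]];
    case: (clE (s n.+1)) => [[-> ?]|[[-> /andP[? ?]]|[-> ?]]]; lra.
  rewrite mulr0; case: (clE (s n)) => [[-> ?]|[[-> /andP[? ?]]|[-> ?]]];
  case: (clE (s n.+1)) => [[-> ?]|[[-> /andP[? ?]]|[-> ?]]]; lra.
have : m * \sum_(n < N) ((u <= s n <= v)%R)%:R <= cl (s N) - cl (s 0%N).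
  rewrite mulr_sumr; apply: (@le_trans _ _ (\sum_(n < N) (cl (s n.+1) - cl (s n)))).
    by apply: ler_sum => n _; exact: step.
  by rewrite -(big_mkord xpredT (fun n => cl (s n.+1) - cl (s n))) telescope_sumr.
have c1 x : u <= cl x <= v + m.
  by case: (clE x) => [[-> ?]|[[-> /andP[? ?]]|[-> ?]]]; apply/andP; split; lra.
have /andP[? ?] := c1 (s N); have /andP[? ?] := c1 (s 0%N) => h.
rewrite (_ : (v - u) / m + 1 = (v + m - u) / m); last by field; rewrite gt_eqF.
by rewrite ler_pdivlMr// mulrC; lra.
Qed.

End trapezoid.

(** * Regularised integration by parts on one fiber *)

Section shear_core.
Context {R : realType}.
Local Notation T1 := (measurableTypeR R).
Implicit Types (y : R).

Lemma mean_lam (g : R -> R) (b : R) : 0 <= b <= 1 -> bmeas (g : T1 -> R) ->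
  mean haar (fun y => ind b y * g y) = \int[lebesgue_measure]_(y in `[0, b]) g y.
Proof.
move=> /andP[b0 b1] bg; have bi := bmeas_ind b.
have [B [gB0 bgB]] := bmeas_ge0_shift bg.
have mgB : measurable_fun [set: T1] (fun y : T1 => (g y + B)%:E) by apply/measurable_EFinP; case: bgB.
have mi : measurable_fun [set: T1] (fun y : T1 => (ind b y * (g y + B))%:E).
  by apply/measurable_EFinP; have [] := bmeasM bi bgB.
have E : ((mean haar (fun y => ind b y * (g y + B)))%:E = \int[lebesgue_measure]_(y in `[0%R, b]) (g y + B)%:E)%E.
  rewrite -meanE; last exact: bmeasM.
  rewrite circ_integralE//; last by move=> y; rewrite lee_fin mulr_ge0// ind_ge0.
  rewrite -integral_itv_bndo_bndc; last by apply: measurable_funTS.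
  rewrite lam.unlock integral_mkcond [RHS]integral_mkcond; apply: eq_integral => y _.
  rewrite !patchE; have [y01|y01] := boolP (y \in `[0, 1[%classic).
    have /= := set_mem y01; rewrite in_itv /= => y01'; have /andP[y0 y1] := y01'.
    rewrite /ind frac_id//; have [yb|by_] := ltP y b.
      by rewrite mul1r mem_set// /= in_itv /= y0 yb.
    rewrite mul0r memNset// /= in_itv /= => /andP[_]; rewrite ltNge by_; done.
  rewrite memNset// /= in_itv /= => /andP[y0 yb].
  by move: y01; rewrite mem_set//= in_itv /= y0 (lt_le_trans yb).
have Eb : mean haar (ind b) = b.
  have mI : measurable (`[0, b[%classic : set T1) by exact: measurable_itv.
  apply: EFin_inj; rewrite -meanE// circ_integralE//; last first.
  - by move=> y; rewrite lee_fin ind_ge0.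
  - by apply/measurable_EFinP; case: bi.
  transitivity (\int[lam]_(y in `[0%R, 1%R[) (\1_(`[0, b[%classic : set T1) y)%:E)%E; last first.
    rewrite integral_indic//.
    rewrite (_ : _ `&` _ = `[0, b[%classic).
      by apply: (eq_trans (lam_itv true true b0)); rewrite subr0.
    apply/seteqP; split => y /=; rewrite !in_itv /=; first by case.
    by move=> /andP[y0 yb]; rewrite y0 yb (lt_le_trans yb).
  apply: eq_integral => y /set_mem /=; rewrite in_itv /= => y01; have /andP[y0 _] := y01.
  rewrite /ind frac_id// indicE; congr (nat_of_bool _)%:R%:E.
  by apply/idP/idP; rewrite inE /= in_itv /= y0.
have Lb : lebesgue_measure (`[0, b]%classic : set (measurableTypeR R)) = b%:E.
  apply: (eq_trans (lebesgue_measure_itv _)) => /=; rewrite lte_fin.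
  case: ltP => [_|h]; first by rewrite -EFinB subr0.
  by rewrite (_ : b = 0)//; apply/eqP; rewrite eq_le h.
have Eb' : (\int[lebesgue_measure]_(y in `[0, b]) B = B * b)%R.
  by rewrite Rintegral_cst// [X in fine X](_ : _ = b%:E).
have bc : bmeas (fun _ : T1 => B) by exact: bmeas_cst.
have ib (h : T1 -> R) : bmeas h -> lebesgue_measure.-integrable (`[0, b]%classic : set (measurableTypeR R)) (EFin \o h).
  move=> [mh [C hC]]; apply: measurable_bounded_integrable => //.
  - apply: (@le_lt_trans _ _ b%:E); last by rewrite ltry.
    exact: (eq_ind_r (fun x => (x <= b%:E)%E) (lexx _) Lb).
  - by apply: measurable_funTS.
  - exists C; split; first exact: num_real.
    by move=> x Cx y _; apply: le_trans (hC y) _; exact: ltW.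
have E2 : mean haar (fun y => ind b y * (g y + B)) =
  \int[lebesgue_measure]_(y in `[0, b]) (g y + B) by exact: (congr1 fine E).
move: E2; rewrite RintegralD//; [|exact: ib|exact: ib].
rewrite Eb' (_ : (fun y => _) = fun y => ind b y * g y + B * ind b y); last first.
  by apply/funext => y; ring.
rewrite meanD ?meanZ// ?Eb; [|exact: bmeasM|exact: bmeasM].
by move=> /addIr.
Qed.

Lemma mean_derive (F g : R -> R) (b : R) : 0 <= b <= 1 -> (forall y, is_derive y 1 F (g y)) ->
  continuous g -> bmeas (g : T1 -> R) -> mean haar (fun y => ind b y * g y) = F b - F 0.
Proof.
move=> b01 dF cg bg; rewrite mean_lam//; have /andP[b0 _] := b01.
have [->|bN] := eqVneq b 0.
  by rewrite subrr set_itv1 Rintegral_set1.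
by rewrite /Rintegral (integral_derive (F := F))// lt_neqAle eq_sym bN.
Qed.

Lemma is_derive_cont (F g : R -> R) : (forall y, is_derive y 1 F (g y)) -> continuous F.
Proof. by move=> dF y; apply/differentiable_continuous/derivable1_diffP; have := dF y; case. Qed.

Lemma sum_window (N : nat) (P : nat -> bool) (z : nat -> R) (C X : R) : 0 <= X ->
  \sum_(n < N) (P n)%:R <= C -> (forall n, (n < N)%N -> P n -> `|z n| <= X) ->
  (forall n, ~~ P n -> z n = 0) -> `|\sum_(n < N) z n| <= C * X.
Proof.
move=> X0 PC zX z0; apply: (@le_trans _ _ (\sum_(n < N) (P n)%:R * X)).
  apply: le_trans (ler_norm_sum _ _ _) _; apply: ler_sum => n _.
  have [Pn|nP] := boolP (P n); first by rewrite mul1r; exact: zX.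
  by rewrite z0// normr0 mul0r.
by rewrite -mulr_suml; apply: ler_wpM2r.
Qed.

Variables (k0 kap : R -> R) (C2 B : R).
Hypothesis Htest : test_fun k0 kap C2 B.
(** In the application [tau n] is t - Phi_n along a fiber, with derivative - [Dn n], and [w n] is
    the weight at the n-th iterate. D is the derivative of the reference sum, M is its amplitude,
    and [eta] measures how far [Dn n] is from D at the relevant times. *)
Variables (N : nat) (tau Dn w w' : nat -> R -> R) (D D' : R -> R).
Variables (C1 W eta delta del M C3 e b : R).
Hypothesis (b01 : 0 <= b <= 1) (eta0 : 0 <= eta) (delta0 : 0 < delta) (del0 : 0 < del) (M0 : 0 < M).
Hypothesis dtau : forall n y, is_derive y 1 (tau n) (- Dn n y).
Hypothesis dw : forall n y, is_derive y 1 (w n) (w' n y).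
Hypothesis dD : forall y, is_derive y 1 D (D' y).
Hypothesis (cDn : forall n, continuous (Dn n)) (cw' : forall n, continuous (w' n)) (cD' : continuous D').
Hypothesis w1 : forall n y, `|w n y| <= 1.
Hypothesis w'W : forall n y, `|w' n y| <= W.
Hypothesis DnD : forall n y, (n < N)%N -> `|tau n y| <= C2 -> `|Dn n y - D y| <= eta * M.
Hypothesis D'M : forall y, `|D' y| <= C3 * M.
Hypothesis count : forall y, \sum_(n < N) ((`|tau n y| <= C2)%R)%:R <= C1.
Hypothesis sublevel : hr [set y : T1 | `|D y| <= del * M] <= e.

(** E below is 1 / D regularised at the zeros of D on the scale delta * M, and q = 1 - E * D is the
    resulting defect. The three terms of rho are the costs of replacing [Dn n] by D, of
    differentiating the weights, and of differentiating E. *)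
Let K := delta ^+ 2 * M ^+ 2.
Let E y := D y / (D y ^+ 2 + K).
Let E' y := D' y * (K - D y ^+ 2) / (D y ^+ 2 + K) ^+ 2.
Let rho := eta / (2 * delta) + W / (2 * delta * M) + C3 / (delta ^+ 2 * M).
Let q y := K / (D y ^+ 2 + K).
Let G y := \sum_(n < N) w n y * k0 (tau n y).
Let P y := \sum_(n < N) w n y * (E y * kap (tau n y)).
Let P' y := \sum_(n < N) (w' n y * (E y * kap (tau n y)) +
  w n y * (E' y * kap (tau n y) + E y * (k0 (tau n y) * (- Dn n y)))).

Let K0 : 0 < K. Proof. by rewrite mulr_gt0// exprn_gt0. Qed.
Let den y : 0 < D y ^+ 2 + K. Proof. by rewrite ltr_wpDl// sqr_ge0. Qed.
Let denN y : D y ^+ 2 + K != 0. Proof. by rewrite gt_eqF. Qed.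
Let ck0 : continuous k0. Proof. by case: Htest. Qed.
Let dkap (u : R) : is_derive u 1 kap (k0 u). Proof. by case: Htest. Qed.
Let C10 : 0 <= C1.
Proof. by apply: le_trans (count 0); apply: sumr_ge0 => n _. Qed.
Let B0 : 0 <= B.
Proof. by case: Htest => _ _ _ /(_ 0)[h _]; apply: le_trans h. Qed.
Let cD : continuous D. Proof. exact: is_derive_cont dD. Qed.
Let ctau n : continuous (tau n). Proof. exact: is_derive_cont (dtau n). Qed.
Let cw n : continuous (w n). Proof. exact: is_derive_cont (dw n). Qed.
Let ckap : continuous kap. Proof. exact: is_derive_cont dkap. Qed.

Let dE (y : R) : is_derive y 1 E (E' y).
Proof.
have H1 : is_derive y 1 (fun z => D z ^+ 2 + K) (2 * D y * D' y).
  have H : is_derive y 1 (D * D + cst K : R -> R) (D y *: D' y + D y *: D' y + 0).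
    by apply: is_deriveD; apply: is_deriveM.
  rewrite (_ : (fun z => _) = (D * D + cst K : R -> R)); last by apply/funext => z; rewrite expr2.
  by apply: is_derive_eq; rewrite /GRing.scale /=; ring.
have H2 := @is_deriveV _ (fun z => D z ^+ 2 + K) y _ 1 (denN y) H1.
have H3 := is_deriveM (dD y) H2.
rewrite (_ : E = (D * (fun z => (D z ^+ 2 + K)^-1))); last by [].
apply: is_derive_eq; rewrite /GRing.scale /= /E'.
have := denN y; set dd := D y ^+ 2 + K => ddN.
rewrite (_ : K = dd - D y ^+ 2); last by rewrite /dd; ring.
by field.
Qed.

Let cE : continuous E. Proof. exact: is_derive_cont dE. Qed.

Let dP (y : R) : is_derive y 1 P (P' y).
Proof.
rewrite (_ : P = \sum_(n < N) (w n * (E * (kap \o tau n)))); last first.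
  by apply/funext => z; rewrite fct_sumE.
apply: is_derive_sum => n.
have H1 : is_derive y 1 (kap \o tau n) (k0 (tau n y) * - Dn n y).
  exact: (@is_derive1_comp _ kap (tau n)).
have H2 := is_deriveM (dw n y) (is_deriveM (dE y) H1).
apply: is_derive_eq; rewrite /GRing.scale /=.
rewrite (_ : (E * (kap \o tau n)) y = E y * kap (tau n y)) => [|//].
ring.
Qed.

Let cP' : continuous P'.
Proof.
have c1 n : continuous (fun y => kap (tau n y)).
  by move=> y; apply: (continuous_comp (@ctau n y)); exact: ckap.
have c2 n : continuous (fun y => k0 (tau n y)).
  by move=> y; apply: (continuous_comp (@ctau n y)); exact: ck0.
have c3 : continuous E'.
  have h : continuous (fun z => D z ^+ 2).
    by move=> z; rewrite /= (_ : (fun z => D z ^+ 2) = (fun z => D z * D z))//; apply: cvgM; exact: cD.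
  have h2 : continuous (fun z => D z ^+ 2 + K) by move=> z; apply: cvgD; [exact: h|exact: cvg_cst].
  move=> z; apply: cvgM.
    by apply: cvgM; [exact: cD'|apply: cvgB; [exact: cvg_cst|exact: h]].
  apply: cvgV; first by rewrite expf_neq0.
  by rewrite (_ : (fun z => _) = (fun z => (D z ^+ 2 + K) * (D z ^+ 2 + K)))//; apply: cvgM; exact: h2.
apply: (continuous_big (op := +%R)) => [|n _ y]; first exact: add_continuous.
apply: cvgD; first by apply: cvgM; [exact: cw'|apply: cvgM; [exact: cE|exact: c1]].
apply: cvgM; first exact: cw.
apply: cvgD; first by apply: cvgM; [exact: c3|exact: c1].
by apply: cvgM; [exact: cE|apply: cvgM; [exact: c2|apply: cvgN; exact: cDn]].
Qed.

Let dM0 : 0 < delta * M. Proof. exact: mulr_gt0. Qed.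

(* AM-GM: [2 * delta * M * |D| <= D ^ 2 + K]. *)
Let E_bound y : `|E y| <= 1 / (2 * delta * M).
Proof.
rewrite /E normrM normfV (gtr0_norm (den y)) ler_pdivrMr// mulrAC ler_pdivlMr; last by rewrite -mulrA mulr_gt0.
rewrite mul1r -(real_normK (num_real (D y))).
have := sqr_ge0 (`|D y| - delta * M); rewrite sqrrB exprMn -/K; lra.
Qed.

Let E'_bound y : `|E' y| <= C3 / (delta ^+ 2 * M).
Proof.
have D20 : 0 <= D y ^+ 2 by exact: sqr_ge0.
rewrite /E' normrM normfV (gtr0_norm (exprn_gt0 2 (den y))) normrM.
apply: (@le_trans _ _ (C3 * M * (D y ^+ 2 + K) / (D y ^+ 2 + K) ^+ 2)).
  apply: ler_wpM2r; first by rewrite invr_ge0 ltW// exprn_gt0.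
  by apply: ler_pM => //; rewrite ler_norml; apply/andP; split; have := K0; lra.
have C30 : 0 <= C3 * M by exact: le_trans (D'M y).
rewrite (_ : _ / _ = C3 * M / (D y ^+ 2 + K)); last by field.
rewrite (_ : C3 / (delta ^+ 2 * M) = C3 * M / K); last by rewrite /K; field; rewrite !gt_eqF.
by apply: ler_wpM2l => //; rewrite lef_pV2 ?posrE//; lra.
Qed.

(** The terms containing [k0] combine to w n * k0 (tau n) * (q - E * (Dn n - D)); the terms
    containing [kap] are errors. Only the boundedly many n with [tau n] in the support
    contribute. *)
Let GP_bound y : `|G y + P' y| <= C1 * (B * (q y + rho)).
Proof.
have q0 : 0 <= q y by rewrite /q divr_ge0 ?ltW.
have W0 : 0 <= W by apply: le_trans (w'W 0%N 0).
have C30 : 0 <= C3 by rewrite -(pmulr_lge0 _ M0); apply: le_trans (D'M 0).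
have rho0 : 0 <= rho by rewrite /rho !addr_ge0// divr_ge0// ?mulr_ge0// ?ltW// exprn_gt0.
rewrite /G /P' -big_split /=.
apply: (@sum_window _ (fun n => `|tau n y| <= C2) (fun n => w n y * k0 (tau n y) +
  (w' n y * (E y * kap (tau n y)) + w n y * (E' y * kap (tau n y) + E y * (k0 (tau n y) * - Dn n y)))));
  first by rewrite mulr_ge0// addr_ge0.
- exact: count.
- move=> n nN tC; have [_ _ _ /(_ (tau n y))[k0B kB]] := Htest.
  rewrite (_ : _ + _ = w n y * k0 (tau n y) * (q y - E y * (Dn n y - D y)) +
     (w' n y * E y * kap (tau n y) + w n y * E' y * kap (tau n y))); last first.
    rewrite /q (_ : K / _ = 1 - E y * D y); first by ring.
    by rewrite /E; field.
  have hA : `|w n y * k0 (tau n y)| <= B by rewrite normrM -[leRHS]mul1r; apply: ler_pM.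
  have hZ : `|E y * (Dn n y - D y)| <= eta / (2 * delta).
    rewrite (normrM (E y)) (_ : eta / (2 * delta) = 1 / (2 * delta * M) * (eta * M)); last by field; rewrite !gt_eqF.
    by apply: ler_pM => //; exact: DnD.
  have h3 : `|w' n y * E y * kap (tau n y)| <= W / (2 * delta * M) * B.
    rewrite normrM (normrM (w' n y)); apply: ler_pM => //.
    rewrite (_ : W / _ = W * (1 / (2 * delta * M))); last by rewrite mul1r.
    exact: ler_pM.
  have h4 : `|w n y * E' y * kap (tau n y)| <= C3 / (delta ^+ 2 * M) * B.
    rewrite normrM (normrM (w n y)); apply: ler_pM => //.
    by rewrite -[leRHS]mul1r; apply: ler_pM.
  rewrite (_ : B * (q y + rho) = B * (q y + eta / (2 * delta)) +
    (W / (2 * delta * M) * B + C3 / (delta ^+ 2 * M) * B)); last by rewrite /rho; ring.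
  apply: le_trans (ler_normD _ _) _; apply: lerD; last first.
    by apply: le_trans (ler_normD _ _) _; exact: lerD.
  rewrite normrM; apply: ler_pM => //; apply: le_trans (ler_normB _ _) _.
  by rewrite (ger0_norm q0); apply: lerD.
- move=> n; rewrite -ltNge => tC; have [_ _ /(_ _ tC)[-> ->] _] := Htest.
  by ring.
Qed.

Let P_bound y : `|P y| <= C1 * (B * (1 / (2 * delta * M))).
Proof.
apply: (@sum_window _ (fun n => `|tau n y| <= C2) (fun n => w n y * (E y * kap (tau n y))));
  first by rewrite mulr_ge0// divr_ge0// !mulr_ge0// ltW.
- exact: count.
- move=> n nN tC; have [_ _ _ /(_ (tau n y))[k0B kB]] := Htest.
  rewrite (normrM (w n y)) (normrM (E y)) -[leRHS]mul1r; apply: ler_pM => //.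
  by rewrite mulrC; apply: ler_pM.
- move=> n; rewrite -ltNge => tC; have [_ _ /(_ _ tC)[_ ->] _] := Htest.
  by rewrite !mulr0.
Qed.

(* Differentiating [w n * E * kap (tau n)] with E = D / (D ^+ 2 + K) returns
   [w n * k0 (tau n)] up to the factor q = K / (D ^+ 2 + K), which is small off
   the sublevel set of D. *)
Lemma shear_core : `|mean haar (fun y => ind b y * \sum_(n < N) w n y * k0 (tau n y))| <=
  C1 * (B * (e + delta ^+ 2 / del ^+ 2 + rho + 1 / (delta * M))).
Proof.
have bG : bmeas (G : T1 -> R).
  apply: bmeas_sum => n; apply: (@bmeas_bound _ _ _ _ (1 * B)).
    apply: continuous_measurable => y; apply: cvgM; first exact: cw.
    by apply: (continuous_comp (@ctau n y)); exact: ck0.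
  move=> y; have [_ _ _ /(_ (tau n y))[k0B _]] := Htest.
  by rewrite normrM; apply: ler_pM.
have q01 y : 0 <= q y <= 1.
  apply/andP; split; first by rewrite /q divr_ge0 ?ltW.
  rewrite /q ler_pdivrMr// mul1r lerDr; exact: sqr_ge0.
have bP' : bmeas (P' : T1 -> R).
  have [mG [BG HG]] := bG.
  apply: (@bmeas_bound _ _ _ _ (C1 * (B * (1 + rho)) + BG)); first exact: continuous_measurable.
  move=> y; rewrite (_ : P' y = (G y + P' y) - G y); last by rewrite addrC addKr || ring.
  apply: le_trans (ler_normB _ _) _; apply: lerD => //; apply: le_trans (GP_bound y) _.
  by apply: ler_wpM2l => //; apply: ler_wpM2l => //; have /andP[_ ?] := q01 y; lra.
have bi := bmeas_ind b.
have FT := mean_derive b01 dP cP' bP'.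
have mA : measurable [set y : T1 | `|D y| <= del * M].
  rewrite -[X in measurable X]setTI; apply: measurable_fun_ler => //.
  by apply: measurableT_comp => //; exact: continuous_measurable.
pose A1 : T1 -> R := \1_[set y : T1 | `|D y| <= del * M].
have bA : bmeas A1 by exact: bmeas_indic.
have -> : mean haar (fun y => ind b y * \sum_(n < N) w n y * k0 (tau n y)) =
   mean haar (fun y => ind b y * (G y + P' y)) - (P b - P 0).
  rewrite -FT -meanB; last 2 first.
  - by apply: bmeasM => //; exact: bmeasD.
  - exact: bmeasM.
  by congr mean; apply/funext => y; rewrite /G; ring.
(* q never exceeds 1, which is used on the sublevel set of D; off it D ^ 2 is larger than (del * M)
   ^ 2. *)
have qb y : q y <= A1 y + delta ^+ 2 / del ^+ 2.
  rewrite /A1 indicE; have /andP[q0 q1] := q01 y.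
  have [h|h] := pselect (`|D y| <= del * M).
    by rewrite mem_set//= ler_wpDr// divr_ge0// sqr_ge0.
  rewrite memNset//= add0r /q ler_pdivrMr// mulrAC ler_pdivlMr ?exprn_gt0//.
  rewrite /K -mulrA; apply: ler_wpM2l; first exact: sqr_ge0.
  apply: ler_wpDr; first exact: ltW.
  move/negP: h; rewrite -ltNge => h; rewrite -exprMn mulrC -(real_normK (num_real (D y))).
  by apply: lerXn2r; rewrite ?nnegrE ?mulr_ge0// ltW.
have rho' : 0 <= C1 * (B * rho) + 0.
  have := GP_bound 0; have W0 : 0 <= W by apply: le_trans (w'W 0%N 0).
  have C30 : 0 <= C3 by rewrite -(pmulr_lge0 _ M0); apply: le_trans (D'M 0).
  rewrite addr0 !mulr_ge0// /rho !addr_ge0// divr_ge0// ?mulr_ge0// ?ltW// exprn_gt0.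
have main : `|mean haar (fun y => ind b y * (G y + P' y))| <= C1 * (B * (e + delta ^+ 2 / del ^+ 2 + rho)).
  apply: le_trans (mean_norm _ _) _; first by apply: bmeasM => //; exact: bmeasD.
  pose c0 := C1 * B * (delta ^+ 2 / del ^+ 2 + rho).
  apply: (@le_trans _ _ (mean haar (fun y => C1 * B * A1 y + c0))).
    apply: mean_le.
    - by apply: bmeas_norm; apply: bmeasM => //; exact: bmeasD.
    - by apply: bmeasD; [apply: bmeasM => //; exact: bmeas_cst|exact: bmeas_cst].
    - move=> y; rewrite normrM; apply: (@le_trans _ _ (`|G y + P' y|)).
        by rewrite ler_piMl// ind_norm.
      apply: le_trans (GP_bound y) _; rewrite /c0 -mulrDr mulrA; apply: ler_wpM2l; first exact: mulr_ge0.
      by have := qb y; lra.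
  rewrite meanD ?mean_cst ?meanZ//; [|apply: bmeasM => //; exact: bmeas_cst|exact: bmeas_cst].
  rewrite mean_indic// -/(hr _) /c0 -mulrDr [leRHS]mulrA; apply: ler_wpM2l; first exact: mulr_ge0.
  by have := sublevel; lra.
apply: le_trans (ler_normB _ _) _; rewrite !mulrDr -mulrDr -addrA.
have h1 := P_bound b; have h2 := P_bound 0; have h3 := ler_normB (P b) (P 0).
have E1 : C1 * (B * (1 / (delta * M))) = C1 * (B * (1 / (2 * delta * M))) + C1 * (B * (1 / (2 * delta * M))).
  by field; rewrite !gt_eqF.
rewrite !mulrDr in main *; lra.
Qed.

End shear_core.

(** * Birkhoff sums of the roof function *)

Section trig_bounds.
Context {R : realType}.
Implicit Types (a b : nat -> R) (y : R).

(** [dcos b] and [dsin a] are the coefficients of the derivative of a trigonometric sum with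
    coefficients a and b. *)
Definition dcos b k : R := 2 * pi * k.+1%:R * b k.
Definition dsin a k : R := - (2 * pi * k.+1%:R * a k).

Lemma trig_sum_le_norm d a b y : `|trig_sum d a b y| <= trig_norm d a b.
Proof.
apply: le_trans (ler_norm_sum _ _ _) _; apply: ler_sum => k _.
apply: le_trans (ler_normD _ _) _; rewrite !normrM; apply: lerD; rewrite ler_piMr//.
  exact: cos_max.
exact: sin_max.
Qed.

Lemma trig_sumB d a b a' b' y : trig_sum d a b y - trig_sum d a' b' y =
  trig_sum d (fun k => a k - a' k) (fun k => b k - b' k) y.
Proof. by rewrite -sumrB; apply: eq_bigr => k _; ring. Qed.

Lemma trig_norm_ge0 d a b : 0 <= trig_norm d a b.
Proof. by apply: sumr_ge0 => k _; rewrite addr_ge0. Qed.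

Lemma trig_norm_derive d a b : trig_norm d a b <= trig_norm d (dcos b) (dsin a) <= 2 * pi * d%:R * trig_norm d a b.
Proof.
have p0 := @pi_gt0 R; have p2 := @pi_ge2 R.
have E k : `|dcos b k| + `|dsin a k| = 2 * pi * k.+1%:R * (`|a k| + `|b k|).
  rewrite /dcos /dsin normrN (normrM _ (b k)) (normrM _ (a k)) ger0_norm; last by rewrite !mulr_ge0// ltW.
  by ring.
apply/andP; split; rewrite /trig_norm ?mulr_sumr; apply: ler_sum => k _; rewrite E.
  have k1 : 1 <= k.+1%:R :> R by rewrite ler1n.
  rewrite -[leLHS]mul1r; apply: ler_wpM2r; first exact: addr_ge0.
  by rewrite -[leLHS]mulr1; apply: ler_pM => //; lra.
apply: ler_wpM2r; first exact: addr_ge0.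
by apply: ler_wpM2l; [rewrite mulr_ge0// ltW|rewrite ler_nat].
Qed.

(** Bernstein's inequality with a crude constant: coefficients recovered from samples are bounded by
    the supremum, and differentiation costs a factor 2 * pi * d. The passage from a, b to the
    sampled coefficients is justified by uniqueness of the derivative. *)
Lemma trig_bernstein d a b (B : R) : (forall y, `|trig_sum d a b y| <= B) ->
  forall y, `|trig_sum d (dcos b) (dsin a) y| <= 8 * pi * d%:R ^+ 2 * B.
Proof.
move=> hB y.
set a' := dft_cos d (trig_sum d a b); set b' := dft_sin d (trig_sum d a b).
have E : trig_sum d a b = trig_sum d a' b'.
  by apply/funext => z; rewrite (trig_poly_dft (@trig_poly_deg_sum R d a b) z) dft_mean_trig_sum add0r.
have -> : trig_sum d (dcos b) (dsin a) y = trig_sum d (dcos b') (dsin a') y.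
  have D1 := is_derive_trig_sum d a b y; have D2 := is_derive_trig_sum d a' b' y.
  rewrite -E in D2; have [_ <-] := D1; by have [_ <-] := D2.
apply: le_trans (trig_sum_le_norm _ _ _ _) _.
have /andP[_ h] := trig_norm_derive d a' b'; apply: le_trans h _.
rewrite (_ : 8 * pi * d%:R ^+ 2 * B = 2 * pi * d%:R * (4 * d%:R * B)); last by ring.
apply: ler_wpM2l; first by rewrite !mulr_ge0// pi_ge0.
exact: trig_norm_bound.
Qed.

End trig_bounds.

Section birkhoff_bounds.
Context {R : realType} {T : Type}.
Variables (f : T -> T) (g : T -> R).

Lemma unif_mean_affine mu (B : R) : unif_mean f g mu -> (forall p, `|g p| <= B) ->
  forall e, 0 < e -> exists2 C, 0 <= C & forall n p, `|birkhoff f g n p - mu * n%:R| <= e * n%:R + C.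
Proof.
move=> ug gB e e0; have [n0 H] := ug e e0.
exists (`|B + `|mu| | * n0%:R); first by rewrite mulr_ge0.
move=> n p; have [nn0|nn0] := leqP n0 n.
  by apply: le_trans (H n nn0 p) _; rewrite lerDl mulr_ge0.
apply: (@le_trans _ _ (`|B + `|mu| | * n%:R)).
  apply: le_trans (ler_normB _ _) _; rewrite normrM [X in _ + _ * X]ger0_norm//.
  apply: (@le_trans _ _ ((B + `|mu|) * n%:R)); last by apply: ler_wpM2r => //; exact: ler_norm.
  rewrite mulrDl; apply: lerD => //.
  rewrite -sumr_const_ord; apply: le_trans (ler_norm_sum _ _ _) _; exact: ler_sum.
apply: ler_wpDl; first by rewrite mulr_ge0// ltW.
by apply: ler_wpM2l => //; rewrite ler_nat ltnW.
Qed.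

Lemma birkhoff_diff (e C : R) : (forall n p, `|birkhoff f g n p| <= e * n%:R + C) ->
  forall n m p, `|birkhoff f g n p - birkhoff f g m p| <= e * `|n%:R - m%:R| + C.
Proof.
move=> H n m p; wlog nm : n m / (m <= n)%N => [W|].
  by have [|/ltnW] := leqP m n; first exact: W; rewrite distrC [X in _ * X]distrC; exact: W.
rewrite -(subnKC nm) birkhoff_add addrC addKr natrD (addrC m%:R) addrK (ger0_norm (ler0n _ _)).
exact: H.
Qed.

End birkhoff_bounds.

Section roof_birkhoff.
Context {R : realType} (alpha beta : R) (d : nat) (Phi : R * R -> R).
Local Notation f := (skew_shift alpha beta).
Local Notation T1 := (measurableTypeR R).
Local Notation T2 := (T1 * T1)%type.
Hypothesis irr : irrational alpha.
Hypothesis PP : class_P_deg d Phi.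
Hypothesis TP : trig_poly (fiber_mean Phi).
Local Notation ra := (roof_cos d Phi).
Local Notation rb := (roof_sin d Phi).
Local Notation A n x := (fun k => modeA alpha beta ra rb k n x).
Local Notation B n x := (fun k => modeB alpha beta ra rb k n x).

Let ca := continuous_roof_cos PP.
Let cb := continuous_roof_sin PP.
Let pa := circle_fun_roof_cos PP.
Let pb := circle_fun_roof_sin PP.

(** The bounded remainder r depends on n and x but not on y, so it disappears under differentiation
    along the fiber. *)
Lemma roof_birkhoff : exists c Cp : R, 0 <= Cp /\ forall n x, exists2 r, `|r| <= Cp &
  forall y, birkhoff f Phi n (x, y) = c * n%:R + r + trig_sum d (A n x) (B n x) y.
Proof.
have [d' [a [b E]]] := TP; have [Cp HC] := trig_poly_birkhoff_bounded beta irr E.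
exists (a 0%N), Cp; split; first by apply: le_trans (HC 0%N (0, 0)).
move=> n x; exists (birkhoff f (fun p => fiber_mean Phi p.1 - a 0%N) n (x, 0)); first exact: HC.
move=> y; rewrite -birkhoff_mode_sum.
have -> : birkhoff f (fun p => fiber_mean Phi p.1 - a 0%N) n (x, 0) =
  birkhoff f (fun p => fiber_mean Phi p.1 - a 0%N) n (x, y).
  by apply: eq_bigr => k _; rewrite !iter_skew.
rewrite -sumr_const_ord /birkhoff -!big_split /=; apply: eq_bigr => k _.
by rewrite (roof_decomposition PP) addrA [in RHS]addrC subrKA || (rewrite (roof_decomposition PP); ring).
Qed.

Lemma unif_mean_roof_mode : unif_mean f (mode_sum d ra rb) 0.
Proof. exact: unif_mean_mode_sum. Qed.

Lemma mode_sum_bounded (m M : R) : (forall p, m <= Phi p <= M) ->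
  exists Bd : R, forall p, `|mode_sum d ra rb p| <= Bd.
Proof.
move=> H; exists (trig_norm d (fun=> 2 * (`|m| + `|M|)) (fun=> 2 * (`|m| + `|M|))) => p.
apply: le_trans (trig_sum_le_norm d (fun k => ra k p.1) (fun k => rb k p.1) p.2) _.
have h y : `|Phi (p.1, y)| <= `|m| + `|M|.
  have /andP[h1 h2] := H (p.1, y); rewrite ler_norml.
  have := ler_norm M; have := ler_norm (- m); rewrite normrN => h3 h4.
  have := normr_ge0 m; have := normr_ge0 M => h5 h6; apply/andP; split; lra.
have h0 : 0 <= 2 * (`|m| + `|M|) by rewrite mulr_ge0// addr_ge0.
apply: ler_sum => k _; rewrite !(ger0_norm h0).
by apply: lerD; [exact: dft_cos_bound|exact: dft_sin_bound].
Qed.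

Variables (c Cp m H : R).
Hypothesis (m0 : 0 < m) (Hm : forall p, m <= Phi p <= H) (Cp0 : 0 <= Cp).
Hypothesis Hc : forall n x, exists2 r, `|r| <= Cp &
  forall y, birkhoff f Phi n (x, y) = c * n%:R + r + trig_sum d (A n x) (B n x) y.

Lemma roof_step n p : m <= birkhoff f Phi n.+1 p - birkhoff f Phi n p <= H.
Proof. by rewrite birkhoffSr addrC addKr. Qed.

Lemma roof_mean_ge : m <= c.
Proof.
have [Bd HBd] := mode_sum_bounded Hm.
rewrite leNgt; apply/negP => cm.
have e0 : 0 < (m - c) / 2 by lra.
have [C C0 HC] := unif_mean_affine unif_mean_roof_mode HBd e0.
pose n := (Num.truncn ((Cp + C) / ((m - c) / 2))).+1.
have n0 : 0 < n%:R :> R by rewrite ltr0n.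
have [r rC Er] := Hc n 0.
have h1 : m * n%:R <= birkhoff f Phi n (0, 0).
  by rewrite -sumr_const_ord; apply: ler_sum => k _; case/andP: (Hm (iter k f (0, 0))).
have := HC n (0, 0); rewrite mul0r subr0 birkhoff_mode_sum => h2.
have : (Cp + C) / ((m - c) / 2) < n%:R by exact: truncnS_gt.
rewrite ltr_pdivrMr// => h3.
have := le_trans (ler_norm _) h2; have := le_trans (ler_norm _) rC; have := Er 0; lra.
Qed.

Let c0 : 0 < c. Proof. exact: lt_le_trans roof_mean_ge. Qed.

Lemma roof_window_count (t C2 : R) x y N : 0 <= C2 ->
  \sum_(n < N) ((`|t - birkhoff f Phi n (x, y)| <= C2)%R)%:R <= 2 * C2 / m + 1.
Proof.
move=> C20; rewrite (_ : 2 * C2 = (t + C2) - (t - C2)); last by ring.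
have E n : (`|t - birkhoff f Phi n (x, y)| <= C2) =
    (t - C2 <= birkhoff f Phi n (x, y) <= t + C2).
  by rewrite ler_norml; apply/andP/andP => -[h1 h2]; split; lra.
under eq_bigr do rewrite E.
apply: (@window_count _ (fun n => birkhoff f Phi n (x, y))) => //; first by lra.
by move=> n; case/andP: (roof_step n (x, y)).
Qed.

(** If Phi_n is within C2 of t, then c * |n - N| is at most M plus a constant plus a small multiple
    of |n - N|, whence |n - N| = O(M). The difference of the two sums runs over |n - N| steps, hence
    is o(|n - N|) + O(1), a small multiple of M once M is large. *)
Lemma fluctuation_window (C2 e : R) : 0 <= C2 -> 0 < e -> exists2 M1 : R, 0 < M1 &
  forall t N x n y, c * N%:R <= t < c * N.+1%:R ->
  M1 <= amplitude alpha beta d ra rb N x -> `|t - birkhoff f Phi n (x, y)| <= C2 ->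
  forall y', `|trig_sum d (A n x) (B n x) y' - trig_sum d (A N x) (B N x) y'| <=
    e * amplitude alpha beta d ra rb N x.
Proof.
move=> C20 e0; have [Bd HBd] := mode_sum_bounded Hm.
(* The bound c / 2 lets the left-hand side absorb e1 * X; the bound e * c / 4 then turns (c / 2) * X
   <= C4 + M into e1 * X <= (e / 2) * (C4 + M). *)
pose e1 := Num.min (c / 2) (e * c / 4).
have e10 : 0 < e1 by rewrite lt_min !divr_gt0// mulr_gt0.
have e1c : e1 <= c / 2 by rewrite ge_min lexx.
have e1e : e1 <= e * c / 4 by rewrite ge_min lexx orbT.
have [C C00 HC] := unif_mean_affine unif_mean_roof_mode HBd e10.
have HC' n p : `|birkhoff f (mode_sum d ra rb) n p| <= e1 * n%:R + C.
  by have := HC n p; rewrite mul0r subr0.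
have HD := birkhoff_diff HC'.
pose C4 := C2 + Cp + c + C.
have C40 : 0 <= C4 by rewrite !addr_ge0// ltW.
exists (C4 + 2 * C / e + 1); first by rewrite ltr_wpDl// addr_ge0// divr_ge0// ?mulr_ge0// ltW.
move=> t N x n y /andP[tN1 tN2]; set M := amplitude _ _ _ _ _ _ _ => MM hy y'.
have D z : `|trig_sum d (A n x) (B n x) z - trig_sum d (A N x) (B N x) z| <= e1 * `|n%:R - N%:R| + C.
  by rewrite -!birkhoff_mode_sum; exact: HD.
have [r rC Er] := Hc n x; rewrite Er in hy.
have hM := trig_sum_le_norm d (A N x) (B N x) y.
set X := `|n%:R - N%:R| in D *.
have cX : c * X <= C4 + M + e1 * X.
  rewrite -[X in X * _](gtr0_norm c0) -normrM mulrBr.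
  have := D y; move: hM hy rC; rewrite -/(amplitude alpha beta d ra rb N x) -/M /C4 -natr1 in tN2 *.
  rewrite !ler_norml => /andP[? ?] /andP[? ?] /andP[? ?] /andP[? ?]; apply/andP; split; lra.
have XM : (c / 2) * X <= C4 + M.
  have := ler_wpM2r (normr_ge0 (n%:R - N%:R) : 0 <= X) e1c; lra.
have e1X : e1 * X <= (e / 2) * (C4 + M).
  apply: (@le_trans _ _ (e * c / 4 * X)); first by apply: ler_wpM2r => //; exact: normr_ge0.
  rewrite (_ : e * c / 4 * X = (e / 2) * ((c / 2) * X)); last by field.
  by apply: ler_wpM2l => //; rewrite divr_ge0// ltW.
apply: le_trans (D y') _.
have h : e * (C4 + 2 * C / e) <= e * M by apply: ler_wpM2l; [exact: ltW|lra].
have h2 : e * (C4 + 2 * C / e) = e * C4 + 2 * C by field; rewrite gt_eqF.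
lra.
Qed.

(** [shear_core] with phi_N as reference sum. Along a fiber the factor from [g1] is constant, and
    [g2] is a trigonometric polynomial, so the derivatives of the weights are bounded independently
    of n. *)
Lemma shear (k0 kap : R -> R) (C2 Bk b : R) (g1 g2 : R -> R) (dd : nat) :
  test_fun k0 kap C2 Bk -> 0 <= C2 -> 0 <= b <= 1 -> trig_poly_deg dd g2 ->
  (forall x, `|g1 x| <= 1) -> (forall x, `|g2 x| <= 1) ->
  forall e, 0 < e -> exists2 M1 : R, 0 < M1 & forall t N x Nt, c * N%:R <= t < c * N.+1%:R ->
    M1 <= amplitude alpha beta d ra rb N x ->
    `|mean haar (fun y => ind b y * \sum_(n < Nt) g1 (iter n f (x, y)).1 * g2 (iter n f (x, y)).2 *
      k0 (t - birkhoff f Phi n (x, y)))| <= e.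
Proof.
move=> Ht C20 b01 tg2 g1B g2B e e0.
pose a2 := dft_cos dd g2; pose b2 := dft_sin dd g2.
pose g2' := trig_sum dd (dcos b2) (dsin a2).
have dg2 (z : R) : is_derive z 1 g2 (g2' z).
  have H1 : is_derive z 1 (cst (dft_mean dd g2) + trig_sum dd a2 b2 : R -> R) (0 + g2' z).
    by apply: is_deriveD; exact: is_derive_trig_sum.
  rewrite (_ : g2 = (cst (dft_mean dd g2) + trig_sum dd a2 b2 : R -> R)); first by rewrite add0r in H1.
  by apply/funext => y; rewrite (trig_poly_dft tg2).
pose W := trig_norm dd (dcos b2) (dsin a2).
have W0 : 0 <= W by exact: trig_norm_ge0.
have Bk0 : 0 <= Bk by case: Ht => _ _ _ /(_ 0)[h _]; apply: le_trans h.
pose C1 := 2 * C2 / m + 1.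
have C10 : 0 < C1 by rewrite ltr_wpDl// divr_ge0 ?mulr_ge0// ltW.
pose X := C1 * (Bk + 1); have X0 : 0 < X by rewrite mulr_gt0// ltr_wpDl.
(* The bound of [shear_core] has six error terms; each of them will be at most u. *)
have [u u0 uE] : exists2 u : R, 0 < u & X * (6 * u) = e.
  exists (e / (6 * X)); first by rewrite divr_gt0// mulr_gt0.
  by field; rewrite gt_eqF.
have [del del0 Hdel] := @trig_sublevel R d u u0.
have [delta delta0 dd2] : exists2 delta : R, 0 < delta & delta ^+ 2 / del ^+ 2 <= u.
  pose s := Num.min 1 u; have s0 : 0 < s by rewrite lt_min ltr01.
  have s1 : s <= 1 by rewrite ge_min lexx.
  have su : s <= u by rewrite ge_min lexx orbT.
  exists (del * s); first exact: mulr_gt0.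
  rewrite exprMn mulrAC divff ?mul1r ?expf_neq0 ?gt_eqF//.
  apply: (@le_trans _ _ s) => //; rewrite expr2 -[leRHS]mulr1.
  by apply: ler_wpM2l => //; exact: ltW.
pose C3 : R := (2 * pi * d%:R) ^+ 2.
pose Cb : R := 8 * pi * d%:R ^+ 2.
have Cb0 : 0 <= Cb by rewrite !mulr_ge0// ?pi_ge0// exprn_ge0.
pose eta := 2 * delta * u; have eta0 : 0 < eta by apply: mulr_gt0 => //; exact: mulr_gt0.
have eC : 0 < eta / (Cb + 1) by rewrite divr_gt0// ltr_wpDl.
have [M2 M20 HM2] := fluctuation_window C20 eC.
(* M2 makes the fluctuations comparable; the other summands bring the three error terms that decay
   with M below u. *)
pose M1 := M2 + W / (2 * delta * u) + C3 / (delta ^+ 2 * u) + 1 / (delta * u).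
have C30 : 0 <= C3 by exact: sqr_ge0.
have du : 0 <= 2 * delta * u by exact: ltW.
have p1 : 0 <= W / (2 * delta * u) by exact: divr_ge0.
have p2 : 0 <= C3 / (delta ^+ 2 * u) by apply: divr_ge0 => //; rewrite mulr_ge0 ?exprn_ge0 ?ltW.
have p3 : 0 <= 1 / (delta * u) by apply: divr_ge0 => //; rewrite mulr_ge0 ?ltW.
exists M1; first by rewrite /M1; lra.
move=> t N x Nt tN; set M := amplitude _ _ _ _ _ _ _ => M1M.
have M2M : M2 <= M by move: M1M; rewrite /M1; lra.
have M0 : 0 < M by exact: lt_le_trans M2M.
have q1 : W / (2 * delta * M) <= u.
  have h : W / (2 * delta * u) <= M by move: M1M; rewrite /M1; lra.
  by move: h; rewrite !ler_pdivrMr ?mulr_gt0// => h; lra.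
have q2 : C3 / (delta ^+ 2 * M) <= u.
  have h : C3 / (delta ^+ 2 * u) <= M by move: M1M; rewrite /M1; lra.
  by move: h; rewrite !ler_pdivrMr ?mulr_gt0 ?exprn_gt0// => h; lra.
have q3 : 1 / (delta * M) <= u.
  have h : 1 / (delta * u) <= M by move: M1M; rewrite /M1; lra.
  by move: h; rewrite !ler_pdivrMr ?mulr_gt0// => h; lra.
have Hr0 n : exists r : R, forall y, birkhoff f Phi n (x, y) = c * n%:R + r + trig_sum d (A n x) (B n x) y.
  by have [r _ E] := Hc n x; exists r.
have [r Hr] := choice Hr0.
pose w n y := g1 (x + n%:R * alpha) * g2 (y + (n%:R * x + skew_drift alpha beta n)).
pose w' n y := g1 (x + n%:R * alpha) * g2' (y + (n%:R * x + skew_drift alpha beta n)).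
pose phi n := trig_sum d (A n x) (B n x).
pose tau n y := t - (c * n%:R + r n + phi n y).
pose Dn n := trig_sum d (dcos (B n x)) (dsin (A n x)).
pose D' := trig_sum d (dcos (dsin (A N x))) (dsin (dcos (B N x))).
have tauE n y : t - birkhoff f Phi n (x, y) = tau n y by rewrite Hr.
have -> : (fun y => ind b y * \sum_(n < Nt) g1 (iter n f (x, y)).1 * g2 (iter n f (x, y)).2 *
      k0 (t - birkhoff f Phi n (x, y))) = fun y => ind b y * \sum_(n < Nt) w n y * k0 (tau n y).
  apply/funext => y; congr (_ * _); apply: eq_bigr => n _; rewrite tauE iter_skew /w /=.
  by rewrite (addrA y).
have dD n (y : R) : is_derive y 1 (phi n) (Dn n y) by exact: is_derive_trig_sum.
have HH : `|mean haar (fun y : R => ind b y * \sum_(n < Nt) w n y * k0 (tau n y))| <=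
    C1 * (Bk * (u + delta ^+ 2 / del ^+ 2 + (eta / (2 * delta) + W / (2 * delta * M) +
    C3 / (delta ^+ 2 * M)) + 1 / (delta * M))).
  apply: (@shear_core R k0 kap C2 Bk Ht Nt tau Dn w w' (Dn N) D' C1 W eta delta del M C3 u b b01 (ltW eta0) delta0 del0 M0).
  - move=> n y.
    have H1 : is_derive y 1 (cst t - (cst (c * n%:R + r n) + phi n) : R -> R) (0 - (0 + Dn n y)).
      by apply: is_deriveB; apply: is_deriveD.
    by rewrite sub0r add0r in H1; exact: H1.
  - move=> n y; have H1 := is_derive_shift (dg2 (y + (n%:R * x + skew_drift alpha beta n))).
    by have := is_deriveZ (g1 (x + n%:R * alpha)) H1.

  - by move=> n; exact: continuous_trig_sum.
  - move=> n y; apply: cvgM; first exact: cvg_cst.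
    apply: (continuous_comp (f := fun y : R => y + (n%:R * x + skew_drift alpha beta n)) (g := g2')); last exact: continuous_trig_sum.
    by apply: cvgD; [exact: cvg_id|exact: cvg_cst].
  - exact: continuous_trig_sum.
  - by move=> n y; rewrite normrM -[leRHS]mul1r; apply: ler_pM.
  - by move=> n y; rewrite normrM -[leRHS]mul1r; apply: ler_pM => //; exact: trig_sum_le_norm.
  - move=> n y _; rewrite -tauE => hy; rewrite /Dn trig_sumB.
    have := HM2 t N x n y tN M2M hy => HH.
    rewrite (_ : trig_sum d _ _ y = trig_sum d (dcos (fun k => B n x k - B N x k)) (dsin (fun k => A n x k - A N x k)) y); last first.
      by apply: eq_bigr => k _; rewrite /dcos /dsin; ring.
    apply: le_trans (trig_bernstein (B := eta / (Cb + 1) * M) _ y) _.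
      by move=> y'; rewrite -trig_sumB; exact: HH.
    rewrite mulrA; apply: ler_wpM2r; first exact: ltW.
    rewrite -/Cb mulrA ler_pdivrMr ?ltr_wpDl// mulrC; apply: ler_wpM2l; [exact: ltW|lra].
  - move=> y; apply: le_trans (trig_sum_le_norm _ _ _ _) _.
    have /andP[_ h1] := trig_norm_derive d (dcos (B N x)) (dsin (A N x)).
    have /andP[_ h2] := trig_norm_derive d (A N x) (B N x).
    rewrite (_ : C3 * M = 2 * pi * d%:R * (2 * pi * d%:R * M)); last by rewrite /C3; ring.
    apply: le_trans h1 _; apply: ler_wpM2l => //.
    by rewrite !mulr_ge0// pi_ge0.
  - by move=> y; under eq_bigr do rewrite -tauE; exact: roof_window_count.
  - have /andP[n1 _] := trig_norm_derive d (A N x) (B N x).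
    have nD0 : 0 < trig_norm d (dcos (B N x)) (dsin (A N x)) by exact: lt_le_trans n1.
    have := Hdel _ _ nD0.
    set S := [set y | _]; have mS : measurable S.
      rewrite -[X in measurable X]setTI; apply: measurable_fun_ler => //.
      by apply: measurableT_comp => //; apply: continuous_measurable; exact: continuous_trig_sum.
    rewrite hrE// lee_fin; apply: le_trans; apply: hr_le => //.
      rewrite -[X in measurable X]setTI; apply: measurable_fun_ler => //.
      by apply: measurableT_comp => //; apply: continuous_measurable; exact: continuous_trig_sum.
    by move=> y /=; rewrite /S /= => h; apply: le_trans h _; apply: ler_wpM2l => //; exact: ltW.
have eta2 : eta / (2 * delta) = u by rewrite /eta; field; rewrite gt_eqF.
apply: (le_trans HH); apply: (@le_trans _ _ (C1 * (Bk * (6 * u)))).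
  apply: ler_wpM2l; first exact: ltW.
  by apply: ler_wpM2l => //; rewrite eta2; lra.
apply: (@le_trans _ _ (X * (6 * u))).
  rewrite mulrA; apply: ler_wpM2r; first by rewrite mulr_ge0// ltW.
  by apply: ler_wpM2l; [exact: ltW|lra].
by rewrite uE.
Qed.

End roof_birkhoff.

(** * Correlations *)

Lemma initial_segment (R : realType) (s : nat -> R) (P : pred R) N : (forall n, s n <= s n.+1) ->
  (forall x y, x <= y -> P y -> P x) ->
  exists2 k, (k <= N)%N & forall n, (n < N)%N -> P (s n) = (n < k)%N.
Proof.
move=> sm Pd; elim: N => [|N [k kN H]]; first by exists 0%N.
have [kN'|Nk] := ltnP k N.
  exists k => [|n nN]; first exact: leqW.
  have [nN'|nN'] := ltnP n N; first exact: H.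
  have -> : n = N by lia.
  rewrite [RHS]ltnNge ltnW//=; apply/negbTE/negP => PN.
  have : P (s k).
    apply: Pd PN; have /nondecreasing_seqP sn := sm; exact: (sn k N (ltnW kN')).
  by rewrite H// ltnn.
have {kN Nk} kN : k = N by lia.
rewrite {k}kN in H.
have [PN|nPN] := boolP (P (s N)); [exists N.+1|exists N] => // n nN; (have [nN'|nN'] := ltnP n N;
  [rewrite H// ?nN'; lia|have -> : n = N by lia]).
  by rewrite PN; lia.
by rewrite (negbTE nPN); lia.
Qed.

Lemma fine_window_sum (R : realType) (T : Type) (f : T -> T) (G : T -> R) (a b N : nat) p :
  (a <= b)%N -> (b <= N)%N ->
  \sum_(n < N) G (iter n f p) * ((a <= n < b)%N)%:R = birkhoff f G (b - a) (iter a f p).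
Proof.
move=> ab bN; have -> : birkhoff f G (b - a) (iter a f p) = birkhoff f G b p - birkhoff f G a p.
  by rewrite -{2}(subnKC ab) birkhoff_add addrC addKr.
have H k : (k <= N)%N -> birkhoff f G k p = \sum_(n < N) G (iter n f p) * ((n < k)%N)%:R.
  move=> kN; rewrite /birkhoff (big_ord_widen _ (fun n => G (iter n f p)) kN) big_mkcond /=.
  by apply: eq_bigr => n _; case: (n < k)%N; rewrite ?mulr1 ?mulr0.
rewrite !H//; last exact: leq_trans bN.
rewrite -sumrB; apply: eq_bigr => n _; rewrite -mulrBr; congr (_ * _).
have [na|an] := ltnP n a; first by rewrite (leq_trans na ab) subrr.
by rewrite subr0.
Qed.

Section ramp.
Context {R : realType}.
Implicit Types (u a b : R).

(** The trapezoid is the increment of the ramp over a step a, so its translates by multiples of a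
    telescope. *)
Definition ramp b u : R := pp u - pp (u - b).

Lemma ramp_trapezoid a b u : trapezoid a b u = ramp b (u + a) - ramp b u.
Proof. by rewrite /trapezoid /ramp; ring. Qed.

Lemma ramp_bounds b u : 0 <= b -> 0 <= ramp b u <= b.
Proof.
move=> b0; rewrite /ramp; case: (ppE u) => -[h1 ->]; case: (ppE (u - b)) => -[h2 ->]; apply/andP; split; lra.
Qed.

Lemma ramp_lo b u : 0 <= b -> u <= 0 -> ramp b u = 0.
Proof.
move=> b0 u0; rewrite /ramp; case: (ppE u) => -[h1 ->]; case: (ppE (u - b)) => -[h2 ->]; lra.
Qed.

Lemma ramp_hi b u : 0 <= b -> b <= u -> ramp b u = b.
Proof.
move=> b0 u0; rewrite /ramp; case: (ppE u) => -[h1 ->]; case: (ppE (u - b)) => -[h2 ->]; lra.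
Qed.

Lemma trapezoid_tiling a b u n :
  \sum_(i < n) trapezoid a b (u - i%:R * a) = ramp b (u + a) - ramp b (u + a - n%:R * a).
Proof.
elim: n => [|n IH]; first by rewrite big_ord0 mul0r subr0 subrr.
rewrite big_ord_recr /= IH ramp_trapezoid -natr1.
rewrite (_ : u - n%:R * a + a = u + a - n%:R * a); last by ring.
rewrite (_ : u - n%:R * a = u + a - (n%:R + 1) * a); last by ring.
by ring.
Qed.

End ramp.

Section inverse_shift.
Context {R : realType} (alpha beta : R).
Local Notation f := (skew_shift alpha beta).
Local Notation T1 := (measurableTypeR R).
Local Notation T2 := (T1 * T1)%type.

Definition skew_inv (p : R * R) : R * R := (p.1 - alpha, p.2 - (p.1 - alpha) - beta).
Local Notation g := skew_inv.

Lemma skew_invK p : g (f p) = p.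
Proof. by case: p => x y; rewrite /skew_inv /skew_shift /=; congr pair; ring. Qed.

Lemma skewK_inv p : f (g p) = p.
Proof. by case: p => x y; rewrite /skew_inv /skew_shift /=; congr pair; ring. Qed.

Lemma iter_skew_invK n p : iter n g (iter n f p) = p.
Proof. by elim: n p => // n IH p; rewrite iterSr iterS skew_invK. Qed.

Lemma iter_skewK_inv n p : iter n f (iter n g p) = p.
Proof. by elim: n p => // n IH p; rewrite iterSr iterS skewK_inv. Qed.

Lemma torus_eq_skew_inv p p' : torus_eq p p' -> torus_eq (g p) (g p').
Proof.
move=> [i [j ->]]; exists i, (j - i); rewrite /skew_inv /= intrD mulrNz.
by congr pair; ring.
Qed.

Lemma torus_eq_iter_inv n p p' : torus_eq p p' -> torus_eq (iter n g p) (iter n g p').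
Proof. by move=> H; elim: n => //= n IH; exact: torus_eq_skew_inv. Qed.

Lemma measurable_iter_inv n : measurable_fun [set: T2] (iter n g : T2 -> T2).
Proof.
elim: n => [|n IH]; first exact: measurable_id.
apply: measurableT_comp => //; apply/measurable_fun_pairP; split => /=.
  by apply: measurable_funB.
by apply: measurable_funB => //; apply: measurable_funB => //; apply: measurable_funB.
Qed.

End inverse_shift.

(** * Correlations against products of Fejer means *)

Section correlations.
Context {R : realType} (alpha beta : R) (d : nat) (Phi : R * R -> R).
Local Notation f := (skew_shift alpha beta).
Local Notation T1 := (measurableTypeR R).
Local Notation T2 := (T1 * T1)%type.
Hypothesis irr : irrational alpha.
Hypothesis PP : class_P_deg d Phi.
Hypothesis TP : trig_poly (fiber_mean Phi).
Hypothesis NC : ~ measurable_coboundary f (fiber_centered Phi).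
Variables (m H : R).
Hypothesis (m0 : 0 < m) (Hm : forall p, m <= Phi p <= H).
Local Notation ra := (roof_cos d Phi).
Local Notation rb := (roof_sin d Phi).
Local Notation S n p := (birkhoff f Phi n p).

Lemma measurable_roof : measurable_fun [set: T2] (Phi : T2 -> R).
Proof.
have [d' tp] := TP.
rewrite (_ : (Phi : T2 -> R) = fun p : T2 => fiber_mean Phi p.1 + \sum_(k < d) mode ra rb k p); last first.
  by apply/funext => p; exact: (roof_decomposition PP).
apply: measurable_funD.
  by apply: (measurableT_comp (f := fiber_mean Phi)) => //; exact: continuous_measurable (continuous_trig_poly_deg tp).
by apply: measurable_sum => k; apply: measurable_mode; [exact: continuous_roof_cos PP|exact: continuous_roof_sin PP].
Qed.

Lemma measurable_birkhoff_roof n : measurable_fun [set: T2] (birkhoff f Phi n : T2 -> R).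
Proof.
apply: measurable_sum => i; apply: (measurableT_comp (f := Phi : T2 -> R)); first exact: measurable_roof.
exact: measurable_iter_skew.
Qed.

Lemma roof_ge n p : m * n%:R <= S n p.
Proof. by rewrite -sumr_const_ord; apply: ler_sum => k _; case/andP: (Hm (iter k f p)). Qed.

Lemma roof_increasing n p : S n p <= S n.+1 p.
Proof. by rewrite birkhoffSr lerDl; have /andP[h _] := Hm (iter n f p); apply: le_trans h; exact: ltW. Qed.

(** The count of [roof_window_count] with the end point of the orbit segment fixed instead of its
    starting point: along a backward orbit the sums also increase by at least m. *)
Lemma window_count_inv (t C2 : R) q N : 0 <= C2 ->
  \sum_(n < N) ((`|t - S n (iter n (skew_inv alpha beta) q)| <= C2)%R)%:R <= 2 * C2 / m + 1.
Proof.
move=> C20; rewrite (_ : 2 * C2 = (t + C2) - (t - C2)); last by ring.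
pose s n := S n (iter n (skew_inv alpha beta) q).
have E n : (`|t - s n| <= C2) = (t - C2 <= s n <= t + C2).
  by rewrite ler_norml; apply/andP/andP => -[h1 h2]; split; lra.
under eq_bigr do rewrite E.
apply: window_count => //; first by lra.
move=> n; rewrite /s iterS birkhoffS skewK_inv addrK.
by case/andP: (Hm (skew_inv alpha beta (iter n (skew_inv alpha beta) q))).
Qed.

(** Moving the n-th term by the measure-preserving n-th iterate puts h at a point independent of n;
    the window condition becomes a count along the backward orbit. Errors of g that are small only
    in mean are thus harmless, uniformly in t. *)
Lemma iter_window_mean (h : T2 -> R) (t C2 : R) N : 0 <= C2 ->
  torus_invariant h -> bmeas h -> (forall p, 0 <= h p) ->
  mean haar2 (fun p => \sum_(n < N) h (iter n f p) * ((`|t - S n p| <= C2)%R)%:R) <=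
  (2 * C2 / m + 1) * mean haar2 h.
Proof.
move=> C20 th bh h0; have [mh [B hB]] := bh.
have tPhi : torus_invariant Phi by case: PP.
have B01 (b : bool) : `|b%:R : R| <= 1 by case: b; rewrite ?normr1 ?normr0.
pose G n (q : T2) := h q * ((`|t - S n (iter n (skew_inv alpha beta) q)| <= C2)%R)%:R.
have mind (g : T2 -> R) : measurable_fun [set: T2] g -> measurable_fun [set: T2] (fun p : T2 => ((`|t - g p| <= C2)%R)%:R : R).
  move=> mg; rewrite (_ : (fun _ => _) = \1_[set p : T2 | `|t - g p| <= C2]); last first.
    apply/funext => p; rewrite indicE; congr (nat_of_bool _)%:R.
    by apply/idP/idP; rewrite inE.
  apply: measurable_indic; rewrite -[X in measurable X]setTI; apply: measurable_fun_ler => //.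
  by apply: measurableT_comp => //; exact: measurable_funB.
have bG n : bmeas (G n).
  apply: bmeasM => //; apply: (@bmeas_bound _ _ _ _ 1) => //; apply: mind.
  exact: (measurableT_comp (measurable_birkhoff_roof n) (@measurable_iter_inv _ _ _ n)).
have tG n : torus_invariant (G n).
  move=> p p' pp'; rewrite /G (th _ _ pp').
  rewrite (torus_invariant_birkhoff alpha beta n tPhi (torus_eq_iter_inv alpha beta n pp')) //.
have bGf n : bmeas (fun p : T2 => G n (iter n f p)).
  case: (bG n) => [mG [C HC]]; apply: (@bmeas_bound _ _ _ _ C) => //.
  exact: (measurableT_comp mG (@measurable_iter_skew R alpha beta n)).
have -> : (fun p => \sum_(n < N) h (iter n f p) * ((`|t - S n p| <= C2)%R)%:R) =
    fun p => \sum_(n < N) G n (iter n f p).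
  by apply/funext => p; apply: eq_bigr => n _; rewrite /G iter_skew_invK.
rewrite mean_sum//; under eq_bigr do rewrite (mean_torus_iter _ _ _ (tG _) (bG _)).
rewrite -mean_sum// -meanZ//; apply: mean_le.
- exact: bmeas_sum.
- by apply: bmeasM => //; exact: bmeas_cst.
- move=> q; rewrite -mulr_sumr mulrC; apply: ler_wpM2r => //; exact: window_count_inv.
Qed.

Variables (a1 a2 : R).
Hypothesis (a1P : 0 <= a1 <= 1) (a2P : 0 <= a2 <= 1).

(** For [k] a trapezoid and [g] the indicator of a rectangle this is the correlation of two boxes
    under the flow, the vertical coordinate being already integrated out. *)
Definition corr (g : R * R -> R) (k : R -> R) N t : R :=
  mean haar2 (fun p : T2 => ind a1 p.1 * ind a2 p.2 * \sum_(n < N) g (iter n f p) * k (t - S n p)).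

Lemma bmeas_corr_term (g : T2 -> R) (k : R -> R) (Bk : R) t n : bmeas g -> continuous k -> (forall u, `|k u| <= Bk) ->
  bmeas (fun p : T2 => g (iter n f p) * k (t - S n p)).
Proof.
move=> [mg [B gB]] ck kB; apply: bmeasM.
  apply: (@bmeas_bound _ _ _ _ B) => //.
  exact: (measurableT_comp mg (@measurable_iter_skew R alpha beta n)).
apply: (@bmeas_bound _ _ _ _ Bk) => //.
apply: (measurableT_comp (f := k : T1 -> R)); first exact: continuous_measurable.
by apply: measurable_funB => //; exact: measurable_birkhoff_roof.
Qed.

Lemma bmeas_corr (g : T2 -> R) (k : R -> R) (Bk : R) N t : bmeas g -> continuous k -> (forall u, `|k u| <= Bk) ->
  bmeas (fun p : T2 => ind a1 p.1 * ind a2 p.2 * \sum_(n < N) g (iter n f p) * k (t - S n p)).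
Proof.
move=> bg ck kB; apply: bmeasM.
  by apply: bmeasM; [apply: bmeas_fst; exact: bmeas_ind|apply: bmeas_snd; exact: bmeas_ind].
by apply: bmeas_sum => n; exact: (@bmeas_corr_term g k Bk).
Qed.

(** Over the x with large amplitude at the time N near t / c, [shear] bounds the integral over the
    fiber. The other x have small measure by [amplitude_growth], and there the trivial bound from
    the window count suffices. *)
Lemma corr_shift g1 g2 dd (a b : R) : 0 <= a -> 0 <= b -> trig_poly_deg dd g2 ->
  bmeas (fun p : T2 => g1 p.1 * g2 p.2 : R) ->
  (forall x, `|g1 x| <= 1) -> (forall x, `|g2 x| <= 1) ->
  forall e, 0 < e -> exists T0 : R, forall t N, T0 <= t ->
    `|corr (fun p => g1 p.1 * g2 p.2) (fun u => trapezoid a b u - trapezoid a b (u - a)) N t| <= e.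
Proof.
move=> a0 b0 tg2 bg g1B g2B e e0.
have [c [Cp [Cp0 Hc]]] := roof_birkhoff beta irr PP TP.
have [Bk Ht] := test_fun_trapezoid a0 b0; set k0 := (fun u => _) in Ht *; set kap := (fun u => _) in Ht.
have C20 : 0 <= a + b by exact: addr_ge0.
have cm := roof_mean_ge irr PP Hm Hc; have c0 : 0 < c by exact: lt_le_trans cm.
have e20 : 0 < e / 2 by rewrite divr_gt0.
have [M1 M10 HM1] := shear irr PP m0 Hm Cp0 Hc Ht C20 a2P tg2 g1B g2B e20.
pose C1 := 2 * (a + b) / m + 1.
have C10 : 0 < C1 by rewrite ltr_wpDl// divr_ge0 ?mulr_ge0// ltW.
have [ck0 _ k0s k0B] := Ht.
have Bk0 : 0 <= Bk by apply: le_trans (k0B 0).1.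
have X0 : 0 < C1 * Bk + 1 by rewrite ltr_wpDl// mulr_ge0// ltW.
have eX : 0 < e / 2 / (C1 * Bk + 1) by rewrite divr_gt0.
have [N0 HN0] := amplitude_growth irr PP NC M1 eX.
exists (c * N0.+1%:R) => t Nt tT; pose N := Num.truncn (t / c).
have t0 : 0 <= t by apply: le_trans tT; rewrite mulr_ge0// ltW.
have tN : c * N%:R <= t < c * N.+1%:R.
  have h0 : 0 <= t / c by rewrite divr_ge0// ltW.
  have /andP[h1 h2] := truncn_itv h0; rewrite -/N in h1 h2.
  by rewrite ler_pdivlMr// in h1; rewrite ltr_pdivrMr// in h2; rewrite mulrC h1 mulrC h2.
have NN0 : (N0 <= N)%N.
  have /andP[_ h] := tN; have := le_lt_trans tT h; by rewrite (ltr_pM2l c0) ltr_nat ltnS => /ltnW.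
set G := (fun p : T2 => _) in bg.
have bI := bmeas_corr Nt t bg ck0 (fun u => (k0B u).1).
rewrite /corr mean_haar2//.
set A := [set x : T1 | amplitude alpha beta d ra rb N x <= M1].
have mA : measurable A.
  rewrite -[X in measurable X]setTI; apply: measurable_fun_ler => //.
  by apply: continuous_measurable; apply: continuous_amplitude; [exact: continuous_roof_cos PP|exact: continuous_roof_sin PP].
have b2 : bmeas (fun x : T1 => C1 * Bk * \1_A x : R) by apply: bmeasM; [exact: bmeas_cst|exact: bmeas_indic].
apply: (@le_trans _ _ (mean haar (fun x : T1 => e / 2 + C1 * Bk * \1_A x))); last first.
  rewrite meanD ?mean_cst ?meanZ ?mean_indic//; [|exact: bmeas_indic|exact: bmeas_cst].
  have := HN0 N NN0; rewrite -/A /hr => h.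
  have : C1 * Bk * fine (haar A) <= (C1 * Bk + 1) * (e / 2 / (C1 * Bk + 1)).
    apply: (@le_trans _ _ ((C1 * Bk + 1) * fine (haar A))); last by apply: ler_wpM2l => //; exact: ltW.
    by apply: ler_wpM2r; [exact: hr_ge0|rewrite lerDl].
  rewrite mulrCA divff ?mulr1 ?gt_eqF//; lra.
apply: le_trans (mean_norm _ (bmeas_fiber_mean bI)) _.
apply: mean_le; first exact: bmeas_norm (bmeas_fiber_mean bI).
  by apply: bmeasD => //; exact: bmeas_cst.
move=> x.
have bIx := bmeas_pair2 x bI.
have bsum : bmeas (fun y : T1 => ind a2 y * \sum_(n < Nt) G (iter n f (x, y)) * k0 (t - S n (x, y)) : R).
  apply: bmeasM; first exact: bmeas_ind.
  apply: (@bmeas_pair2 _ (fun p => \sum_(n < Nt) G (iter n f p) * k0 (t - S n p))).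
  by apply: bmeas_sum => n; apply: (@bmeas_corr_term G k0 Bk t n bg ck0) => w; exact: (k0B w).1.
rewrite (_ : (fun y => _) = fun y => ind a1 x * (ind a2 y * \sum_(n < Nt) G (iter n f (x, y)) * k0 (t - S n (x, y)))); last first.
  by apply/funext => y; rewrite mulrA.
rewrite meanZ// normrM; apply: (@le_trans _ _ `|mean haar (fun y => ind a2 y * \sum_(n < Nt) G (iter n f (x, y)) * k0 (t - S n (x, y)))|).
  by rewrite ler_piMl// ind_norm.
rewrite indicE; have [Ax|nAx] := pselect (A x); last first.
  rewrite memNset//= mulr0 addr0; apply: HM1 tN _.
  by rewrite leNgt; apply/negP => /ltW.
rewrite mem_set//= mulr1; apply: ler_wpDl; first exact: ltW.
apply: mean_norm_le => // y; rewrite normrM.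
apply: (@le_trans _ _ `|\sum_(n < Nt) G (iter n f (x, y)) * k0 (t - S n (x, y))|).
  by rewrite ler_piMl// ind_norm.
apply: (@sum_window _ _ (fun n => `|t - S n (x, y)| <= a + b) (fun n => G (iter n f (x, y)) * k0 (t - S n (x, y)))) => //.
- exact: (roof_window_count alpha beta m0 Hm).
- move=> n _ _; rewrite normrM -[leRHS]mul1r; apply: ler_pM => //.
    by rewrite /G normrM -[leRHS]mul1r; apply: ler_pM.
  exact: (k0B _).1.
- by move=> n; rewrite -ltNge => /k0s[-> _]; rewrite mulr0.
Qed.

(* The ramps select the times at which the sums of Phi lie in a window of length
   L; over these times [g - (mu / c) * Phi] averages out. *)
Lemma ramp_sum_mean (g : R * R -> R) (mu c a b : R) : unif_mean f g mu -> unif_mean f Phi c -> 0 < c ->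
  (forall p, `|g p| <= 1) -> 0 <= a -> 0 <= b ->
  forall e, 0 < e -> exists2 C : R, 0 <= C & forall (L t : R) N p, b <= L -> L <= t -> t + a < m * N%:R ->
    `|\sum_(n < N) g (iter n f p) * (ramp b (t - S n p + a) - ramp b (t - S n p + a - L)) - b * (mu / c) * L|
    <= e * L + C.
Proof.
move=> ug uP c0 g1 a0 b0 e e0.
pose w p := g p + - (mu / c) * Phi p.
have uw : unif_mean f w 0.
  have := unif_meanD ug (unif_meanZ (- (mu / c)) uP).
  rewrite (_ : mu + - (mu / c) * c = 0)//; by field; rewrite gt_eqF.
have H0 : m <= H by have /andP[h1 h2] := Hm (0, 0); exact: le_trans h2.
pose Bw := 1 + `|mu / c| * H.
have PhiH p : `|Phi p| <= H.
  by have /andP[h1 h2] := Hm p; rewrite ger0_norm//; apply: le_trans h1; exact: ltW.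
have HP : 0 <= H by apply: le_trans H0; exact: ltW.
have wB p : `|w p| <= Bw.
  apply: le_trans (ler_normD _ _) _; apply: lerD => //.
  by rewrite normrM normrN; apply: ler_wpM2l.
have e1 : 0 < e * m / (b + 1) by rewrite divr_gt0 ?mulr_gt0// ltr_wpDl.
have [Ce Ce0 HCe] := unif_mean_affine uw wB e1.
pose Cw := b / m + 1; have Cw0 : 0 <= Cw by rewrite addr_ge0// divr_ge0// ltW.
pose C := e * H + b * (Ce + `|mu / c| * (H + b)) + b * (2 * Cw).
have C0 : 0 <= C.
  apply: addr_ge0; last by apply: mulr_ge0 => //; exact: mulr_ge0.
  apply: addr_ge0; first by apply: mulr_ge0 => //; exact: ltW.
  apply: mulr_ge0 => //; apply: addr_ge0 => //; apply: mulr_ge0 => //; exact: addr_ge0.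
exists C => // L t N p bL Lt tN.
(* The difference of ramps equals b when the sum of Phi lies between u and v, and takes intermediate
   values only within b outside these ends. *)
pose u := t - L + a; pose v := t - b + a.
have uv : u <= v by rewrite /u /v; lra.
have sm n : S n p <= S n.+1 p by exact: roof_increasing.
have [k1 k1N E1] := @initial_segment R (fun n => S n p) (fun x => x < u) N sm (fun x y xy yu => le_lt_trans xy yu).
have [k2 k2N E2] := @initial_segment R (fun n => S n p) (fun x => x <= v) N sm (fun x y xy yu => le_trans xy yu).
have SN : v < S N p.
  by apply: lt_le_trans (roof_ge N p); apply: le_lt_trans tN; rewrite /v; lra.
have k12 : (k1 <= k2)%N.
  rewrite leqNgt; apply/negP => k21.
  have k2N' : (k2 < N)%N by exact: leq_trans k1N.
  have h1 := E1 _ k2N'; have h2 := E2 _ k2N'; rewrite k21 in h1; rewrite ltnn in h2.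
  by move/negbT: h2; rewrite -ltNge => h2; lra.
have In n : (n < N)%N -> (k1 <= n < k2)%N = (u <= S n p <= v).
  by move=> nN; rewrite -E2// leqNgt -E1// -leNgt.
have Sk2v : v < S k2 p.
  move: k2N; rewrite leq_eqVlt => /predU1P[->//|k2N].
  by rewrite ltNge E2// ltnn.
have Sk2 : S k2 p <= v + H.
  case: k2 E2 k12 In Sk2v k2N => [|k2'] E2 k12 In Sk2v k2N; first by rewrite birkhoff0; rewrite /v; lra.
  have h := E2 _ k2N; rewrite ltnSn in h; rewrite birkhoffSr; have /andP[_ h2] := Hm (iter k2' f p); lra.
have Sk1u : u <= S k1 p.
  have := k1N; rewrite leq_eqVlt => /predU1P[->|k1N']; first by apply: ltW; exact: le_lt_trans SN.
  by rewrite leNgt E1// ltnn.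
have Sk1 : S k1 p <= u + H.
  case: k1 E1 k12 In Sk1u k1N => [|k1'] E1 k12 In Sk1u k1N; first by rewrite birkhoff0; rewrite /u; lra.
  have h := E1 _ k1N; rewrite ltnSn in h; rewrite birkhoffSr; have /andP[_ h2] := Hm (iter k1' f p); lra.
pose K n := ramp b (t - S n p + a) - ramp b (t - S n p + a - L).
pose one n : R := ((k1 <= n < k2)%N)%:R.
have Kn n : (n < N)%N -> `|K n - b * one n| <= b * (((v <= S n p <= v + b)%R)%:R + ((u - b <= S n p <= u)%R)%:R).
  move=> nN; rewrite /one In// /K.
  have /andP[q1 q2] := ramp_bounds (t - S n p + a) b0; have /andP[q3 q4] := ramp_bounds (t - S n p + a - L) b0.
  have [vS|Sv] := ltP v (S n p).
    rewrite (@ramp_lo _ b (t - S n p + a - L)) ?subr0//; last by rewrite /v in vS; lra.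
    rewrite andbF mulr0 subr0 ger0_norm//; have [Sb|bS] := leP (S n p) (v + b).
      rewrite andbT (_ : (v <= S n p) = true); last exact: ltW.
      apply: (le_trans q2); rewrite (_ : b * _ = b + b * ((u - b <= S n p <= u)%R)%:R); last by rewrite mulrDr mulr1.
      by rewrite lerDl mulr_ge0.
    by rewrite ramp_lo//; [rewrite mulr_ge0// addr_ge0|rewrite /v in bS; lra].
  rewrite (@ramp_hi _ b (t - S n p + a)) ?andbT//; last by rewrite /v in Sv; lra.
  have [uS|Su] := leP u (S n p).
    rewrite ramp_lo//; last by rewrite /u in uS; lra.
    by rewrite mulr1 subr0 subrr normr0 mulr_ge0// addr_ge0.
  rewrite mulr0 subr0 ger0_norm ?subr_ge0//; have [Sb|bS] := leP (u - b) (S n p).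
    rewrite (_ : (S n p <= u) = true); last exact: ltW.
    rewrite (_ : b * _ = b * ((v <= S n p <= v + b)%R)%:R + b); last by rewrite mulrDr mulr1.
    by apply: ler_wpDl; [rewrite mulr_ge0|lra].
  by rewrite ramp_hi//; [rewrite subrr mulr_ge0// addr_ge0|rewrite /u in bS; lra].
have wc x : \sum_(n < N) ((x <= S n p <= x + b)%R)%:R <= Cw.
  rewrite /Cw -{2}(addrK x b) (addrC b).
  apply: (@window_count _ (fun n => S n p)) => //; first by rewrite lerDl.
  by move=> n; case/andP: (roof_step alpha beta Hm n p).
pose k := (k2 - k1)%N.
have Pk : birkhoff f Phi k (iter k1 f p) = S k2 p - S k1 p.
  by rewrite -(subnKC k12) birkhoff_add addrC addKr.
have S1 : \sum_(n < N) g (iter n f p) * one n = birkhoff f w k (iter k1 f p) + (mu / c) * (S k2 p - S k1 p).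
  rewrite fine_window_sum// -Pk /birkhoff mulr_sumr -big_split /=; apply: eq_bigr => n _.
  by rewrite /w; ring.
have d1 : `|\sum_(n < N) g (iter n f p) * K n - b * \sum_(n < N) g (iter n f p) * one n| <= b * (2 * Cw).
  rewrite mulr_sumr -sumrB; apply: le_trans (ler_norm_sum _ _ _) _.
  apply: (@le_trans _ _ (\sum_(n < N) b * (((v <= S n p <= v + b)%R)%:R + ((u - b <= S n p <= u)%R)%:R))).
    apply: ler_sum => n _; rewrite mulrCA -mulrBr normrM -[leRHS]mul1r.
    by apply: ler_pM => //; exact: Kn.
  rewrite -mulr_sumr big_split /=; apply: ler_wpM2l => //.
  have := wc v; have := wc (u - b); rewrite subrK; lra.
have wk := HCe k (iter k1 f p); rewrite mul0r subr0 in wk.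
have mk : m * k%:R <= L + H.
  apply: (@le_trans _ _ (S k2 p - S k1 p)); first by rewrite -Pk; exact: roof_ge.
  by move: Sk2 Sk1u; rewrite /u /v; lra.
have bek : b * (e * m / (b + 1) * k%:R) <= e * (L + H).
  apply: (@le_trans _ _ (e * (m * k%:R))); last by apply: ler_wpM2l => //; exact: ltW.
  rewrite (_ : b * _ = b / (b + 1) * (e * (m * k%:R))); last by field; rewrite gt_eqF// ltr_wpDl.
  apply: ler_piMl.
    by apply: mulr_ge0; [exact: ltW|apply: mulr_ge0 => //; exact: ltW].
  have b1 : 0 < b + 1 by rewrite ltr_wpDl.
  by rewrite (ler_pdivrMr _ _ b1) mul1r lerDl.
have d2 : `|b * birkhoff f w k (iter k1 f p)| <= e * (L + H) + b * Ce.
  rewrite normrM (ger0_norm b0); apply: (@le_trans _ _ (b * (e * m / (b + 1) * k%:R + Ce))); first exact: ler_wpM2l.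
  by rewrite mulrDr lerD2r.
have d3 : `|b * ((mu / c) * (S k2 p - S k1 p - L))| <= b * (`|mu / c| * (H + b)).
  rewrite normrM (ger0_norm b0) normrM; apply: ler_wpM2l => //; apply: ler_wpM2l => //.
  by rewrite ler_norml; apply/andP; split; move: Sk2 Sk1 Sk1u Sk2v; rewrite /u /v; lra.
rewrite (_ : \sum_(n < N) _ - _ = (\sum_(n < N) g (iter n f p) * K n - b * \sum_(n < N) g (iter n f p) * one n) +
  (b * birkhoff f w k (iter k1 f p) + b * ((mu / c) * (S k2 p - S k1 p - L)))); last by rewrite S1; ring.
apply: le_trans (ler_normD _ _) _; have := ler_normD (b * birkhoff f w k (iter k1 f p)) (b * ((mu / c) * (S k2 p - S k1 p - L))).
by rewrite /C; lra.
Qed.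

(* Shifts of [t] by multiples of [a] tile a long window and change the
   correlation negligibly, so it is close to its average over the window. *)
Lemma corr_limit g1 g2 dd (a b mu c : R) : 0 < a -> 0 <= b -> trig_poly_deg dd g2 ->
  bmeas (fun p : T2 => g1 p.1 * g2 p.2 : R) ->
  (forall x, `|g1 x| <= 1) -> (forall x, `|g2 x| <= 1) ->
  unif_mean f (fun p => g1 p.1 * g2 p.2) mu -> unif_mean f Phi c -> 0 < c ->
  forall e, 0 < e -> exists T0 : R, forall t N, T0 <= t -> t + a < m * N%:R ->
    `|corr (fun p => g1 p.1 * g2 p.2) (trapezoid a b) N t -
      mean haar2 (fun p : T2 => ind a1 p.1 * ind a2 p.2) * (a * b * (mu / c))| <= e.
Proof.
move=> a0 b0 tg2; set G := (fun p : T2 => _) => bG g1B g2B uG uP c0 e e0.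
have a00 := ltW a0.
have GB p : `|G p| <= 1 by rewrite /G normrM -[leRHS]mul1r; apply: ler_pM.
have e1 : 0 < e / (3 * a) by rewrite divr_gt0// mulr_gt0.
have [C C0 HC] := ramp_sum_mean uG uP c0 GB a00 b0 e1.
(* Enough tiles for the constant error C to be at most e / 3 per tile, and for the window n * a to
   be at least b. *)
pose n := (Num.truncn (3 * C / e) + Num.truncn (b / a)).+1.
have n0 : 0 < n%:R :> R by rewrite ltr0n.
have nC : C <= n%:R * (e / 3).
  have := truncnS_gt (3 * C / e); rewrite ltr_pdivrMr// => h.
  have : (Num.truncn (3 * C / e)).+1%:R <= n%:R :> R by rewrite ler_nat /n ltnS leq_addr.
  by move=> /(ler_wpM2r (ltW e0)); lra.
have nb : b <= n%:R * a.
  have := truncnS_gt (b / a); rewrite ltr_pdivrMr// => h.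
  have : (Num.truncn (b / a)).+1%:R <= n%:R :> R by rewrite ler_nat /n ltnS leq_addl.
  by move=> /(ler_wpM2r a00); lra.
have e2 : 0 < e / (3 * n%:R) by rewrite divr_gt0// mulr_gt0.
have [T0 HT] := corr_shift a00 b0 tg2 bG g1B g2B e2.
exists (`|T0| + n%:R * a) => t N tT tN.
have T0t : T0 + n%:R * a <= t by apply: le_trans tT; rewrite lerD2r ler_norm.
have nt : n%:R * a <= t by apply: le_trans tT; rewrite lerDr.
have ck := @continuous_trapezoid R a b.
have kB u : `|trapezoid a b u| <= a by have /andP[h1 h2] := trapezoid_bounds u a00 b0; rewrite ger0_norm.
pose D i := corr G (trapezoid a b) N (t - i%:R * a).
have bD s : bmeas (fun p : T2 => ind a1 p.1 * ind a2 p.2 * \sum_(n < N) G (iter n f p) * trapezoid a b (s - S n p)).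
  exact: bmeas_corr.
have stepD i : (i < n)%N -> `|D i - D i.+1| <= e / (3 * n%:R).
  move=> ilt; have Ti : T0 <= t - i%:R * a.
    have : i%:R * a <= n%:R * a by apply: ler_wpM2r => //; rewrite ler_nat ltnW.
    lra.
  have := HT _ N Ti; rewrite (_ : corr _ _ _ _ = D i - D i.+1)//.
  rewrite /D /corr -meanB//; congr mean; apply/funext => p.
  rewrite -mulrBr -sumrB; congr (_ * _); apply: eq_bigr => j _.
  rewrite -mulrBr; congr (_ * (_ - trapezoid _ _ _)); rewrite -natr1; ring.
have D0i i : (i <= n)%N -> `|D i - D 0%N| <= i%:R * (e / (3 * n%:R)).
  elim: i => [_|i IH ilt]; first by rewrite subrr normr0 mul0r.
  rewrite (_ : _ - _ = (D i - D 0%N) - (D i - D i.+1)); last by ring.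
  apply: le_trans (ler_normB _ _) _; rewrite -natr1 mulrDl mul1r.
  by apply: lerD; [exact/IH/ltnW|exact: stepD].
have sumD : `|\sum_(i < n) D i - n%:R * D 0%N| <= n%:R * (e / 3).
  rewrite mulrC -(sumr_const_ord n (D 0%N)) -sumrB; apply: le_trans (ler_norm_sum _ _ _) _.
  rewrite mulrC -sumr_const_ord; apply: ler_sum => i _; apply: le_trans (D0i i (ltnW (ltn_ord i))) _.
  apply: (@le_trans _ _ (n%:R * (e / (3 * n%:R)))).
    by apply: ler_wpM2r; [exact: ltW|rewrite ler_nat ltnW].
  by rewrite le_eqVlt; apply/orP; left; apply/eqP; field; rewrite gt_eqF.
pose I2 (p : T2) : R := ind a1 p.1 * ind a2 p.2.
have bI2 : bmeas I2 by apply: bmeasM; [apply: bmeas_fst; exact: bmeas_ind|apply: bmeas_snd; exact: bmeas_ind].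
pose L := n%:R * a.
have main : `|\sum_(i < n) D i - mean haar2 I2 * (b * (mu / c) * L)| <= e / (3 * a) * L + C.
  rewrite /D /corr -mean_sum//.
  rewrite mulrC -meanZ//; apply: (@le_trans _ _ (mean haar2 (fun _ : T2 => e / (3 * a) * L + C))); last by rewrite mean_cst.
  apply: mean_dist.
  - exact: bmeas_sum.
  - by apply: bmeasM => //; exact: bmeas_cst.
  - exact: bmeas_cst.
  - move=> p; rewrite -mulr_sumr -/(I2 p) mulrC -mulrBl normrM.
    have I1 : `|I2 p| <= 1 by rewrite /I2 normrM -[leRHS]mul1r; apply: ler_pM => //; exact: ind_norm.
    apply: (@le_trans _ _ (e / (3 * a) * L + C)) => //.
    rewrite -[leRHS]mulr1; apply: ler_pM => //.
    rewrite exchange_big /=; under eq_bigr do rewrite -mulr_sumr.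
    have := HC L t N p nb nt tN; rewrite (_ : \sum_(n < N) _ = \sum_(i < N) G (iter i f p) *
        \sum_(i0 < n) trapezoid a b (t - i0%:R * a - S i p))//.
    apply: eq_bigr => j _; congr (_ * _); rewrite /L -trapezoid_tiling; apply: eq_bigr => i _.
    by congr trapezoid; ring.
have D0E : D 0%N = corr G (trapezoid a b) N t by rewrite /D mul0r subr0.
rewrite -D0E -/I2 -(ler_pM2l n0) -{1}(gtr0_norm n0) -normrM mulrBr.
rewrite (_ : n%:R * D 0%N - _ = (\sum_(i < n) D i - mean haar2 I2 * (b * (mu / c) * L)) -
  (\sum_(i < n) D i - n%:R * D 0%N)); last by rewrite /L; ring.
apply: le_trans (ler_normB _ _) _.
have : e / (3 * a) * L = n%:R * (e / 3) by rewrite /L; field; rewrite gt_eqF.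
by move=> E; move: main sumD; rewrite E; lra.
Qed.

End correlations.

(** * Correlations of indicators of boxes *)

Section quadrant_correlations.
Context {R : realType} (alpha beta : R) (d : nat) (Phi : R * R -> R).
Local Notation f := (skew_shift alpha beta).
Local Notation T1 := (measurableTypeR R).
Local Notation T2 := (T1 * T1)%type.
Hypothesis irr : irrational alpha.
Hypothesis PP : class_P_deg d Phi.
Hypothesis TP : trig_poly (fiber_mean Phi).
Hypothesis NC : ~ measurable_coboundary f (fiber_centered Phi).
Variables (m H : R).
Hypothesis (m0 : 0 < m) (Hm : forall p, m <= Phi p <= H).
Local Notation S n p := (birkhoff f Phi n p).

Lemma bmeas_roof : bmeas (Phi : T2 -> R).
Proof.
apply: (@bmeas_bound _ _ _ _ H); first exact: measurable_roof PP TP.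
move=> p; have /andP[h1 h2] := Hm p; rewrite ger0_norm//; apply: le_trans h1; exact: ltW.
Qed.

Lemma roof_unif_mean : exists2 c : R, 0 < c & unif_mean f Phi c.
Proof.
have [d' [a [b E]]] := TP; have [Cp HC] := trig_poly_birkhoff_bounded beta irr E.
have Cp0 : 0 <= Cp by apply: le_trans (HC 0%N (0, 0)).
have u0 : unif_mean f (fun p => fiber_mean Phi p.1 - a 0%N) 0.
  move=> e e0; exists (Num.truncn (Cp / e)).+1 => n nN p; rewrite mul0r subr0; apply: le_trans (HC n p) _.
  have := truncnS_gt (Cp / e); rewrite ltr_pdivrMr// => /ltW h; apply: (le_trans h).
  by rewrite mulrC; apply: ler_wpM2l; [exact: ltW|rewrite ler_nat].
have uP : unif_mean f Phi (a 0%N).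
  have := unif_meanD (unif_meanD u0 (unif_mean_roof_mode beta irr PP)) (unif_mean_cst f (a 0%N)).
  rewrite !add0r; set F := (fun p => _); rewrite (_ : F = Phi)//; apply/funext => p.
  by rewrite /F (roof_decomposition PP); ring.
exists (a 0%N) => //; apply: (lt_le_trans m0); apply/ler_addgt0Pr => e e0.
have [n0 Hn] := uP e e0.
have n1 : (n0 <= n0.+1)%N by [].
have := Hn _ n1 (0, 0); rewrite ler_norml => /andP[_ h].
have h2 : m * n0.+1%:R <= S n0.+1 (0, 0) by exact: roof_ge.
have nn : 0 < n0.+1%:R :> R by rewrite ltr0n.
by rewrite -(ler_pM2r nn); lra.
Qed.

Lemma roof_mean_haar2 c : unif_mean f Phi c -> mean haar2 (Phi : T2 -> R) = c.
Proof.
move=> uP; have mT : measurable [set: T2] by [].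
have tP : torus_invariant Phi by case: PP.
have := invariant_mean mT (fun _ _ _ => iff_refl _) (fun _ => iff_refl _) tP bmeas_roof uP.
have -> : (\1_[set: T2] : T2 -> R) = fun _ => 1 by apply/funext => p; rewrite indicT.
by rewrite mean_cst mulr1 => <-; congr mean; apply/funext => p; rewrite mul1r.
Qed.

(** Passage from Fejer products to indicators, which are close only in mean; [iter_window_mean]
    keeps the error uniform in t. For a = 0 the trapezoid vanishes and both correlation and limit
    are 0. *)
Lemma quadrant_corr a1 a2 b1 b2 (a b c : R) : 0 <= a1 <= 1 -> 0 <= a2 <= 1 -> 0 <= b1 <= 1 -> 0 <= b2 <= 1 ->
  0 <= a -> 0 <= b -> 0 < c -> unif_mean f Phi c ->
  forall e : R, 0 < e -> exists T0 : R, forall t N, T0 <= t -> t + a < m * N%:R ->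
    `|corr alpha beta Phi a1 a2 (fun p => ind b1 p.1 * ind b2 p.2) (trapezoid a b) N t -
      mean haar2 (fun p : T2 => ind a1 p.1 * ind a2 p.2) *
      (a * b * (mean haar2 (fun p : T2 => ind b1 p.1 * ind b2 p.2) / c))| <= e.
Proof.
move=> a1P a2P b1P b2P; rewrite le_eqVlt => /predU1P[<-|a0] b0 c0 uP e e0.
  exists 0 => t N _ _; rewrite mul0r mul0r mulr0 subr0 /corr.
  rewrite (_ : (fun p => _) = fun _ => 0); first by rewrite mean_cst normr0 ltW.
  apply/funext => p; rewrite big1 ?mulr0// => n _.
  have /andP[h1 h2] := trapezoid_bounds (t - S n p) (lexx 0) b0.
  by rewrite (@le_anti _ _ (trapezoid 0 b (t - S n p)) 0) ?mulr0// h2.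
have a00 := ltW a0; have ab0 : 0 <= a + b by exact: addr_ge0.
pose I2 x1 x2 (p : T2) : R := ind x1 p.1 * ind x2 p.2.
have bI2 x1 x2 : bmeas (I2 x1 x2) by apply: bmeasM; [apply: bmeas_fst; exact: bmeas_ind|apply: bmeas_snd; exact: bmeas_ind].
have I2B x1 x2 p : `|I2 x1 x2 p| <= 1 by rewrite /I2 normrM -[leRHS]mul1r; apply: ler_pM => //; exact: ind_norm.
(* The total factor by which an error in mean enters: the first term in the correlation, the second
   in its limit. *)
pose W := a * (2 * (a + b) / m + 1) + a * b / c.
have W0 : 0 <= W.
  apply: addr_ge0; last by rewrite divr_ge0 ?mulr_ge0// ltW.
  by rewrite mulr_ge0// addr_ge0// divr_ge0 ?mulr_ge0// ltW.
have W1 : 0 < W + 1 by rewrite ltr_wpDl.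
have e1 : 0 < e / 2 by rewrite divr_gt0.
have e2 : 0 < e / 2 / (W + 1) by rewrite divr_gt0.
have [m1 [m2 [f1 f2 HI]]] := quadrant_fejer_mean b1P b2P e2.
have bG := bmeas_fejer2 f1 f2.
have tG := torus_invariant_fejer2 m1 m2 (ind b1) (ind b2).
have [mu uG] := unif_mean_fejer_fejer beta irr (ind b1) m1 (ind b2) m2.
have mT : measurable [set: T2] by [].
have HT := invariant_mean mT (fun _ _ _ => iff_refl _) (fun _ => iff_refl _) tG bG uG.
have T1E : (\1_[set: T2] : T2 -> R) = fun _ => 1 by apply/funext => p; rewrite indicT.
rewrite T1E mean_cst mulr1 in HT.
have [T0 HT0] := corr_limit irr PP TP NC m0 Hm a1 a2P a0 b0 (fejer_trig_poly_deg (ind b2) m2) bG f1 f2 uG uP c0 e1.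
set G := (fun p : T2 => _) in bG HT HI uG tG HT0.
have {}HT : mean haar2 G = mu by rewrite -HT; congr mean; apply/funext => p; rewrite mul1r.
exists T0 => t N tT tN; have {}HT0 := HT0 t N tT tN.
pose h (p : T2) := `|I2 b1 b2 p - G p|.
have bh : bmeas h by exact/bmeas_norm/bmeasB.
have h0 p : 0 <= h p by exact: normr_ge0.
have th : torus_invariant h by move=> p p' pp'; rewrite /h /I2 (torus_invariant_quadrant b1 b2 pp') (tG _ _ pp').
have ck := @continuous_trapezoid R a b.
have kB u : `|trapezoid a b u| <= a by have /andP[h1 h2] := trapezoid_bounds u a00 b0; rewrite ger0_norm.
have d1 : `|corr alpha beta Phi a1 a2 (I2 b1 b2) (trapezoid a b) N t - corr alpha beta Phi a1 a2 G (trapezoid a b) N t| <=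
    a * ((2 * (a + b) / m + 1) * (e / 2 / (W + 1))).
  apply: (@le_trans _ _ (a * mean haar2 (fun p => \sum_(n < N) h (iter n f p) * ((`|t - S n p| <= a + b)%R)%:R))); last first.
    apply: ler_wpM2l => //; apply: le_trans (iter_window_mean alpha beta PP TP m0 Hm t N ab0 th bh h0) _.
    by apply: ler_wpM2l => //; rewrite addr_ge0// divr_ge0 ?mulr_ge0// ltW.
  have bs : bmeas (fun p : T2 => \sum_(n < N) h (iter n f p) * ((`|t - S n p| <= a + b)%R)%:R : R).
    apply: bmeas_sum => n; have [mh [B hB]] := bh; apply: bmeasM.
      apply: (@bmeas_bound _ _ _ _ B) => //; exact: (measurableT_comp mh (@measurable_iter_skew R alpha beta n)).
    rewrite (_ : (fun _ => _) = \1_[set p : T2 | `|t - S n p| <= a + b]); last first.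
      by apply/funext => p; rewrite indicE; congr (nat_of_bool _)%:R; apply/idP/idP; rewrite inE.
    apply: bmeas_indic; rewrite -[X in measurable X]setTI; apply: measurable_fun_ler => //.
    by apply: measurableT_comp => //; apply: measurable_funB => //; exact: (measurable_birkhoff_roof alpha beta PP TP n).
  rewrite -meanZ//; apply: mean_dist.
  - exact: (bmeas_corr alpha beta PP TP _ _ _ _ (bI2 b1 b2) ck kB).
  - exact: (bmeas_corr alpha beta PP TP _ _ _ _ bG ck kB).
  - by apply: bmeasM => //; exact: bmeas_cst.
  - move=> p; rewrite -mulrBr normrM; apply: (@le_trans _ _ `|\sum_(n < N) I2 b1 b2 (iter n f p) * trapezoid a b (t - S n p) -
        \sum_(n < N) G (iter n f p) * trapezoid a b (t - S n p)|).
      by rewrite ler_piMl//; exact: I2B.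
    rewrite -sumrB mulr_sumr; apply: le_trans (ler_norm_sum _ _ _) _; apply: ler_sum => n _.
    rewrite -mulrBl normrM mulrCA; apply: ler_wpM2l => //.
    have [hh|hh] := boolP (`|t - S n p| <= a + b); first by rewrite mulr1.
    rewrite mulr0; move: hh; rewrite -ltNge lter_normr => /orP[hh|hh].
      by rewrite (@trapezoid_hi _ a b _ a00 b0 _).1 ?normr0//; lra.
    by rewrite (@trapezoid_lo _ a b _ a00 b0 _).1 ?normr0//; lra.
have d2 : `|mean haar2 (I2 b1 b2) - mu| <= e / 2 / (W + 1).
  by apply: le_trans HI; rewrite -HT; apply: mean_dist.
have I1 : `|mean haar2 (I2 a1 a2)| <= 1 by apply: mean_norm_le.
have d3 : `|mean haar2 (I2 a1 a2) * (a * b * (mean haar2 (I2 b1 b2) / c)) - mean haar2 (I2 a1 a2) * (a * b * (mu / c))| <=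
    a * b / c * (e / 2 / (W + 1)).
  rewrite (_ : _ - _ = mean haar2 (I2 a1 a2) * (a * b / c * (mean haar2 (I2 b1 b2) - mu))); last by ring.
  have abc : 0 <= a * b / c by rewrite divr_ge0 ?mulr_ge0// ltW.
  rewrite normrM -[leRHS]mul1r; apply: ler_pM => //.
  by rewrite normrM (ger0_norm abc); apply: ler_wpM2l.
rewrite -/(I2 a1 a2) -/(I2 b1 b2).
set X := corr _ _ _ _ _ (I2 b1 b2) _ _ _ in d1 *; set Y := corr _ _ _ _ _ G _ _ _ in d1 HT0.
rewrite -/(I2 a1 a2) in HT0.
set U := mean haar2 (I2 a1 a2) * (a * b * (mean _ _ / c)) in d3 *.
set V := mean haar2 (I2 a1 a2) * (a * b * (mu / c)) in d3 HT0.
have q : a * ((2 * (a + b) / m + 1) * (e / 2 / (W + 1))) + a * b / c * (e / 2 / (W + 1)) <= e / 2.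
  rewrite mulrA -mulrDl -/W mulrCA; apply: ler_piMr; first exact: ltW.
  by rewrite (ler_pdivrMr _ _ W1) mul1r lerDl.
rewrite (_ : X - _ = (X - Y) + (Y - V) - (U - V)); last by ring.
by apply: le_trans (ler_normB _ _) _; have := ler_normD (X - Y) (Y - V); move: HT0 d1 d3 q; lra.
Qed.

End quadrant_correlations.

(** * Mixing of the suspension *)

Lemma sum_measure_le d (T : measurableType d) (R : realType) (m : {measure set T -> \bar R})
    (N : nat) (X : 'I_N -> set T) (Y : set T) (C : R) :
  (forall n, measurable (X n)) -> measurable Y -> (m Y < +oo)%E -> (forall n, (m (X n) < +oo)%E) -> 0 <= C ->
  (forall q, \sum_(n < N) \1_(X n) q <= C * \1_Y q) ->
  \sum_(n < N) fine (m (X n)) <= C * fine (m Y).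
Proof.
move=> mX mY fY fX C0 H.
have fYn : m Y \is a fin_num by rewrite ge0_fin_numE.
rewrite -lee_fin EFinM fineK// -sumEFin; under eq_bigr do rewrite fineK ?ge0_fin_numE//.
rewrite (eq_bigr (fun n => \int[m]_x (\1_(X n) x)%:E)%E); last by move=> n _; rewrite integral_indic// setIT.
have -> : (m Y = \int[m]_x (\1_Y x)%:E)%E by rewrite integral_indic// setIT.
rewrite -ge0_integral_sum//; last first.
  by move=> n; apply/measurable_EFinP; exact: measurable_indic.
rewrite -ge0_integralZl//; last by apply/measurable_EFinP; exact: measurable_indic.
apply: ge0_le_integral => //.
- by move=> x _; apply: sume_ge0.
- apply: emeasurable_sum => n; apply/measurable_EFinP; exact: measurable_indic.
- by apply: measurable_funeM; apply/measurable_EFinP; exact: measurable_indic.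
- by move=> q _; rewrite sumEFin -EFinM lee_fin.
Qed.

Section windows.
Context {R : realType}.
Local Notation T1 := (measurableTypeR R).

Lemma lam_window (a b u : R) : 0 <= a -> 0 <= b ->
  lam [set z : T1 | 0 <= z < a /\ 0 <= z + u < b] = (trapezoid a b u)%:E.
Proof.
move=> a0 b0.
have [ab|ab] := leP (Num.max 0 (- u)) (Num.min a (b - u)).
  rewrite (_ : [set z | _] = [set` Interval (BSide true (Num.max 0 (- u))) (BSide true (Num.min a (b - u)))]); last first.
    apply/seteqP; split => z /=; rewrite in_itv /= ge_max lt_min.
      by move=> [/andP[-> ->] /andP[h1 h2]]; apply/andP; split; lra.
    by move=> /andP[/andP[h1 h2] /andP[h3 h4]]; split; apply/andP; split; lra.
  apply: (eq_trans (lam_itv true true ab)); congr EFin; rewrite /trapezoid.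
  move: ab; rewrite le_min !ge_max => /andP[/andP[h1 h2] /andP[h3 h4]].
  have -> : pp (u + a) = u + a by case: (ppE (u + a)) => -[? ->]; lra.
  have -> : pp (u - b) = 0 by case: (ppE (u - b)) => -[? ->]; lra.
  case: (ppE u) => -[k2 ->]; case: (ppE (u + a - b)) => -[k3 ->];
  case: (leP 0 (- u)) => k5; case: (leP a (b - u)) => k6; lra.
rewrite (_ : [set z | _] = set0); last first.
  apply/seteqP; split => z //= [/andP[h1 h2] /andP[h3 h4]]; move: ab; rewrite gt_min !lt_max => /orP[/orP[]|/orP[]]; lra.
rewrite measure0; congr EFin; move: ab; rewrite gt_min !lt_max => /orP[/orP[]|/orP[]] h1; [lra| | |lra].
  by rewrite (@trapezoid_lo _ a b u a0 b0 _).1//; lra.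
by rewrite (@trapezoid_hi _ a b u a0 b0 _).1//; lra.
Qed.

End windows.

Section box.
Context {R : realType}.
Local Notation T1 := (measurableTypeR R).
Local Notation T2 := (T1 * T1)%type.
Local Notation T3 := (T1 * T1 * T1)%type.
Variable H : R.
Hypothesis H0 : 0 <= H.

Definition box : set T3 := (unit_square : set T2) `*` `[0, H[%classic.

Lemma measurable_box : measurable box.
Proof. by apply: measurableX; [exact: measurable_unit_square|exact: measurable_itv]. Qed.

Lemma haar3_unit_square (A : set T3) : measurable A -> haar3 (A `&` (unit_square `*` setT)) = haar3 A.
Proof.
move=> mA; rewrite !haar3_leb3//; first by rewrite -setIA setIid.
by apply: measurableI => //; apply: measurableX => //; exact: measurable_unit_square.
Qed.

Definition quad (x1 x2 x3 : R) : set T3 := (`]-oo, x1[ `*` `]-oo, x2[) `*` `]-oo, x3[.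
Definition height x3 : R := Num.min H (Num.max 0 x3).

Lemma heightP x : 0 <= height x <= H.
Proof. by rewrite /height le_min ge_min lexx le_max lexx H0. Qed.

Lemma height_lt z x : 0 <= z < height x <-> 0 <= z < H /\ z < x.
Proof.
rewrite /height lt_min lt_max; split.
  by move=> /andP[z0 /andP[zH /orP[|zx]]]; [rewrite ltNge z0|rewrite z0 zH].
by move=> [/andP[-> ->] ->]; rewrite orbT.
Qed.

Lemma quad_box x1 x2 x3 p z : (quad x1 x2 x3 `&` box) (p, z) <->
  unit_square p /\ (ind (clamp x1) p.1 * ind (clamp x2) p.2 = 1) /\ 0 <= z < height x3.
Proof.
have I1 : (p.1 < x1)%R -> (p.2 < x2)%R -> unit_square p -> ind (clamp x1) p.1 * ind (clamp x2) p.2 = 1.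
  move=> p1 p2 [/= u1 u2]; rewrite !in_itv /= in u1 u2; by rewrite /ind !frac_clamp// p1 p2 mulr1.
have I2 : unit_square p -> ind (clamp x1) p.1 * ind (clamp x2) p.2 = 1 -> (p.1 < x1) /\ (p.2 < x2).
  move=> [/= u1 u2]; rewrite !in_itv /= in u1 u2; rewrite /ind !frac_clamp//.
  case: (p.1 < x1)%R; case: (p.2 < x2)%R; rewrite ?mulr0 ?mul0r ?mulr1 => // /esym/eqP; rewrite oner_eq0//.
split.
  move=> [[[/= p1 p2] zx] [/= up zH]]; rewrite !in_itv /= in p1 p2 zx zH.
  by split => //; split; [exact: I1|apply/height_lt].
move=> [up [E zh]]; have [zH zx] := (height_lt _ _).1 zh; have [p1 p2] := I2 up E.
by split; split => //=; rewrite ?in_itv//=; split; rewrite /= in_itv.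
Qed.

Lemma quad1_box : quad 1 1 H `&` box = box.
Proof.
apply/seteqP; split => [q []//|[p z] [/= [u1 u2] zH]]; split => //.
move: u1 u2 zH; rewrite /= !in_itv /= => /andP[_ u1] /andP[_ u2] /andP[_ zH].
by split; [split|] => /=; rewrite in_itv.
Qed.

Lemma haar3_box : haar3 box = H%:E.
Proof.
have -> : haar3 box = (haar2 (unit_square : set T2) * lam (`[0%R, H[%classic : set T1))%E.
  by rewrite /box haar3.unlock; apply: product_measure1E; [exact: measurable_unit_square|exact: measurable_itv].
rewrite (lam_itv true true H0) subr0 -[unit_square]setTI haar2_unit_square// probability_setT.
by rewrite mul1e.
Qed.

Lemma haar3_fin A : measurable A -> (haar3 (A `&` box) < +oo)%E.
Proof.
move=> mA; apply: (@le_lt_trans _ _ (haar3 box)); last by rewrite haar3_box ltry.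
apply: measure_mono => //; [apply: measurableI => //|]; exact: measurable_box.
Qed.

End box.

(** * Overlaps of Borel sets transported across the roof *)

Section transfer.
Context {R : realType} (alpha beta : R) (d : nat) (Phi : R * R -> R).
Local Notation f := (skew_shift alpha beta).
Local Notation T1 := (measurableTypeR R).
Local Notation T2 := (T1 * T1)%type.
Local Notation T3 := (T1 * T1 * T1)%type.
Hypothesis irr : irrational alpha.
Hypothesis PP : class_P_deg d Phi.
Hypothesis TP : trig_poly (fiber_mean Phi).
Hypothesis NC : ~ measurable_coboundary f (fiber_centered Phi).
Variables (m H : R).
Hypothesis (m0 : 0 < m) (Hm : forall p, m <= Phi p <= H).
Local Notation S n p := (birkhoff f Phi n p).

Let H0 : 0 <= H.
Proof. by have /andP[h1 h2] := Hm (0, 0); apply: le_trans h2; apply: le_trans h1; exact: ltW. Qed.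

Let mS n : measurable_fun [set: T2] (birkhoff f Phi n : T2 -> R).
Proof. exact: (measurable_birkhoff_roof alpha beta PP TP n). Qed.

Let tPhi : torus_invariant Phi. Proof. by case: PP. Qed.

(** The representative over the unit square of the point at time t if n crossings of the roof are
    subtracted. It is defined for every n, whether or not the result lies under the roof. *)
Definition transport n t (q : T3) : T3 := (frac2 (iter n f q.1), q.2 + t - S n q.1).

Lemma measurable_transport n t : measurable_fun [set: T3] (transport n t).
Proof.
apply: measurable_fun_pair.
  apply: (measurableT_comp measurable_frac2); apply: measurableT_comp => //; exact: measurable_iter_skew.
by apply: measurable_funB; [exact: measurable_funD|apply: measurableT_comp => //; exact: mS].
Qed.

(** The box of height H replaces the domain under the roof, so that quadrants stay product sets; a
    point may then be counted for several n. *)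
Definition passage n t (A B : set T3) : set T3 :=
  (A `&` box H) `&` (transport n t @^-1` (B `&` box H)).

Lemma measurable_passage n t A B : measurable A -> measurable B -> measurable (passage n t A B).
Proof.
move=> mA mB; apply: measurableI; first by apply: measurableI => //; exact: measurable_box.
rewrite -[X in measurable X]setTI; apply: (measurable_transport n t) => //.
by apply: measurableI => //; exact: measurable_box.
Qed.

Lemma passage_fin n t A B : measurable A -> measurable B -> (haar3 (passage n t A B) < +oo)%E.
Proof.
move=> mA mB; apply: le_lt_trans (haar3_fin H0 mA); apply: measure_mono; first exact: measurable_passage.
  by apply: measurableI => //; exact: measurable_box.
by move=> q [].
Qed.

(* No passage to the box occurs after [steps t] crossings of the roof. *)
Definition steps (t : R) := (Num.truncn ((t + H) / m)).+1.

Lemma steps_lt t : t + H < m * (steps t)%:R.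
Proof. by have := truncnS_gt ((t + H) / m); rewrite ltr_pdivrMr// mulrC. Qed.

Definition overlap t (A B : set T3) : R := \sum_(n < steps t) fine (haar3 (passage n t A B)).

Lemma overlap_ge0 t A B : 0 <= overlap t A B.
Proof. by apply: sumr_ge0 => n _; exact: fine_ge0. Qed.

Lemma overlapUr t A B C : measurable A -> measurable B -> measurable C -> B `&` C = set0 ->
  overlap t A (B `|` C) = overlap t A B + overlap t A C.
Proof.
move=> mA mB mC BC; rewrite /overlap -big_split; apply: eq_bigr => n _ /=.
rewrite -fineD ?ge0_fin_numE ?passage_fin//; congr fine.
rewrite -measureU; [|exact: measurable_passage|exact: measurable_passage|].
  by congr (haar3 _); rewrite /passage setIUl preimage_setU setIUr.
apply/seteqP; split => q //; rewrite /passage => -[[_ [/= b _]] [_ [/= c _]]].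
by have : (B `&` C) (transport n t q) by []; rewrite BC.
Qed.

Lemma overlapUl t A B C : measurable A -> measurable B -> measurable C -> B `&` C = set0 ->
  overlap t (B `|` C) A = overlap t B A + overlap t C A.
Proof.
move=> mA mB mC BC; rewrite /overlap -big_split; apply: eq_bigr => n _ /=.
rewrite -fineD ?ge0_fin_numE ?passage_fin//; congr fine.
rewrite -measureU; [|exact: measurable_passage|exact: measurable_passage|].
  by congr (haar3 _); rewrite /passage setIUl setIUl.
apply/seteqP; split => q //; rewrite /passage => -[[[b _] _] [[c _] _]].
by have : (B `&` C) q by []; rewrite BC.
Qed.

Let C0 : 0 <= 2 * (H / 2) / m + 1.
Proof. by rewrite addr_ge0// divr_ge0 ?mulr_ge0 ?divr_ge0// ltW. Qed.

(** A point of A enters the box for boundedly many n only, because the sum Phi_n has to lie in a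
    window of length H. *)
Lemma overlap_le_left t A B : measurable A -> measurable B ->
  overlap t A B <= (2 * (H / 2) / m + 1) * fine (haar3 (A `&` box H)).
Proof.
move=> mA mB; apply: sum_measure_le => //.
- by move=> n; exact: measurable_passage.
- by apply: measurableI => //; exact: measurable_box.
- exact: haar3_fin.
- by move=> n; exact: passage_fin.
move=> [[x y] z]; rewrite indicE; have [Aq|nAq] := pselect ((A `&` box H) (x, y, z)); last first.
  rewrite memNset// mulr0 big1// => n _; rewrite indicE memNset// => -[/nAq].
  by [].
rewrite mem_set// mulr1; apply: (@le_trans _ _ (\sum_(n < steps t) ((`|(z + t - H / 2) - S n (x, y)| <= H / 2)%R)%:R)); last first.
  by apply: (roof_window_count alpha beta m0 Hm); rewrite divr_ge0.
apply: ler_sum => n _; rewrite indicE ler_nat.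
have [/set_mem|//] := boolP (_ \in _) => -[_ [_ [_ /=]]]; rewrite in_itv /= => /andP[h1 h2].
by rewrite (_ : `|_| <= _)//; rewrite ler_norml; apply/andP; split; lra.
Qed.

(** The passages are first moved to the side of B by the measure-preserving map of the suspension;
    the numbers n are then counted along backward orbits. *)
Lemma overlap_le_right t A B : measurable A -> measurable B ->
  overlap t A B <= (2 * (H / 2) / m + 1) * fine (haar3 (B `&` box H)).
Proof.
move=> mA mB; pose g := skew_inv alpha beta.
have mB' : measurable (B `&` box H) by apply: measurableI => //; exact: measurable_box.
have mfr : measurable_fun [set: T3] (fun q : T3 => (frac2 q.1, q.2) : T3).
  by apply: measurable_fun_pair => //; apply: measurableT_comp => //; exact: measurable_frac2.
(* The periodic extension of the target set: [torus_flow_integral] is about torus-invariant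
   integrands. *)
pose B' : set T3 := (fun q : T3 => (frac2 q.1, q.2) : T3) @^-1` (B `&` box H).
have mB2 : measurable B' by rewrite -[X in measurable X]setTI; exact: mfr.
have B'E : haar3 B' = haar3 (B `&` box H).
  rewrite -haar3_unit_square// -[in RHS]haar3_unit_square//; congr (haar3 _).
  apply/seteqP; split => -[p z] [h /= [up _]]; split => //; move: h; rewrite /B' /= /frac2;
    by case: up => /=; rewrite !in_itv /= => u1 u2; rewrite !frac_id// -surjective_pairing.
pose Sg n (p : T2) := S n (iter n g p).
have mSg n : measurable_fun [set: T2] (Sg n) by apply: (measurableT_comp (mS n)); exact: measurable_iter_inv.
pose V n : set T3 := [set q | 0 <= q.2 - t + Sg n q.1 < H].
have mV n : measurable (V n).
  have mh : measurable_fun [set: T3] (fun q : T3 => q.2 - t + Sg n q.1 : T1).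
    by apply: measurable_funD; [exact: measurable_funB|apply: measurableT_comp].
  have := mh measurableT _ (measurable_itv `[0, H[); rewrite setTI => h.
  by rewrite (_ : V n = (fun q : T3 => q.2 - t + Sg n q.1) @^-1` `[0, H[)//; apply/seteqP; split => q; rewrite /V /= in_itv.
pose Y n := B' `&` V n.
have mY n : measurable (Y n) by exact: measurableI.
have fY n : (haar3 (Y n) < +oo)%E.
  apply: (@le_lt_trans _ _ (haar3 B')); last by rewrite B'E; exact: haar3_fin.
  by apply: measure_mono => // q [].
have PY n : (haar3 (passage n t A B) <= haar3 (Y n))%E.
  have <- : (\int[haar3]_q (\1_(Y n) q)%:E = haar3 (Y n))%E by rewrite integral_indic// setIT.
  have := @torus_flow_integral R alpha beta (fun q => (\1_(Y n) q)%:E) n (fun p => S n p - t).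
  move=> /(_ _ _ _ _)/wrap[].
  - move=> z p i j; rewrite !indicE; congr (nat_of_bool _)%:R%:E; apply: mem_iff.
    have e1 : Sg n (p.1 + i%:~R, p.2 + j%:~R) = Sg n p.
      apply/esym; apply: (torus_invariant_birkhoff alpha beta n tPhi); apply: torus_eq_iter_inv.
      by exists i, j.
    by rewrite /Y /B' /V /= frac2_torus e1.
  - by apply/measurable_EFinP; exact: measurable_indic.
  - by move=> q; rewrite lee_fin.
  - by apply: measurable_funB.
  move=> <-.
  have mW : measurable_fun [set: T3] (fun q : T3 => (iter n f q.1, q.2 - (S n q.1 - t)) : T3).
    apply: measurable_fun_pair; first by apply: measurableT_comp => //; exact: measurable_iter_skew.
    apply: measurable_funB => //; apply: (measurableT_comp (f := fun p : T2 => S n p - t)) => //.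
    exact: measurable_funB.
  have mP := measurable_passage n t mA mB.
  have <- : (\int[haar3]_q (\1_(passage n t A B) q)%:E = haar3 (passage n t A B))%E by rewrite integral_indic// setIT.
  apply: ge0_le_integral => //.
  - by apply/measurable_EFinP; exact: measurable_indic.
  - apply/measurable_EFinP; apply: (measurableT_comp (f := \1_(Y n) : T3 -> R)) => //; exact: measurable_indic.
  move=> [p z] _; rewrite lee_fin !indicE ler_nat.
  have [/set_mem|//] := boolP (_ \in passage _ _ _ _) => -[[_ [_ /= zH]] Bq]; rewrite mem_set//.
  split; first by rewrite /B' /=; move: Bq; rewrite /transport /= opprB addrA.
  move: zH; rewrite in_itv /V /= /Sg iter_skew_invK.
  by rewrite (_ : z - (S n p - t) - t + S n p = z)//; ring.
apply: (@le_trans _ _ (\sum_(n < steps t) fine (haar3 (Y n)))).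
  apply: ler_sum => n _; apply: fine_le; rewrite ?ge0_fin_numE ?passage_fin//.
rewrite -B'E; apply: sum_measure_le => //; first by rewrite B'E; exact: haar3_fin.
move=> [p z]; rewrite indicE; have [Bq|nBq] := pselect (B' (p, z)); last first.
  by rewrite memNset// mulr0 big1// => n _; rewrite indicE memNset// => -[/nBq].
rewrite mem_set// mulr1; apply: (@le_trans _ _ (\sum_(n < steps t) ((`|(t - z + H / 2) - S n (iter n g p)| <= H / 2)%R)%:R)); last first.
  by apply: (window_count_inv alpha beta m0 Hm); rewrite divr_ge0.
apply: ler_sum => n _; rewrite indicE ler_nat.
have [/set_mem|//] := boolP (_ \in _) => -[_ /= /andP[]]; rewrite /Sg /= => h1 h2.
by rewrite (_ : `|_| <= _)//; rewrite ler_norml; apply/andP; split; lra.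
Qed.

Lemma measurable_quad (x1 x2 x3 : R) : measurable (quad x1 x2 x3).
Proof. by apply: measurableX; [apply: measurableX|]; exact: measurable_itv. Qed.

Lemma haar3_quad (x1 x2 x3 : R) : fine (haar3 (quad x1 x2 x3 `&` box H)) =
  mean haar2 (fun p : T2 => ind (clamp x1) p.1 * ind (clamp x2) p.2) * height H x3.
Proof.
set D : set T2 := [set p | ind (clamp x1) p.1 * ind (clamp x2) p.2 = 1].
have mD : measurable D.
  rewrite (_ : D = (fun p : T2 => ind (clamp x1) p.1 * ind (clamp x2) p.2 : T1) @^-1` [set 1])//.
  rewrite -[X in measurable X]setTI.
  by apply: (bmeasM (bmeas_fst (bmeas_ind (clamp x1))) (bmeas_snd (bmeas_ind (clamp x2)))).1 => //; exact: measurable_set1.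
have /andP[h0 _] := heightP H0 x3.
rewrite (_ : quad x1 x2 x3 `&` box H = (D `*` `[0, height H x3[%classic) `&` (unit_square `*` setT)); last first.
  apply/seteqP; split => -[p z].
    by move=> /quad_box[up [E zh]]; split.
  by move=> [[/= E]]; rewrite in_itv /= => zh [/= up _]; apply/quad_box.
rewrite haar3_unit_square; last by apply: measurableX => //; exact: measurable_itv.
have -> : haar3 (D `*` `[0%R, height H x3[%classic) = (haar2 D * lam (`[0%R, height H x3[%classic : set T1))%E.
  by rewrite haar3.unlock; apply: product_measure1E => //; exact: measurable_itv.
rewrite (lam_itv true true h0) subr0 fineM ?fin_num_measure//; congr (_ * _).
rewrite -mean_indic//; congr mean; apply/funext => p; rewrite indicE.
have [Dp|nD] := pselect (D p); first by rewrite mem_set//.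
rewrite memNset//; move: nD; rewrite /D /= /ind; case: (_ < _)%R; case: (_ < _)%R; rewrite ?mulr0 ?mul0r ?mulr1 //.
Qed.

(** On a vertical line both z and z + t - Phi_n have to lie in an interval, and the length of such z
    is the trapezoid. *)
Lemma haar3_passage_quad n t (x1 x2 x3 y1 y2 y3 : R) : fine (haar3 (passage n t (quad x1 x2 x3) (quad y1 y2 y3))) =
  mean haar2 (fun p : T2 => ind (clamp x1) p.1 * ind (clamp x2) p.2 *
   (ind (clamp y1) (iter n f p).1 * ind (clamp y2) (iter n f p).2 * trapezoid (height H x3) (height H y3) (t - S n p))).
Proof.
have /andP[hx _] := heightP H0 x3; have /andP[hy _] := heightP H0 y3.
set g := (fun p : T2 => _).
have bg : bmeas g.
  apply: bmeasM; first by apply: bmeasM; [apply: bmeas_fst; exact: bmeas_ind|apply: bmeas_snd; exact: bmeas_ind].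
  have bI : bmeas (fun p : T2 => ind (clamp y1) p.1 * ind (clamp y2) p.2).
    by apply: bmeasM; [apply: bmeas_fst; exact: bmeas_ind|apply: bmeas_snd; exact: bmeas_ind].
  apply: (bmeas_corr_term alpha beta PP TP t n bI (@continuous_trapezoid R (height H x3) (height H y3)) (Bk := height H x3)).
  by move=> u; have /andP[h1 h2] := trapezoid_bounds u hx hy; rewrite ger0_norm.
have mp := measurable_passage n t (measurable_quad x1 x2 x3) (measurable_quad y1 y2 y3).
have -> : haar3 (passage n t (quad x1 x2 x3) (quad y1 y2 y3)) =
    (\int[haar2]_p lam (xsection (passage n t (quad x1 x2 x3) (quad y1 y2 y3)) p))%E by rewrite haar3.unlock.
rewrite -integral_unit_square; last 2 first.
- exact: measurable_fun_xsection.
- by [].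
rewrite (_ : (\int[leb2]_(p in unit_square) _)%E = (\int[leb2]_(p in (unit_square : set T2)) (g p)%:E)%E).
  rewrite integral_unit_square; last 2 first.
  - by apply/measurable_EFinP; exact: bg.1.
  - move=> p; rewrite lee_fin !mulr_ge0 ?ind_ge0//.
    by have /andP[] := trapezoid_bounds (t - S n p) hx hy.
  by rewrite meanE.
apply: eq_integral => p /set_mem up.
have us : unit_square (frac2 (iter n f p)).
  by split; rewrite /= in_itv /=; exact: frac_itv.
have I2E (z1 z2 : R) (q : T2) : ind (clamp z1) (frac q.1) = ind (clamp z1) q.1 by rewrite /ind (frac_id (frac_itv _)).
have E : xsection (passage n t (quad x1 x2 x3) (quad y1 y2 y3)) p =
    [set z | (ind (clamp x1) p.1 * ind (clamp x2) p.2 = 1 /\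
      ind (clamp y1) (iter n f p).1 * ind (clamp y2) (iter n f p).2 = 1) /\
      (0 <= z < height H x3 /\ 0 <= z + (t - S n p) < height H y3)].
  apply/seteqP; split => z; rewrite /xsection /= inE /passage.
    move=> [/quad_box[_ [E1 E2]]] /quad_box[_ [E3 E4]]; split; first split => //.
      by rewrite -E3 /frac2 /= /ind !(frac_id (frac_itv _)).
    by split => //; rewrite addrA.
  move=> [[E1 E3] [E2 E4]]; split; apply/quad_box; first by [].
  split => //; split; last by rewrite -addrA.
  by rewrite -E3 /frac2 /= /ind !(frac_id (frac_itv _)).
rewrite E /g.
have i01 x (s : R) : ind x s = 0 \/ ind x s = 1 by rewrite /ind; case: (_ < _)%R; [right|left].
have [[E1 E3]|nE] := pselect (ind (clamp x1) p.1 * ind (clamp x2) p.2 = 1 /\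
      ind (clamp y1) (iter n f p).1 * ind (clamp y2) (iter n f p).2 = 1).
  rewrite E1 E3 !mul1r -lam_window//; congr (lam _); apply/seteqP; split => z /=; first by case.
  by [].
rewrite (_ : [set z | _] = set0) ?measure0; last by apply/seteqP; split => z // [].
congr EFin; apply/esym; rewrite mulrA; apply/eqP; rewrite mulf_eq0; apply/orP; left.
case: (i01 (clamp x1) p.1) => e1; case: (i01 (clamp x2) p.2) => e2;
case: (i01 (clamp y1) (iter n f p).1) => e3; case: (i01 (clamp y2) (iter n f p).2) => e4;
  try by rewrite e1 e2 e3 e4 !(mulr0, mul0r, mulr1).
by exfalso; apply: nE; rewrite e1 e2 e3 e4 !mulr1.
Qed.

Lemma overlap_quad t (x1 x2 x3 y1 y2 y3 : R) : overlap t (quad x1 x2 x3) (quad y1 y2 y3) =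
  corr alpha beta Phi (clamp x1) (clamp x2) (fun p => ind (clamp y1) p.1 * ind (clamp y2) p.2)
    (trapezoid (height H x3) (height H y3)) (steps t) t.
Proof.
have /andP[hx _] := heightP H0 x3; have /andP[hy _] := heightP H0 y3.
have bI x y : bmeas (fun p : T2 => ind x p.1 * ind y p.2).
  by apply: bmeasM; [apply: bmeas_fst; exact: bmeas_ind|apply: bmeas_snd; exact: bmeas_ind].
rewrite /corr; under [X in mean _ X]funext do rewrite mulr_sumr.
rewrite mean_sum; first by apply: eq_bigr => n _; exact: haar3_passage_quad.
move=> n; apply: bmeasM; first exact: bI.
apply: (bmeas_corr_term alpha beta PP TP t n (bI _ _) (@continuous_trapezoid R (height H x3) (height H y3)) (Bk := height H x3)).
by move=> u; have /andP[h1 h2] := trapezoid_bounds u hx hy; rewrite ger0_norm.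
Qed.

Lemma overlap_quad_cvg c (x1 x2 x3 y1 y2 y3 : R) : 0 < c -> unif_mean f Phi c ->
  overlap t (quad x1 x2 x3) (quad y1 y2 y3) @[t --> +oo] -->
  fine (haar3 (quad x1 x2 x3 `&` box H)) / c * fine (haar3 (quad y1 y2 y3 `&` box H)).
Proof.
move=> c0 uP; apply/cvgrPdist_le => e e0.
have /andP[hx hxH] := heightP H0 x3; have /andP[hy _] := heightP H0 y3.
have [T0 HT] := quadrant_corr irr PP TP NC m0 Hm (clampP x1) (clampP x2) (clampP y1) (clampP y2) hx hy c0 uP e0.
near=> t; rewrite distrC overlap_quad !haar3_quad.
have tT : T0 <= t by near: t; apply: nbhs_pinfty_ge; exact: num_real.
have tN : t + height H x3 < m * (steps t)%:R by apply: le_lt_trans (steps_lt t); rewrite lerD2l.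
have := HT t _ tT tN; apply: le_trans; rewrite le_eqVlt; apply/orP; left; apply/eqP; congr `|_ - _|; ring.
Unshelve. all: by end_near. Qed.

Lemma quadrant3_quad (A : set T3) : quadrant3 A -> exists x1 x2 x3 : R, A = quad x1 x2 x3.
Proof. by move=> [_ [_ [[_ [_ [[x1 ->] [x2 ->] ->]]] [x3 ->] ->]]]; exists x1, x2, x3. Qed.

Lemma overlap_full t A : overlap t A setT = overlap t A (quad 1 1 H) /\ overlap t setT A = overlap t (quad 1 1 H) A.
Proof. by split; apply: eq_bigr => n _; rewrite /passage quad1_box// setTI. Qed.

(** [dynkin_limit] acts on one argument at a time: on B while A is a quadrant, with domination by
    the measure of B, then on A for arbitrary B, with domination by the measure of A. *)
Lemma overlap_cvg c A B : 0 < c -> unif_mean f Phi c -> measurable A -> measurable B ->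
  overlap t A B @[t --> +oo] --> fine (haar3 (A `&` box H)) / c * fine (haar3 (B `&` box H)).
Proof.
move=> c0 uP mA mB.
have fbox : (haar3 (box H) < +oo)%E by rewrite haar3_box// ltry.
have mbox := @measurable_box R H.
have E1 : haar3 (box H) = haar3 (quad 1 1 H `&` box H) by rewrite quad1_box.
have HQ (x1 x2 x3 : R) B' : measurable B' -> overlap t (quad x1 x2 x3) B' @[t --> +oo] -->
    fine (haar3 (quad x1 x2 x3 `&` box H)) / c * fine (haar3 (B' `&` box H)).
  have D := @dynkin_limit _ T3 R haar3 (box H) quadrant3 R (pinfty_nbhs R)
    (fun t X => overlap t (quad x1 x2 x3) X) (2 * (H / 2) / m + 1) (fine (haar3 (quad x1 x2 x3 `&` box H)) / c)
    _ mbox fbox quadrant3_generates (@quadrant3_setI R).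
  apply: D.
  - by move=> t X Y mX mY XY; apply: overlapUr => //; exact: measurable_quad.
  - by move=> t X mX; exact: overlap_ge0.
  - by apply: nearW => t X mX; apply: overlap_le_right => //; exact: measurable_quad.
  - under eq_fun do rewrite (overlap_full _ _).1.
    by rewrite E1; exact: overlap_quad_cvg.
  - by move=> _ /quadrant3_quad[y1 [y2 [y3 ->]]]; exact: overlap_quad_cvg.
rewrite (_ : _ / c * _ = fine (haar3 (B `&` box H)) / c * fine (haar3 (A `&` box H))); last by ring.
have HQB (x1 x2 x3 : R) : overlap t (quad x1 x2 x3) B @[t --> +oo] -->
    fine (haar3 (B `&` box H)) / c * fine (haar3 (quad x1 x2 x3 `&` box H)).
  rewrite (_ : _ / c * _ = fine (haar3 (quad x1 x2 x3 `&` box H)) / c * fine (haar3 (B `&` box H))); last by ring.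
  exact: HQ.
have D := @dynkin_limit _ T3 R haar3 (box H) quadrant3 R (pinfty_nbhs R)
  (fun t X => overlap t X B) (2 * (H / 2) / m + 1) (fine (haar3 (B `&` box H)) / c)
  _ mbox fbox quadrant3_generates (@quadrant3_setI R).
apply: D mA.
- by move=> t X Y mX mY XY; apply: overlapUl.
- by move=> t X mX; exact: overlap_ge0.
- by apply: nearW => t X mX; exact: overlap_le_left.
- under eq_fun do rewrite (overlap_full _ _).2.
  by rewrite E1; exact: HQB.
- by move=> _ /quadrant3_quad[y1 [y2 [y3 ->]]]; exact: HQB.
Qed.

End transfer.

(** * The special flow *)

Section torus_equality.
Context {R : realType}.
Implicit Types p q r : R * R.

Lemma torus_eq_refl p : torus_eq p p.
Proof. by exists 0, 0; rewrite !addr0 -surjective_pairing. Qed.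

Lemma torus_eq_sym p q : torus_eq p q -> torus_eq q p.
Proof.
move=> [i [j ->]]; exists (- i), (- j); rewrite /= !mulrNz !addrK.
exact: surjective_pairing.
Qed.

Lemma torus_eq_trans p q r : torus_eq p q -> torus_eq q r -> torus_eq p r.
Proof. by move=> [i [j ->]] [k [l ->]]; exists (i + k), (j + l); rewrite /= !intrD !addrA. Qed.

Lemma torus_eq_frac2 p : torus_eq p (frac2 p).
Proof. by exists (- Num.floor p.1), (- Num.floor p.2); rewrite /frac2 /frac !mulrNz. Qed.

Lemma frac2_eq p q : torus_eq p q -> frac2 p = frac2 q.
Proof. by move=> [i [j ->]]; rewrite frac2_torus. Qed.

Lemma frac2_id p : unit_square p -> frac2 p = p.
Proof. by case: p => x y [/=]; rewrite !in_itv /= => x01 y01; rewrite /frac2 /= !frac_id. Qed.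

Lemma unit_square_frac2 p : unit_square (frac2 p).
Proof. by split; rewrite /= in_itv /=; exact: frac_itv. Qed.

Lemma unit_square_torus_eq p q : unit_square p -> unit_square q -> torus_eq p q -> p = q.
Proof. by move=> /frac2_id {2}<- /frac2_id {2}<- /frac2_eq. Qed.

End torus_equality.

(** * The special flow in terms of transports *)

Section flow.
Context {R : realType} (alpha beta : R) (d : nat) (Phi : R * R -> R).
Local Notation f := (skew_shift alpha beta).
Local Notation g := (skew_inv alpha beta).
Local Notation T1 := (measurableTypeR R).
Local Notation T2 := (T1 * T1)%type.
Local Notation T3 := (T1 * T1 * T1)%type.
Hypothesis tPhi : torus_invariant Phi.
Variables (m H : R).
Hypothesis (m0 : 0 < m) (Hm : forall p, m <= Phi p <= H).
Local Notation S n p := (birkhoff f Phi n p).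
Local Notation Om := (special_domain Phi).
Local Notation h t := (special_flow f Phi t).

Let tS n p p' : torus_eq p p' -> S n p = S n p'.
Proof. exact: (torus_invariant_birkhoff alpha beta n tPhi). Qed.

(** Points that agree on the torus times R after n, respectively k, crossings. This relation
    contains the generated equivalence and, unlike a closure, can be inverted. *)
Definition merges (q q' : R * R * R) : Prop := exists n k,
  torus_eq (iter n f q.1) (iter k f q'.1) /\ q.2 - S n q.1 = q'.2 - S k q'.1.

Lemma merges_sym q q' : merges q q' -> merges q' q.
Proof. by move=> [n [k [h1 h2]]]; exists k, n; split; [exact: torus_eq_sym|]. Qed.

(** Both meeting points are pushed forward until the middle point has made k + n' crossings in each
    of them. *)
Lemma merges_trans q q' q'' : merges q q' -> merges q' q'' -> merges q q''.
Proof.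
move=> [n [k [h1 e1]]] [n' [k' [h2 e2]]]; exists (n' + n)%N, (k + k')%N; split.
  rewrite !iterD; apply: (torus_eq_trans (torus_eq_iter alpha beta n' h1)).
  by rewrite -iterD addnC iterD; exact: torus_eq_iter.
have := tS n' h1; have := tS k h2; rewrite addnC (addnC k) !birkhoff_add.
have := birkhoff_comm f Phi n' k q'.1; lra.
Qed.

Lemma special_equiv_merges q q' : special_equiv f Phi q q' -> merges q q'.
Proof.
elim=> [_ _ [p p' z pp'|p z]|{}q|q1 q2 _|q1 q2 q3 _ h1 _ h2].
- by exists 0%N, 0%N; split => //=; rewrite !birkhoff0.
- exists 1%N, 0%N; split; first exact: torus_eq_refl.
  by rewrite birkhoffS !birkhoff0 /= addr0 subr0 addrC addKr.
- by exists 0%N, 0%N; split => //; exact: torus_eq_refl.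
- exact: merges_sym.
- exact: merges_trans h2.
Qed.

(** Inverse iteration cancels the common crossings, and any further crossing would take a point
    under the roof to negative height. Representatives are therefore unique, so the choice made in
    [special_flow] is determined. *)
Lemma merges_domain q q' : Om q -> Om q' -> merges q q' -> q = q'.
Proof.
move=> Oq Oq' [n [k]]; wlog nk : q q' n k Oq Oq' / (n <= k)%N => [W [h1 h2]|].
  have [nk|/ltnW kn] := leqP n k; first exact: (W q q' n k).
  by apply/esym; apply: (W q' q k n) => //; split => //; exact: torus_eq_sym.
rewrite -(subnKC nk); move: (k - n)%N => j; rewrite iterD => -[h1].
have {}h1 : torus_eq q.1 (iter j f q'.1).
  by have := torus_eq_iter_inv alpha beta n h1; rewrite !iter_skew_invK.
rewrite addnC birkhoff_add (tS n h1).
case: j h1 => [|j] h1 e; last first.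
  have [_ /andP[z0 _]] := Oq; have [_ /andP[_ zP]] := Oq'.
  have := @roof_ge R alpha beta Phi m H Hm j (f q'.1).
  have : 0 <= m * j%:R by rewrite mulr_ge0// ltW.
  by move=> h2 h3; exfalso; move: e; rewrite birkhoffS; lra.
case: q q' Oq Oq' h1 e => [p z] [p' z'] [/= up _] [/= up' _] h1 e.
by rewrite (unit_square_torus_eq up up' h1); congr pair; move: e; rewrite /= birkhoff0; lra.
Qed.

Lemma transport_equiv n t q : special_equiv f Phi (q.1, q.2 + t) (transport alpha beta Phi n t q).
Proof.
apply: rst_trans (rst_step _ _ _ _ (special_step_torus _ _ _ (torus_eq_frac2 (iter n f q.1)))).
set z := q.2 + t.
elim: n => [|n IH]; first by rewrite birkhoff0 subr0; exact: rst_refl.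
apply: (rst_trans _ _ _ _ _ IH).
have := special_step_roof f Phi (iter n f q.1) (z - S n.+1 q.1).
rewrite (_ : Phi _ + _ = z - S n q.1); last by rewrite birkhoffSr; ring.
exact: rst_step.
Qed.

Lemma special_flow_transport n t q : Om (transport alpha beta Phi n t q) ->
  h t q = transport alpha beta Phi n t q.
Proof.
move=> Ot; rewrite /special_flow; case: xgetP => [q' _ [Oq' eq']|/(_ (transport alpha beta Phi n t q))[]].
  apply: merges_domain => //; apply/special_equiv_merges.
  by apply: rst_trans (transport_equiv n t q); exact: rst_sym.
by split => //; exact: transport_equiv.
Qed.

Lemma transport_exists t q : 0 <= t -> Om q ->
  exists2 n, (n < steps m H t)%N & Om (transport alpha beta Phi n t q).
Proof.
move=> t0 [_ /andP[z0 zP]]; set z := q.2 + t.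
have z0' : 0 <= z by exact: addr_ge0.
have sm n : S n q.1 <= S n.+1 q.1 by exact: (@roof_increasing R alpha beta Phi m H m0 Hm).
have [k kN Hk] := @initial_segment R (fun n => S n q.1) (fun x => x <= z) (steps m H t) sm
  (fun x y xy yz => le_trans xy yz).
have SN : z < S (steps m H t) q.1.
  apply: lt_le_trans (@roof_ge R alpha beta Phi m H Hm _ _); apply: le_lt_trans (steps_lt H m0 t).
  by have /andP[_ h] := Hm q.1; rewrite /z; lra.
case: k kN Hk => [|k] kN Hk.
  by have := Hk 0%N isT; rewrite birkhoff0 z0'.
exists k => //; split; first exact: unit_square_frac2.
rewrite /transport /= -/z -(tPhi (torus_eq_frac2 _)); apply/andP; split.
  by rewrite subr_ge0 Hk// ltnSn.
rewrite ltrBlDl -birkhoffSr.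
move: kN; rewrite leq_eqVlt => /predU1P[->//|kN].
by rewrite ltNge Hk// ltnn.
Qed.

Definition retransport n t (q : T3) : T3 := (frac2 (iter n g q.1), q.2 - t + S n (iter n g q.1)).

Lemma transportK n t q : unit_square q.1 -> retransport n t (transport alpha beta Phi n t q) = q.
Proof.
case: q => p z up; rewrite /retransport /transport /=.
have h1 := torus_eq_iter_inv alpha beta n (torus_eq_frac2 (iter n f p)); rewrite iter_skew_invK in h1.
by rewrite -(frac2_eq h1) -(tS n h1) frac2_id//; congr pair; ring.
Qed.

Lemma retransportK n t q : unit_square q.1 -> transport alpha beta Phi n t (retransport n t q) = q.
Proof.
case: q => p z up; rewrite /retransport /transport /=.
have h1 := torus_eq_iter alpha beta n (torus_eq_frac2 (iter n g p)); rewrite iter_skewK_inv in h1.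
by rewrite -(frac2_eq h1) -(tS n (torus_eq_frac2 (iter n g p))) frac2_id//; congr pair; ring.
Qed.

(** Mixing is stated with direct images under the flow. On the image side they split into preimages
    under the measurable maps [retransport n t], which is where their measurability comes from. *)
Definition piece n t (A B : set T3) : set T3 := B `&` (retransport n t @^-1` A).

Lemma flow_image t A B : 0 <= t -> A `<=` Om -> B `<=` Om ->
  (h t @` A) `&` B = \big[setU/set0]_(n < steps m H t) piece n t A B.
Proof.
move=> t0 AO BO; rewrite -(bigcup_mkord _ (fun n => piece n t A B)); apply/seteqP; split.
  move=> _ [[q Aq <-] Bq]; have [n nN On] := transport_exists t0 (AO _ Aq).
  exists n => //; split => //; rewrite /= (special_flow_transport On) transportK//.
  by case: (AO _ Aq).
move=> q' [n _ [Bq' Aq]]; split => //; exists (retransport n t q') => //.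
have uq : unit_square q'.1 by case: (BO _ Bq').
by rewrite (special_flow_transport (n := n)) retransportK//; exact: BO.
Qed.

(** Two origins of the same point both lie under the roof and are equivalent, hence equal. The sums
    over n and k steps then coincide at this origin, although they are strictly increasing in the
    number of steps. *)
Lemma trivIset_piece t A B : A `<=` Om -> B `<=` Om -> trivIset setT (fun n => piece n t A B).
Proof.
move=> AO BO; apply/trivIsetP => n k _ _ nk; apply/seteqP; split => q' // [[Bq' A1] [_ A2]].
have uq : unit_square q'.1 by case: (BO _ Bq').
have E1 := retransportK n t uq; have E2 := retransportK k t uq.
have M : merges (retransport n t q') (retransport k t q').
  have : merges ((retransport n t q').1, (retransport n t q').2 + t)
      ((retransport k t q').1, (retransport k t q').2 + t).
    apply: special_equiv_merges; have e1 := transport_equiv n t (retransport n t q').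
    have e2 := transport_equiv k t (retransport k t q'); rewrite E1 in e1; rewrite E2 in e2.
    by apply: rst_trans e1 _; exact: rst_sym.
  by move=> [i [j [h1 h2]]]; exists i, j; split => //; move: h2; rewrite /=; lra.
have EE := merges_domain (AO _ A1) (AO _ A2) M.
have SS : S n (retransport n t q').1 = S k (retransport n t q').1.
  have : (transport alpha beta Phi n t (retransport n t q')).2 = (transport alpha beta Phi k t (retransport n t q')).2.
    by rewrite E1 EE E2.
  by rewrite /transport /=; lra.
have sm p i j : (i < j)%N -> S i p < S j p.
  move=> ij; rewrite -(subnKC ij) addSn -addnS birkhoff_add ltrDl.
  apply: lt_le_trans (@roof_ge R alpha beta Phi m H Hm _ _).
  by rewrite mulr_gt0// ltr0n.
by move: nk; rewrite neq_ltn => /orP[/sm|/sm] => /(_ (retransport n t q').1); rewrite SS ltxx.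
Qed.

Hypothesis PP : class_P_deg d Phi.
Hypothesis TP : trig_poly (fiber_mean Phi).

Let H0 : 0 <= H.
Proof. by have /andP[h1 h2] := Hm (0, 0); apply: le_trans h2; apply: le_trans h1; exact: ltW. Qed.

Let mS n : measurable_fun [set: T2] (birkhoff f Phi n : T2 -> R).
Proof. exact: (measurable_birkhoff_roof alpha beta PP TP n). Qed.

Lemma domain_box : Om `<=` box H.
Proof.
move=> [p z] [/= up /andP[z0 zP]]; split => //=; rewrite in_itv /= z0.
by have /andP[_ hH] := Hm p; exact: lt_le_trans hH.
Qed.

Lemma measurable_retransport n t : measurable_fun [set: T3] (retransport n t : T3 -> T3).
Proof.
have mg : measurable_fun [set: T3] (fun q : T3 => iter n g q.1 : T2).
  by apply: measurableT_comp => //; exact: measurable_iter_inv.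
apply: measurable_fun_pair; first by apply: (measurableT_comp measurable_frac2).
apply: measurable_funD; first exact: measurable_funB.
exact: (measurableT_comp (mS n) mg).
Qed.

Lemma measurable_piece n t A B : measurable A -> measurable B -> measurable (piece n t A B).
Proof.
move=> mA mB; apply: measurableI => //; rewrite -[X in measurable X]setTI.
exact: measurable_retransport.
Qed.

Lemma haar3_piece n t (A B : set T3) : measurable A -> measurable B -> A `<=` Om -> B `<=` Om ->
  haar3 (piece n t A B) = haar3 (passage alpha beta Phi H n t A B).
Proof.
move=> mA mB AO BO.
have mfr : measurable_fun [set: T3] (fun q : T3 => (frac2 q.1, q.2) : T3).
  by apply: measurable_fun_pair => //; apply: measurableT_comp => //; exact: measurable_frac2.
(* The piece with B extended periodically; it agrees with the piece over the unit square and is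
   torus-invariant, as [torus_flow_integral] requires. *)
pose Y : set T3 := ((fun q : T3 => (frac2 q.1, q.2) : T3) @^-1` B) `&` (retransport n t @^-1` A).
have mY : measurable Y.
  apply: measurableI; first by rewrite -[X in measurable X]setTI; exact: mfr.
  by rewrite -[X in measurable X]setTI; exact: measurable_retransport.
have mPi := measurable_piece n t mA mB.
have mPa := measurable_passage alpha beta PP TP H n t mA mB.
have -> : haar3 (piece n t A B) = haar3 Y.
  rewrite -haar3_unit_square// -[in RHS]haar3_unit_square//; congr (haar3 _).
  by apply/seteqP; split => -[p z] [[/= h1 h2] [/= up _]]; split => //; split => //=; move: h1; rewrite /= frac2_id.
have mW : measurable_fun [set: T3] (fun q : T3 => (iter n f q.1, q.2 - (S n q.1 - t)) : T3).
  apply: measurable_fun_pair; first by apply: measurableT_comp => //; exact: measurable_iter_skew.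
  apply: measurable_funB => //; apply: (measurableT_comp (f := fun p : T2 => S n p - t)) => //.
  exact: measurable_funB.
have mWY : measurable ((fun q : T3 => (iter n f q.1, q.2 - (S n q.1 - t)) : T3) @^-1` Y).
  by rewrite -[X in measurable X]setTI; exact: mW.
have -> : (haar3 Y = \int[haar3]_q (\1_Y q)%:E)%E by rewrite integral_indic// setIT.
have := @torus_flow_integral R alpha beta (fun q => (\1_Y q)%:E) n (fun p => S n p - t).
move=> /(_ _ _ _ _)/wrap[].
- move=> z p i j; rewrite !indicE; congr (nat_of_bool _)%:R%:E; apply: mem_iff.
  have pp' : torus_eq p (p.1 + i%:~R, p.2 + j%:~R) by exists i, j.
  have := torus_eq_iter_inv alpha beta n pp' => gg.
  by rewrite /Y /retransport /= (frac2_eq pp') (frac2_eq gg) (tS n gg).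
- by apply/measurable_EFinP; exact: measurable_indic.
- by move=> q; rewrite lee_fin.
- by apply: measurable_funB.
move=> <-.
rewrite (_ : (\int[haar3]_q _)%E = haar3 ((fun q : T3 => (iter n f q.1, q.2 - (S n q.1 - t)) : T3) @^-1` Y)); last first.
  by rewrite -[X in haar3 X]setIT -integral_indic//; apply: eq_integral.
rewrite -haar3_unit_square// -[in RHS]haar3_unit_square//; congr (haar3 _).
have key p z : unit_square p -> Y (iter n f p, z - (S n p - t)) <-> passage alpha beta Phi H n t A B (p, z).
  move=> up; rewrite /Y /retransport /= iter_skew_invK (frac2_id up).
  rewrite (_ : z - (S n p - t) - t + S n p = z); last by ring.
  rewrite (_ : z - (S n p - t) = z + t - S n p); last by ring.
  split.
    by move=> [Bq Aq]; split; split => //; [exact/domain_box/AO|exact/domain_box/BO].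
  by move=> [[Aq _] [Bq _]].
apply/seteqP; split => -[p z] [h1 [up _]]; split => //.
  exact: (key p z up).1.
exact: (key p z up).2.
Qed.

Lemma measurable_domain : measurable (Om : set T3).
Proof.
have mu : measurable ((unit_square : set T2) `*` (setT : set T1)).
  by apply: measurableX => //; exact: measurable_unit_square.
have m1 : measurable [set q : T3 | 0 <= q.2].
  by rewrite -[X in measurable X]setTI; apply: measurable_fun_ler.
have m2 : measurable [set q : T3 | q.2 < Phi q.1].
  rewrite -[X in measurable X]setTI; apply: measurable_fun_ltr => //.
  by apply: (measurableT_comp (f := Phi : T2 -> R)) => //; exact: measurable_roof PP TP.
rewrite (_ : Om = ((unit_square : set T2) `*` setT) `&` ([set q : T3 | 0 <= q.2] `&` [set q : T3 | q.2 < Phi q.1])).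
  by apply: measurableI => //; exact: measurableI.
apply/seteqP; split => [q [uq /andP[h1 h2]]|q [[uq _] [/= h1 h2]]]; split => //=.
by rewrite h1 h2.
Qed.

Lemma leb3_haar3 (A : set T3) : measurable A -> A `<=` Om -> leb3 A = haar3 A.
Proof.
move=> mA AO; rewrite haar3_leb3//; congr (leb3 _); apply/seteqP; split => [q Aq|q []//].
by split => //; split => //; case: (AO _ Aq).
Qed.

Lemma haar3_domain : haar3 (Om : set T3) = (mean haar2 (Phi : T2 -> R))%:E.
Proof.
have mPhi : measurable_fun [set: T2] (Phi : T2 -> R) := measurable_roof PP TP.
have P0 p : 0 <= Phi p by have /andP[h1 _] := Hm p; apply: le_trans h1; exact: ltW.
have -> : haar3 (Om : set T3) = (\int[haar2]_p lam (xsection (Om : set T3) p))%E by rewrite haar3.unlock.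
rewrite -integral_unit_square; last 2 first.
- by apply: measurable_fun_xsection; exact: measurable_domain.
- by [].
rewrite (_ : (\int[leb2]_(p in unit_square) _)%E = (\int[leb2]_(p in (unit_square : set T2)) (Phi p)%:E)%E).
  rewrite integral_unit_square; last 2 first.
  - exact/measurable_EFinP.
  - by move=> p; rewrite lee_fin.
  by rewrite meanE//; exact: (bmeas_roof PP TP m0 Hm).
apply: eq_integral => p /set_mem up.
rewrite (_ : xsection _ p = `[0, Phi p[%classic) ?(lam_itv true true (P0 p)) ?subr0//.
by apply/seteqP; split => z; rewrite /xsection /= inE in_itv /=; [case|move=> zP; split].
Qed.

End flow.

Theorem theorem5 (R : realType) (alpha beta : R) (Phi : R * R -> R) :
  irrational alpha ->
  (forall p, 0 < Phi p) ->
  class_M (skew_shift alpha beta) Phi ->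
  special_flow_mixing (skew_shift alpha beta) Phi.
Proof.
move=> irr pos [[[d _ PP] TP] NC] A B mA mB AO BO.
have [tPhi _ _] := PP.
have [m m0 [H Hm]] := roof_bounds PP pos.
have [c c0 uP] := roof_unif_mean beta irr PP TP m0 Hm.
have cE := roof_mean_haar2 PP TP m0 Hm uP.
(* The normalising volume is the mean c of Phi, the same constant by which the limit in
   [overlap_cvg] is divided. *)
have OE : fine (leb3 (special_domain Phi)) = c.
  by rewrite (leb3_haar3 (measurable_domain PP TP) (@subset_refl _ _)) (haar3_domain m0 Hm PP TP) cE.
have BE X : X `<=` special_domain Phi -> X `&` box H = X.
  by move=> XO; apply/setIidPl => q Xq; exact/(domain_box Hm)/XO.
have ME X : measurable X -> X `<=` special_domain Phi -> special_measure Phi X = fine (haar3 (X `&` box H)) / c.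
  by move=> mX XO; rewrite /special_measure OE (setIidl XO) (leb3_haar3 mX XO) BE.
(* Nonnegative times suffice for the limit at infinity, and for them the number of crossings is
   nonnegative and below [steps m H t]. *)
have key t : 0 <= t -> special_measure Phi ((special_flow (skew_shift alpha beta) Phi t @` A) `&` B) =
    overlap alpha beta Phi m H t A B / c.
  move=> t0.
  have mU n : measurable (piece alpha beta Phi n t A B) by exact: (measurable_piece alpha beta PP TP n t mA mB).
  have UE := flow_image alpha beta tPhi m0 Hm t0 AO BO.
  have sub : (special_flow (skew_shift alpha beta) Phi t @` A) `&` B `<=` special_domain Phi.
    by move=> q [_ /BO].
  have mI : measurable ((special_flow (skew_shift alpha beta) Phi t @` A) `&` B).
    rewrite UE; apply: (@bigsetU_measurable _ (RT R * RT R * RT R)%type) => n _; exact: mU.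
  rewrite (ME _ mI sub).
  rewrite (BE _ sub) UE.
  have -> := @measure_bigsetU _ _ _ (@haar3 R) (fun n => piece alpha beta Phi n t A B) mU
    (trivIset_piece tPhi m0 Hm AO BO) (steps m H t).
  congr (_ / _).
  rewrite (eq_bigr (fun n : 'I__ => (fine (haar3 (passage alpha beta Phi H n t A B)))%:E)) ?sumEFin// => n _.
  apply: (eq_trans (haar3_piece alpha beta tPhi Hm PP TP n t mA mB AO BO)).
  rewrite fineK// ge0_fin_numE//.
  exact: (passage_fin alpha beta PP TP m0 Hm).
rewrite (ME A mA AO) (ME B mB BO) mulrA.
apply: cvg_trans (cvgMr_tmp (b := c^-1) (overlap_cvg irr PP TP NC m0 Hm c0 uP mA mB)).
apply: near_eq_cvg; near=> t; rewrite key//; near: t; apply: nbhs_pinfty_ge; exact: num_real.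
Unshelve. all: by end_near. Qed.
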